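(* Let $\mu\in(0,1)\cup(1,\infty)$. Let $\mathcal A,\mathcal B,\mathcal C,\mathcal D$ be four points of $\overline{\mathbb C}$ such that $\mathcal A\neq\mathcal B$ and $\mathcal C\neq\mathcal D$. Let $E$ be a catenoidal end of growth $1-\mu$, of asymptotic boundary $\mathcal B$ and of axis $(\mathcal A,\mathcal B)$. Then the flux through $E$ of the Killing field associated to the translation along the geodesic $(\mathcal C,\mathcal D)$ is $$\pi(1-\mu^2)\bigl(2\operatorname{Re}(\mathcal A,\mathcal C,\mathcal D,\mathcal B)-1\bigr),$$ the flux through $E$ of the Killing field associated to the rotation about the geodesic $(\mathcal C,\mathcal D)$ is $$-2\pi(1-\mu^2)\operatorname{Im}(\mathcal A,\mathcal C,\mathcal D,\mathcal B),$$ and the flux polynomial of $E$ is $$\Pi_E(X)=2\pi(1-\mu^2)\frac{(X-\mathcal A)(X-\mathcal B)}{\mathcal B-\mathcal A}.$$ (If $\mathcal A=\infty$ (respectively $\mathcal B=\infty$), the last formula means $\Pi_E(X)=2\pi(1-\mu^2)(X-\mathcal B)$ (respectively $\Pi_E(X)=-2\pi(1-\mu^2)(X-\mathcal A)$).)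
   Context: Hyperbolic space is $\mathbb H^3=\{(\zeta,w)\in\mathbb C\times\mathbb R: w>0\}$, $\zeta=u+iv$, with metric $\langle\cdot,\cdot\rangle=(|d\zeta|^2+dw^2)/w^2$ and orientation $du\wedge dv\wedge dw$; its asymptotic boundary is identified with $\overline{\mathbb C}=\mathbb C\cup\{\infty\}$, on which isometries act. $(\mathcal A,\mathcal B)$ is the oriented geodesic from $\mathcal A$ to $\mathcal B$. Cross-ratio (for $z_1\ne z_4$, $z_2\neq z_3$ in $\overline{\mathbb C}$, extended by continuity at $\infty$): $(z_1,z_2,z_3,z_4)=\frac{z_3-z_1}{z_3-z_2}\cdot\frac{z_4-z_2}{z_4-z_1}$. A Bryant surface is a surface of constant mean curvature $1$ (half the trace of the second fundamental form). $\Omega$ is a neighbourhood of $0$ in $\mathbb C$, $\Omega^*=\Omega\setminus\{0\}$. A Bryant surface end is given by a conformal immersion $X=(\zeta,w):\Omega^*\to\mathbb H^3$ of constant mean curvature $1$ (puncture $0$ corresponding to the end), with the orientation induced by $X$ being that induced by the mean curvature vector $\vec H$. A Bryant representation is a holomorphic map $F=\begin{pmatrix}A&B\\C&D\end{pmatrix}$ from the universal cover of $\Omega^*$ to $\mathrm{SL}_2(\mathbb C)$ with $dA\,dD-dB\,dC=0$, $\zeta=\frac{\bar A C+\bar B D}{|A|^2+|B|^2}$, $w=\frac1{|A|^2+|B|^2}$. The Weierstrass data $(g,\omega)$ are defined by $F^{-1}dF=\begin{pmatrix}g&-g^2\\1&-g\end{pmatrix}\omega$. Canonical catenoidal end of growth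 $1-\mu$, asymptotic boundary $\infty$ and axis $(\mathcal Z,\infty)$ ($\mathcal Z\in\mathbb C$): an embedded Bryant surface end of finite total curvature with Weierstrass data $g=z^\mu$, $\omega=z^{-1-\mu}h(z)\,dz$ ($h$ holomorphic near $0$, $h(0)\ne0$) and a Bryant representation $F(z)=\begin{pmatrix}z^{(1-\mu)/2}f_2(z)&\frac{\mu-1}{\mu+1}z^{(1+\mu)/2}g_2(z)\\\frac{\mu^2-1}{4\mu}z^{(-1-\mu)/2}f_1(z)&\frac{(1+\mu)^2}{4\mu}z^{(\mu-1)/2}g_1(z)\end{pmatrix}$ with $f_1,f_2,g_1,g_2$ holomorphic near $0$, equal to $1$ at $0$, and $\mathcal Z=\frac{\mu^2-1}{4\mu}f_1'(0)$. Catenoidal end: an embedded Bryant surface end $E$ of finite total curvature, not part of a horosphere, is a catenoidal end of growth $1-\mu$, asymptotic boundary $\mathcal B$ and axis $(\mathcal A,\mathcal B)$ if there is an isometry of $\mathbb H^3$ (orientation-preserving or not) mapping $\mathcal A$ to $0$, $\mathcal B$ to $\infty$ and $E$ to a canonical catenoidal end of growth $1-\mu$, asymptotic boundary $\infty$ and axis $(0,\infty)$. Killing fields: for the translation $\Phi_t$ of (signed) distance $t$ along $(\mathcal C,\mathcal D)$, $Y$ is defined by $\frac{d\Phi_t}{dt}=Y(\Phi_t)$; for the rotation $R_\theta$ of angle $\theta$ in the direct sense about $(\mathcal C,\mathcal D)$, by $\frac{dR_\theta}{d\theta}=Y(R_\theta)$ (for $(0,\infty)$: $Y=(\zeta,w)$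 and $Y=(i\zeta,0)$ respectively; the direct sense in general is obtained by conjugating with orientation-preserving isometries). Flux of a Killing field $Y$ through $E$: $\int_\Gamma\langle\eta,Y\rangle-2\int_K\langle\nu,Y\rangle$, where $\Gamma$ is a generator of $\pi_1(E)$, $K$ a topological disk with boundary $\Gamma$, $\eta$ the unit conormal to $\Gamma$ pointing towards the asymptotic boundary of the end; $\Gamma$ is oriented so that $(\Gamma,\eta,-\vec H)$ is positively oriented, and $\nu$ is the unit normal to $K$ inducing the same orientation on $\Gamma$. It does not depend on $\Gamma$, $K$. Flux polynomial: there is a unique $P_E(X,Y)\in\mathbb C[X,Y]$ such that for all distinct $\mathcal C,\mathcal D\in\overline{\mathbb C}$ the flux of the translation field along $(\mathcal C,\mathcal D)$ is $\operatorname{Re}\frac{P_E(\mathcal C,\mathcal D)}{\mathcal C-\mathcal D}$ and that of the rotation field is $-\operatorname{Im}\frac{P_E(\mathcal C,\mathcal D)}{\mathcal C-\mathcal D}$ (limits taken at $\infty$); it is $P_E=\varphi_2XY+\varphi_1(X+Y)+\varphi_0$ with $\varphi_0,\varphi_1,\varphi_2$ equal to $4\pi$ times the residues at $0$ of $D\,dC-C\,dD$, $C\,dB-D\,dA$, $B\,dA-A\,dB$. The flux polynomial is $\Pi_E(X)=P_E(X,X)$. *)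

(* Defs.v *)
From Stdlib Require Import Reals.
From Coquelicot Require Import Coquelicot.

Open Scope R_scope.

Definition plane : NormedModule R_AbsRing := C_R_NormedModule.

(* Ambient space C * R of the half-space model; points and tangent vectors
   share this type. *)
Definition space : NormedModule R_AbsRing :=
  prod_NormedModule R_AbsRing C_R_NormedModule R_NormedModule.

Definition dir_deriv {V : NormedModule R_AbsRing} (f : V -> R) (v p : V) : R :=
  Derive (fun t : R => f (plus p (scal t v))) 0.

(* Only used for V = R, C, C * R and U open, where it is the usual notion. *)
Fixpoint Ck (n : nat) {V : NormedModule R_AbsRing} (U : V -> Prop) (f : V -> R)
  : Prop :=
  match n with
  | O => forall p : V, U p -> continuous f p
  | S m =>
      (forall p v : V, U p ->
         ex_derive (fun t : R => f (plus p (scal t v))) 0) /\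
      (forall v : V, Ck m U (dir_deriv f v))
  end.

Definition Ck_plane (n : nat) {V : NormedModule R_AbsRing} (U : V -> Prop)
  (f : V -> plane) : Prop :=
  Ck n U (fun q => Re (f q)) /\ Ck n U (fun q => Im (f q)).

Definition Ck_space (n : nat) {V : NormedModule R_AbsRing} (U : V -> Prop)
  (f : V -> space) : Prop :=
  Ck_plane n U (fun q => fst (f q)) /\ Ck n U (fun q => snd (f q)).

Definition dplane {V : NormedModule R_AbsRing} (f : V -> plane) (v p : V)
  : plane :=
  (dir_deriv (fun q => Re (f q)) v p, dir_deriv (fun q => Im (f q)) v p).

Definition dspace {V : NormedModule R_AbsRing} (f : V -> space) (v p : V)
  : space :=
  (dplane (fun q => fst (f q)) v p, dir_deriv (fun q => snd (f q)) v p).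

Definition holomorphic_on (U : C -> Prop) (f : C -> C) : Prop :=
  forall z : C, U z -> ex_derive (K := C_AbsRing) (V := C_NormedModule) f z.

Definition cexp (s : C) : C :=
  (exp (Re s) * cos (Im s), exp (Re s) * sin (Im s)).

Definition vec (u v w : R) : space := ((u, v), w).

Definition dot (a b : space) : R :=
  Re (fst a) * Re (fst b) + Im (fst a) * Im (fst b) + snd a * snd b.

Definition cross (a b : space) : space :=
  vec (Im (fst a) * snd b - snd a * Im (fst b))
      (snd a * Re (fst b) - Re (fst a) * snd b)
      (Re (fst a) * Im (fst b) - Im (fst a) * Re (fst b)).

Definition det3 (a b c : space) : R := dot (cross a b) c.

Definition H3 (p : space) : Prop := 0 < snd p.

Definition hyp_inner (p a b : space) : R := dot a b / (snd p) ^ 2.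

Definition hyp_norm (p a : space) : R := sqrt (hyp_inner p a a).

(* Christoffel symbols: for the metric delta / w^2,
   nabla_a b = D_a b + christoffel p a b. *)
Definition christoffel (p a b : space) : space :=
  scal (/ snd p)
    (plus (plus (scal (- snd a) b) (scal (- snd b) a)) (vec 0 0 (dot a b))).

Definition isometry (phi : space -> space) : Prop :=
  (forall p, H3 p -> H3 (phi p)) /\
  (exists psi : space -> space, forall p, H3 p ->
     H3 (psi p) /\ phi (psi p) = p /\ psi (phi p) = p) /\
  (forall n, Ck_space n H3 phi) /\
  (forall p a b, H3 p ->
     hyp_inner (phi p) (dspace phi a p) (dspace phi b p) = hyp_inner p a b).

Definition orientation_preserving (phi : space -> space) : Prop :=
  forall p, H3 p ->
    0 < det3 (dspace phi (vec 1 0 0) p) (dspace phi (vec 0 1 0) p)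
             (dspace phi (vec 0 0 1) p).

(* [None] is the point at infinity. *)
Definition Cbar : Type := option C.

(* Trace on H3 of the neighbourhoods of a boundary point in the closed ball. *)
Definition at_boundary (a : Cbar) (Q : space -> Prop) : Prop :=
  match a with
  | Some z => within H3 (locally ((z, 0) : space)) Q
  | None => exists M : R, forall p : space, H3 p -> M < dot p p -> Q p
  end.

Definition boundary_maps (phi : space -> space) (a b : Cbar) : Prop :=
  filterlim phi (at_boundary a) (at_boundary b).

(* [bracket z z'] is z - z' for finite points and, up to a factor that cancels
   in the cross-ratio, its homogeneous version with infinity = [1 : 0]. *)
Definition bracket (z z' : Cbar) : C :=
  match z, z' with
  | Some x, Some y => Cminus x y
  | None, Some _ => RtoC 1
  | Some _, None => RtoC (-1)
  | None, None => RtoC 0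
  end.

Definition cross_ratio (z1 z2 z3 z4 : Cbar) : C :=
  Cmult (Cdiv (bracket z3 z1) (bracket z3 z2))
        (Cdiv (bracket z4 z2) (bracket z4 z1)).

Definition std_translation (t : R) (p : space) : space := scal (exp t) p.

Definition std_rotation (t : R) (p : space) : space :=
  (Cmult (cos t, sin t) (fst p), snd p).

Definition conjugate_along (c d : Cbar) (T Phi : space -> space) : Prop :=
  exists phi : space -> space,
    isometry phi /\ orientation_preserving phi /\
    boundary_maps phi c (Some (RtoC 0)) /\ boundary_maps phi d None /\
    forall p, H3 p -> H3 (Phi p) /\ phi (Phi p) = T (phi p).

Definition generated_by (c d : Cbar) (T : R -> space -> space)
  (Y : space -> space) : Prop :=
  exists Phi : R -> space -> space,
    (forall t, conjugate_along c d (T t) (Phi t)) /\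
    (forall t p, H3 p ->
       is_derive (K := R_AbsRing) (V := space) (fun s : R => Phi s p) t
         (Y (Phi t p))).

Definition translation_field (c d : Cbar) (Y : space -> space) : Prop :=
  generated_by c d std_translation Y.

Definition rotation_field (c d : Cbar) (Y : space -> space) : Prop :=
  generated_by c d std_rotation Y.

Definition e1 : plane := (1, 0).
Definition e2 : plane := (0, 1).

Definition fst_form (X : plane -> space) (a b z : plane) : R :=
  hyp_inner (X z) (dspace X a z) (dspace X b z).

Definition area_density (X : plane -> space) (z : plane) : R :=
  sqrt (fst_form X e1 e1 z * fst_form X e2 e2 z - (fst_form X e1 e2 z) ^ 2).

(* Unit normal N with (X_1, X_2, N) positively oriented. *)
Definition unit_normal (X : plane -> space) (z : plane) : space :=
  let c := cross (dspace X e1 z) (dspace X e2 z) in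
  scal (snd (X z) / sqrt (dot c c)) c.

Definition snd_form (X : plane -> space) (a b z : plane) : R :=
  hyp_inner (X z)
    (plus (dspace (dspace X b) a z)
          (christoffel (X z) (dspace X a z) (dspace X b z)))
    (unit_normal X z).

Definition mean_curvature (X : plane -> space) (z : plane) : R :=
  (fst_form X e2 e2 z * snd_form X e1 e1 z
   - 2 * fst_form X e1 e2 z * snd_form X e1 e2 z
   + fst_form X e1 e1 z * snd_form X e2 e2 z)
  / (2 * (fst_form X e1 e1 z * fst_form X e2 e2 z - (fst_form X e1 e2 z) ^ 2)).

Definition mean_curvature_vector (X : plane -> space) (z : plane) : space :=
  scal (mean_curvature X z) (unit_normal X z).

Definition conformal_immersion_at (X : plane -> space) (z : plane) : Prop :=
  0 < fst_form X e1 e1 z /\ fst_form X e1 e1 z = fst_form X e2 e2 z /\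
  fst_form X e1 e2 z = 0.

(* Intrinsic curvature in isothermal coordinates, metric lambda |dz|^2:
   K = - Laplacian (ln lambda) / (2 lambda). *)
Definition gauss_curvature (X : plane -> space) (z : plane) : R :=
  let L := fun q : plane => ln (fst_form X e1 e1 q) in
  - (dir_deriv (dir_deriv L e1) e1 z + dir_deriv (dir_deriv L e2) e2 z)
  / (2 * fst_form X e1 e1 z).

Record surface_end : Type := SurfaceEnd {
  dom : plane -> Prop;
  param : plane -> space
}.

Definition dom_star (E : surface_end) (z : plane) : Prop :=
  dom E z /\ z <> RtoC 0.

Definition bryant_end (E : surface_end) : Prop :=
  open (dom E) /\ dom E (RtoC 0) /\
  (forall n, Ck_space n (dom_star E) (param E)) /\
  forall z, dom_star E z ->
    H3 (param E z) /\
    conformal_immersion_at (param E) z /\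
    hyp_norm (param E z) (mean_curvature_vector (param E) z) = 1 /\
    0 < det3 (dspace (param E) e1 z) (dspace (param E) e2 z)
             (mean_curvature_vector (param E) z).

(* Homeomorphism onto the image. *)
Definition embedded (E : surface_end) : Prop :=
  forall z, dom_star E z -> forall eps : posreal, exists delta : posreal,
    forall z', dom_star E z' ->
      ball (param E z) delta (param E z') -> ball z eps z'.

Definition finite_total_curvature (E : surface_end) : Prop :=
  exists r M : R, 0 < r /\ (forall z : C, Cmod z <= r -> dom E z) /\
    forall eps, 0 < eps < r ->
      RInt (fun rho => RInt (fun theta =>
        let z : plane := (rho * cos theta, rho * sin theta) in
        Rabs (gauss_curvature (param E) z) * area_density (param E) z * rho)
        0 (2 * PI)) eps r <= M.

Definition horosphere (S : space -> Prop) : Prop :=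
  (exists c, 0 < c /\ forall p, S p <-> snd p = c) \/
  (exists (a : C) (r : R), 0 < r /\
     forall p, S p <->
       H3 p /\ Cmod (Cminus (fst p) a) ^ 2 + (snd p - r) ^ 2 = r ^ 2).

Definition part_of_horosphere (E : surface_end) : Prop :=
  exists S, horosphere S /\ forall z, dom_star E z -> S (param E z).

(* Bryant representations and Weierstrass data are taken near the puncture, on the half-plane exp(s) in D(0,delta)*,
   the universal cover of the punctured disc D(0,delta)*, with z = exp(s);
   z^a is exp(a s). *)
Definition half_plane (delta : R) (s : C) : Prop := exp (Re s) < delta.

Definition zpow (a : R) (s : C) : C := cexp (Cmult (RtoC a) s).

Definition bryant_representation (delta : R) (X : plane -> space)
  (A B C' D : C -> C) : Prop :=
  holomorphic_on (half_plane delta) A /\ holomorphic_on (half_plane delta) B /\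
  holomorphic_on (half_plane delta) C' /\ holomorphic_on (half_plane delta) D /\
  forall s, half_plane delta s ->
    (A s * D s - B s * C' s)%C = RtoC 1 /\
    (C_derive A s * C_derive D s - C_derive B s * C_derive C' s)%C = RtoC 0 /\
    let n := Cmod (A s) ^ 2 + Cmod (B s) ^ 2 in
    X (cexp s) =
      (((Cconj (A s) * C' s + Cconj (B s) * D s) / RtoC n)%C, / n).

(* omega is given by its coefficient [om] with respect to ds; the four
   equations are the entries of F^{-1} dF. *)
Definition weierstrass_data (delta : R) (A B C' D g om : C -> C) : Prop :=
  forall s, half_plane delta s ->
    (D s * C_derive A s - B s * C_derive C' s = g s * om s)%C /\
    (D s * C_derive B s - B s * C_derive D s = - (g s * g s) * om s)%C /\
    (A s * C_derive C' s - C' s * C_derive A s = om s)%C /\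
    (A s * C_derive D s - C' s * C_derive B s = - g s * om s)%C.

Definition disc (delta : R) (z : C) : Prop := Cmod z < delta.

(* Asymptotic boundary infinity, axis (Z, infinity). *)
Definition canonical_catenoidal_end (mu : R) (Z : C) (E : surface_end) : Prop :=
  bryant_end E /\ embedded E /\ finite_total_curvature E /\
  exists (delta : R) (h f1 f2 g1 g2 : C -> C),
    0 < delta /\ (forall z, disc delta z -> dom E z) /\
    holomorphic_on (disc delta) h /\ h (RtoC 0) <> RtoC 0 /\
    holomorphic_on (disc delta) f1 /\ f1 (RtoC 0) = RtoC 1 /\
    holomorphic_on (disc delta) f2 /\ f2 (RtoC 0) = RtoC 1 /\
    holomorphic_on (disc delta) g1 /\ g1 (RtoC 0) = RtoC 1 /\
    holomorphic_on (disc delta) g2 /\ g2 (RtoC 0) = RtoC 1 /\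
    Z = (RtoC ((mu ^ 2 - 1) / (4 * mu)) * C_derive f1 (RtoC 0))%C /\
    let A := fun s => (zpow ((1 - mu) / 2) s * f2 (cexp s))%C in
    let B := fun s => (RtoC ((mu - 1) / (mu + 1)) *
                       zpow ((1 + mu) / 2) s * g2 (cexp s))%C in
    let C' := fun s => (RtoC ((mu ^ 2 - 1) / (4 * mu)) *
                        zpow ((-1 - mu) / 2) s * f1 (cexp s))%C in
    let D := fun s => (RtoC ((1 + mu) ^ 2 / (4 * mu)) *
                       zpow ((mu - 1) / 2) s * g1 (cexp s))%C in
    let g := zpow mu in
    (* omega = z^(-1-mu) h(z) dz with dz = exp(s) ds *)
    let om := fun s => (zpow (-1 - mu) s * h (cexp s) * cexp s)%C in
    bryant_representation delta (param E) A B C' D /\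
    weierstrass_data delta A B C' D g om.

(* [phi] maps the end E onto the end E': it induces a diffeomorphism, with
   inverse [psi], between the parameter domains, matching the punctures.  It may
   reverse orientation, as it must when [phi] does. *)
Definition maps_end (phi : space -> space) (E E' : surface_end) : Prop :=
  exists psi psi' : plane -> plane,
    (forall n, Ck_plane n (dom_star E') psi) /\
    (forall n, Ck_plane n (dom_star E) psi') /\
    (forall z, dom_star E' z ->
       dom_star E (psi z) /\ psi' (psi z) = z /\
       phi (param E (psi z)) = param E' z) /\
    (forall z, dom_star E z -> dom_star E' (psi' z) /\ psi (psi' z) = z) /\
    filterlim psi (within (dom_star E') (locally (RtoC 0 : plane)))
      (locally (RtoC 0 : plane)) /\
    filterlim psi' (within (dom_star E) (locally (RtoC 0 : plane)))
      (locally (RtoC 0 : plane)).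

(* Growth 1 - mu, asymptotic boundary b, axis (a, b). *)
Definition catenoidal_end (mu : R) (a b : Cbar) (E : surface_end) : Prop :=
  bryant_end E /\ embedded E /\ finite_total_curvature E /\
  ~ part_of_horosphere E /\
  exists (phi : space -> space) (E' : surface_end),
    isometry phi /\
    boundary_maps phi a (Some (RtoC 0)) /\ boundary_maps phi b None /\
    maps_end phi E E' /\
    canonical_catenoidal_end mu (RtoC 0) E'.

Definition circle (r : R) (n : Z) (t : R) : C :=
  (r * cos (IZR n * t), r * sin (IZR n * t)).

(* Strip of parameters of homotopies and of polar coordinates on discs. *)
Definition strip (q : plane) : Prop := 0 <= fst q <= 1.

(* The 2 PI-periodic loop [gamma] generates the fundamental group of the end
   (n = 1 or -1): it is homotopic in the punctured domain to the circle run n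
   times around the puncture. *)
Definition generator (E : surface_end) (n : Z) (gamma : R -> plane) : Prop :=
  (n = 1%Z \/ n = (-1)%Z) /\
  Ck_plane 2 (fun _ : R_NormedModule => True) gamma /\
  exists (r : R) (h : plane -> plane) (U : plane -> Prop),
    0 < r /\ (forall z : C, Cmod z <= r -> dom E z) /\
    open U /\ (forall q, strip q -> U q) /\ Ck_plane 2 U h /\
    (forall q, strip q -> dom_star E (h q)) /\
    (forall x t, 0 <= x <= 1 -> h (x, t + 2 * PI) = h (x, t)) /\
    (forall t, h (0, t) = gamma t) /\
    (forall t, h (1, t) = circle r n t).

(* [kappa], in polar coordinates (rho, theta), parametrizes a disc with oriented
   boundary [Gamma].  Singular points are allowed: the area density vanishes
   there. *)
Definition spanning_disc (Gamma : R -> space) (kappa : plane -> space) : Prop :=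
  (exists U : plane -> Prop,
     open U /\ (forall q, strip q -> U q) /\ Ck_space 2 U kappa) /\
  (forall q, strip q -> H3 (kappa q)) /\
  (forall rho t, 0 <= rho <= 1 -> kappa (rho, t + 2 * PI) = kappa (rho, t)) /\
  (forall t t', kappa (0, t) = kappa (0, t')) /\
  (forall t, kappa (1, t) = Gamma t).

Definition loop_in (E : surface_end) (gamma : R -> plane)
  (t : R_NormedModule) : space := param E (gamma t).

Definition velocity (Gamma : R_NormedModule -> space) (t : R) : space :=
  dspace Gamma (1 : R_NormedModule) t.

(* [eta] is the unit conormal pointing towards the puncture, which lies on the
   left of the loop if n = 1 and on its right if n = -1; the last condition is
   the one fixing the orientation of the loop. *)
Definition conormal (E : surface_end) (n : Z) (gamma : R -> plane)
  (eta : R -> space) : Prop :=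
  let Gamma := loop_in E gamma in
  forall t : R,
    (exists v : plane,
       eta t = dspace (param E) v (gamma t) /\
       0 < IZR n * Im (Cmult (Cconj (dplane (V := R_NormedModule) gamma 1 t)) v))
    /\
    hyp_norm (Gamma t) (eta t) = 1 /\
    hyp_inner (Gamma t) (eta t) (velocity Gamma t) = 0 /\
    0 < det3 (velocity Gamma t) (eta t)
          (opp (mean_curvature_vector (param E) (gamma t))).

Definition flux_integral (Gamma : R -> space) (eta : R -> space)
  (kappa : plane -> space) (Y : space -> space) : R :=
  RInt (fun t => hyp_inner (Gamma t) (eta t) (Y (Gamma t)) *
                 hyp_norm (Gamma t) (velocity Gamma t)) 0 (2 * PI)
  - 2 * RInt (fun rho => RInt (fun theta =>
          let q : plane := (rho, theta) in
          hyp_inner (kappa q) (unit_normal kappa q) (Y (kappa q)) *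
          area_density kappa q) 0 (2 * PI)) 0 1.

Definition is_flux (E : surface_end) (Y : space -> space) (x : R) : Prop :=
  forall n gamma eta kappa,
    generator E n gamma -> conormal E n gamma eta ->
    spanning_disc (loop_in E gamma) kappa ->
    flux_integral (loop_in E gamma) eta kappa Y = x.

Definition polynomial2 (P : C -> C -> C) : Prop :=
  exists (N : nat) (a : nat -> nat -> C), forall x y : C,
    P x y = sum_n (fun i => sum_n (fun j =>
              Cmult (a i j) (Cmult (Cpow x i) (Cpow y j))) N) N.

Definition at_infinity (Q : C -> Prop) : Prop :=
  exists M : R, forall z : C, M < Cmod z -> Q z.

(* l = P(c, d) / (c - d), as a limit if c or d is infinite. *)
Definition flux_ratio (P : C -> C -> C) (c d : Cbar) (l : C) : Prop :=
  match c, d with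
  | Some x, Some y => l = (P x y / (x - y))%C
  | Some x, None =>
      filterlim (fun y : C => (P x y / (x - y))%C) at_infinity (locally l)
  | None, Some y =>
      filterlim (fun x : C => (P x y / (x - y))%C) at_infinity (locally l)
  | None, None => False
  end.

Definition flux_polynomial2 (E : surface_end) (P : C -> C -> C) : Prop :=
  polynomial2 P /\
  forall c d : Cbar, c <> d -> exists l : C, flux_ratio P c d l /\
    (forall Y, translation_field c d Y -> is_flux E Y (Re l)) /\
    (forall Y, rotation_field c d Y -> is_flux E Y (- Im l)).

(* Polynomials over C are identified with polynomial functions. *)
Definition flux_polynomial (E : surface_end) (Pi : C -> C) : Prop :=
  exists P : C -> C -> C,
    flux_polynomial2 E P /\
    (forall P', flux_polynomial2 E P' -> forall x y, P' x y = P x y) /\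
    forall x, Pi x = P x x.

(* (X - a)(X - b) / (b - a), with its limit values if a or b is infinite. *)
Definition axis_polynomial (a b : Cbar) (x : C) : C :=
  match a, b with
  | Some a, Some b => ((x - a) * (x - b) / (b - a))%C
  | None, Some b => (x - b)%C
  | Some a, None => (- (x - a))%C
  | None, None => RtoC 0
  end.

(* Main.v *)
Require Import Defs.
From Stdlib Require Import Reals.
From Coquelicot Require Import Coquelicot.
From Stdlib Require Import Lra Lia ZArith FunctionalExtensionality ClassicalEpsilon Classical.

Open Scope R_scope.

(** The flux of a Killing field is computed as the residue of a holomorphic form.

    A Killing field Y of H3 comes from a quadratic field of the boundary sphere,
    that is from a traceless matrix k. Let M be the positive hermitian matrix of a
    point of H3 and T = trace (dM M^-1 k). The real part of T is the inner product
    with Y, and -1/2 Im T is a primitive of the contraction of the volume form with Y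
    ([dITf_curl]). By Stokes the integral over a spanning disc becomes the integral
    of Im T over its boundary. Hence the flux is the integral over the loop of the
    sum of the Hodge dual of Re T and of Im T ([flux_line_integral]). This form is
    closed because Y is a Killing field and the mean curvature is one
    ([flux_form_closed]), so that the flux is a period of the end ([flux_period]).

    Where the surface is given by M = F F^* with F a Bryant representation, the form
    is the imaginary part of 2 trace (dF F^-1 k) ([frame_flux]), which is holomorphic.
    The representation of a canonical catenoidal end gives the limits of the entries
    of dF F^-1 at the puncture: (1 - mu^2)/4 on the diagonal, 0 above it, and below it
    a simple pole without constant term in the universal cover ([canonical_frame]).
    Only the diagonal coefficient K11 of k contributes to the period
    ([vertical_exp_integral]).

    A catenoidal end is related to a canonical one by an isometry and by a
    diffeomorphism of the parameters. The coordinates of the hyperboloid model are the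
    solutions of Hess n = n g, so that isometries are linear in that model
    ([isometry_linear]); this makes explicit those that send a to 0 and b to infinity
    ([isometry_classification]). The change of parameter is conformal; if it reversed
    the orientation somewhere, then Im T would be closed there for every Killing field,
    which is impossible ([Psi_holomorphic]); it has degree one ([Psi_winding]). So the
    computation applies to the given end, with k expressed in a basis adapted to the
    points a and b, where K11 is a cross-ratio ([K11_cross_ratio]).

    The translation and rotation fields are given by their flows; the same
    classification identifies them with the quadratic fields vanishing at c and d
    ([generated_killing]). The values of the flux then show the flux polynomial. It is
    unique because the flux is attained ([flux_data]) and because flows exist about
    every geodesic with finite ends ([flow_exists]). *)

(** * Iterated directional derivatives *)

(** Ck with continuity asked at every order. On the plane it follows from Ck
    (Ck_plane_CK), and so does it on any space for functions that are Ck for all n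
    (CK_of_Ck); asking for it makes the class stable under sums, products and
    compositions, by induction on n. *)
Fixpoint CK (n : nat) {V : NormedModule R_AbsRing} (U : V -> Prop) (f : V -> R)
  : Prop :=
  (forall p : V, U p -> continuous f p) /\
  match n with
  | O => True
  | S m =>
      (forall p v : V, U p ->
         ex_derive (fun t : R => f (plus p (scal t v))) 0) /\
      (forall v : V, CK m U (dir_deriv f v))
  end.

Arguments CK : simpl never.

Section Generic.
Context {V : NormedModule R_AbsRing}.
Implicit Types (U : V -> Prop) (f g : V -> R) (p v : V).

Lemma CK_cont n U f p : CK n U f -> U p -> continuous f p.
Proof. destruct n; intros [H _] Hp; exact (H p Hp). Qed.

Lemma CK_S n U f : CK (S n) U f -> forall v, CK n U (dir_deriv f v).
Proof. intros (_ & _ & H); exact H. Qed.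

Lemma CK_ex n U f p v : CK (S n) U f -> U p ->
  ex_derive (fun t : R => f (plus p (scal t v))) 0.
Proof. intros (_ & H & _) Hp; auto. Qed.

Lemma CK_pred n : forall U f, CK (S n) U f -> CK n U f.
Proof.
  induction n as [|n IH]; intros U f (H1 & H2 & H3); split; auto.
Qed.

Lemma CK_le n m U f : (m <= n)%nat -> CK n U f -> CK m U f.
Proof. induction 1; auto. intros H0; apply IHle, CK_pred, H0. Qed.

Lemma CK_sub n : forall U U' f, (forall p, U' p -> U p) -> CK n U f -> CK n U' f.
Proof.
  induction n as [|n IH]; intros U U' f HU (H1 & H2); split; auto.
  destruct H2 as [H2 H3]. split; auto. intros v; apply (IH U); auto.
Qed.

Lemma CK_to_Ck n : forall U f, CK n U f -> Ck n U f.
Proof.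
  induction n as [|n IH]; intros U f (H1 & H2); simpl; auto.
  destruct H2 as [H2 H3]. split; auto.
Qed.

Lemma CK_of_Ck U f : (forall n, Ck n U f) -> forall n, CK n U f.
Proof.
  intros H n; revert f H. induction n as [|n IH]; intros f H; split.
  - exact (H 0%nat).
  - exact I.
  - exact (H 0%nat).
  - split; [exact (proj1 (H 1%nat))|]. intros v. apply IH. intros m.
    exact (proj2 (H (S m)) v).
Qed.

Lemma line_continuous p v (s : R) : continuous (fun t : R => plus p (scal t v)) s.
Proof.
  apply (continuous_plus (fun _ : R => p) (fun t : R => scal t v)).
  - apply continuous_const.
  - apply (continuous_scal_l (fun t : R => t) v). apply continuous_id.
Qed.

Lemma line_0 p v : plus p (scal 0 v) = p.
Proof.
  replace (scal 0 v) with (zero : V)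
    by (symmetry; exact (@scal_zero_l R_AbsRing V v)).
  apply plus_zero_r.
Qed.

Lemma line_locally U p v (s : R) : open U -> U (plus p (scal s v)) ->
  locally s (fun t : R => U (plus p (scal t v))).
Proof.
  intros HU Hp. apply (line_continuous p v s). apply HU, Hp.
Qed.

Lemma line_locally0 U p v : open U -> U p ->
  locally (0 : R) (fun t : R => U (plus p (scal t v))).
Proof. intros HU Hp. apply line_locally; auto. now rewrite line_0. Qed.

Lemma dir_is_derive n U f p v : CK (S n) U f -> U p ->
  is_derive (fun t : R => f (plus p (scal t v))) 0 (dir_deriv f v p).
Proof. intros H Hp. apply Derive_correct. eapply CK_ex; eauto. Qed.

Lemma line_shift p v (s t : R) :
  plus (plus p (scal s v)) (scal (t - s) v) = plus p (scal t v).
Proof.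
  rewrite <- plus_assoc. f_equal. rewrite <- (@scal_distr_r R_AbsRing V).
  f_equal. unfold plus; simpl. ring.
Qed.

Lemma line_is_derive n U f p v (s : R) : CK (S n) U f -> U (plus p (scal s v)) ->
  is_derive (fun t : R => f (plus p (scal t v))) s
    (dir_deriv f v (plus p (scal s v))).
Proof.
  intros H Hp. pose proof (dir_is_derive n U f _ v H Hp) as D.
  apply (is_derive_ext
    (fun t : R => (fun r : R => f (plus (plus p (scal s v)) (scal r v))) (t - s))).
  { intros t. now rewrite line_shift. }
  replace (dir_deriv f v (plus p (scal s v)))
    with (1 * dir_deriv f v (plus p (scal s v))) by ring.
  apply (is_derive_comp (fun r : R => f (plus (plus p (scal s v)) (scal r v)))
    (fun t => t - s) s).
  - replace (s - s) with 0 by ring. exact D.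
  - auto_derive; auto; ring.
Qed.

Lemma dir_unique f p v l :
  is_derive (fun t : R => f (plus p (scal t v))) 0 l -> dir_deriv f v p = l.
Proof. apply is_derive_unique. Qed.

Lemma dir_ext_loc U f g p v : open U -> (forall q, U q -> f q = g q) -> U p ->
  dir_deriv f v p = dir_deriv g v p.
Proof.
  intros HU E Hp. apply Derive_ext_loc.
  generalize (line_locally0 U p v HU Hp). apply filter_imp. auto.
Qed.

Lemma CK_ext n : forall U f g, open U -> (forall q, U q -> f q = g q) ->
  CK n U f -> CK n U g.
Proof.
  induction n as [|n IH]; intros U f g HU E (H1 & H2); split.
  1,3: intros p Hp; eapply continuous_ext_loc; [|exact (H1 p Hp)];
       generalize (HU p Hp); apply filter_imp; intros q Hq; rewrite (E q Hq); auto.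
  - exact I.
  - destruct H2 as [H2 H3]. split.
    + intros p v Hp. apply (ex_derive_ext_loc (fun t => f (plus p (scal t v)))).
      * generalize (line_locally0 U p v HU Hp). apply filter_imp. auto.
      * auto.
    + intros v. apply (IH U (dir_deriv f v)); auto.
      intros q Hq. now apply (dir_ext_loc U).
Qed.

Lemma CK_const n : forall U (c : R), CK n U (fun _ => c).
Proof.
  induction n as [|n IH]; intros U c; split; auto.
  1,2: intros p _; apply continuous_const.
  split. { intros; apply ex_derive_const. }
  intros v. assert (E : (dir_deriv (fun _ : V => c) v) = fun _ : V => 0).
  { apply functional_extensionality. intros p.
    unfold dir_deriv. apply Derive_const. }
  rewrite E. apply IH.
Qed.

Lemma CK_linear n U f : (forall p, continuous f p) ->
  (forall p v (t : R), f (plus p (scal t v)) = f p + t * f v) -> CK n U f.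
Proof.
  intros H E. destruct n; split; auto. split.
  - intros p v _. apply (ex_derive_ext (fun t => f p + t * f v)).
    { intros; now rewrite E. }
    now auto_derive.
  - intros v. assert (F : (dir_deriv f v) = fun _ : V => f v).
    { apply functional_extensionality. intros p.
      apply dir_unique. apply (is_derive_ext (fun t => f p + t * f v)).
      { intros; now rewrite E. }
      auto_derive; auto; ring. }
    rewrite F. apply CK_const.
Qed.

Lemma CK_plus n : forall U f g, open U -> CK n U f -> CK n U g ->
  CK n U (fun p => f p + g p).
Proof.
  induction n as [|n IH]; intros U f g HU Hf Hg; split.
  1,3: intros p Hp; apply (continuous_plus f g); eapply CK_cont; eauto.
  - exact I.
  - split.
    + intros p v Hp. apply (ex_derive_plus (fun t : R => f (plus p (scal t v)))
        (fun t : R => g (plus p (scal t v)))); eapply CK_ex; eauto.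
    + intros v. apply (CK_ext n U (fun p => dir_deriv f v p + dir_deriv g v p)); auto.
      2:{ apply IH; auto; now apply CK_S. }
      intros q Hq. symmetry. apply dir_unique.
      apply (is_derive_plus (fun t : R => f (plus q (scal t v)))
        (fun t : R => g (plus q (scal t v)))); eapply dir_is_derive; eauto.
Qed.

Lemma dir_mult n U f g p v : CK (S n) U f -> CK (S n) U g -> U p ->
  is_derive (fun t : R => f (plus p (scal t v)) * g (plus p (scal t v))) 0
   (dir_deriv f v p * g p + f p * dir_deriv g v p).
Proof.
  intros Hf Hg Hp.
  pose proof (is_derive_mult (fun t : R => f (plus p (scal t v)))
    (fun t : R => g (plus p (scal t v))) 0 _ _
    (dir_is_derive _ _ _ _ v Hf Hp) (dir_is_derive _ _ _ _ v Hg Hp)) as D.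
  cbv beta in D. rewrite (line_0 p v) in D. apply D. intros; apply Rmult_comm.
Qed.

Lemma CK_mult n : forall U f g, open U -> CK n U f -> CK n U g ->
  CK n U (fun p => f p * g p).
Proof.
  induction n as [|n IH]; intros U f g HU Hf Hg; split.
  1,3: intros p Hp; apply (continuous_mult f g); eapply CK_cont; eauto.
  - exact I.
  - split.
    + intros p v Hp. eexists. apply (dir_mult n U); auto.
    + intros v. apply (CK_ext n U
        (fun p => dir_deriv f v p * g p + f p * dir_deriv g v p)); auto.
      2:{ apply CK_plus; auto; apply IH; auto; try (now apply CK_S); now apply CK_pred. }
      intros q Hq. symmetry. apply dir_unique. now apply (dir_mult n U).
Qed.

Lemma CK_opp n U f : open U -> CK n U f -> CK n U (fun p => - f p).
Proof.
  intros HU H. apply (CK_ext n U (fun p => (-1) * f p)); auto.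
  { intros; ring. }
  apply CK_mult; auto. apply CK_const.
Qed.

Lemma CK_minus n U f g : open U -> CK n U f -> CK n U g ->
  CK n U (fun p => f p - g p).
Proof. intros HU Hf Hg. apply CK_plus; auto. now apply CK_opp. Qed.

End Generic.

Lemma dir_R (f : R -> R) (x : R) :
  dir_deriv (V := R_NormedModule) f 1 x = Derive f x.
Proof.
  unfold dir_deriv.
  apply (f_equal real). apply Lim_ext. intros h.
  change (plus (x : R_NormedModule) (scal (0 + h) (1 : R_NormedModule)))
    with (x + (0 + h) * 1).
  change (plus (x : R_NormedModule) (scal 0 (1 : R_NormedModule)))
    with (x + 0 * 1).
  replace (x + (0 + h) * 1) with (x + h) by ring.
  now replace (x + 0 * 1) with x by ring.
Qed.

Lemma is_derive_line_R (f : R -> R) (x v : R) (l : R) : is_derive f x l ->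
  is_derive (fun t : R => f (plus (x : R_NormedModule) (scal t (v : R_NormedModule)))) 0
    (v * l).
Proof.
  intros H. apply (is_derive_ext (fun t : R => f (x + t * v))).
  { reflexivity. }
  apply (is_derive_comp f (fun t => x + t * v)).
  - replace (x + 0 * v) with x by ring. exact H.
  - auto_derive; auto; ring.
Qed.

Lemma is_derive_of_line_R (f : R -> R) (x : R) :
  ex_derive (fun t : R => f (plus (x : R_NormedModule) (scal t (1 : R_NormedModule)))) 0 ->
  is_derive f x (dir_deriv (V := R_NormedModule) f 1 x).
Proof.
  intros [l H].
  assert (E : is_derive f x l).
  { apply (is_derive_ext (fun t : R => (fun r : R =>
      f (plus (x : R_NormedModule) (scal r (1 : R_NormedModule)))) (t - x))).
    { intros t. f_equal. change (x + (t - x) * 1 = t). ring. }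
    replace l with (1 * l) by ring.
    apply (is_derive_comp (fun r : R =>
      f (plus (x : R_NormedModule) (scal r (1 : R_NormedModule)))) (fun t => t - x)).
    - replace (x - x) with 0 by ring. exact H.
    - auto_derive; auto; ring. }
  rewrite dir_R. now rewrite (is_derive_unique _ _ _ E).
Qed.

Lemma CK_R_is_derive n (U : R_NormedModule -> Prop) (f : R_NormedModule -> R) x :
  CK (S n) U f -> U x -> is_derive f x (dir_deriv f (1 : R_NormedModule) x).
Proof. intros H Hx. apply is_derive_of_line_R. eapply CK_ex; eauto. Qed.

Lemma Ck_R_CK n : forall (U : R_NormedModule -> Prop) f, Ck n U f -> CK n U f.
Proof.
  assert (B : forall (U : R_NormedModule -> Prop) f m, Ck (S m) U f ->
    forall p, U p -> continuous f p).
  { intros U f m [H _] p Hp.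
    apply (ex_derive_continuous f p). eexists. apply is_derive_of_line_R. auto. }
  induction n as [|n IH]; intros U f H; split; auto.
  - eauto.
  - destruct H as [H1 H2]. split; auto.
Qed.

Lemma CK_comp1 {V : NormedModule R_AbsRing} n :
  forall (U : V -> Prop) (f : V -> R) (W : R_NormedModule -> Prop) (g : R_NormedModule -> R),
  open U -> (forall p, U p -> W (f p)) -> CK n W g -> CK n U f ->
  CK n U (fun p => g (f p)).
Proof.
  induction n as [|n IH]; intros U f W g HU HW Hg Hf; split.
  1,3: intros p Hp; apply (continuous_comp f g);
    [eapply (CK_cont _ U f); eauto | eapply (CK_cont _ W g); eauto].
  - exact I.
  - assert (D : forall p v, U p -> is_derive (fun t : R => g (f (plus p (scal t v)))) 0
      (dir_deriv f v p * dir_deriv g (1 : R_NormedModule) (f p))).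
    { intros p v Hp.
      apply (is_derive_comp g (fun t : R => f (plus p (scal t v)))).
      - rewrite line_0. eapply CK_R_is_derive; eauto.
      - eapply dir_is_derive; eauto. }
    split. { intros p v Hp. eexists; apply D, Hp. }
    intros v. apply (CK_ext n U
      (fun p => dir_deriv f v p * dir_deriv g (1 : R_NormedModule) (f p))); auto.
    { intros q Hq. symmetry. now apply dir_unique, D. }
    apply CK_mult; auto. { now apply CK_S. }
    apply (IH U f W (dir_deriv g (1 : R_NormedModule))); auto.
    + now apply CK_S.
    + now apply CK_pred.
Qed.

Lemma CK_R_intro n (W : R_NormedModule -> Prop) (g g' : R -> R) : open W ->
  (forall x, W x -> is_derive g x (g' x)) -> CK n W g' -> CK (S n) W g.
Proof.
  intros HW D H. split.
  { intros x Hx. apply (ex_derive_continuous g x). eexists; apply D, Hx. }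
  split.
  { intros x v Hx. eexists. apply is_derive_line_R, D, Hx. }
  intros v. apply (CK_ext n W (fun x => v * g' x)); auto.
  - intros x Hx. symmetry. apply is_derive_unique, is_derive_line_R, D, Hx.
  - apply CK_mult; auto. apply CK_const.
Qed.

Definition allR (x : R_NormedModule) : Prop := True.
Definition posR (x : R_NormedModule) : Prop := 0 < x.

Lemma open_allR : open allR.
Proof. apply open_true. Qed.

Lemma open_posR : open posR.
Proof. apply (open_gt 0). Qed.

Lemma CK_exp n : CK n allR exp.
Proof.
  induction n as [|n IH]; [split; auto|].
  - intros x _. apply (ex_derive_continuous exp x). now auto_derive.
  - apply (CK_R_intro n allR exp exp); auto using open_allR.
    intros x _. auto_derive; auto; ring.
Qed.

(** Each is the derivative of the other up to sign, hence the simultaneous induction. *)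
Lemma CK_sin_cos n : CK n allR sin /\ CK n allR cos.
Proof.
  induction n as [|n [IH1 IH2]]; split.
  - split; auto. intros x _. apply (ex_derive_continuous sin x). now auto_derive.
  - split; auto. intros x _. apply (ex_derive_continuous cos x). now auto_derive.
  - apply (CK_R_intro n allR sin cos); auto using open_allR.
    intros x _. auto_derive; auto; ring.
  - apply (CK_R_intro n allR cos (fun x => - sin x)); auto using open_allR.
    + intros x _. auto_derive; auto; ring.
    + apply CK_opp; auto using open_allR.
Qed.

Lemma CK_Rinv n : CK n posR Rinv.
Proof.
  induction n as [|n IH]; [split; auto|].
  - intros x Hx. unfold posR in Hx. apply (ex_derive_continuous Rinv x). auto_derive. lra.
  - apply (CK_R_intro n posR Rinv (fun x => - (/ x * / x))); auto using open_posR.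
    + intros x Hx. unfold posR in Hx. auto_derive; [lra|]. field. lra.
    + apply CK_opp; auto using open_posR. apply CK_mult; auto using open_posR.
Qed.

Lemma CK_inv {V : NormedModule R_AbsRing} n (U : V -> Prop) f : open U ->
  (forall p, U p -> 0 < f p) -> CK n U f -> CK n U (fun p => / f p).
Proof.
  intros HU Hp Hf. apply (CK_comp1 n U f posR Rinv); auto. apply CK_Rinv.
Qed.

(** * Functions on the plane *)

Definition pdx (f : plane -> R) : plane -> R := dir_deriv f e1.
Definition pdy (f : plane -> R) : plane -> R := dir_deriv f e2.

Lemma plane_x (f : plane -> R) x y :
  ex_derive (fun t : R => f (plus ((x, y) : plane) (scal t e1))) 0 ->
  is_derive (fun t => f (t, y)) x (pdx f (x, y)).
Proof.
  intros [l H].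
  assert (E : is_derive (fun t => f (t, y)) x l).
  { apply (is_derive_ext (fun t : R => (fun r : R =>
      f (plus ((x, y) : plane) (scal r e1))) (t - x))).
    { intros t. f_equal. change ((x + (t - x) * 1, y + (t - x) * 0) = (t, y) :> R * R).
      apply injective_projections; simpl; ring. }
    replace l with (1 * l) by ring.
    apply (is_derive_comp (fun r : R =>
      f (plus ((x, y) : plane) (scal r e1))) (fun t => t - x)).
    - replace (x - x) with 0 by ring. exact H.
    - auto_derive; auto; ring. }
  unfold pdx, dir_deriv. now rewrite (is_derive_unique _ _ _ H).
Qed.

Lemma plane_y (f : plane -> R) x y :
  ex_derive (fun t : R => f (plus ((x, y) : plane) (scal t e2))) 0 ->
  is_derive (fun t => f (x, t)) y (pdy f (x, y)).
Proof.
  intros [l H].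
  assert (E : is_derive (fun t => f (x, t)) y l).
  { apply (is_derive_ext (fun t : R => (fun r : R =>
      f (plus ((x, y) : plane) (scal r e2))) (t - y))).
    { intros t. f_equal. change ((x + (t - y) * 0, y + (t - y) * 1) = (x, t) :> R * R).
      apply injective_projections; simpl; ring. }
    replace l with (1 * l) by ring.
    apply (is_derive_comp (fun r : R =>
      f (plus ((x, y) : plane) (scal r e2))) (fun t => t - y)).
    - replace (y - y) with 0 by ring. exact H.
    - auto_derive; auto; ring. }
  unfold pdy, dir_deriv. now rewrite (is_derive_unique _ _ _ H).
Qed.

(** The classical criterion of differentiability; it recovers the continuity that Ck
    does not ask for. *)
Lemma plane_diff0 (U : plane -> Prop) (f : plane -> R) x y : open U ->
  (forall p v, U p -> ex_derive (fun t : R => f (plus p (scal t v))) 0) ->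
  (forall p, U p -> continuous (pdx f) p) -> U (x, y) ->
  filterdiff (fun u : R * R => f (fst u, snd u)) (locally (x, y))
    (fun u : R * R => fst u * pdx f (x, y) + snd u * pdy f (x, y)).
Proof.
  intros HU H HC Hp.
  apply (is_derive_filterdiff (fun a b => f (a, b)) x y (fun a b => pdx f (a, b))
    (pdy f (x, y))).
  - generalize (HU _ Hp). apply filter_imp. intros [a b] Hab. simpl.
    apply plane_x; auto.
  - apply plane_y; auto.
  - apply (continuous_ext (pdx f)).
    + intros [a b]; reflexivity.
    + now apply HC.
Qed.

Lemma Ck_plane_continuous (U : plane -> Prop) (f : plane -> R) m : open U ->
  Ck (S m) U f -> forall p, U p -> continuous f p.
Proof.
  revert f. induction m as [|m IH]; intros f HU [H1 H2] [x y] Hp.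
  all: assert (D : filterdiff (fun u : R * R => f (fst u, snd u)) (locally (x, y))
    (fun u : R * R => fst u * pdx f (x, y) + snd u * pdy f (x, y))).
  - apply (plane_diff0 U); auto. apply (H2 e1).
  - apply (continuous_ext (fun u : R * R => f (fst u, snd u))).
    { intros [a b]; reflexivity. }
    exact (@filterdiff_continuous R_AbsRing
      (prod_NormedModule R_AbsRing R_NormedModule R_NormedModule) R_NormedModule
      _ (x, y) (ex_intro _ _ D)).
  - apply (plane_diff0 U); auto. exact (IH (pdx f) HU (H2 e1)).
  - apply (continuous_ext (fun u : R * R => f (fst u, snd u))).
    { intros [a b]; reflexivity. }
    exact (@filterdiff_continuous R_AbsRing
      (prod_NormedModule R_AbsRing R_NormedModule R_NormedModule) R_NormedModule
      _ (x, y) (ex_intro _ _ D)).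
Qed.

Lemma Ck_plane_CK n : forall (U : plane -> Prop) f, open U -> Ck n U f -> CK n U f.
Proof.
  induction n as [|n IH]; intros U f HU H; split; auto.
  - apply (Ck_plane_continuous U f n HU H).
  - destruct H as [H1 H2]. split; auto.
Qed.

Lemma plane_diff (U : plane -> Prop) (f : plane -> R) p : open U -> CK 1 U f -> U p ->
  differentiable_pt_lim (fun a b => f (a, b)) (fst p) (snd p) (pdx f p) (pdy f p).
Proof.
  destruct p as [x y]. intros HU H Hp.
  apply filterdiff_differentiable_pt_lim.
  apply (plane_diff0 U); auto.
  - intros; eapply CK_ex; eauto.
  - intros q Hq. eapply (CK_cont 0); eauto. now apply (CK_S 0).
Qed.

Lemma chain_plane (U : plane -> Prop) (f : plane -> R) (c1 c2 : R -> R) (t l1 l2 : R) :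
  open U -> CK 1 U f -> U (c1 t, c2 t) ->
  is_derive c1 t l1 -> is_derive c2 t l2 ->
  is_derive (fun s => f (c1 s, c2 s)) t
    (l1 * pdx f (c1 t, c2 t) + l2 * pdy f (c1 t, c2 t)).
Proof.
  intros HU Hf Hp D1 D2. apply is_derive_Reals.
  replace (l1 * pdx f (c1 t, c2 t) + l2 * pdy f (c1 t, c2 t))
    with (pdx f (c1 t, c2 t) * l1 + pdy f (c1 t, c2 t) * l2) by ring.
  apply (derivable_pt_lim_comp_2d (fun a b => f (a, b)) c1 c2);
    try now apply is_derive_Reals.
  apply (plane_diff U f (c1 t, c2 t) HU Hf Hp).
Qed.

Lemma dir_plane (U : plane -> Prop) (f : plane -> R) p v : open U -> CK 1 U f -> U p ->
  dir_deriv f v p = Re v * pdx f p + Im v * pdy f p.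
Proof.
  intros HU Hf Hp. apply dir_unique. destruct p as [x y], v as [a b].
  apply (is_derive_ext (fun t : R => f (x + t * a, y + t * b))).
  { reflexivity. }
  replace (Re (a, b) * pdx f (x, y) + Im (a, b) * pdy f (x, y)) with
   (a * pdx f (x + 0 * a, y + 0 * b) + b * pdy f (x + 0 * a, y + 0 * b)).
  2:{ replace (x + 0 * a) with x by ring. now replace (y + 0 * b) with y by ring. }
  apply (chain_plane U f (fun t => x + t * a) (fun t => y + t * b)); auto.
  - replace (x + 0 * a) with x by ring. now replace (y + 0 * b) with y by ring.
  - auto_derive; auto; ring.
  - auto_derive; auto; ring.
Qed.

Lemma CK_comp2 {V : NormedModule R_AbsRing} n :
  forall (U : V -> Prop) (f1 f2 : V -> R) (W : plane -> Prop) (g : plane -> R),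
  open U -> open W -> (forall p, U p -> W (f1 p, f2 p)) ->
  CK n W g -> CK n U f1 -> CK n U f2 ->
  CK n U (fun p => g (f1 p, f2 p)).
Proof.
  induction n as [|n IH]; intros U f1 f2 W g HU HO HW Hg H1 H2; split.
  1,3: intros p Hp; apply (continuous_comp_2 f1 f2 (fun a b => g (a, b)));
    try (eapply CK_cont; now eauto);
    apply (continuous_ext g); [intros [a b]; reflexivity | eapply CK_cont; now eauto].
  - exact I.
  - assert (D : forall p v, U p ->
      is_derive (fun t : R => g (f1 (plus p (scal t v)), f2 (plus p (scal t v)))) 0
      (dir_deriv f1 v p * pdx g (f1 p, f2 p) + dir_deriv f2 v p * pdy g (f1 p, f2 p))).
    { intros p v Hp.
      pose proof (chain_plane W g (fun t : R => f1 (plus p (scal t v)))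
        (fun t : R => f2 (plus p (scal t v))) 0 (dir_deriv f1 v p) (dir_deriv f2 v p) HO)
        as C.
      cbv beta in C. rewrite line_0 in C. apply C; auto.
      - apply (CK_le (S n)); auto. lia.
      - eapply dir_is_derive; eauto.
      - eapply dir_is_derive; eauto. }
    split. { intros p v Hp. eexists; apply D, Hp. }
    intros v. apply (CK_ext n U
      (fun p => dir_deriv f1 v p * pdx g (f1 p, f2 p) + dir_deriv f2 v p * pdy g (f1 p, f2 p)));
      auto.
    { intros q Hq. symmetry. now apply dir_unique, D. }
    apply CK_plus; auto; apply CK_mult; auto; try now apply CK_S.
    all: apply (IH U f1 f2 W); auto; try (now apply CK_pred); now apply CK_S.
Qed.

Lemma CK_fst n (U : plane -> Prop) : CK n U (fun p : plane => fst p).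
Proof.
  apply CK_linear.
  - intros p. apply continuous_fst.
  - reflexivity.
Qed.

Lemma CK_snd n (U : plane -> Prop) : CK n U (fun p : plane => snd p).
Proof.
  apply CK_linear.
  - intros p. apply continuous_snd.
  - reflexivity.
Qed.

(** Schwarz's theorem. *)
Lemma pdx_pdy (U : plane -> Prop) (f : plane -> R) p : open U -> CK 2 U f -> U p ->
  pdx (pdy f) p = pdy (pdx f) p.
Proof.
  intros HU Hf Hp. destruct p as [x y].
  assert (H1 : CK 1 U f) by now apply CK_pred.
  assert (Hx : CK 1 U (pdx f)) by now apply CK_S.
  assert (Hy : CK 1 U (pdy f)) by now apply CK_S.
  assert (Ix : forall g, CK 1 U g -> forall a b, U (a, b) ->
    is_derive (fun t => g (t, b)) a (pdx g (a, b))).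
  { intros g Hg a b Hab. apply plane_x. eapply CK_ex; eauto. }
  assert (Iy : forall g, CK 1 U g -> forall a b, U (a, b) ->
    is_derive (fun t => g (a, t)) b (pdy g (a, b))).
  { intros g Hg a b Hab. apply plane_y. eapply CK_ex; eauto. }
  assert (L : forall a b, U (a, b) -> locally a (fun t => U (t, b))).
  { intros a b Hab. pose proof (HU _ Hab) as [d Hd]. exists d. intros t Ht.
    apply Hd. split; [exact Ht | apply ball_center]. }
  assert (L' : forall a b, U (a, b) -> locally b (fun t => U (a, t))).
  { intros a b Hab. pose proof (HU _ Hab) as [d Hd]. exists d. intros t Ht.
    apply Hd. split; [apply ball_center | exact Ht]. }
  assert (E1 : forall a b, U (a, b) ->
    is_derive (fun z => Derive (fun t => f (z, t)) b) a (pdx (pdy f) (a, b))).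
  { intros a b Hab. apply (is_derive_ext_loc (fun z => pdy f (z, b))).
    - generalize (L a b Hab). apply filter_imp. intros z Hz. symmetry.
      apply is_derive_unique. auto.
    - auto. }
  assert (E2 : forall a b, U (a, b) ->
    is_derive (fun z => Derive (fun t => f (t, z)) a) b (pdy (pdx f) (a, b))).
  { intros a b Hab. apply (is_derive_ext_loc (fun z => pdx f (a, z))).
    - generalize (L' a b Hab). apply filter_imp. intros z Hz. symmetry.
      apply is_derive_unique. auto.
    - auto. }
  assert (LU : locally_2d (fun a b => U (a, b)) x y).
  { apply locally_2d_locally. generalize (HU _ Hp). apply filter_imp.
    intros [a b]; auto. }
  refine (eq_trans (eq_sym (is_derive_unique _ _ _ (E1 x y Hp)))
    (eq_trans _ (is_derive_unique _ _ _ (E2 x y Hp)))).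
  assert (CC : forall g h : R -> R -> R, forall k : plane -> R, CK 0 U k ->
     (forall a b, U (a, b) -> g a b = k (a, b)) -> continuity_2d_pt g x y).
  { intros g _ k Hk E. apply (continuity_2d_pt_ext_loc (fun a b => k (a, b))).
    - generalize LU. apply locally_2d_impl. apply locally_2d_forall.
      intros a b Hab. symmetry; auto.
    - apply continuity_2d_pt_filterlim.
      change (continuous (fun z : R * R => k (fst z, snd z)) (x, y)).
      apply (continuous_ext k). { intros [a b]; reflexivity. }
      eapply (CK_cont 0 U k); eauto. }
  apply (Schwarz (fun a b => f (a, b)) x y).
  - generalize LU. apply locally_2d_impl. apply locally_2d_forall.
    intros a b Hab. repeat split.
    + eexists; apply (Ix f); auto.
    + eexists; apply (Iy f); auto.
    + eexists; apply E1; auto.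
    + eexists; apply E2; auto.
  - apply (CC _ (fun _ _ => 0) (pdx (pdy f))); [now apply CK_S|].
    intros; now apply is_derive_unique, E1.
  - apply (CC _ (fun _ _ => 0) (pdy (pdx f))); [now apply CK_S|].
    intros; now apply is_derive_unique, E2.
Qed.

Lemma pdx_val (f : plane -> R) (x y l : R) : is_derive (fun t : R => f (t, y)) x l ->
  pdx f (x, y) = l.
Proof.
  intros H. apply is_derive_unique.
  apply (is_derive_ext (fun t : R => f (x + t * 1, y))).
  { intros t. change (f (x + t * 1, y) = f (x + t * 1, y + t * 0)). do 2 f_equal. ring. }
  replace l with (1 * l) by ring.
  apply (is_derive_comp (fun t : R => f (t, y)) (fun t => x + t * 1)).
  - replace (x + 0 * 1) with x by ring. exact H.
  - auto_derive; auto; ring.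
Qed.

Lemma pdy_val (f : plane -> R) (x y l : R) : is_derive (fun t : R => f (x, t)) y l ->
  pdy f (x, y) = l.
Proof.
  intros H. apply is_derive_unique.
  apply (is_derive_ext (fun t : R => f (x, y + t * 1))).
  { intros t. change (f (x, y + t * 1) = f (x + t * 0, y + t * 1)). do 2 f_equal. ring. }
  replace l with (1 * l) by ring.
  apply (is_derive_comp (fun t : R => f (x, t)) (fun t => y + t * 1)).
  - replace (y + 0 * 1) with y by ring. exact H.
  - auto_derive; auto; ring.
Qed.

(** * Stokes on a strip *)

(** The segment is compact, so the neighbourhoods of its points have a common width. *)
Lemma tube (P : R -> R -> Prop) (x a b : R) :
  (forall t, a <= t <= b -> locally ((x, t) : R * R) (fun q => P (fst q) (snd q))) ->
  exists d : posreal, forall x', Rabs (x' - x) < d ->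
    forall t, a <= t <= b -> P x' t.
Proof.
  intros H.
  assert (C : forall t, exists d : posreal, a <= t <= b ->
    forall x' t', Rabs (x' - x) < d -> Rabs (t' - t) < d -> P x' t').
  { intros t. destruct (classic (a <= t <= b)) as [Ht|Ht].
    - destruct (H t Ht) as [d Hd]. exists d. intros _ x' t' H1 H2.
      apply (Hd (x', t')). split; assumption.
    - exists (mkposreal 1 Rlt_0_1). tauto. }
  pose (delta := fun t => proj1_sig (constructive_indefinite_description _ (C t))).
  assert (Hdelta : forall t, a <= t <= b ->
    forall x' t', Rabs (x' - x) < delta t -> Rabs (t' - t) < delta t -> P x' t').
  { intros t. exact (proj2_sig (constructive_indefinite_description _ (C t))). }
  destruct (compactness_value_1d a b delta) as [d Hd].
  exists d. intros x' Hx t Ht. apply NNPP. intros N. apply (Hd t Ht).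
  intros (t0 & H0 & H1 & H2). apply N, (Hdelta t0 H0); lra.
Qed.

Lemma cont_x (f : plane -> R) x y : continuous f (x, y) -> continuous (fun t => f (t, y)) x.
Proof.
  intros H. apply (continuous_comp_2 (fun t : R => t) (fun _ : R => y) (fun a b => f (a, b))).
  - apply continuous_id.
  - apply continuous_const.
  - apply (continuous_ext f); [intros [? ?]; reflexivity | exact H].
Qed.

Lemma cont_y (f : plane -> R) x y : continuous f (x, y) -> continuous (fun t => f (x, t)) y.
Proof.
  intros H. apply (continuous_comp_2 (fun _ : R => x) (fun t : R => t) (fun a b => f (a, b))).
  - apply continuous_const.
  - apply continuous_id.
  - apply (continuous_ext f); [intros [? ?]; reflexivity | exact H].
Qed.

Lemma ex_RInt_y (f : plane -> R) x a b : a <= b ->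
  (forall t, a <= t <= b -> continuous f (x, t)) ->
  ex_RInt (fun t => f (x, t)) a b.
Proof.
  intros Hab H. apply (ex_RInt_continuous (V := R_CompleteNormedModule)).
  rewrite Rmin_left, Rmax_right by lra. intros t Ht. now apply cont_y, H.
Qed.

Lemma RInt_param_continuous (g : plane -> R) (x a b : R) (U : plane -> Prop) :
  a <= b -> open U -> (forall t, a <= t <= b -> U (x, t)) ->
  (forall p, U p -> continuous g p) ->
  continuous (fun y => RInt (fun t => g (y, t)) a b) x.
Proof.
  intros Hab HU Hx Hg.
  apply filterlim_locally. intros eps.
  assert (Hk : 0 < eps / (b - a + 1)).
  { apply Rdiv_lt_0_compat; [apply eps | lra]. }
  destruct (tube (fun x' t => U (x', t) /\ Rabs (g (x', t) - g (x, t)) < eps / (b - a + 1))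
    x a b) as [d Hd].
  { intros t Ht.
    assert (Hk2 : 0 < eps / (b - a + 1) / 2) by lra.
    pose proof (proj1 (filterlim_locally g (g (x, t))) (Hg _ (Hx t Ht))
      (mkposreal _ Hk2)) as L.
    assert (L2 : locally ((x, t) : R * R) (fun q => U q /\
       ball (g (x, t)) (eps / (b - a + 1) / 2) (g q))).
    { apply filter_and; [apply HU, Hx, Ht | exact L]. }
    destruct L2 as [e He]. exists e. intros [x' t'] [B1 B2]. simpl in B1, B2.
    destruct (He (x', t')) as [A1 A2]. { split; assumption. }
    destruct (He (x, t')) as [A3 A4]. { split; [apply ball_center | assumption]. }
    split; auto. simpl.
    assert (TR : forall u v w k, Rabs (u - w) < k / 2 -> Rabs (v - w) < k / 2 ->
      Rabs (u - v) < k).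
    { intros u v w k C1 C2. apply Rabs_def2 in C1. apply Rabs_def2 in C2.
      apply Rabs_def1; lra. }
    exact (TR _ _ _ _ A2 A4). }
  exists d. intros y Hy.
  assert (Ey : ex_RInt (fun t => g (y, t)) a b).
  { apply ex_RInt_y; auto. intros t Ht. apply Hg, (Hd y Hy t Ht). }
  assert (Ex : ex_RInt (fun t => g (x, t)) a b).
  { apply ex_RInt_y; auto. }
  change (Rabs (RInt (fun t => g (y, t)) a b - RInt (fun t => g (x, t)) a b) < eps).
  replace (RInt (fun t => g (y, t)) a b - RInt (fun t => g (x, t)) a b)
    with (RInt (fun t => g (y, t) - g (x, t)) a b)
    by (apply (RInt_minus (V := R_CompleteNormedModule)); auto).
  apply Rle_lt_trans with ((b - a) * (eps / (b - a + 1))).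
  - apply abs_RInt_le_const; auto.
    + apply (ex_RInt_minus (V := R_NormedModule)); auto.
    + intros t Ht. left. apply (Hd y Hy t Ht).
  - assert (Ek : pos eps = (b - a + 1) * (eps / (b - a + 1))) by (field; lra).
    rewrite Ek at 2. set (k := eps / (b - a + 1)) in *. nra.
Qed.

Lemma is_derive_RInt_y (U : plane -> Prop) (Q : plane -> R) (x a b : R) :
  a <= b -> open U -> CK 1 U Q -> (forall t, a <= t <= b -> U (x, t)) ->
  is_derive (fun y => RInt (fun t => Q (y, t)) a b) x
    (RInt (fun t => pdx Q (x, t)) a b).
Proof.
  intros Hab HU HQ Hx.
  assert (D : forall y t : R, U (y, t) -> is_derive (fun z => Q (z, t)) y (pdx Q (y, t))).
  { intros y t H. apply plane_x. eapply CK_ex; eauto. }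
  assert (CQ : forall p, U p -> continuous Q p) by (intros; eapply CK_cont; eauto).
  destruct (tube (fun y t => U (y, t)) x a b) as [d Hd].
  { intros t Ht. generalize (HU _ (Hx t Ht)). apply filter_imp. intros [? ?]; auto. }
  assert (L : forall P : R -> Prop, (forall y, (forall t, a <= t <= b -> U (y, t)) -> P y) ->
    locally x P).
  { intros P HP. exists d. intros y Hy. apply HP. intros t Ht. apply (Hd y Hy t Ht). }
  rewrite (RInt_ext (fun t => pdx Q (x, t)) (fun t => Derive (fun z => Q (z, t)) x)).
  - apply (is_derive_RInt_param (fun z t => Q (z, t)) a b x).
    + apply L. intros y Hy t Ht. rewrite Rmin_left, Rmax_right in Ht by lra.
      eexists; apply D; auto.
    + rewrite Rmin_left, Rmax_right by lra. intros t Ht.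
      apply (continuity_2d_pt_ext_loc (fun y s => pdx Q (y, s))).
      * apply locally_2d_locally. generalize (HU _ (Hx t Ht)). apply filter_imp.
        intros [y s] Hys. symmetry. apply is_derive_unique. auto.
      * apply continuity_2d_pt_filterlim.
        change (continuous (fun z : R * R => pdx Q (fst z, snd z)) (x, t)).
        apply (continuous_ext (pdx Q)). { intros [? ?]; reflexivity. }
        apply (CK_cont 0 U); auto. now apply CK_S.
    + apply L. intros y Hy. apply ex_RInt_y; auto.
  - rewrite Rmin_left, Rmax_right by lra. intros t Ht. symmetry.
    apply is_derive_unique. apply D, Hx. lra.
Qed.

Lemma RInt_derive_y (U : plane -> Prop) (P : plane -> R) (x a b : R) :
  a <= b -> CK 1 U P -> (forall t, a <= t <= b -> U (x, t)) ->
  RInt (fun t => pdy P (x, t)) a b = P (x, b) - P (x, a).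
Proof.
  intros Hab HP Hx.
  apply is_RInt_unique.
  apply (is_RInt_derive (V := R_CompleteNormedModule) (fun t => P (x, t))).
  - rewrite Rmin_left, Rmax_right by lra. intros t Ht. apply plane_y.
    eapply CK_ex; eauto.
  - rewrite Rmin_left, Rmax_right by lra. intros t Ht. apply cont_y.
    apply (CK_cont 0 U); auto. now apply CK_S.
Qed.

(** The integral of Q over a vertical segment has derivative the integral of pdx Q, and
    the integral of pdy P vanishes by periodicity: integrals need not be exchanged. *)
Lemma stokes_strip (U : plane -> Prop) (P Q : plane -> R) :
  open U -> (forall q, strip q -> U q) -> CK 1 U P -> CK 1 U Q ->
  (forall x, 0 < x < 1 -> P (x, 2 * PI) = P (x, 0)) ->
  RInt (fun x => RInt (fun t => pdx Q (x, t) - pdy P (x, t)) 0 (2 * PI)) 0 1 =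
  RInt (fun t => Q (1, t)) 0 (2 * PI) - RInt (fun t => Q (0, t)) 0 (2 * PI).
Proof.
  intros HU HS HP HQ Per.
  assert (P0 : 0 <= 2 * PI) by (pose proof PI_RGT_0; lra).
  assert (HSx : forall x t, 0 <= x <= 1 -> U (x, t)) by (intros; apply HS; assumption).
  rewrite (RInt_ext _ (fun x => RInt (fun t => pdx Q (x, t)) 0 (2 * PI))).
  - apply is_RInt_unique.
    apply (is_RInt_derive (V := R_CompleteNormedModule)
      (fun x => RInt (fun t => Q (x, t)) 0 (2 * PI))).
    + rewrite Rmin_left, Rmax_right by lra. intros x Hx.
      apply (is_derive_RInt_y U); auto.
    + rewrite Rmin_left, Rmax_right by lra. intros x Hx.
      apply (RInt_param_continuous (pdx Q) x 0 (2 * PI) U); auto.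
      intros p Hp. apply (CK_cont 0 U); auto. now apply CK_S.
  - rewrite Rmin_left, Rmax_right by lra. intros x Hx.
    assert (Hx' : forall t, 0 <= t <= 2 * PI -> U (x, t)) by (intros; apply HSx; lra).
    rewrite (RInt_minus (V := R_CompleteNormedModule) (fun t => pdx Q (x, t))
      (fun t => pdy P (x, t))).
    + rewrite (RInt_derive_y U P x); auto. rewrite Per by lra.
      change (RInt (fun t => pdx Q (x, t)) 0 (2 * PI) - (P (x, 0) - P (x, 0)) =
        RInt (fun t => pdx Q (x, t)) 0 (2 * PI)). ring.
    + apply ex_RInt_y; auto. intros t Ht. apply (CK_cont 0 U); auto. now apply CK_S.
    + apply ex_RInt_y; auto. intros t Ht. apply (CK_cont 0 U); auto. now apply CK_S.
Qed.

(** * Closed forms *)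

Definition form (P Q : plane -> R) (p : C) (v : C) : R :=
  P p * Re v + Q p * Im v.

Definition C1_form (U : plane -> Prop) (P Q : plane -> R) : Prop :=
  CK 1 U P /\ CK 1 U Q.

Definition curl (P Q : plane -> R) (p : plane) : R := pdx Q p - pdy P p.

Definition C2_map (W : plane -> Prop) (h : plane -> plane) : Prop :=
  CK 2 W (fun q => Re (h q)) /\ CK 2 W (fun q => Im (h q)).

Definition hx (h : plane -> plane) (q : plane) : plane :=
  (pdx (fun q => Re (h q)) q, pdx (fun q => Im (h q)) q).
Definition hy (h : plane -> plane) (q : plane) : plane :=
  (pdy (fun q => Re (h q)) q, pdy (fun q => Im (h q)) q).

(** Components of the pull-back of the form P dx + Q dy by h. *)
Definition pullP (P Q : plane -> R) (h : plane -> plane) (q : plane) : R :=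
  form P Q (h q) (hx h q).
Definition pullQ (P Q : plane -> R) (h : plane -> plane) (q : plane) : R :=
  form P Q (h q) (hy h q).

Lemma CK_compp n (U W : plane -> Prop) (h : plane -> plane) (P : plane -> R) :
  open U -> open W -> (forall q, W q -> U (h q)) -> CK n U P ->
  CK n W (fun q => Re (h q)) -> CK n W (fun q => Im (h q)) ->
  CK n W (fun q => P (h q)).
Proof.
  intros HU HW Hh HP H1 H2.
  apply (CK_ext n W (fun q => P (Re (h q), Im (h q)))); auto.
  { intros q _. now destruct (h q). }
  apply (CK_comp2 n W (fun q => Re (h q)) (fun q => Im (h q)) U P); auto.
  intros q Hq. specialize (Hh q Hq). now destruct (h q).
Qed.

Lemma dir_comp (U W : plane -> Prop) (h : plane -> plane) (P : plane -> R) v q :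
  open U -> open W -> (forall q, W q -> U (h q)) -> CK 1 U P ->
  CK 1 W (fun q => Re (h q)) -> CK 1 W (fun q => Im (h q)) -> W q ->
  dir_deriv (fun q => P (h q)) v q =
  dir_deriv (fun q => Re (h q)) v q * pdx P (h q) + dir_deriv (fun q => Im (h q)) v q * pdy P (h q).
Proof.
  intros HU HW Hh HP H1 H2 Hq. apply dir_unique.
  apply (is_derive_ext (fun t : R => P (Re (h (plus q (scal t v))), Im (h (plus q (scal t v)))))).
  { intros t. apply f_equal. symmetry. apply surjective_pairing. }
  pose proof (chain_plane U P (fun t : R => Re (h (plus q (scal t v))))
    (fun t : R => Im (h (plus q (scal t v)))) 0
    (dir_deriv (fun q => Re (h q)) v q) (dir_deriv (fun q => Im (h q)) v q) HU HP) as C.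
  cbv beta in C. rewrite line_0 in C.
  replace (h q) with (Re (h q), Im (h q)) by now destruct (h q).
  apply C.
  - specialize (Hh q Hq). now destruct (h q).
  - now apply (dir_is_derive 0 W (fun q => Re (h q))).
  - now apply (dir_is_derive 0 W (fun q => Im (h q))).
Qed.

Lemma dir_add {V : NormedModule R_AbsRing} (W : V -> Prop) (f g : V -> R) v q : CK 1 W f -> CK 1 W g -> W q ->
  dir_deriv (fun q => f q + g q) v q = dir_deriv f v q + dir_deriv g v q.
Proof.
  intros Hf Hg Hq. apply dir_unique.
  apply (is_derive_plus (fun t : R => f (plus q (scal t v)))
    (fun t : R => g (plus q (scal t v)))); eapply dir_is_derive; eauto.
Qed.

Lemma dir_mul {V : NormedModule R_AbsRing} (W : V -> Prop) (f g : V -> R) v q : CK 1 W f -> CK 1 W g -> W q ->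
  dir_deriv (fun q => f q * g q) v q = dir_deriv f v q * g q + f q * dir_deriv g v q.
Proof. intros Hf Hg Hq. apply dir_unique. now apply (dir_mult 0 W). Qed.

Lemma pull_C1 (U W : plane -> Prop) P Q h : open U -> open W ->
  (forall q, W q -> U (h q)) -> C1_form U P Q -> C2_map W h ->
  C1_form W (pullP P Q h) (pullQ P Q h).
Proof.
  intros HU HW Hh [HP HQ] [H1 H2].
  assert (H1' := CK_pred _ _ _ H1). assert (H2' := CK_pred _ _ _ H2).
  assert (M : forall F f, CK 1 U F -> CK 1 W f -> CK 1 W (fun q => F (h q) * f q)).
  { intros F f HF Hf. apply (CK_mult 1 W (fun q => F (h q)) f HW); auto.
    exact (CK_compp 1 U W h F HU HW Hh HF H1' H2'). }
  assert (A : forall f g, CK 1 W f -> CK 1 W g -> CK 1 W (fun q => f q + g q))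
    by (intros f g; apply (CK_plus 1 W f g HW)).
  split; unfold pullP, pullQ, form, hx, hy; simpl.
  - exact (A _ _ (M P _ HP (CK_S 1 W _ H1 e1)) (M Q _ HQ (CK_S 1 W _ H2 e1))).
  - exact (A _ _ (M P _ HP (CK_S 1 W _ H1 e2)) (M Q _ HQ (CK_S 1 W _ H2 e2))).
Qed.

(** The second derivatives of h cancel by symmetry. *)
Lemma pull_curl (U W : plane -> Prop) P Q h q : open U -> open W ->
  (forall q, W q -> U (h q)) -> C1_form U P Q -> C2_map W h -> W q ->
  curl (pullP P Q h) (pullQ P Q h) q =
  curl P Q (h q) * (Re (hx h q) * Im (hy h q) - Im (hx h q) * Re (hy h q)).
Proof.
  intros HU HW Hh [HP HQ] [H1 H2] Hq.
  assert (H1' := CK_pred _ _ _ H1). assert (H2' := CK_pred _ _ _ H2).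
  assert (CP : CK 1 W (fun q => P (h q))) by exact (CK_compp 1 U W h P HU HW Hh HP H1' H2').
  assert (CQ : CK 1 W (fun q => Q (h q))) by exact (CK_compp 1 U W h Q HU HW Hh HQ H1' H2').
  change (dir_deriv (fun q => P (h q) * Re (hy h q) + Q (h q) * Im (hy h q)) e1 q -
    dir_deriv (fun q => P (h q) * Re (hx h q) + Q (h q) * Im (hx h q)) e2 q =
    curl P Q (h q) * (Re (hx h q) * Im (hy h q) - Im (hx h q) * Re (hy h q))).
  assert (X1 : CK 1 W (fun q => Re (hx h q))) by exact (CK_S 1 W _ H1 e1).
  assert (X2 : CK 1 W (fun q => Im (hx h q))) by exact (CK_S 1 W _ H2 e1).
  assert (Y1 : CK 1 W (fun q => Re (hy h q))) by exact (CK_S 1 W _ H1 e2).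
  assert (Y2 : CK 1 W (fun q => Im (hy h q))) by exact (CK_S 1 W _ H2 e2).
  assert (M : forall f g, CK 1 W f -> CK 1 W g -> CK 1 W (fun q => f q * g q))
    by (intros f g; exact (CK_mult 1 W f g HW)).
  rewrite (dir_add W (fun q => P (h q) * Re (hy h q)) (fun q => Q (h q) * Im (hy h q)) e1 q
    (M _ _ CP Y1) (M _ _ CQ Y2) Hq).
  rewrite (dir_add W (fun q => P (h q) * Re (hx h q)) (fun q => Q (h q) * Im (hx h q)) e2 q
    (M _ _ CP X1) (M _ _ CQ X2) Hq).
  rewrite (dir_mul W _ _ e1 q CP Y1 Hq), (dir_mul W _ _ e1 q CQ Y2 Hq).
  rewrite (dir_mul W _ _ e2 q CP X1 Hq), (dir_mul W _ _ e2 q CQ X2 Hq).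
  rewrite (dir_comp U W h P e1 q HU HW Hh HP H1' H2' Hq).
  rewrite (dir_comp U W h Q e1 q HU HW Hh HQ H1' H2' Hq).
  rewrite (dir_comp U W h P e2 q HU HW Hh HP H1' H2' Hq).
  rewrite (dir_comp U W h Q e2 q HU HW Hh HQ H1' H2' Hq).
  pose proof (pdx_pdy W _ q HW H1 Hq) as S1. pose proof (pdx_pdy W _ q HW H2 Hq) as S2.
  assert (S1' : dir_deriv (fun q => Re (hy h q)) e1 q = dir_deriv (fun q => Re (hx h q)) e2 q)
    by exact S1.
  assert (S2' : dir_deriv (fun q => Im (hy h q)) e1 q = dir_deriv (fun q => Im (hx h q)) e2 q)
    by exact S2.
  rewrite S1', S2'. unfold curl.
  change (dir_deriv (fun q => Re (h q)) e1 q) with (Re (hx h q)).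
  change (dir_deriv (fun q => Im (h q)) e1 q) with (Im (hx h q)).
  change (dir_deriv (fun q => Re (h q)) e2 q) with (Re (hy h q)).
  change (dir_deriv (fun q => Im (h q)) e2 q) with (Im (hy h q)).
  ring.
Qed.

Definition closed_form (U : plane -> Prop) (P Q : plane -> R) : Prop :=
  C1_form U P Q /\ forall p, U p -> curl P Q p = 0.

Lemma pull_closed (U W : plane -> Prop) P Q h : open U -> open W ->
  (forall q, W q -> U (h q)) -> closed_form U P Q -> C2_map W h ->
  closed_form W (pullP P Q h) (pullQ P Q h).
Proof.
  intros HU HW Hh [HF HC] H2. split. { now apply (pull_C1 U). }
  intros q Hq. rewrite (pull_curl U W) by auto. rewrite HC by auto. ring.
Qed.

(** * Line integrals *)

Definition is_deriveC (L : R -> C) (t : R) (v : C) : Prop :=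
  is_derive (fun s => Re (L s)) t (Re v) /\ is_derive (fun s => Im (L s)) t (Im v).

(** Stokes on the strip of the homotopy, for the form pulled back to it. *)
Lemma homotopy_invariance (U W : plane -> Prop) P Q h : open U -> open W ->
  (forall q, strip q -> W q) -> (forall q, strip q -> U (h q)) ->
  closed_form U P Q -> C2_map W h ->
  (forall x t, 0 <= x <= 1 -> h (x, t + 2 * PI) = h (x, t)) ->
  RInt (fun t => pullQ P Q h (1, t)) 0 (2 * PI) =
  RInt (fun t => pullQ P Q h (0, t)) 0 (2 * PI).
Proof.
  intros HU HW HS Hh HF H2 Per.
  (* h takes values in U on the strip; it does so on a neighbourhood of the strip *)
  pose (W' := fun q => W q /\ U (h q)).
  assert (HC : forall q, W q -> continuous h q).
  { intros q Hq. apply (continuous_ext (fun q => (Re (h q), Im (h q)))).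
    { intros p. now destruct (h p). }
    apply (continuous_comp_2 (fun q => Re (h q)) (fun q => Im (h q)) (fun a b => (a, b))).
    - exact (CK_cont 2 W _ q (proj1 H2) Hq).
    - exact (CK_cont 2 W _ q (proj2 H2) Hq).
    - apply (continuous_ext (fun z : R * R => z)).
      + intros [? ?]; reflexivity.
      + apply continuous_id. }
  assert (HW' : open W').
  { intros q [A B]. apply filter_and; [apply HW, A|].
    apply (HC q A). apply HU, B. }
  assert (H2' : C2_map W' h).
  { destruct H2 as [A B]. split.
    - exact (CK_sub 2 W W' _ (fun q Hq => proj1 Hq) A).
    - exact (CK_sub 2 W W' _ (fun q Hq => proj1 Hq) B). }
  assert (HF' : closed_form W' (pullP P Q h) (pullQ P Q h)).
  { exact (pull_closed U W' P Q h HU HW' (fun q Hq => proj2 Hq) HF H2'). }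
  destruct HF' as [[F1 F2] F3].
  assert (S' : forall q, strip q -> W' q) by (intros; split; auto).
  pose proof (stokes_strip W' (pullP P Q h) (pullQ P Q h) HW' S' F1 F2) as S.
  match type of S with _ -> ?l = ?r => cut (0 = r) end.
  { intros E. lra. }
  rewrite <- S.
  - symmetry. rewrite (RInt_ext _ (fun _ => 0)).
    + rewrite RInt_const. unfold scal; simpl. unfold mult; simpl. ring.
    + rewrite Rmin_left, Rmax_right by lra. intros x Hx.
      rewrite (RInt_ext _ (fun _ => 0)).
      * rewrite RInt_const. unfold scal; simpl. unfold mult; simpl. ring.
      * intros t _. apply (F3 (x, t)). apply S'. unfold strip; simpl; lra.
  - intros x Hx.
    assert (T : h (x, 2 * PI) = h (x, 0)).
    { rewrite <- (Per x 0) by lra. do 2 f_equal. ring. }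
    assert (P' : hx h (x, 2 * PI) = hx h (x, 0)).
    { destruct H2 as [A B].
      assert (G : forall f : plane -> R, CK 2 W f ->
        (forall y, 0 < y < 1 -> f (y, 2 * PI) = f (y, 0)) ->
        pdx f (x, 2 * PI) = pdx f (x, 0)).
      { intros f Hf E.
        assert (D : forall t, is_derive (fun y => f (y, t)) x (pdx f (x, t))).
        { intros t. apply plane_x. eapply (CK_ex 1 W); eauto. apply HS.
          unfold strip; simpl; lra. }
        rewrite <- (is_derive_unique _ _ _ (D (2 * PI))).
        rewrite <- (is_derive_unique _ _ _ (D 0)).
        apply Derive_ext_loc.
        assert (L : locally x (fun y : R => 0 < y < 1)).
        { apply filter_and; [apply (open_gt 0) | apply (open_lt 1)]; lra. }
        generalize L. apply filter_imp. intros y Hy. now apply E. }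
      assert (Ph : forall y, 0 < y < 1 -> h (y, 2 * PI) = h (y, 0)).
      { intros y Hy. rewrite <- (Per y 0) by lra. do 2 f_equal. ring. }
      unfold hx. f_equal; apply G; auto; intros y Hy; now rewrite Ph. }
    unfold pullP. now rewrite T, P'.
Qed.

(** * Primitives on half-planes *)

Lemma CK1_intro (U : plane -> Prop) (f P Q : plane -> R) : open U ->
  (forall x y, U (x, y) -> is_derive (fun t => f (t, y)) x (P (x, y))) ->
  (forall x y, U (x, y) -> is_derive (fun t => f (x, t)) y (Q (x, y))) ->
  (forall p, U p -> continuous P p) -> (forall p, U p -> continuous Q p) ->
  CK 1 U f /\ (forall p, U p -> pdx f p = P p /\ pdy f p = Q p).
Proof.
  intros HU D1 D2 C1 C2.
  assert (F : forall x y, U (x, y) -> filterdiff (fun u : R * R => f (fst u, snd u))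
    (locally (x, y)) (fun u : R * R => fst u * P (x, y) + snd u * Q (x, y))).
  { intros x y Hp. apply (is_derive_filterdiff (fun a b => f (a, b)) x y
      (fun a b => P (a, b)) (Q (x, y))).
    - generalize (HU _ Hp). apply filter_imp. intros [a b] Hab. simpl. auto.
    - auto.
    - apply (continuous_ext P); [intros [a b]; reflexivity | now apply C1]. }
  assert (D : forall p v : plane, U p ->
    is_derive (fun t : R => f (plus p (scal t v))) 0 (Re v * P p + Im v * Q p)).
  { intros [x y] [a b] Hp.
    apply (is_derive_ext (fun t : R => f (x + t * a, y + t * b))). { reflexivity. }
    apply is_derive_Reals.
    replace (Re (a, b) * P (x, y) + Im (a, b) * Q (x, y)) with
      (P (x, y) * a + Q (x, y) * b) by (simpl; ring).
    apply (derivable_pt_lim_comp_2d (fun r s => f (r, s)) (fun t => x + t * a)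
      (fun t => y + t * b)).
    - replace (x + 0 * a) with x by ring. replace (y + 0 * b) with y by ring.
      apply filterdiff_differentiable_pt_lim. now apply F.
    - apply is_derive_Reals. auto_derive; auto; ring.
    - apply is_derive_Reals. auto_derive; auto; ring. }
  assert (E : forall p, U p -> pdx f p = P p /\ pdy f p = Q p).
  { intros p Hp. split; unfold pdx, pdy; rewrite (dir_unique _ _ _ _ (D p _ Hp)); simpl; ring. }
  split; auto. split; [|split].
  - intros [x y] Hp. apply (continuous_ext (fun u : R * R => f (fst u, snd u))).
    { intros [a b]; reflexivity. }
    exact (@filterdiff_continuous R_AbsRing
      (prod_NormedModule R_AbsRing R_NormedModule R_NormedModule) R_NormedModule
      _ (x, y) (ex_intro _ _ (F x y Hp))).
  - intros p v Hp. eexists; apply D, Hp.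
  - intros v. apply (CK_ext 0 U (fun p => Re v * P p + Im v * Q p)); auto.
    { intros q Hq. symmetry. apply dir_unique. now apply D. }
    apply CK_plus; auto; apply CK_mult; auto; try apply CK_const; split; auto.
Qed.

Definition HP (c : R) (q : plane) : Prop := fst q < c.

Lemma open_HP c : open (HP c).
Proof.
  apply (open_comp (fst : plane -> R) (fun x => x < c)).
  - intros x _. apply continuous_fst.
  - apply (open_lt c).
Qed.

Lemma is_derive_RInt_y_any (U : plane -> Prop) (Q : plane -> R) (x b : R) :
  open U -> CK 1 U Q -> (forall t, U (x, t)) ->
  is_derive (fun y : R => RInt (fun t => Q (y, t)) 0 b) x (RInt (fun t => pdx Q (x, t)) 0 b).
Proof.
  intros HU HQ Hx. destruct (Rle_dec 0 b) as [Hb|Hb].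
  - apply (is_derive_RInt_y U); auto.
  - assert (Hb' : b <= 0) by lra.
    assert (CQ : forall p, U p -> continuous Q p).
    { intros p Hp. exact (CK_cont 1 U Q p HQ Hp). }
    assert (CQx : forall p, U p -> continuous (pdx Q) p).
    { intros p Hp. exact (CK_cont 0 U _ p (CK_S 0 U Q HQ e1) Hp). }
    destruct (tube (fun y t => U (y, t)) x b 0) as [d Hd].
    { intros t Ht. generalize (HU _ (Hx t)). apply filter_imp. intros [? ?]; auto. }
    apply (is_derive_ext_loc (fun y : R => opp (RInt (fun t => Q (y, t)) b 0))).
    { exists d. intros y Hy. apply (opp_RInt_swap (V := R_CompleteNormedModule)).
      apply ex_RInt_y; [lra|]. intros t Ht. apply CQ, (Hd y Hy t Ht). }
    rewrite <- (opp_RInt_swap (V := R_CompleteNormedModule)).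
    2:{ apply (ex_RInt_y (pdx Q)); auto. }
    apply (is_derive_opp (fun y : R => RInt (fun t => Q (y, t)) b 0)).
    apply (is_derive_RInt_y U); auto.
Qed.

Lemma RInt_derive_y_any (U : plane -> Prop) (P : plane -> R) (x b : R) :
  CK 1 U P -> (forall t, U (x, t)) ->
  RInt (fun t => pdy P (x, t)) 0 b = P (x, b) - P (x, 0).
Proof.
  intros HP0 Hx. apply is_RInt_unique.
  apply (is_RInt_derive (V := R_CompleteNormedModule) (fun t => P (x, t))).
  - intros t _. apply plane_y. exact (CK_ex 0 U P (x, t) e2 HP0 (Hx t)).
  - intros t _. apply cont_y. exact (CK_cont 0 U _ _ (CK_S 0 U P HP0 e2) (Hx t)).
Qed.

(** Integrate along a horizontal segment of the real axis, then along a vertical one. *)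
Lemma primitive_HP c (P Q : plane -> R) : closed_form (HP c) P Q ->
  exists f : plane -> R, CK 1 (HP c) f /\
    forall p, HP c p -> pdx f p = P p /\ pdy f p = Q p.
Proof.
  intros [[HP1 HQ1] HC].
  assert (CP : forall p, HP c p -> continuous P p).
  { intros p Hp. exact (CK_cont 1 (HP c) P p HP1 Hp). }
  assert (CQ : forall p, HP c p -> continuous Q p).
  { intros p Hp. exact (CK_cont 1 (HP c) Q p HQ1 Hp). }
  exists (fun p => RInt (fun s => P (s, 0)) (c - 1) (fst p) +
                   RInt (fun t => Q (fst p, t)) 0 (snd p)).
  assert (IP : forall x, x < c -> ex_RInt (fun s => P (s, 0)) (c - 1) x).
  { intros x Hx. apply (ex_RInt_continuous (V := R_CompleteNormedModule)).
    intros z Hz. apply cont_x, CP. unfold HP; simpl.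
    apply Rle_lt_trans with (1 := proj2 Hz). apply Rmax_lub_lt; lra. }
  assert (IQ : forall x y, x < c -> ex_RInt (fun t => Q (x, t)) 0 y).
  { intros x y Hx. apply (ex_RInt_continuous (V := R_CompleteNormedModule)).
    intros z _. apply cont_y, CQ. exact Hx. }
  apply CK1_intro; auto.
  - apply open_HP.
  - intros x y Hx. simpl fst; simpl snd. change (x < c) in Hx.
    replace (P (x, y)) with (plus (P (x, 0)) (RInt (fun t => pdx Q (x, t)) 0 y)).
    + apply (is_derive_plus (fun t : R => RInt (fun s => P (s, 0)) (c - 1) t)
        (fun z : R => RInt (fun t => Q (z, t)) 0 y)).
      * apply (is_derive_RInt (fun s => P (s, 0))
          (fun t : R => RInt (fun s => P (s, 0)) (c - 1) t) (c - 1)).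
        -- generalize (open_lt c x Hx). apply filter_imp. intros z Hz.
           apply (RInt_correct (V := R_CompleteNormedModule)). auto.
        -- apply cont_x, CP. exact Hx.
      * apply (is_derive_RInt_y_any (HP c)); auto. apply open_HP.
    + rewrite (RInt_ext _ (fun t => pdy P (x, t))).
      * rewrite (RInt_derive_y_any (HP c)); auto. unfold plus; simpl. ring.
      * intros t _. assert (H : HP c (x, t)) by exact Hx.
        specialize (HC _ H). unfold curl in HC. lra.
  - intros x y Hx. simpl fst; simpl snd. change (x < c) in Hx.
    replace (Q (x, y)) with (plus 0 (Q (x, y))) by (unfold plus; simpl; ring).
    apply (is_derive_plus (fun t : R => RInt (fun s => P (s, 0)) (c - 1) x)
        (fun z : R => RInt (fun t => Q (x, t)) 0 z)).
    + apply (is_derive_const (V := R_NormedModule)).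
    + apply (is_derive_RInt (fun t => Q (x, t))
          (fun z : R => RInt (fun t => Q (x, t)) 0 z) 0).
      * apply filter_forall. intros z. apply (RInt_correct (V := R_CompleteNormedModule)). auto.
      * apply cont_y, CQ. exact Hx.
Qed.

Lemma is_derive_0_const (f : R -> R) (U : R -> Prop) a b :
  (forall x y z, U x -> U y -> x <= z <= y -> U z) ->
  (forall x, U x -> is_derive f x 0) -> U a -> U b -> f a = f b.
Proof.
  intros HU D Ha Hb.
  assert (G : forall a b, a < b -> U a -> U b -> f a = f b).
  { intros x y Hxy Hx Hy. apply (eq_is_derive (V := R_NormedModule)); auto.
    intros t Ht. apply D. exact (HU x y t Hx Hy Ht). }
  destruct (Rtotal_order a b) as [H|[H|H]]; [auto | now subst | symmetry; auto].
Qed.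

Lemma HP_const c (f : plane -> R) : CK 1 (HP c) f ->
  (forall p, HP c p -> pdx f p = 0 /\ pdy f p = 0) ->
  forall p q, HP c p -> HP c q -> f p = f q.
Proof.
  intros Hf H0 [x y] [x' y'] Hx Hx'. unfold HP in Hx, Hx'; simpl in Hx, Hx'.
  transitivity (f (x', y)).
  - apply (is_derive_0_const (fun t => f (t, y)) (fun t => t < c)); auto.
    + intros; lra.
    + intros t Ht. rewrite <- (proj1 (H0 (t, y) Ht)). apply plane_x.
      exact (CK_ex 0 (HP c) f (t, y) e1 Hf Ht).
  - apply (is_derive_0_const (fun t => f (x', t)) (fun t => True)); auto.
    intros t _. rewrite <- (proj2 (H0 (x', t) Hx')). apply plane_y.
    exact (CK_ex 0 (HP c) f (x', t) e2 Hf Hx').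
Qed.

Definition contC (v : R -> C) : Prop :=
  (forall t : R, continuous (fun t => Re (v t)) t) /\ (forall t : R, continuous (fun t => Im (v t)) t).

Definition vshift (s : C) (y : R) : C := (Re s, Im s + y).

(** A primitive of the form changes by a constant under the vertical translation by 2
    PI, because the form does not change; this constant is the period J. *)
Lemma half_plane_period c (P Q : plane -> R) : closed_form (HP c) P Q ->
  (forall x y, x < c -> P (x, y + 2 * PI) = P (x, y)) ->
  (forall x y, x < c -> Q (x, y + 2 * PI) = Q (x, y)) ->
  exists J : R, forall (l v : R -> C) (m : Z),
    (forall t, is_deriveC l t (v t)) -> contC v -> (forall t, HP c (l t)) ->
    l (2 * PI) = vshift (l 0) (2 * PI * IZR m) ->
    RInt (fun t => form P Q (l t) (v t)) 0 (2 * PI) = IZR m * J.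
Proof.
  intros HF PP PQ. destruct (primitive_HP c P Q HF) as (f & Hf & Df).
  destruct HF as [[HP1 HQ1] HC].
  assert (Hsh : CK 1 (HP c) (fun p : plane => f (fst p, snd p + 2 * PI))).
  { apply (CK_comp2 1 (HP c) (fun p : plane => fst p) (fun p : plane => snd p + 2 * PI)
      (HP c) f); auto using open_HP.
    - apply CK_fst.
    - apply CK_plus; [apply open_HP | apply CK_snd | apply CK_const]. }
  assert (Dsh : forall p, HP c p -> is_derive (fun t : R => f (t, snd p + 2 * PI)) (fst p)
      (P (fst p, snd p + 2 * PI)) /\
      is_derive (fun t : R => f (fst p, t + 2 * PI)) (snd p) (Q (fst p, snd p + 2 * PI))).
  { intros [x y] Hx. assert (Hx' : HP c (x, y + 2 * PI)) by exact Hx.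
    simpl fst; simpl snd. split.
    - rewrite <- (proj1 (Df _ Hx')). apply plane_x. exact (CK_ex 0 _ f _ e1 Hf Hx').
    - rewrite <- (proj2 (Df _ Hx')).
      replace (pdy f (x, y + 2 * PI)) with (1 * pdy f (x, y + 2 * PI)) by ring.
      apply (is_derive_comp (fun t : R => f (x, t)) (fun t => t + 2 * PI)).
      + apply plane_y. exact (CK_ex 0 _ f _ e2 Hf Hx').
      + auto_derive; auto; ring. }
  (* f translated by 2 PI minus f has zero derivatives *)
  assert (K : exists J, forall p, HP c p -> f (fst p, snd p + 2 * PI) = f p + J).
  { exists (f (c - 1, 0 + 2 * PI) - f (c - 1, 0)).
    intros p Hp.
    pose (g := fun p : plane => f (fst p, snd p + 2 * PI) - f p).
    assert (Hg : CK 1 (HP c) g) by (apply CK_minus; auto using open_HP).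
    assert (G : g p = g (c - 1, 0)).
    { apply (HP_const c); auto.
      2:{ unfold HP; simpl; lra. }
      intros [x y] Hxy. pose proof (Dsh _ Hxy) as [D1 D2]. simpl in D1, D2.
      pose proof (Df _ Hxy) as [E1 E2].
      assert (X1 : is_derive (fun t : R => f (t, y)) x (P (x, y))).
      { rewrite <- E1. apply plane_x. exact (CK_ex 0 _ f _ e1 Hf Hxy). }
      assert (X2 : is_derive (fun t : R => f (x, t)) y (Q (x, y))).
      { rewrite <- E2. apply plane_y. exact (CK_ex 0 _ f _ e2 Hf Hxy). }
      split.
      - rewrite <- (is_derive_unique _ _ _ (plane_x g x y (CK_ex 0 _ g _ e1 Hg Hxy))).
        apply is_derive_unique. unfold g; simpl.
        replace 0 with (P (x, y + 2 * PI) - P (x, y)) by (rewrite PP; [ring | exact Hxy]).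
        now apply (is_derive_minus (fun t : R => f (t, y + 2 * PI)) (fun t : R => f (t, y))).
      - rewrite <- (is_derive_unique _ _ _ (plane_y g x y (CK_ex 0 _ g _ e2 Hg Hxy))).
        apply is_derive_unique. unfold g; simpl.
        replace 0 with (Q (x, y + 2 * PI) - Q (x, y)) by (rewrite PQ; [ring | exact Hxy]).
        now apply (is_derive_minus (fun t : R => f (x, t + 2 * PI)) (fun t : R => f (x, t))). }
    unfold g in G; simpl in G. lra. }
  destruct K as [J HJ]. exists J. intros l v m Dl [Cv1 Cv2] Hl Em.
  assert (Km : forall (n : nat) p, HP c p -> f (fst p, snd p + 2 * PI * INR n) = f p + INR n * J).
  { induction n as [|n IH]; intros p Hp.
    - simpl INR. rewrite Rmult_0_r, Rplus_0_r, Rmult_0_l, Rplus_0_r. now destruct p.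
    - rewrite S_INR. replace (snd p + 2 * PI * (INR n + 1))
        with ((snd p + 2 * PI * INR n) + 2 * PI) by ring.
      transitivity (f (fst p, snd p + 2 * PI * INR n) + J).
      + exact (HJ (fst p, snd p + 2 * PI * INR n) Hp).
      + rewrite IH by auto. ring. }
  assert (Kz : forall p, HP c p -> f (vshift p (2 * PI * IZR m)) = f p + IZR m * J).
  { intros p Hp. unfold vshift. change (Re p) with (fst p). change (Im p) with (snd p).
    destruct (Z_le_dec 0 m) as [H|H].
    - rewrite <- (Z2Nat.id m) by lia. rewrite <- INR_IZR_INZ. now apply Km.
    - pose proof (Km (Z.to_nat (- m)) (fst p, snd p + 2 * PI * IZR m) Hp) as K.
      rewrite INR_IZR_INZ, Z2Nat.id, opp_IZR in K by lia. simpl fst in K; simpl snd in K.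
      replace (snd p + 2 * PI * IZR m + 2 * PI * - IZR m) with (snd p) in K by ring.
      rewrite <- surjective_pairing in K. lra. }
  transitivity (f (l (2 * PI)) - f (l 0)).
  - apply is_RInt_unique.
    apply (is_RInt_derive (V := R_CompleteNormedModule) (fun t => f (l t))).
    + intros t _. destruct (Dl t) as [D1 D2].
      apply (is_derive_ext (fun t => f (Re (l t), Im (l t)))).
      { intros s. apply f_equal. symmetry. apply surjective_pairing. }
      pose proof (chain_plane (HP c) f (fun t => Re (l t)) (fun t => Im (l t)) t _ _
        (open_HP c) Hf (Hl t) D1 D2) as D.
      assert (El : (Re (l t), Im (l t)) = l t) by (symmetry; apply surjective_pairing).
      cbv beta in D. rewrite El in D. destruct (Df (l t) (Hl t)) as [E1 E2]. rewrite E1, E2 in D.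
      unfold form. replace (P (l t) * Re (v t) + Q (l t) * Im (v t))
       with (Re (v t) * P (l t) + Im (v t) * Q (l t)) by ring. exact D.
    + intros t _. unfold form.
      assert (Cl : continuous l t).
      { destruct (Dl t) as [D1 D2].
        apply (continuous_ext (fun t => (Re (l t), Im (l t)))).
        { intros s. symmetry. apply surjective_pairing. }
        apply (continuous_comp_2 (fun t => Re (l t)) (fun t => Im (l t)) (fun a b => (a, b))).
        - apply (ex_derive_continuous (fun t => Re (l t))). eexists; exact D1.
        - apply (ex_derive_continuous (fun t => Im (l t))). eexists; exact D2.
        - apply (continuous_ext (fun z : R * R => z)).
          + intros [? ?]; reflexivity.
          + apply continuous_id. }
      apply (continuous_plus (fun t => P (l t) * Re (v t)) (fun t => Q (l t) * Im (v t))).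
      * apply (continuous_mult (fun t => P (l t)) (fun t => Re (v t))); auto.
        apply (continuous_comp l P); auto. exact (CK_cont 1 _ P _ HP1 (Hl t)).
      * apply (continuous_mult (fun t => Q (l t)) (fun t => Im (v t))); auto.
        apply (continuous_comp l Q); auto. exact (CK_cont 1 _ Q _ HQ1 (Hl t)).
  - rewrite Em, (Kz _ (Hl 0)).
    change (f (l 0) + IZR m * J - f (l 0) = IZR m * J). ring.
Qed.

(** * The exponential and winding numbers *)

Lemma C2_cexp (U : plane -> Prop) : open U -> C2_map U cexp.
Proof.
  intros HU.
  assert (E : CK 2 U (fun q : plane => exp (Re q))).
  { apply (CK_comp1 2 U (fun q : plane => fst q) allR exp); auto.
    - now intros.
    - apply CK_exp.
    - apply CK_fst. }
  split; apply (CK_mult (V := plane)); auto.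
  - apply (CK_comp1 2 U (fun q : plane => snd q) allR cos); auto.
    + now intros.
    + apply CK_sin_cos.
    + apply CK_snd.
  - apply (CK_comp1 2 U (fun q : plane => snd q) allR sin); auto.
    + now intros.
    + apply CK_sin_cos.
    + apply CK_snd.
Qed.

Lemma open_all : open (fun _ : plane => True).
Proof. apply open_true. Qed.

Lemma hx_cexp s : hx cexp s = cexp s.
Proof.
  destruct s as [x y]. apply injective_projections.
  - apply pdx_val. simpl. auto_derive; auto; ring.
  - apply pdx_val. simpl. auto_derive; auto; ring.
Qed.

Lemma hy_cexp s : hy cexp s = Cmult Ci (cexp s).
Proof.
  destruct s as [x y]. apply injective_projections.
  - apply pdy_val. simpl. auto_derive; auto; ring.
  - apply pdy_val. simpl. auto_derive; auto; ring.
Qed.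

Lemma cexp_add s t : cexp (Cplus s t) = Cmult (cexp s) (cexp t).
Proof.
  destruct s as [a b], t as [c d]. unfold cexp; simpl. rewrite exp_plus, cos_plus, sin_plus.
  apply injective_projections; simpl; ring.
Qed.

Lemma cexp_opp s : Cmult (cexp s) (cexp (Copp s)) = RtoC 1.
Proof.
  rewrite <- cexp_add. replace (Cplus s (Copp s)) with (RtoC 0) by ring.
  unfold cexp; simpl. rewrite exp_0, cos_0, sin_0. apply injective_projections; simpl; ring.
Qed.

Lemma cexp_neq0 s : cexp s <> RtoC 0.
Proof.
  intros H. pose proof (cexp_opp s) as E. rewrite H in E.
  apply (f_equal fst) in E. simpl in E. lra.
Qed.

Lemma Cmod2 (z : C) : Cmod z ^ 2 = Re z ^ 2 + Im z ^ 2.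
Proof. unfold Cmod. rewrite pow2_sqrt; auto. pose proof (pow2_ge_0 (fst z)). pose proof (pow2_ge_0 (snd z)). lra. Qed.

Lemma Cmod_cexp s : Cmod (cexp s) = exp (Re s).
Proof.
  unfold Cmod, cexp. simpl fst; simpl snd.
  replace ((exp (Re s) * cos (Im s)) ^ 2 + (exp (Re s) * sin (Im s)) ^ 2)
    with (exp (Re s) ^ 2 * (Rsqr (sin (Im s)) + Rsqr (cos (Im s)))) by (unfold Rsqr; ring).
  rewrite sin2_cos2, Rmult_1_r. apply sqrt_pow2. left. apply exp_pos.
Qed.

Lemma sin_cos_2PI_nat (n : nat) x :
  sin (x + 2 * PI * INR n) = sin x /\ cos (x + 2 * PI * INR n) = cos x.
Proof.
  replace (x + 2 * PI * INR n) with (x + 2 * INR n * PI) by ring.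
  split; [apply sin_period | apply cos_period].
Qed.

Lemma sin_cos_2PI (m : Z) x :
  sin (x + 2 * PI * IZR m) = sin x /\ cos (x + 2 * PI * IZR m) = cos x.
Proof.
  destruct (Z_le_dec 0 m) as [H|H].
  - rewrite <- (Z2Nat.id m) by lia. rewrite <- INR_IZR_INZ. apply sin_cos_2PI_nat.
  - pose proof (sin_cos_2PI_nat (Z.to_nat (- m)) (x + 2 * PI * IZR m)) as [A B].
    rewrite INR_IZR_INZ, Z2Nat.id, opp_IZR in A, B by lia.
    replace (x + 2 * PI * IZR m + 2 * PI * - IZR m) with x in A, B by ring. auto.
Qed.

Lemma cexp_shift s m : cexp (vshift s (2 * PI * IZR m)) = cexp s.
Proof.
  unfold cexp, vshift; simpl. destruct (sin_cos_2PI m (Im s)) as [-> ->]. reflexivity.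
Qed.

Lemma cos_eq_1_2PI x : cos x = 1 -> exists m : Z, x = 2 * PI * IZR m.
Proof.
  intros H. pose proof (sin2_cos2 x) as E. rewrite H in E. unfold Rsqr in E.
  assert (S : sin x = 0) by nra.
  destruct (sin_eq_0_0 x S) as [k Hk].
  destruct (Z.Even_or_Odd k) as [[m ->]|[m ->]].
  - exists m. rewrite Hk, mult_IZR. simpl. ring.
  - exfalso. rewrite plus_IZR, mult_IZR in Hk. simpl in Hk.
    replace x with (PI + 2 * PI * IZR m) in H by (rewrite Hk; ring).
    rewrite (proj2 (sin_cos_2PI m PI)), cos_PI in H. lra.
Qed.

Lemma cexp_eq s t : cexp s = cexp t -> exists m : Z, s = vshift t (2 * PI * IZR m).
Proof.
  intros H.
  assert (E : Re s = Re t).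
  { apply exp_inv. rewrite <- !Cmod_cexp. now rewrite H. }
  destruct s as [a b], t as [c d]. simpl in E. subst c.
  unfold cexp in H. simpl in H. pose proof (exp_pos a) as P.
  assert (H1 : cos b = cos d).
  { apply (f_equal fst) in H. simpl in H. apply Rmult_eq_reg_l in H; lra. }
  assert (H2 : sin b = sin d).
  { apply (f_equal snd) in H. simpl in H. apply Rmult_eq_reg_l in H; lra. }
  destruct (cos_eq_1_2PI (b - d)) as [m Hm].
  { rewrite cos_minus, H1, H2. pose proof (sin2_cos2 d) as Q. unfold Rsqr in Q. lra. }
  exists m. unfold vshift. simpl. f_equal. lra.
Qed.

Lemma cexp_surj z : z <> RtoC 0 -> exists s, cexp s = z.
Proof.
  intros Hz. assert (P : 0 < Cmod z) by now apply Cmod_gt_0.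
  pose proof (Cmod2 z) as E. destruct z as [x y]. simpl Re in E; simpl Im in E.
  set (r := Cmod (x, y)) in *.
  assert (E1 : (x / r) ^ 2 + (y / r) ^ 2 = 1) by (field_simplify; [rewrite <- E; field|]; lra).
  assert (B : -1 <= x / r <= 1) by (pose proof (pow2_ge_0 (y / r)); split; nra).
  assert (S : sin (acos (x / r)) = Rabs (y / r)).
  { rewrite sin_acos by auto. rewrite <- sqrt_Rsqr_abs. f_equal. unfold Rsqr. lra. }
  destruct (Rle_dec 0 y) as [Hy|Hy].
  - exists (ln r, acos (x / r)). unfold cexp; simpl. rewrite exp_ln, cos_acos, S by auto.
    rewrite Rabs_pos_eq by (apply Rmult_le_pos; [lra | left; now apply Rinv_0_lt_compat]).
    f_equal; field; lra.
  - exists (ln r, - acos (x / r)). unfold cexp; simpl.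
    rewrite exp_ln, cos_neg, sin_neg, cos_acos, S by auto.
    rewrite Rabs_left.
    + f_equal; field; lra.
    + apply Ropp_lt_cancel. rewrite Ropp_0. replace (- (y / r)) with ((- y) / r) by (field; lra).
      apply Rdiv_lt_0_compat; lra.
Qed.

Lemma is_deriveC_unique (L : R -> C) t v w : is_deriveC L t v -> is_deriveC L t w -> v = w.
Proof.
  intros [A B] [A' B']. apply injective_projections.
  - change (Re v = Re w). rewrite <- (is_derive_unique _ _ _ A). now apply is_derive_unique.
  - change (Im v = Im w). rewrite <- (is_derive_unique _ _ _ B). now apply is_derive_unique.
Qed.

Lemma is_deriveC_ext (L M : R -> C) t v : (forall s, L s = M s) ->
  is_deriveC L t v -> is_deriveC M t v.
Proof.
  intros E [A B]. split.
  - apply (is_derive_ext (fun s => Re (L s))); auto. intros s; now rewrite E.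
  - apply (is_derive_ext (fun s => Im (L s))); auto. intros s; now rewrite E.
Qed.

Lemma is_deriveC_mult (f g : R -> C) t a b : is_deriveC f t a -> is_deriveC g t b ->
  is_deriveC (fun s => Cmult (f s) (g s)) t (Cplus (Cmult a (g t)) (Cmult (f t) b)).
Proof.
  intros [A B] [A' B'].
  assert (M : forall (u v : R -> R) a b, is_derive u t a -> is_derive v t b ->
    is_derive (fun s => u s * v s) t (a * v t + u t * b)).
  { intros u v p q Hu Hv. apply (is_derive_mult u v t p q); auto.
    intros; apply Rmult_comm. }
  split; simpl.
  - pose proof (is_derive_minus _ _ _ _ _ (M _ _ _ _ A A') (M _ _ _ _ B B')) as D.
    match type of D with is_derive _ _ ?l => match goal with |- is_derive _ _ ?k =>
      replace k with l end end. { exact D. }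
    unfold minus, plus, opp, Re, Im; simpl. ring.
  - pose proof (is_derive_plus _ _ _ _ _ (M _ _ _ _ A B') (M _ _ _ _ B A')) as D.
    match type of D with is_derive _ _ ?l => match goal with |- is_derive _ _ ?k =>
      replace k with l end end. { exact D. }
    unfold minus, plus, opp, Re, Im; simpl. ring.
Qed.

Lemma is_deriveC_cexp (l : R -> C) t v : is_deriveC l t v ->
  is_deriveC (fun s => cexp (l s)) t (Cmult (cexp (l t)) v).
Proof.
  intros [A B]. split; simpl.
  - evar_last.
    + apply (is_derive_mult (fun s => exp (Re (l s))) (fun s => cos (Im (l s))) t).
      * apply (is_derive_comp exp (fun s => Re (l s))); [apply is_derive_exp | exact A].
      * apply (is_derive_comp cos (fun s => Im (l s))); [apply is_derive_cos | exact B].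
      * intros; apply Rmult_comm.
    + unfold plus, mult, scal; simpl. unfold mult; simpl. unfold Re, Im. ring.
  - evar_last.
    + apply (is_derive_mult (fun s => exp (Re (l s))) (fun s => sin (Im (l s))) t).
      * apply (is_derive_comp exp (fun s => Re (l s))); [apply is_derive_exp | exact A].
      * apply (is_derive_comp sin (fun s => Im (l s))); [apply is_derive_sin | exact B].
      * intros; apply Rmult_comm.
    + unfold plus, mult, scal; simpl. unfold mult; simpl. unfold Re, Im. ring.
Qed.

Lemma is_deriveC_const0 (G : R -> C) : (forall t, is_deriveC G t (RtoC 0)) ->
  forall a b, G a = G b.
Proof.
  intros H a b. apply injective_projections.
  - apply (is_derive_0_const (fun t => Re (G t)) (fun _ => True)); auto.
    intros t _. apply (H t).
  - apply (is_derive_0_const (fun t => Im (G t)) (fun _ => True)); auto.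
    intros t _. apply (H t).
Qed.

Definition lift (L l v : R -> C) : Prop :=
  (forall t, is_deriveC l t (v t)) /\ contC v /\ (forall t, cexp (l t) = L t).

(** Winding number around 0, read on a lift to the universal cover. *)
Definition winds (L : R -> C) (m : Z) : Prop :=
  exists l v, lift L l v /\ l (2 * PI) = vshift (l 0) (2 * PI * IZR m).

Lemma is_deriveC_cont L t v : is_deriveC L t v ->
  continuous (fun t => Re (L t)) t /\ continuous (fun t => Im (L t)) t.
Proof.
  intros [A B]. split.
  - apply (ex_derive_continuous (fun t => Re (L t))). eexists; exact A.
  - apply (ex_derive_continuous (fun t => Im (L t))). eexists; exact B.
Qed.

(** The lift l is the primitive of L'/L that starts at a logarithm of L(0): then L
    exp(-l) has derivative zero. *)
Lemma lift_exists (L L' : R -> C) : (forall t, is_deriveC L t (L' t)) -> contC L' ->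
  (forall t, L t <> RtoC 0) -> exists l v, lift L l v.
Proof.
  intros HL [C1 C2] H0.
  pose (n := fun t => Re (L t) * Re (L t) + Im (L t) * Im (L t)).
  pose (v1 := fun t => (Re (L' t) * Re (L t) + Im (L' t) * Im (L t)) / n t).
  pose (v2 := fun t => (Im (L' t) * Re (L t) - Re (L' t) * Im (L t)) / n t).
  assert (Hn : forall t, 0 < n t).
  { intros t. unfold n. specialize (H0 t). destruct (L t) as [x y]. simpl.
    assert (x <> 0 \/ y <> 0).
    { destruct (Req_dec x 0) as [->|]; auto. right. intros ->. now apply H0. }
    destruct H as [H|H]; [pose proof (Rsqr_pos_lt x H)|pose proof (Rsqr_pos_lt y H)];
      unfold Rsqr in *; nra. }
  assert (K : forall t, continuous (fun t => Re (L t)) t /\ continuous (fun t => Im (L t)) t).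
  { intros t. exact (is_deriveC_cont L t _ (HL t)). }
  assert (M : forall (f g : R -> R) t, continuous f t -> continuous g t ->
     continuous (fun t => f t * g t) t).
  { intros f g t Hf Hg. now apply (continuous_mult f g). }
  assert (Cn : forall t : R, continuous (fun t => / n t) t).
  { intros t. apply (continuous_comp n Rinv).
    - apply (continuous_plus (fun t => Re (L t) * Re (L t)) (fun t => Im (L t) * Im (L t)));
        apply M; apply K.
    - apply (ex_derive_continuous Rinv). auto_derive. specialize (Hn t); lra. }
  assert (Cv1 : forall t : R, continuous v1 t).
  { intros t. apply M; auto. apply (continuous_plus (fun t => Re (L' t) * Re (L t))
      (fun t => Im (L' t) * Im (L t))); apply M; auto; apply K. }
  assert (Cv2 : forall t : R, continuous v2 t).
  { intros t. apply M; auto. apply (continuous_minus (fun t => Im (L' t) * Re (L t))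
      (fun t => Re (L' t) * Im (L t))); apply M; auto; apply K. }
  assert (DI : forall (f : R -> R), (forall t : R, continuous f t) -> forall (c t : R),
    is_derive (fun t => c + RInt f 0 t) t (f t)).
  { intros f Hf c t. replace (f t) with (plus 0 (f t)) by (unfold plus; simpl; ring).
    apply (is_derive_plus (fun _ : R => c) (fun t : R => RInt f 0 t)).
    - apply (is_derive_const (V := R_NormedModule)).
    - apply (is_derive_RInt f (fun t : R => RInt f 0 t) 0); auto.
      apply filter_forall. intros z. apply (RInt_correct (V := R_CompleteNormedModule)).
      apply (ex_RInt_continuous (V := R_CompleteNormedModule)). auto. }
  destruct (cexp_surj (L 0) (H0 0)) as [s0 Hs0].
  pose (l := fun t => (Re s0 + RInt v1 0 t, Im s0 + RInt v2 0 t) : C).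
  pose (v := fun t => (v1 t, v2 t) : C).
  assert (Dl : forall t, is_deriveC l t (v t)) by (intros t; split; apply DI; auto).
  exists l, v. split; [exact Dl | split; [split; auto|]].
  assert (HLv : forall t, L' t = Cmult (L t) (v t)).
  { intros t. specialize (Hn t). unfold v, v1, v2. unfold n in *.
    destruct (L t) as [x y], (L' t) as [a b]. simpl in *.
    apply injective_projections; simpl; field; lra. }
  pose (nl := fun t => Copp (l t)).
  assert (Dn : forall t, is_deriveC nl t (Copp (v t))).
  { intros t. destruct (Dl t) as [A B]. split; simpl.
    - apply (is_derive_opp (fun t => Re (l t))), A.
    - apply (is_derive_opp (fun t => Im (l t))), B. }
  assert (G : forall t, Cmult (L t) (cexp (nl t)) = Cmult (L 0) (cexp (nl 0))).
  { intros t. apply (is_deriveC_const0 (fun t => Cmult (L t) (cexp (nl t)))). intros r.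
    replace (RtoC 0) with (Cplus (Cmult (L' r) (cexp (nl r)))
      (Cmult (L r) (Cmult (cexp (nl r)) (Copp (v r))))) by (rewrite HLv; ring).
    apply is_deriveC_mult; auto. apply is_deriveC_cexp; auto. }
  intros t. specialize (G t).
  assert (E0 : l 0 = s0).
  { unfold l. rewrite !RInt_point. unfold zero; simpl. rewrite !Rplus_0_r.
    symmetry; apply surjective_pairing. }
  unfold nl in G. rewrite E0, <- Hs0, cexp_opp in G.
  pose proof (cexp_opp (l t)) as E.
  replace (cexp (l t)) with (Cmult (cexp (l t)) (Cmult (L t) (cexp (Copp (l t)))))
    by (rewrite G; ring).
  replace (Cmult (cexp (l t)) (Cmult (L t) (cexp (Copp (l t)))))
    with (Cmult (L t) (Cmult (cexp (l t)) (cexp (Copp (l t))))) by ring.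
  rewrite E. ring.
Qed.

Lemma winds_exists (L L' : R -> C) : (forall t, is_deriveC L t (L' t)) -> contC L' ->
  (forall t, L t <> RtoC 0) -> L (2 * PI) = L 0 -> exists m, winds L m.
Proof.
  intros H1 H2 H3 H4. destruct (lift_exists L L' H1 H2 H3) as (l & v & Hl).
  destruct (cexp_eq (l (2 * PI)) (l 0)) as [m Hm].
  { destruct Hl as (_ & _ & E). now rewrite !E. }
  exists m, l, v. auto.
Qed.

Lemma lift_deriv L l v t w : lift L l v -> is_deriveC L t w -> w = Cmult (cexp (l t)) (v t).
Proof.
  intros (H1 & H2 & H3) Hw. apply (is_deriveC_unique L t); auto.
  apply (is_deriveC_ext (fun s => cexp (l s))); auto. now apply is_deriveC_cexp.
Qed.

(** On the half-plane the form pulled back by the exponential is periodic, and the lift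
    of a loop of winding number m ends 2 m PI above its origin. *)
Lemma loop_period (U : plane -> Prop) P Q c : open U -> closed_form U P Q ->
  (forall s, HP c s -> U (cexp s)) ->
  exists J : R, forall (L L' : R -> C) m, winds L m ->
    (forall t, is_deriveC L t (L' t)) -> (forall t, Cmod (L t) < exp c) ->
    RInt (fun t => form P Q (L t) (L' t)) 0 (2 * PI) = IZR m * J.
Proof.
  intros HU HF HS.
  assert (Per : forall x y, cexp (x, y + 2 * PI) = cexp (x, y)).
  { intros x y. rewrite <- (cexp_shift (x, y) 1). unfold vshift; simpl. do 2 f_equal. ring. }
  destruct (half_plane_period c (pullP P Q cexp) (pullQ P Q cexp)) as [J HJ].
  - apply (pull_closed U (HP c)); auto.
    + apply open_HP.
    + apply C2_cexp, open_HP.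
  - intros x y _. unfold pullP. now rewrite !hx_cexp, Per.
  - intros x y _. unfold pullQ. now rewrite !hy_cexp, Per.
  - exists J. intros L L' m (l & v & Hl & Hm) HL Hc.
    rewrite <- (HJ l v m); auto; try apply Hl.
    + apply RInt_ext. intros t _. rewrite (lift_deriv L l v t _ Hl (HL t)).
      unfold form, pullP, pullQ, form. rewrite hx_cexp, hy_cexp.
      rewrite (proj2 (proj2 Hl)). simpl. unfold Re, Im. ring.
    + intros t. unfold HP. specialize (Hc t).
      rewrite <- (proj2 (proj2 Hl) t), Cmod_cexp in Hc. now apply exp_lt_inv in Hc.
Qed.

(** Components of the form d arg. *)
Definition angP (p : plane) : R := - Im p * / (Re p * Re p + Im p * Im p).
Definition angQ (p : plane) : R := Re p * / (Re p * Re p + Im p * Im p).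

Lemma ang_form (z v : C) : z <> RtoC 0 -> form angP angQ z (Cmult z v) = Im v.
Proof.
  intros Hz. assert (P := Cmod_gt_0 z). apply P in Hz. pose proof (Cmod2 z) as E.
  destruct z as [x y], v as [a b]. unfold form, angP, angQ. simpl in *.
  field. nra.
Qed.

Lemma ang_winds L L' m : winds L m -> (forall t, is_deriveC L t (L' t)) ->
  RInt (fun t => form angP angQ (L t) (L' t)) 0 (2 * PI) = 2 * PI * IZR m.
Proof.
  intros (l & v & Hl & Hm) HL.
  rewrite (RInt_ext _ (fun t => Im (v t))).
  - transitivity (Im (l (2 * PI)) - Im (l 0)).
    + apply is_RInt_unique.
      apply (is_RInt_derive (V := R_CompleteNormedModule) (fun t => Im (l t))).
      * intros t _. apply (proj1 Hl).
      * intros t _. apply (proj1 (proj2 Hl)).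
    + rewrite Hm. simpl. unfold Im. ring.
  - intros t _. rewrite (lift_deriv L l v t _ Hl (HL t)), <- (proj2 (proj2 Hl) t).
    apply ang_form, cexp_neq0.
Qed.

Definition Cstar (z : plane) : Prop := z <> RtoC 0.

Lemma open_Cstar : open Cstar.
Proof.
  intros z Hz. assert (P := proj1 (Cmod_gt_0 z) Hz).
  assert (H2 : 0 < Cmod z / 2) by lra.
  assert (D : 0 < Rabs (Re z) \/ 0 < Rabs (Im z)).
  { destruct (Req_dec (Re z) 0) as [E|E]; [right|left; now apply Rabs_pos_lt].
    apply Rabs_pos_lt. intros E'. apply Hz. destruct z; simpl in *; now subst. }
  destruct D as [D|D]; exists (mkposreal _ D); intros q Hq E; subst q; destruct Hq as [A B];
    destruct z as [x y]; simpl in *.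
  - change (Rabs (0 - x) < Rabs x) in A. rewrite Rminus_0_l, Rabs_Ropp in A. lra.
  - change (Rabs (0 - y) < Rabs y) in B. rewrite Rminus_0_l, Rabs_Ropp in B. lra.
Qed.

Lemma Cstar_pos (z : C) : Cstar z -> 0 < Re z * Re z + Im z * Im z.
Proof.
  intros Hz. assert (P := proj1 (Cmod_gt_0 z) Hz). pose proof (Cmod2 z). nra.
Qed.

Lemma ang_closed : closed_form Cstar angP angQ.
Proof.
  assert (X : CK 1 Cstar (fun q : plane => Re q)) by apply CK_fst.
  assert (Y : CK 1 Cstar (fun q : plane => Im q)) by apply CK_snd.
  assert (N : CK 1 Cstar (fun q : plane => / (Re q * Re q + Im q * Im q))).
  { apply (CK_inv (V := plane)); [apply open_Cstar | exact Cstar_pos |].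
    apply (CK_plus 1 Cstar (fun q : plane => Re q * Re q) (fun q : plane => Im q * Im q));
      [apply open_Cstar | |].
    - apply (CK_mult 1 Cstar (fun q : plane => Re q)); auto using open_Cstar.
    - apply (CK_mult 1 Cstar (fun q : plane => Im q)); auto using open_Cstar. }
  assert (HP1 : CK 1 Cstar angP).
  { apply (CK_mult 1 Cstar (fun q : plane => - Im q)
      (fun q : plane => / (Re q * Re q + Im q * Im q))); auto using open_Cstar.
    apply (CK_opp 1 Cstar (fun q : plane => Im q)); auto using open_Cstar. }
  assert (HQ1 : CK 1 Cstar angQ).
  { apply (CK_mult 1 Cstar (fun q : plane => Re q)
      (fun q : plane => / (Re q * Re q + Im q * Im q))); auto using open_Cstar. }
  split; [split; auto|]. intros [x y] Hz. pose proof (Cstar_pos _ Hz) as P. simpl in P.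
  unfold curl.
  rewrite (pdx_val angQ x y ((y * y - x * x) / (x * x + y * y) ^ 2)).
  2:{ unfold angQ; simpl. auto_derive; [nra|]. field. nra. }
  rewrite (pdy_val angP x y ((y * y - x * x) / (x * x + y * y) ^ 2)).
  2:{ unfold angP; simpl. auto_derive; [nra|]. field. nra. }
  ring.
Qed.

(** * Killing fields and the flux form *)

Definition qf (al be ga z : C) : C :=
  Cplus (Cplus (Cmult al (Cmult z z)) (Cmult be z)) ga.
Definition qf' (al be z : C) : C := Cplus (Cmult (RtoC 2) (Cmult al z)) be.

(** The Killing field of H3 extending the field (al z^2 + be z + ga) d/dz of the
    boundary. *)
Definition Kf (al be ga : C) (p : space) : space :=
  (Cminus (qf al be ga (fst p)) (Cmult (Cconj al) (RtoC (snd p ^ 2))),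
   snd p * Re (qf' al be (fst p))).

(** Complex pairing of a tangent vector with a Killing field. It is the trace of dM M^-1
    k in the model of positive hermitian matrices M (Tf_trace); its real part is the
    inner product with the field. *)
Definition Tf (al be ga : C) (p xi : space) : C :=
  Cdiv (Cplus (Cminus (Cmult (qf al be ga (fst p)) (Cconj (fst xi)))
                (Cmult (Cmult al (RtoC (snd p ^ 2))) (fst xi)))
              (Cmult (qf' al be (fst p)) (RtoC (snd p * snd xi))))
       (RtoC (snd p ^ 2)).

Definition RTf al be ga (p xi : space) : R :=
  let q := qf al be ga (fst p) in let q' := qf' al be (fst p) in
  (Re q * Re (fst xi) + Im q * Im (fst xi)
   - snd p ^ 2 * (Re al * Re (fst xi) - Im al * Im (fst xi))
   + Re q' * (snd p * snd xi)) * / snd p ^ 2.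

Definition ITf al be ga (p xi : space) : R :=
  let q := qf al be ga (fst p) in let q' := qf' al be (fst p) in
  (Im q * Re (fst xi) - Re q * Im (fst xi)
   - snd p ^ 2 * (Re al * Im (fst xi) + Im al * Re (fst xi))
   + Im q' * (snd p * snd xi)) * / snd p ^ 2.

Lemma Tf_parts al be ga p xi : 0 < snd p ->
  Tf al be ga p xi = (RTf al be ga p xi, ITf al be ga p xi).
Proof.
  intros Hp. unfold Tf, RTf, ITf. cbv zeta.
  generalize (qf al be ga (fst p)) (qf' al be (fst p)). intros [q1 q2] [r1 r2].
  destruct p as [[u v] w], xi as [[a b] c], al as [a1 a2]. simpl in *.
  apply injective_projections; simpl; field; lra.
Qed.

Lemma RTf_inner al be ga p xi : 0 < snd p ->
  RTf al be ga p xi = hyp_inner p xi (Kf al be ga p).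
Proof.
  intros Hp. unfold RTf, hyp_inner, dot, Kf. cbv zeta. simpl fst; simpl snd.
  generalize (qf al be ga (fst p)) (qf' al be (fst p)). intros [q1 q2] [r1 r2].
  destruct p as [[u v] w], xi as [[a b] c], al as [a1 a2]. simpl in *.
  field. lra.
Qed.

Definition dq al be (z dz : C) : C := Cmult (qf' al be z) dz.
(** Derivatives of RTf and ITf when the point moves with velocity p' and the vector xi
    with velocity xi'. *)
Definition dRTf al be ga (p xi p' xi' : space) : R :=
  let q := qf al be ga (fst p) in let q' := qf' al be (fst p) in
  let d := dq al be (fst p) (fst p') in
  let d' := Cmult (RtoC 2) (Cmult al (fst p')) in
  (Re d * Re (fst xi) + Re q * Re (fst xi') + Im d * Im (fst xi) + Im q * Im (fst xi')
   - 2 * snd p * snd p' * (Re al * Re (fst xi) - Im al * Im (fst xi))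
   - snd p ^ 2 * (Re al * Re (fst xi') - Im al * Im (fst xi'))
   + Re d' * (snd p * snd xi) + Re q' * (snd p' * snd xi + snd p * snd xi')) * / snd p ^ 2
  - 2 * (snd p' * / snd p) * RTf al be ga p xi.
Definition dITf al be ga (p xi p' xi' : space) : R :=
  let q := qf al be ga (fst p) in let q' := qf' al be (fst p) in
  let d := dq al be (fst p) (fst p') in
  let d' := Cmult (RtoC 2) (Cmult al (fst p')) in
  (Im d * Re (fst xi) + Im q * Re (fst xi') - Re d * Im (fst xi) - Re q * Im (fst xi')
   - 2 * snd p * snd p' * (Re al * Im (fst xi) + Im al * Re (fst xi))
   - snd p ^ 2 * (Re al * Im (fst xi') + Im al * Re (fst xi'))
   + Im d' * (snd p * snd xi) + Im q' * (snd p' * snd xi + snd p * snd xi')) * / snd p ^ 2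
  - 2 * (snd p' * / snd p) * ITf al be ga p xi.

Definition is_deriveS (c : R -> space) (t : R) (v : space) : Prop :=
  is_derive (fun s => Re (fst (c s))) t (Re (fst v)) /\
  is_derive (fun s => Im (fst (c s))) t (Im (fst v)) /\
  is_derive (fun s => snd (c s)) t (snd v).

(* The derivative H of u at t, in the forms used by auto_derive *)
Ltac derivative H u t F :=
  lazymatch type of H with is_derive _ _ ?l =>
    let E := fresh "E" in assert (E : ex_derive u t) by (exists l; exact H);
    assert (F : Derive (fun x : R => u x) t = l) by (exact (is_derive_unique _ _ _ H)) end.

Lemma Tf_derive al be ga (c x : R -> space) t c' x' : 0 < snd (c t) ->
  is_deriveS c t c' -> is_deriveS x t x' ->
  is_derive (fun s => RTf al be ga (c s) (x s)) t (dRTf al be ga (c t) (x t) c' x') /\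
  is_derive (fun s => ITf al be ga (c s) (x s)) t (dITf al be ga (c t) (x t) c' x').
Proof.
  intros Hp (H1 & H2 & H3) (H4 & H5 & H6).
  destruct al as [a1 a2], be as [b1 b2], ga as [g1 g2].
  unfold dRTf, dITf, RTf, ITf, dq, qf, qf'. cbv zeta.
  destruct c' as [[u' v'] w'], x' as [[p' q'] r'].
  unfold Re, Im in *. simpl in *.
  set (u := fun s => fst (fst (c s))) in *. set (v := fun s => snd (fst (c s))) in *.
  set (w := fun s => snd (c s)) in *.
  set (p := fun s => fst (fst (x s))) in *. set (q := fun s => snd (fst (x s))) in *.
  set (r := fun s => snd (x s)) in *.
  change (fst (fst (c t))) with (u t). change (snd (fst (c t))) with (v t).
  change (snd (c t)) with (w t). change (fst (fst (x t))) with (p t).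
  change (snd (fst (x t))) with (q t). change (snd (x t)) with (r t).
  change (0 < w t) in Hp.
  derivative H1 u t F1.
  derivative H2 v t F2.
  derivative H3 w t F3.
  derivative H4 p t F4.
  derivative H5 q t F5.
  derivative H6 r t F6.
  split.
  - apply (is_derive_ext (fun s : R =>
      (((a1 * (u s * u s - v s * v s) - a2 * (u s * v s + v s * u s) + (b1 * u s - b2 * v s) + g1) * p s
      + (a1 * (u s * v s + v s * u s) + a2 * (u s * u s - v s * v s) + (b1 * v s + b2 * u s) + g2) * q s
      - w s ^ 2 * (a1 * p s - a2 * q s)
      + (2 * (a1 * u s - a2 * v s) + b1) * (w s * r s)) * / w s ^ 2))).
    { intros s. unfold u, v, w, p, q, r. unfold Re, Im. simpl. ring. }
    auto_derive.
    + repeat split; auto. nra.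
    + rewrite F1, F2, F3, F4, F5, F6. field_simplify_eq; [ring | lra].
  - apply (is_derive_ext (fun s : R =>
      (((a1 * (u s * v s + v s * u s) + a2 * (u s * u s - v s * v s) + (b1 * v s + b2 * u s) + g2) * p s
      - (a1 * (u s * u s - v s * v s) - a2 * (u s * v s + v s * u s) + (b1 * u s - b2 * v s) + g1) * q s
      - w s ^ 2 * (a1 * q s + a2 * p s)
      + (2 * (a1 * v s + a2 * u s) + b2) * (w s * r s)) * / w s ^ 2))).
    { intros s. unfold u, v, w, p, q, r. unfold Re, Im. simpl. ring. }
    auto_derive.
    + repeat split; auto. nra.
    + rewrite F1, F2, F3, F4, F5, F6. field_simplify_eq; [ring | lra].
Qed.

(** Exterior derivative of the one-form Im T: this is what turns the integral over a
    spanning disc into an integral over its boundary. *)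
Lemma dITf_curl al be ga p x y xy : 0 < snd p ->
  dITf al be ga p y x xy - dITf al be ga p x y xy =
  - 2 * (dot (cross x y) (Kf al be ga p) / snd p ^ 3).
Proof.
  intros Hp. destruct al as [a1 a2], be as [b1 b2], ga as [g1 g2].
  destruct p as [[u v] w], x as [[x1 x2] x3], y as [[y1 y2] y3], xy as [[z1 z2] z3].
  unfold dITf, ITf, dq, dot, cross, vec, Kf, qf, qf'. simpl in *. field. lra.
Qed.

(** The Killing equation: the field contributes nothing to the derivative of its
    inner product with the velocity of a curve. *)
Lemma dRTf_killing al be ga p x x' : 0 < snd p ->
  dRTf al be ga p x x x' =
  hyp_inner p (plus x' (christoffel p x x)) (Kf al be ga p).
Proof.
  intros Hp. destruct al as [a1 a2], be as [b1 b2], ga as [g1 g2].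
  destruct p as [[u v] w], x as [[x1 x2] x3], x' as [[z1 z2] z3].
  change (plus ((z1, z2, z3) : space) (christoffel (u, v, w) (x1, x2, x3) (x1, x2, x3)))
   with ((z1 + / w * (- x3 * x1 + - x3 * x1 + 0), z2 + / w * (- x3 * x2 + - x3 * x2 + 0),
     z3 + / w * (- x3 * x3 + - x3 * x3 + dot (x1, x2, x3) (x1, x2, x3))) : space).
  unfold hyp_inner, dRTf, RTf, dq, dot, Kf, qf, qf'. simpl in *. field. lra.
Qed.

(** * Surfaces *)

Definition CKS (n : nat) {V : NormedModule R_AbsRing} (U : V -> Prop) (X : V -> space) : Prop :=
  CK n U (fun q => Re (fst (X q))) /\ CK n U (fun q => Im (fst (X q))) /\
  CK n U (fun q => snd (X q)).

Definition C2_surf : (plane -> Prop) -> (plane -> space) -> Prop := CKS 2.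

Definition X1 (X : plane -> space) : plane -> space := dspace X e1.
Definition X2 (X : plane -> space) : plane -> space := dspace X e2.

Ltac ck := lazymatch goal with
  | |- CK ?n ?U (fun q => @?f q + @?g q) => apply (CK_plus n U f g); [assumption | ck | ck]
  | |- CK ?n ?U (fun q => @?f q - @?g q) => apply (CK_minus n U f g); [assumption | ck | ck]
  | |- CK ?n ?U (fun q => @?f q * @?g q) => apply (CK_mult n U f g); [assumption | ck | ck]
  | |- CK ?n ?U (fun q => - @?f q) => apply (CK_opp n U f); [assumption | ck]
  | |- CK _ _ (fun _ => ?c) => apply CK_const
  | _ => try assumption end.

Lemma CK_T (U : plane -> Prop) al be ga (p x : plane -> space) : open U ->
  (forall q, U q -> 0 < snd (p q)) ->
  CK 1 U (fun q => Re (fst (p q))) -> CK 1 U (fun q => Im (fst (p q))) ->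
  CK 1 U (fun q => snd (p q)) ->
  CK 1 U (fun q => Re (fst (x q))) -> CK 1 U (fun q => Im (fst (x q))) ->
  CK 1 U (fun q => snd (x q)) ->
  CK 1 U (fun q => RTf al be ga (p q) (x q)) /\ CK 1 U (fun q => ITf al be ga (p q) (x q)).
Proof.
  intros HU Hw H1 H2 H3 H4 H5 H6.
  assert (HI : CK 1 U (fun q => / (snd (p q) ^ 2))).
  { apply (CK_inv 1 U (fun q => snd (p q) ^ 2)); auto.
    - intros q Hq. apply pow_lt. auto.
    - apply (CK_ext 1 U (fun q => snd (p q) * snd (p q))); auto; [intros; ring | ck]. }
  destruct al as [a1 a2], be as [b1 b2], ga as [g1 g2].
  set (u := fun q => Re (fst (p q))) in *. set (v := fun q => Im (fst (p q))) in *.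
  set (w := fun q => snd (p q)) in *. set (a := fun q => Re (fst (x q))) in *.
  set (b := fun q => Im (fst (x q))) in *. set (c := fun q => snd (x q)) in *.
  split.
  - apply (CK_ext 1 U (fun s =>
      (((a1 * (u s * u s - v s * v s) - a2 * (u s * v s + v s * u s) + (b1 * u s - b2 * v s) + g1) * a s
      + (a1 * (u s * v s + v s * u s) + a2 * (u s * u s - v s * v s) + (b1 * v s + b2 * u s) + g2) * b s
      - (w s * w s) * (a1 * a s - a2 * b s)
      + (2 * (a1 * u s - a2 * v s) + b1) * (w s * c s)) * / (snd (p s)) ^ 2))); auto.
    { intros q _. unfold u, v, w, a, b, c, RTf, qf, qf'. simpl. unfold Re, Im. ring. }
    ck.
  - apply (CK_ext 1 U (fun s =>
      (((a1 * (u s * v s + v s * u s) + a2 * (u s * u s - v s * v s) + (b1 * v s + b2 * u s) + g2) * a s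
      - (a1 * (u s * u s - v s * v s) - a2 * (u s * v s + v s * u s) + (b1 * u s - b2 * v s) + g1) * b s
      - (w s * w s) * (a1 * b s + a2 * a s)
      + (2 * (a1 * v s + a2 * u s) + b2) * (w s * c s)) * / (snd (p s)) ^ 2))); auto.
    { intros q _. unfold u, v, w, a, b, c, ITf, qf, qf'. simpl. unfold Re, Im. ring. }
    ck.
Qed.

(** * Surfaces of mean curvature one *)

Lemma dot_scal_l k a b : dot (scal k a) b = k * dot a b.
Proof.
  destruct a as [[a1 a2] a3], b as [[b1 b2] b3].
  change (k * a1 * b1 + k * a2 * b2 + k * a3 * b3 = k * (a1 * b1 + a2 * b2 + a3 * b3)). ring.
Qed.
Lemma dot_scal_r k a b : dot a (scal k b) = k * dot a b.
Proof.
  destruct a as [[a1 a2] a3], b as [[b1 b2] b3].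
  change (a1 * (k * b1) + a2 * (k * b2) + a3 * (k * b3) = k * (a1 * b1 + a2 * b2 + a3 * b3)). ring.
Qed.
Lemma dot_plus_l a b c : dot (plus a b) c = dot a c + dot b c.
Proof.
  destruct a as [[a1 a2] a3], b as [[b1 b2] b3], c as [[c1 c2] c3].
  change ((a1 + b1) * c1 + (a2 + b2) * c2 + (a3 + b3) * c3 =
   (a1 * c1 + a2 * c2 + a3 * c3) + (b1 * c1 + b2 * c2 + b3 * c3)). ring.
Qed.
Lemma dot_comm a b : dot a b = dot b a.
Proof. unfold dot. ring. Qed.
Lemma cross_sq a b : dot (cross a b) (cross a b) = dot a a * dot b b - dot a b ^ 2.
Proof.
  destruct a as [[a1 a2] a3], b as [[b1 b2] b3]. unfold dot, cross, vec; simpl. ring.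
Qed.

Lemma space_eq (a b : space) : fst (fst a) = fst (fst b) -> snd (fst a) = snd (fst b) ->
  snd a = snd b -> a = b.
Proof. destruct a as [[? ?] ?], b as [[? ?] ?]. simpl. congruence. Qed.

(** x, y and their cross product form an orthogonal basis. *)
Lemma normal_component x y t : dot x x = dot y y -> 0 < dot x x -> dot x y = 0 ->
  dot t x = 0 -> dot t y = 0 ->
  t = scal (dot t (cross x y) / (dot x x) ^ 2) (cross x y).
Proof.
  intros Hxy Hx H0 H1 H2.
  assert (C : dot (cross x y) (cross x y) = (dot x x) ^ 2).
  { rewrite cross_sq, <- Hxy, H0. ring. }
  assert (Hp : (dot x x) ^ 2 <> 0) by (apply pow_nonzero; lra).
  assert (G : forall a b c d, c <> 0 -> c * a = d * b -> a = d / c * b).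
  { intros a b c d Hc E. field_simplify_eq; auto. rewrite Rmult_comm. exact E. }
  assert (V : forall (pr : space -> R),
    dot (cross x y) (cross x y) * pr t = dot t (cross x y) * pr (cross x y)
      + dot t x * pr (cross y (cross x y)) + dot t y * pr (cross (cross x y) x) ->
    pr t = dot t (cross x y) / (dot x x) ^ 2 * pr (cross x y)).
  { intros pr E. apply G; auto. rewrite <- C, E, H1, H2. ring. }
  apply space_eq.
  - apply (V (fun s => fst (fst s))).
    destruct x as [[x1 x2] x3], y as [[y1 y2] y3], t as [[t1 t2] t3].
    unfold dot, cross, vec; simpl. ring.
  - apply (V (fun s => snd (fst s))).
    destruct x as [[x1 x2] x3], y as [[y1 y2] y3], t as [[t1 t2] t3].
    unfold dot, cross, vec; simpl. ring.
  - apply (V (fun s => snd s)).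
    destruct x as [[x1 x2] x3], y as [[y1 y2] y3], t as [[t1 t2] t3].
    unfold dot, cross, vec; simpl. ring.
Qed.

Lemma christoffel_self (p x : space) : christoffel p x x =
  vec (/ snd p * (- snd x * Re (fst x) + - snd x * Re (fst x) + 0))
      (/ snd p * (- snd x * Im (fst x) + - snd x * Im (fst x) + 0))
      (/ snd p * (- snd x * snd x + - snd x * snd x + dot x x)).
Proof. reflexivity. Qed.

Lemma christoffel_dot (p x y z : space) : 0 < snd p -> dot x x = dot y y -> dot x y = 0 ->
  z = x \/ z = y ->
  dot (christoffel p x x) z + dot (christoffel p y y) z = 0.
Proof.
  intros Hp E0 E1 Hz.
  rewrite !christoffel_self.
  destruct p as [[p1 p2] w], x as [[x1 x2] x3], y as [[y1 y2] y3]. simpl in Hp.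
  unfold dot in *. simpl in *. unfold Re, Im in *. simpl in *.
  assert (W : w <> 0) by lra.
  destruct Hz as [-> | ->]; simpl.
  - transitivity (/ w * (x3 * ((y1 * y1 + y2 * y2 + y3 * y3) - (x1 * x1 + x2 * x2 + x3 * x3))
      - 2 * y3 * (x1 * y1 + x2 * y2 + x3 * y3))); [ring | rewrite E1, E0; ring].
  - transitivity (/ w * (y3 * ((x1 * x1 + x2 * x2 + x3 * x3) - (y1 * y1 + y2 * y2 + y3 * y3))
      - 2 * x3 * (x1 * y1 + x2 * y2 + x3 * y3))); [ring | rewrite E1, E0; ring].
Qed.

(** The parametrization is conformal, so the tension field t1 + t2 is orthogonal to x
    and y; its normal component is the mean curvature H. The length of the mean
    curvature vector and its orientation give H = 1. *)
Lemma tension_algebra (p x y x11 x12 x22 : space) (H : R) :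
  let N := scal (snd p / sqrt (dot (cross x y) (cross x y))) (cross x y) in
  let t1 := plus x11 (christoffel p x x) in
  let t2 := plus x22 (christoffel p y y) in
  0 < snd p -> dot x x = dot y y -> 0 < dot x x -> dot x y = 0 ->
  dot x11 x = dot x12 y -> dot x12 x = dot x22 y ->
  dot x11 y + dot x x12 = 0 -> dot x12 y + dot x x22 = 0 ->
  H = (hyp_inner p t1 N + hyp_inner p t2 N) / (2 * hyp_inner p x x) ->
  hyp_norm p (scal H N) = 1 -> 0 < det3 x y (scal H N) ->
  H = 1 /\ plus t1 t2 = scal (2 / snd p) (cross x y).
Proof.
  intros N t1 t2 Hp Exy Hx Oxy D1 D2 D3 D4 EH NH OH.
  set (w := snd p) in *. set (L := dot x x) in *.
  assert (C : dot (cross x y) (cross x y) = L ^ 2).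
  { rewrite cross_sq, <- Exy, Oxy. unfold L. ring. }
  assert (S : sqrt (dot (cross x y) (cross x y)) = L).
  { rewrite C. apply sqrt_pow2. lra. }
  assert (NN : hyp_inner p N N = 1).
  { unfold hyp_inner, N. rewrite S, dot_scal_l, dot_scal_r, C. fold w. field. lra. }
  assert (H1 : H = 1).
  { unfold hyp_norm, hyp_inner in NH. rewrite dot_scal_l, dot_scal_r in NH.
    replace (H * (H * dot N N) / snd p ^ 2) with (H ^ 2 * hyp_inner p N N) in NH
      by (unfold hyp_inner; field; fold w; lra).
    rewrite NN, Rmult_1_r in NH.
    assert (HH : H ^ 2 = 1).
    { pose proof (pow2_ge_0 H) as Q. rewrite <- (pow2_sqrt _ Q), NH. ring. }
    assert (P : 0 < H).
    { unfold det3, N in OH. rewrite !dot_scal_r, S, C in OH. fold w in OH.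
      assert (0 < w / L) by (apply Rdiv_lt_0_compat; lra).
      assert (0 < L ^ 2) by (apply pow_lt; lra).
      destruct (Rlt_dec 0 H) as [|Hn]; auto. exfalso.
      assert (H * (w / L * L ^ 2) <= 0); [|lra].
      assert (0 < w / L * L ^ 2) by (apply Rmult_lt_0_compat; lra). nra. }
    nra. }
  split; auto.
  assert (T1 : dot (plus t1 t2) x = 0).
  { unfold t1, t2. rewrite !dot_plus_l.
    pose proof (christoffel_dot p x y x Hp Exy Oxy (or_introl eq_refl)).
    rewrite (dot_comm x22 x). lra. }
  assert (T2 : dot (plus t1 t2) y = 0).
  { unfold t1, t2. rewrite !dot_plus_l.
    pose proof (christoffel_dot p x y y Hp Exy Oxy (or_intror eq_refl)).
    rewrite (dot_comm x x12) in D3. lra. }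
  rewrite (normal_component x y (plus t1 t2)) at 1; auto.
  f_equal. fold L.
  rewrite H1 in EH. unfold hyp_inner, N in EH. rewrite S, !dot_scal_r in EH. fold w L in EH.
  rewrite dot_plus_l.
  assert (EQ : dot t1 (cross x y) + dot t2 (cross x y) = 2 * L ^ 2 / w).
  { set (A := dot t1 (cross x y)) in *. set (B := dot t2 (cross x y)) in *.
    assert (E : 1 * (2 * (L / w ^ 2)) = w / L * A / w ^ 2 + w / L * B / w ^ 2).
    { rewrite EH. field. repeat split; lra. }
    apply (Rmult_eq_reg_r (/ (L * w))).
    2:{ apply Rinv_neq_0_compat, Rgt_not_eq, Rmult_lt_0_compat; lra. }
    transitivity (w / L * A / w ^ 2 + w / L * B / w ^ 2); [field; lra|].
    rewrite <- E. field. lra. }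
  rewrite EQ. field. lra.
Qed.

Lemma C2_surf_of (U : plane -> Prop) X : open U -> Ck_space 2 U X -> C2_surf U X.
Proof.
  intros HU [[A B] D]. refine (conj _ (conj _ _)); apply Ck_plane_CK; auto.
Qed.

Definition cmc1 (U : plane -> Prop) (X : plane -> space) : Prop :=
  open U /\ C2_surf U X /\ forall z, U z -> 0 < snd (X z) /\
   conformal_immersion_at X z /\
   hyp_norm (X z) (mean_curvature_vector X z) = 1 /\
   0 < det3 (X1 X z) (X2 X z) (mean_curvature_vector X z).

Lemma dot_dir {V : NormedModule R_AbsRing} (U : V -> Prop) (F G : V -> space) v z : open U -> U z ->
  CKS 1 U F ->
  CKS 1 U G ->
  dir_deriv (fun q => dot (F q) (G q)) v z = dot (dspace F v z) (G z) + dot (F z) (dspace G v z).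
Proof.
  intros HU Hz (A1 & A2 & A3) (B1 & B2 & B3). unfold dot.
  assert (M1 := CK_mult 1 U _ _ HU A1 B1). assert (M2 := CK_mult 1 U _ _ HU A2 B2).
  assert (M3 := CK_mult 1 U _ _ HU A3 B3).
  rewrite (dir_add U _ _ v z (CK_plus 1 U _ _ HU M1 M2) M3 Hz).
  rewrite (dir_add U _ _ v z M1 M2 Hz).
  rewrite (dir_mul U _ _ v z A1 B1 Hz), (dir_mul U _ _ v z A2 B2 Hz), (dir_mul U _ _ v z A3 B3 Hz).
  unfold dspace, dplane. simpl. ring.
Qed.

Lemma C1_partial (U : plane -> Prop) X v : C2_surf U X ->
  CKS 1 U (dspace X v).
Proof.
  intros (A & B & D). refine (conj _ (conj _ _)).
  - exact (CK_S 1 U _ A v).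
  - exact (CK_S 1 U _ B v).
  - exact (CK_S 1 U _ D v).
Qed.

Lemma conformal_dot X z : 0 < snd (X z) -> conformal_immersion_at X z ->
  0 < dot (X1 X z) (X1 X z) /\ dot (X1 X z) (X1 X z) = dot (X2 X z) (X2 X z) /\
  dot (X1 X z) (X2 X z) = 0.
Proof.
  unfold conformal_immersion_at, fst_form, hyp_inner, X1, X2. intros Hw (A & B & D).
  assert (W : 0 < snd (X z) ^ 2) by (apply pow_lt; auto).
  assert (W' : / snd (X z) ^ 2 <> 0) by (apply Rinv_neq_0_compat; lra).
  refine (conj _ (conj _ _)).
  - apply (Rmult_lt_reg_r (/ snd (X z) ^ 2)); [now apply Rinv_0_lt_compat|].
    rewrite Rmult_0_l. exact A.
  - exact (Rmult_eq_reg_r _ _ _ B W').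
  - apply (Rmult_eq_reg_r (/ snd (X z) ^ 2)); auto. rewrite Rmult_0_l. exact D.
Qed.

Lemma mixed_partials (U : plane -> Prop) X z : open U -> C2_surf U X -> U z ->
  dspace (X1 X) e2 z = dspace (X2 X) e1 z.
Proof.
  intros HU (A & B & D) Hz. apply space_eq; symmetry.
  - exact (pdx_pdy U _ z HU A Hz).
  - exact (pdx_pdy U _ z HU B Hz).
  - exact (pdx_pdy U _ z HU D Hz).
Qed.

Lemma cmc1_tension U X z : cmc1 U X -> U z ->
  mean_curvature X z = 1 /\
  plus (plus (dspace (X1 X) e1 z) (christoffel (X z) (X1 X z) (X1 X z)))
       (plus (dspace (X2 X) e2 z) (christoffel (X z) (X2 X z) (X2 X z))) =
  scal (2 / snd (X z)) (cross (X1 X z) (X2 X z)).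
Proof.
  intros (HU & HX & HC) Hz.
  assert (K1 := C1_partial U X e1 HX). assert (K2 := C1_partial U X e2 HX).
  destruct (HC z Hz) as (Hw & Hcf & HN & HO).
  destruct (conformal_dot X z Hw Hcf) as (Q1 & Q2 & Q3).
  assert (E1 : forall v, dir_deriv (fun q => dot (X1 X q) (X1 X q)) v z =
    dir_deriv (fun q => dot (X2 X q) (X2 X q)) v z).
  { intros v. apply (dir_ext_loc U); auto. intros q Hq.
    destruct (HC q Hq) as (Hw' & Hcf' & _). apply (conformal_dot X q Hw' Hcf'). }
  assert (E2 : forall v, dir_deriv (fun q => dot (X1 X q) (X2 X q)) v z = 0).
  { intros v. rewrite (dir_ext_loc U _ (fun _ => 0) z v HU); auto.
    - exact (Derive_const 0 0).
    - intros q Hq. destruct (HC q Hq) as (Hw' & Hcf' & _). apply (conformal_dot X q Hw' Hcf'). }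
  pose proof (E1 e1) as D1. pose proof (E1 e2) as D2. pose proof (E2 e1) as D3.
  pose proof (E2 e2) as D4.
  rewrite (dot_dir U (X1 X) (X1 X) e1 z HU Hz K1 K1), (dot_dir U (X2 X) (X2 X) e1 z HU Hz K2 K2)
    in D1.
  rewrite (dot_dir U (X1 X) (X1 X) e2 z HU Hz K1 K1), (dot_dir U (X2 X) (X2 X) e2 z HU Hz K2 K2)
    in D2.
  rewrite (dot_dir U (X1 X) (X2 X) e1 z HU Hz K1 K2) in D3.
  rewrite (dot_dir U (X1 X) (X2 X) e2 z HU Hz K1 K2) in D4.
  rewrite (mixed_partials U X z HU HX Hz) in D2, D4.
  pose proof (dot_comm (X1 X z) (dspace (X1 X) e1 z)).
  pose proof (dot_comm (X2 X z) (dspace (X2 X) e1 z)).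
  pose proof (dot_comm (X1 X z) (dspace (X2 X) e1 z)).
  pose proof (dot_comm (X2 X z) (dspace (X2 X) e2 z)).
  apply (tension_algebra (X z) (X1 X z) (X2 X z) (dspace (X1 X) e1 z) (dspace (X2 X) e1 z)
    (dspace (X2 X) e2 z) (mean_curvature X z)); auto; try lra.
  - destruct Hcf as (F1 & F2 & F3). unfold mean_curvature. rewrite F3, <- F2.
    unfold snd_form.
    change (dspace X e1 z) with (X1 X z). change (dspace X e2 z) with (X2 X z).
    change (dspace (dspace X e1) e1 z) with (dspace (X1 X) e1 z).
    change (dspace (dspace X e2) e2 z) with (dspace (X2 X) e2 z).
    change (fst_form X e1 e1 z) with (hyp_inner (X z) (X1 X z) (X1 X z)) in *.
    unfold unit_normal. change (dspace X e1 z) with (X1 X z). change (dspace X e2 z) with (X2 X z).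
    cbv zeta. field. lra.
Qed.

(** * The flux form of a surface *)

Definition RT al be ga X v (q : plane) : R := RTf al be ga (X q) (dspace X v q).
Definition IT al be ga X v (q : plane) : R := ITf al be ga (X q) (dspace X v q).

(** The flux form: the sum of the Hodge dual of Re T and of Im T along the surface. *)
Definition fluxP al be ga X (q : plane) : R := - RT al be ga X e2 q + IT al be ga X e1 q.
Definition fluxQ al be ga X (q : plane) : R := RT al be ga X e1 q + IT al be ga X e2 q.

Lemma is_deriveS_dir {V : NormedModule R_AbsRing} (U : V -> Prop) (X : V -> space) q v : U q ->
  CKS 1 U X ->
  is_deriveS (fun t : R => X (plus q (scal t v))) 0 (dspace X v q).
Proof.
  intros Hq (A & B & D). refine (conj _ (conj _ _)).
  - exact (dir_is_derive 0 U _ q v A Hq).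
  - exact (dir_is_derive 0 U _ q v B Hq).
  - exact (dir_is_derive 0 U _ q v D Hq).
Qed.

Lemma C2_C1 U X : C2_surf U X -> CKS 1 U X.
Proof. intros (A & B & D). refine (conj _ (conj _ _)); now apply CK_pred. Qed.

Section FluxForm.
Variables (al be ga : C) (U : plane -> Prop) (X : plane -> space).
Hypotheses (HU : open U) (HX : C2_surf U X) (Hw : forall q, U q -> 0 < snd (X q)).

Lemma CK_RT_IT v : CK 1 U (RT al be ga X v) /\ CK 1 U (IT al be ga X v).
Proof.
  destruct (C2_C1 U X HX) as (A & B & D). destruct (C1_partial U X v HX) as (A' & B' & D').
  apply (CK_T U al be ga X (dspace X v)); auto.
Qed.

Lemma dir_RT_IT v a q : U q ->
  dir_deriv (RT al be ga X v) a q =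
    dRTf al be ga (X q) (dspace X v q) (dspace X a q) (dspace (dspace X v) a q) /\
  dir_deriv (IT al be ga X v) a q =
    dITf al be ga (X q) (dspace X v q) (dspace X a q) (dspace (dspace X v) a q).
Proof.
  intros Hq.
  pose proof (is_deriveS_dir U X q a Hq (C2_C1 U X HX)) as H1.
  pose proof (is_deriveS_dir U (dspace X v) q a Hq (C1_partial U X v HX)) as H2.
  pose proof (fun c' x' => Tf_derive al be ga (fun t : R => X (plus q (scal t a)))
    (fun t : R => dspace X v (plus q (scal t a))) 0 c' x') as T.
  cbv beta in T. rewrite line_0 in T.
  destruct (T _ _ (Hw q Hq) H1 H2) as [T1 T2].
  split; apply dir_unique; [exact T1 | exact T2].
Qed.

Lemma curl_IT q : U q ->
  curl (IT al be ga X e1) (IT al be ga X e2) q =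
  - 2 * (dot (cross (X1 X q) (X2 X q)) (Kf al be ga (X q)) / snd (X q) ^ 3).
Proof.
  intros Hq. unfold curl, pdx, pdy.
  rewrite (proj2 (dir_RT_IT e2 e1 q Hq)), (proj2 (dir_RT_IT e1 e2 q Hq)).
  change (dspace (dspace X e1) e2 q) with (dspace (X1 X) e2 q).
  rewrite (mixed_partials U X q HU HX Hq). apply dITf_curl. auto.
Qed.

End FluxForm.

(** The differential of the Hodge dual of Re T is the inner product of the Killing field
    with the tension field, because the terms containing derivatives of the field
    cancel; for mean curvature one it is the opposite of the differential of Im T. *)
Lemma flux_form_closed al be ga U X : cmc1 U X ->
  closed_form U (fluxP al be ga X) (fluxQ al be ga X).
Proof.
  intros HC. destruct HC as (HU & HX & HC0).
  assert (HC : cmc1 U X) by exact (conj HU (conj HX HC0)).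
  assert (Hw : forall q, U q -> 0 < snd (X q)) by (intros q Hq; apply (HC0 q Hq)).
  destruct (CK_RT_IT al be ga U X HU HX Hw e1) as [R1 I1].
  destruct (CK_RT_IT al be ga U X HU HX Hw e2) as [R2 I2].
  assert (NR2 := CK_opp 1 U _ HU R2).
  split.
  { split; apply CK_plus; auto. }
  intros q Hq. unfold curl, pdx, pdy, fluxP, fluxQ.
  rewrite (dir_add U _ _ e1 q R1 I2 Hq), (dir_add U _ _ e2 q NR2 I1 Hq).
  assert (EN : dir_deriv (fun q => - RT al be ga X e2 q) e2 q = - dir_deriv (RT al be ga X e2) e2 q).
  { apply dir_unique. apply (is_derive_opp (fun t : R => RT al be ga X e2 (plus q (scal t e2)))).
    exact (dir_is_derive 0 U _ q e2 R2 Hq). }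
  rewrite EN.
  pose proof (curl_IT al be ga U X HU HX Hw q Hq) as CI. unfold curl, pdx, pdy in CI.
  rewrite (proj1 (dir_RT_IT al be ga U X HX Hw e1 e1 q Hq)).
  rewrite (proj1 (dir_RT_IT al be ga U X HX Hw e2 e2 q Hq)).
  rewrite !dRTf_killing by auto.
  destruct (cmc1_tension U X q HC Hq) as [_ T].
  assert (K : hyp_inner (X q) (plus (dspace (X1 X) e1 q) (christoffel (X q) (X1 X q) (X1 X q)))
      (Kf al be ga (X q)) +
     hyp_inner (X q) (plus (dspace (X2 X) e2 q) (christoffel (X q) (X2 X q) (X2 X q)))
      (Kf al be ga (X q)) = 2 * (dot (cross (X1 X q) (X2 X q)) (Kf al be ga (X q)) / snd (X q) ^ 3)).
  { unfold hyp_inner. rewrite <- Rdiv_plus_distr, <- dot_plus_l, T, dot_scal_l.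
    field. specialize (Hw q Hq). lra. }
  change (dspace X e1 q) with (X1 X q). change (dspace X e2 q) with (X2 X q).
  change (dspace (dspace X e1) e1 q) with (dspace (X1 X) e1 q).
  change (dspace (dspace X e2) e2 q) with (dspace (X2 X) e2 q).
  lra.
Qed.

(** * The flux as a line integral *)

Definition comb (a b : R) (x y : space) : space := plus (scal a x) (scal b y).

Lemma comb_eq a b x y : comb a b x y =
  vec (a * Re (fst x) + b * Re (fst y)) (a * Im (fst x) + b * Im (fst y))
      (a * snd x + b * snd y).
Proof. reflexivity. Qed.

Lemma dspace_plane (U : plane -> Prop) X v q : open U ->
  CKS 1 U X -> U q ->
  dspace X v q = comb (Re v) (Im v) (X1 X q) (X2 X q).
Proof.
  intros HU (A & B & D) Hq. rewrite comb_eq. apply space_eq.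
  - exact (dir_plane U _ q v HU A Hq).
  - exact (dir_plane U _ q v HU B Hq).
  - exact (dir_plane U _ q v HU D Hq).
Qed.

Lemma surf_curve (U : plane -> Prop) X (g : R -> C) t v : open U ->
  CKS 1 U X -> U (g t) -> is_deriveC g t v ->
  is_deriveS (fun s => X (g s)) t (comb (Re v) (Im v) (X1 X (g t)) (X2 X (g t))).
Proof.
  intros HU (A & B & D) Hg [G1 G2].
  assert (E : forall s, (Re (g s), Im (g s)) = g s) by (intros; symmetry; apply surjective_pairing).
  assert (G : forall f, CK 1 U f -> is_derive (fun s => f (g s)) t
    (Re v * pdx f (g t) + Im v * pdy f (g t))).
  { intros f Hf. apply (is_derive_ext (fun s => f (Re (g s), Im (g s)))).
    { intros s. apply f_equal, E. }
    pose proof (chain_plane U f (fun s => Re (g s)) (fun s => Im (g s)) t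
      (Re v) (Im v) HU Hf) as K.
    cbv beta in K. rewrite E in K. now apply K. }
  rewrite comb_eq. refine (conj _ (conj _ _)); [exact (G _ A) | exact (G _ B) | exact (G _ D)].
Qed.

Lemma dspace_R (G : R -> space) t v : is_deriveS G t v ->
  dspace (V := R_NormedModule) G 1 t = v.
Proof.
  intros (A & B & D).
  assert (K : forall f : R -> R, forall l, is_derive f t l -> dir_deriv (V := R_NormedModule) f 1 t = l).
  { intros f l H. rewrite dir_R. now apply is_derive_unique. }
  apply space_eq; [exact (K _ _ A) | exact (K _ _ B) | exact (K _ _ D)].
Qed.

Lemma is_deriveS_unique (G : R -> space) t v w : is_deriveS G t v -> is_deriveS G t w -> v = w.
Proof. intros A B. rewrite <- (dspace_R G t v A). now apply dspace_R. Qed.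

Lemma dplane_R (g : R -> C) t v : is_deriveC g t v -> dplane (V := R_NormedModule) g 1 t = v.
Proof.
  intros (A & B).
  assert (K : forall f : R -> R, forall l, is_derive f t l -> dir_deriv (V := R_NormedModule) f 1 t = l).
  { intros f l H. rewrite dir_R. now apply is_derive_unique. }
  apply injective_projections; [exact (K _ _ A) | exact (K _ _ B)].
Qed.

Lemma Ck_plane_R (g : R_NormedModule -> plane) : Ck_plane 2 allR g ->
  (forall t, is_deriveC g t (dplane g (1 : R_NormedModule) t)) /\
  contC (fun t => dplane g (1 : R_NormedModule) t).
Proof.
  intros [A B].
  assert (A' := Ck_R_CK 2 _ _ A). assert (B' := Ck_R_CK 2 _ _ B).
  split.
  - intros t. split.
    + exact (CK_R_is_derive 1 allR _ t A' I).
    + exact (CK_R_is_derive 1 allR _ t B' I).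
  - split; intros t.
    + exact (CK_cont 1 allR _ t (CK_S 1 allR _ A' (1 : R_NormedModule)) I).
    + exact (CK_cont 1 allR _ t (CK_S 1 allR _ B' (1 : R_NormedModule)) I).
Qed.

Lemma RTf_comb al be ga p a b x y :
  RTf al be ga p (comb a b x y) = a * RTf al be ga p x + b * RTf al be ga p y.
Proof.
  unfold RTf. rewrite comb_eq. unfold vec. cbv zeta. simpl.
  generalize (qf al be ga (fst p)) (qf' al be (fst p)). intros. unfold Re, Im. simpl. ring.
Qed.
Lemma ITf_comb al be ga p a b x y :
  ITf al be ga p (comb a b x y) = a * ITf al be ga p x + b * ITf al be ga p y.
Proof.
  unfold ITf. rewrite comb_eq. unfold vec. cbv zeta. simpl.
  generalize (qf al be ga (fst p)) (qf' al be (fst p)). intros. unfold Re, Im. simpl. ring.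
Qed.

Lemma dot_comb a b c d x y : dot x x = dot y y -> dot x y = 0 ->
  dot (comb a b x y) (comb c d x y) = (a * c + b * d) * dot x x.
Proof.
  intros E O. unfold comb. rewrite !dot_plus_l, !dot_scal_l.
  rewrite !(dot_comm _ (plus _ _)), !dot_plus_l, !dot_scal_l, (dot_comm y x), O, <- E. ring.
Qed.

Lemma det3_comb a b c d x y z :
  det3 (comb a b x y) (comb c d x y) z = (a * d - b * c) * dot (cross x y) z.
Proof.
  unfold det3. rewrite !comb_eq. destruct x as [[x1 x2] x3], y as [[y1 y2] y3], z as [[z1 z2] z3].
  unfold cross, dot, vec; simpl. ring.
Qed.

(** The unit conormal times the speed of the loop is the velocity turned by a right
    angle. *)
Lemma conormal_algebra (w L p1 p2 q1 q2 s : R) : 0 < w -> 0 < L -> 0 <= s ->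
  p1 * q1 + p2 * q2 = 0 -> (q1 * q1 + q2 * q2) * L = w ^ 2 ->
  s ^ 2 = (p1 * p1 + p2 * p2) * L / w ^ 2 -> p1 * q2 - p2 * q1 < 0 ->
  q1 * s = p2 /\ q2 * s = - p1.
Proof.
  intros Hw HL Hs0 O N S D.
  set (P := p1 * p1 + p2 * p2) in *. set (d := p2 * q1 - p1 * q2).
  assert (Hd : 0 < d) by (unfold d; lra).
  assert (HP : 0 < P).
  { unfold P. destruct (Req_dec p1 0) as [E1|E1]; [destruct (Req_dec p2 0) as [E2|E2]|].
    - subst. lra.
    - pose proof (Rsqr_pos_lt p2 E2). unfold Rsqr in *. nra.
    - pose proof (Rsqr_pos_lt p1 E1). unfold Rsqr in *. nra. }
  assert (W : 0 < w ^ 2) by (apply pow_lt; auto).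
  assert (Q1 : q1 * P = d * p2).
  { unfold P, d. transitivity (p2 * (p2 * q1 - p1 * q2) + p1 * (p1 * q1 + p2 * q2)); [ring|].
    rewrite O. ring. }
  assert (Q2 : q2 * P = - d * p1).
  { unfold P, d. transitivity (- (p2 * q1 - p1 * q2) * p1 + p2 * (p1 * q1 + p2 * q2)); [ring|].
    rewrite O. ring. }
  assert (DD : d ^ 2 * L = P * w ^ 2).
  { rewrite <- N. unfold d, P.
    transitivity (((p1 * p1 + p2 * p2) * (q1 * q1 + q2 * q2) - (p1 * q1 + p2 * q2) ^ 2) * L); [ring|].
    rewrite O. ring. }
  assert (DS : (d * s) ^ 2 = P ^ 2).
  { replace ((d * s) ^ 2) with (d ^ 2 * s ^ 2) by ring. rewrite S.
    transitivity (d ^ 2 * L * P / w ^ 2); [field; lra|]. rewrite DD. field. lra. }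
  assert (E : d * s = P).
  { assert (0 <= d * s) by (apply Rmult_le_pos; lra).
    assert ((d * s - P) * (d * s + P) = 0) by (ring_simplify; ring_simplify in DS; lra).
    apply Rmult_integral in H0. destruct H0; lra. }
  split.
  - apply (Rmult_eq_reg_r P); [|lra]. transitivity (q1 * P * s); [ring|]. rewrite Q1, <- E. ring.
  - apply (Rmult_eq_reg_r P); [|lra]. transitivity (q2 * P * s); [ring|]. rewrite Q2, <- E. ring.
Qed.

Lemma neg_of_mult (d k : R) : 0 < k -> 0 < d * - k -> d < 0.
Proof. intros. nra. Qed.

Lemma sq3_zero (a b c : R) : a * a + b * b + c * c = 0 -> a = 0 /\ b = 0 /\ c = 0.
Proof.
  intros H. pose proof (Rle_0_sqr a). pose proof (Rle_0_sqr b). pose proof (Rle_0_sqr c).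
  unfold Rsqr in *. repeat split; apply Rsqr_0_uniq; unfold Rsqr; lra.
Qed.

Lemma unit_normal_area X q Y : 0 < snd (X q) ->
  hyp_inner (X q) (unit_normal X q) Y * area_density X q =
  dot (cross (X1 X q) (X2 X q)) Y / snd (X q) ^ 3.
Proof.
  intros Hw. set (w := snd (X q)) in *. set (c := cross (X1 X q) (X2 X q)).
  change (dot (scal (w / sqrt (dot c c)) c) Y / w ^ 2 *
    sqrt (dot (X1 X q) (X1 X q) / w ^ 2 * (dot (X2 X q) (X2 X q) / w ^ 2) -
    (dot (X1 X q) (X2 X q) / w ^ 2) ^ 2) = dot c Y / w ^ 3).
  assert (W : 0 < w ^ 2) by (apply pow_lt; auto).
  replace (dot (X1 X q) (X1 X q) / w ^ 2 * (dot (X2 X q) (X2 X q) / w ^ 2) -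
    (dot (X1 X q) (X2 X q) / w ^ 2) ^ 2) with (dot c c / (w ^ 2) ^ 2)
    by (unfold c; rewrite cross_sq; field; lra).
  assert (C : 0 <= dot c c).
  { unfold dot. nra. }
  rewrite sqrt_div_alt by (apply pow_lt; auto). rewrite sqrt_pow2 by lra.
  rewrite dot_scal_l. destruct C as [C|C].
  - assert (0 < sqrt (dot c c)) by now apply sqrt_lt_R0. field. lra.
  - rewrite <- C, sqrt_0.
    assert (E : dot c Y = 0).
    { destruct c as [[c1 c2] c3], Y as [[y1 y2] y3]. unfold dot in *; simpl in *.
      unfold Re, Im in *. simpl in *.
      destruct (sq3_zero c1 c2 c3 (eq_sym C)) as (-> & -> & ->). ring. }
    rewrite E. unfold Rdiv. ring.
Qed.

Lemma open_pos (U : plane -> Prop) (f : plane -> R) : open U ->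
  (forall q, U q -> continuous f q) -> open (fun q => U q /\ 0 < f q).
Proof.
  intros HU Hf q [A B]. apply filter_and; [apply HU, A|].
  apply (Hf q A). apply (open_gt 0 _ B).
Qed.

(** Stokes on the disc in polar coordinates: the inner circle is a point and contributes
    nothing. *)
Lemma disc_flux al be ga (Y : space -> space) (G : R -> space) kappa :
  (forall p, H3 p -> Y p = Kf al be ga p) ->
  spanning_disc G kappa -> (forall t, exists v, is_deriveS G t v) ->
  - 2 * RInt (fun rho => RInt (fun theta =>
     let q : plane := (rho, theta) in
     hyp_inner (kappa q) (unit_normal kappa q) (Y (kappa q)) * area_density kappa q)
     0 (2 * PI)) 0 1 =
  RInt (fun t => ITf al be ga (G t) (velocity G t)) 0 (2 * PI).
Proof.
  intros HY ((U0 & HU0 & HS0 & HK0) & Hw & Hper & H0 & H1) HG.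
  pose proof (C2_surf_of U0 kappa HU0 HK0) as HC0.
  pose (U := fun q => U0 q /\ 0 < snd (kappa q)).
  assert (HU : open U).
  { apply open_pos; auto. intros q Hq. exact (CK_cont 2 U0 _ q (proj2 (proj2 HC0)) Hq). }
  assert (HC : C2_surf U kappa).
  { destruct HC0 as (A & B & D).
    refine (conj _ (conj _ _)); apply (CK_sub 2 U0); auto; intros q [? ?]; auto. }
  assert (HS : forall q, strip q -> U q) by (intros q Hq; split; [auto | now apply Hw]).
  assert (HwU : forall q, U q -> 0 < snd (kappa q)) by (intros q [? ?]; auto).
  destruct (CK_RT_IT al be ga U kappa HU HC HwU e1) as [_ I1].
  destruct (CK_RT_IT al be ga U kappa HU HC HwU e2) as [_ I2].
  assert (C1 := C2_C1 U kappa HC).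
  assert (HSx : forall x t, 0 <= x <= 1 -> U (x, t)) by (intros x t Hx; apply HS; exact Hx).
  assert (Hp : forall x, 0 < x < 1 ->
    IT al be ga kappa e1 (x, 2 * PI) = IT al be ga kappa e1 (x, 0)).
  { intros x Hx.
    assert (PK : forall y, 0 < y < 1 -> kappa (y, 2 * PI) = kappa (y, 0)).
    { intros y Hy. rewrite <- (Hper y 0) by lra. do 2 f_equal. ring. }
    assert (PD : forall f : plane -> R, CK 1 U f ->
      (forall y, 0 < y < 1 -> f (y, 2 * PI) = f (y, 0)) -> pdx f (x, 2 * PI) = pdx f (x, 0)).
    { intros f Hf E. apply pdx_val.
      apply (is_derive_ext_loc (fun y : R => f (y, 0))).
      - assert (L : locally x (fun y : R => 0 < y < 1)).
        { apply filter_and; [apply (open_gt 0) | apply (open_lt 1)]; lra. }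
        generalize L. apply filter_imp. intros y Hy. symmetry. now apply E.
      - apply plane_x. apply (CK_ex 0 U f); auto. apply HSx. lra. }
    unfold IT. rewrite PK by auto. f_equal. destruct C1 as (A & B & D).
    apply space_eq.
    - apply (PD _ A). intros y Hy. now rewrite PK.
    - apply (PD _ B). intros y Hy. now rewrite PK.
    - apply (PD _ D). intros y Hy. now rewrite PK. }
  assert (DK : forall x (c : R -> space) t v, (forall s, kappa (x, s) = c s) -> is_deriveS c t v ->
    dspace kappa e2 (x, t) = v).
  { intros x c t v E (A & B & D). apply space_eq.
    - apply (pdy_val (fun q => Re (fst (kappa q)))).
      apply (is_derive_ext (fun s => Re (fst (c s)))); auto. intros s; now rewrite E.
    - apply (pdy_val (fun q => Im (fst (kappa q)))).
      apply (is_derive_ext (fun s => Im (fst (c s)))); auto. intros s; now rewrite E.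
    - apply (pdy_val (fun q => snd (kappa q))).
      apply (is_derive_ext (fun s => snd (c s))); auto. intros s; now rewrite E. }
  pose proof (stokes_strip U _ _ HU HS I1 I2 Hp) as ST.
  rewrite (RInt_ext (fun t => ITf al be ga (G t) (velocity G t))
    (fun t => IT al be ga kappa e2 (1, t))).
  2:{ intros t _. unfold IT. destruct (HG t) as [v Hv].
      rewrite (DK 1 G t v H1 Hv), H1. unfold velocity. now rewrite (dspace_R G t v Hv). }
  assert (Z : RInt (fun t => IT al be ga kappa e2 (0, t)) 0 (2 * PI) = 0).
  { rewrite (RInt_ext _ (fun _ => 0)).
    - rewrite RInt_const. unfold scal; simpl. unfold mult; simpl. ring.
    - intros t _. unfold IT.
      rewrite (DK 0 (fun _ => kappa (0, t)) t (vec 0 0 0)).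
      + unfold ITf, vec. simpl. cbv zeta.
        generalize (qf al be ga (fst (kappa (0, t)))) (qf' al be (fst (kappa (0, t)))).
        intros. unfold Re, Im. simpl. ring.
      + intros s. apply H0.
      + refine (conj _ (conj _ _)); apply (is_derive_const (V := R_NormedModule)). }
  assert (P0 : 0 <= 2 * PI) by (pose proof PI_RGT_0; lra).
  set (g := curl (IT al be ga kappa e1) (IT al be ga kappa e2)) in *.
  assert (Cg : forall q, U q -> continuous g q).
  { intros q Hq.
    apply (continuous_minus (pdx (IT al be ga kappa e2)) (pdy (IT al be ga kappa e1))).
    - exact (CK_cont 0 U _ _ (CK_S 0 U _ I2 e1) Hq).
    - exact (CK_cont 0 U _ _ (CK_S 0 U _ I1 e2) Hq). }
  assert (Eg : forall x, 0 <= x <= 1 -> ex_RInt (fun t => g (x, t)) 0 (2 * PI)).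
  { intros x Hx. apply ex_RInt_y; auto. }
  assert (EG : ex_RInt (fun x => RInt (fun t => g (x, t)) 0 (2 * PI)) 0 1).
  { apply (ex_RInt_continuous (V := R_CompleteNormedModule)).
    rewrite Rmin_left, Rmax_right by lra. intros x Hx.
    apply (RInt_param_continuous g x 0 (2 * PI) U); auto. }
  assert (ST' : RInt (fun x => RInt (fun t => g (x, t)) 0 (2 * PI)) 0 1 =
    RInt (fun t => IT al be ga kappa e2 (1, t)) 0 (2 * PI)).
  { etransitivity; [exact ST|]. rewrite Z. exact (Rminus_0_r _). }
  rewrite <- ST'.
  rewrite (RInt_ext _ (fun x => scal (- / 2) (RInt (fun t => g (x, t)) 0 (2 * PI)))).
  - rewrite (RInt_scal (V := R_CompleteNormedModule)) by auto.
    match goal with |- _ = ?r => change (- 2 * (- / 2 * r) = r) end. field.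
  - rewrite Rmin_left, Rmax_right by lra. intros x Hx.
    rewrite <- (RInt_scal (V := R_CompleteNormedModule)) by (apply Eg; lra).
    apply RInt_ext. intros t _. cbv zeta.
    assert (Hq : U (x, t)) by (apply HSx; lra).
    rewrite HY by (apply HwU, Hq). rewrite unit_normal_area by (apply HwU, Hq).
    unfold g. rewrite (curl_IT al be ga U kappa HU HC HwU (x, t) Hq).
    match goal with |- ?a = _ => change (a = - / 2 * (-2 * a)) end. field.
    apply Rgt_not_eq, HwU, Hq.
Qed.

Lemma cmc1_end E : bryant_end E -> cmc1 (dom_star E) (param E).
Proof.
  intros (HO & H0 & HK & H).
  assert (HU : open (dom_star E)).
  { intros z [A B]. apply filter_and; [apply HO, A | exact (open_Cstar z B)]. }
  refine (conj HU (conj _ _)).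
  - apply C2_surf_of; auto.
  - intros z Hz. exact (H z Hz).
Qed.

Lemma contC_form (U : plane -> Prop) P Q (g v : R -> C) : C1_form U P Q ->
  (forall t, U (g t)) -> (forall t, is_deriveC g t (v t)) -> contC v ->
  forall t : R, continuous (fun t => form P Q (g t) (v t)) t.
Proof.
  intros [HP1 HQ1] Hg Dg [C1 C2] t.
  assert (Cl : continuous g t).
  { destruct (is_deriveC_cont g t _ (Dg t)) as [D1 D2].
    apply (continuous_ext (fun t => (Re (g t), Im (g t)))).
    { intros s. symmetry. apply surjective_pairing. }
    apply (continuous_comp_2 (fun t => Re (g t)) (fun t => Im (g t)) (fun a b => (a, b))); auto.
    apply (continuous_ext (fun z : R * R => z)).
    + intros [? ?]; reflexivity.
    + apply continuous_id. }
  apply (continuous_plus (fun t => P (g t) * Re (v t)) (fun t => Q (g t) * Im (v t))).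
  * apply (continuous_mult (fun t => P (g t)) (fun t => Re (v t))); auto.
    apply (continuous_comp g P); auto. exact (CK_cont 1 _ P _ HP1 (Hg t)).
  * apply (continuous_mult (fun t => Q (g t)) (fun t => Im (v t))); auto.
    apply (continuous_comp g Q); auto. exact (CK_cont 1 _ Q _ HQ1 (Hg t)).
Qed.

(** The conormal is the velocity turned by a right angle, which gives the Hodge dual of
    Re T; the spanning disc gives Im T. The mean curvature vector is the positive
    normal, so that the orientation condition leaves only n = -1. *)
Lemma flux_line_integral al be ga (Y : space -> space) E n gamma eta kappa :
  bryant_end E -> (forall p, H3 p -> Y p = Kf al be ga p) ->
  generator E n gamma -> conormal E n gamma eta -> spanning_disc (loop_in E gamma) kappa ->
  n = (-1)%Z /\
  flux_integral (loop_in E gamma) eta kappa Y =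
  RInt (fun t => form (fluxP al be ga (param E)) (fluxQ al be ga (param E)) (gamma t)
     (dplane (V := R_NormedModule) gamma 1 t)) 0 (2 * PI).
Proof.
  intros HE HY HG HN HD. pose proof (cmc1_end E HE) as HC.
  destruct HG as (Hn & Hg & (r & h & W & Hr & Hdisc & HW & HSW & Hh & Hhs & Hper & Hh0 & Hh1)).
  set (X := param E) in *. set (U := dom_star E) in *.
  destruct (Ck_plane_R gamma Hg) as [Dg Cg].
  set (g' := fun t => dplane (V := R_NormedModule) gamma 1 t) in *.
  assert (HgU : forall t, U (gamma t)).
  { intros t. rewrite <- Hh0. apply Hhs. unfold strip; simpl; lra. }
  pose proof HC as (HU & HX & HC0). pose proof (C2_C1 U X HX) as HX1.
  assert (Hw : forall q, U q -> 0 < snd (X q)) by (intros q Hq; apply (HC0 q Hq)).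
  assert (Dv : forall t, is_deriveS (loop_in E gamma) t
     (comb (Re (g' t)) (Im (g' t)) (X1 X (gamma t)) (X2 X (gamma t)))).
  { intros t. apply (surf_curve U X gamma t (g' t)); auto. }
  assert (Ve : forall t, velocity (loop_in E gamma) t =
     comb (Re (g' t)) (Im (g' t)) (X1 X (gamma t)) (X2 X (gamma t))).
  { intros t. apply dspace_R, Dv. }
  assert (KEY : forall t, n = (-1)%Z /\
    hyp_inner (loop_in E gamma t) (eta t) (Y (loop_in E gamma t)) *
    hyp_norm (loop_in E gamma t) (velocity (loop_in E gamma) t) =
    - RT al be ga X e2 (gamma t) * Re (g' t) + RT al be ga X e1 (gamma t) * Im (g' t)).
  { intros t. destruct (HN t) as ((v & Ev & Hv) & N1 & N2 & N3).
    change (loop_in E gamma t) with (X (gamma t)) in *.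
    change (dplane (V := R_NormedModule) gamma 1 t) with (g' t) in Hv.
    rewrite Ve in N2, N3 |- *. rewrite Ev in *.
    change (dspace (param E) v (gamma t)) with (dspace X v (gamma t)) in *.
    rewrite (dspace_plane U X v _ HU HX1 (HgU t)) in N1, N2, N3 |- *.
    specialize (Hw _ (HgU t)). specialize (HgU t). destruct (HC0 _ HgU) as (_ & Hcf & _ & HO).
    destruct (conformal_dot X _ Hw Hcf) as (L0 & L1 & L2).
    destruct (cmc1_tension U X _ HC HgU) as [M1 _].
    set (z := gamma t) in *. set (w := snd (X z)) in *.
    set (x := X1 X z) in *. set (y := X2 X z) in *. set (p := g' t) in *.
    assert (W2 : 0 < w ^ 2) by (apply pow_lt; auto).
    assert (Hv' : 0 < IZR n * (Re p * Im v - Im p * Re v)).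
    { replace (Re p * Im v - Im p * Re v) with (Im (Cmult (Cconj p) v)); auto.
      unfold Cconj, Cmult, Re, Im; simpl. ring. }
    assert (O : Re p * Re v + Im p * Im v = 0).
    { unfold hyp_inner in N2. rewrite dot_comb in N2 by auto. fold w in N2.
      apply (Rmult_eq_reg_r (dot x x / w ^ 2)).
      - rewrite Rmult_0_l, <- N2. field. lra.
      - apply Rgt_not_eq, Rdiv_lt_0_compat; lra. }
    assert (S : (Re v * Re v + Im v * Im v) * dot x x = w ^ 2).
    { unfold hyp_norm, hyp_inner in N1. rewrite dot_comb in N1 by auto. fold w in N1.
      assert (Q : 0 <= (Re v * Re v + Im v * Im v) * dot x x / w ^ 2).
      { apply Rmult_le_pos; [|left; now apply Rinv_0_lt_compat]. apply Rmult_le_pos; nra. }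
      assert (Q2 : (Re v * Re v + Im v * Im v) * dot x x / w ^ 2 = 1).
      { rewrite <- (pow2_sqrt _ Q), N1. ring. }
      apply (Rmult_eq_reg_r (/ w ^ 2)); [|apply Rinv_neq_0_compat; lra].
      rewrite Rinv_r by lra. exact Q2. }
    assert (D : Re p * Im v - Im p * Re v < 0).
    { rewrite det3_comb in N3.
      assert (K : 0 < dot (cross x y) (mean_curvature_vector X z)) by exact HO.
      assert (K2 : dot (cross x y) (opp (mean_curvature_vector X z)) =
        - dot (cross x y) (mean_curvature_vector X z)).
      { destruct (mean_curvature_vector X z) as [[c1 c2] c3]. destruct (cross x y) as [[d1 d2] d3].
        change (d1 * - c1 + d2 * - c2 + d3 * - c3 = - (d1 * c1 + d2 * c2 + d3 * c3)). ring. }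
      change (mean_curvature_vector (param E) z) with (mean_curvature_vector X z) in N3.
      rewrite K2 in N3.
      exact (neg_of_mult _ _ K N3). }
    split.
    { destruct Hn as [Hn|Hn]; auto. rewrite Hn in Hv'. lra. }
    set (s := hyp_norm (X z) (comb (Re p) (Im p) x y)).
    assert (Hs0 : 0 <= s) by apply sqrt_pos.
    assert (Hs : s ^ 2 = (Re p * Re p + Im p * Im p) * dot x x / w ^ 2).
    { unfold s, hyp_norm, hyp_inner. rewrite dot_comb by auto. fold w.
      apply pow2_sqrt. apply Rmult_le_pos; [|left; now apply Rinv_0_lt_compat].
      apply Rmult_le_pos; nra. }
    destruct (conormal_algebra w (dot x x) (Re p) (Im p) (Re v) (Im v) s) as [A1 A2]; auto.
    rewrite HY by exact Hw. rewrite <- RTf_inner by exact Hw. rewrite RTf_comb.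
    unfold RT. change (dspace X e1 z) with x. change (dspace X e2 z) with y.
    transitivity (Re v * s * RTf al be ga (X z) x + Im v * s * RTf al be ga (X z) y); [ring|].
    rewrite A1, A2. ring. }
  split. { apply (KEY 0). }
  unfold flux_integral.
  pose proof (disc_flux al be ga Y (loop_in E gamma) kappa HY HD) as DF.
  assert (HGs : forall t, exists v, is_deriveS (loop_in E gamma) t v).
  { intros t. eexists; apply Dv. }
  specialize (DF HGs).
  destruct (CK_RT_IT al be ga U X HU HX Hw e1) as [R1 I1].
  destruct (CK_RT_IT al be ga U X HU HX Hw e2) as [R2 I2].
  assert (CA : forall t : R, continuous (fun t => form (fun q => - RT al be ga X e2 q)
      (RT al be ga X e1) (gamma t) (g' t)) t).
  { apply (contC_form U); auto. split; auto. now apply CK_opp. }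
  assert (CB : forall t : R, continuous (fun t => form (IT al be ga X e1)
      (IT al be ga X e2) (gamma t) (g' t)) t).
  { apply (contC_form U); auto. split; auto. }
  assert (EX : forall f : R -> R, (forall t : R, continuous f t) -> ex_RInt f 0 (2 * PI)).
  { intros f Hf. apply (ex_RInt_continuous (V := R_CompleteNormedModule)). auto. }
  transitivity (RInt (fun t => form (fun q => - RT al be ga X e2 q)
      (RT al be ga X e1) (gamma t) (g' t)) 0 (2 * PI) +
     RInt (fun t => form (IT al be ga X e1)
      (IT al be ga X e2) (gamma t) (g' t)) 0 (2 * PI)).
  - unfold Rminus.
    rewrite (RInt_ext (fun t => hyp_inner (loop_in E gamma t) (eta t) (Y (loop_in E gamma t)) *
      hyp_norm (loop_in E gamma t) (velocity (loop_in E gamma) t))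
      (fun t => form (fun q => - RT al be ga X e2 q)
      (RT al be ga X e1) (gamma t) (g' t))) by (intros t _; apply (KEY t)).
    f_equal. rewrite Ropp_mult_distr_l. etransitivity; [exact DF|].
    apply RInt_ext. intros t _. rewrite Ve, ITf_comb. unfold form, IT.
    change (loop_in E gamma t) with (X (gamma t)).
    unfold X1, X2. apply f_equal2; apply Rmult_comm.
  - symmetry. etransitivity; [|apply (RInt_plus (V := R_CompleteNormedModule)); auto].
    apply RInt_ext. intros t _. unfold form, fluxP, fluxQ, plus; simpl. unfold g'. ring.
Qed.

(** * From the loop of the definition to small circles *)

Lemma circle_deriv r n t : is_deriveC (circle r n) t (Cmult (0, IZR n) (circle r n t)).
Proof.
  split; simpl; auto_derive; auto; ring.
Qed.

Lemma circle_cont r n : contC (fun t => Cmult (0, IZR n) (circle r n t)).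
Proof.
  split; intros t; simpl.
  - apply (ex_derive_continuous (fun t => 0 * (r * cos (IZR n * t)) - IZR n * (r * sin (IZR n * t)))).
    auto_derive; auto.
  - apply (ex_derive_continuous (fun t => 0 * (r * sin (IZR n * t)) + IZR n * (r * cos (IZR n * t)))).
    auto_derive; auto.
Qed.

Lemma circle_cexp r n t : 0 < r -> circle r n t = cexp (ln r, IZR n * t).
Proof. intros Hr. unfold circle, cexp; simpl. now rewrite exp_ln. Qed.

Lemma Cmod_circle r n t : 0 < r -> Cmod (circle r n t) = r.
Proof. intros Hr. rewrite circle_cexp, Cmod_cexp by auto. simpl. now apply exp_ln. Qed.

Lemma circle_neq0 r n t : 0 < r -> circle r n t <> RtoC 0.
Proof. intros Hr. rewrite circle_cexp by auto. apply cexp_neq0. Qed.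

Lemma circle_winds r n : 0 < r -> winds (circle r n) n.
Proof.
  intros Hr. exists (fun t => (ln r, IZR n * t)), (fun _ => (0, IZR n)). split.
  - refine (conj _ (conj _ _)).
    + intros t. split; simpl; auto_derive; auto; ring.
    + split; intros t; apply continuous_const.
    + intros t. now rewrite circle_cexp.
  - unfold vshift; simpl. f_equal. ring.
Qed.

Lemma C2_scaled_circle (a b : R) (n : Z) :
  C2_map (fun _ => True) (fun q : plane => circle (a + fst q * b) n (snd q)).
Proof.
  assert (HO := open_all).
  assert (A : CK 2 (fun _ : plane => True) (fun q : plane => a + fst q * b)).
  { ck. apply CK_fst. }
  assert (B : CK 2 (fun _ : plane => True) (fun q : plane => IZR n * snd q)).
  { ck. apply CK_snd. }
  split.
  - apply (CK_mult 2 _ (fun q : plane => a + fst q * b) (fun q : plane => cos (IZR n * snd q))); auto.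
    apply (CK_comp1 2 _ (fun q : plane => IZR n * snd q) allR cos); auto; apply CK_sin_cos.
  - apply (CK_mult 2 _ (fun q : plane => a + fst q * b) (fun q : plane => sin (IZR n * snd q))); auto.
    apply (CK_comp1 2 _ (fun q : plane => IZR n * snd q) allR sin); auto; apply CK_sin_cos.
Qed.

Lemma circle_per r n t : circle r n (t + 2 * PI) = circle r n t.
Proof.
  unfold circle. replace (IZR n * (t + 2 * PI)) with (IZR n * t + 2 * PI * IZR n) by ring.
  destruct (sin_cos_2PI n (IZR n * t)) as [-> ->]. reflexivity.
Qed.

Lemma pullQ_line (W : plane -> Prop) P Q (h : plane -> plane) x (L L' : R -> C) t :
  (forall s, h (x, s) = L s) -> is_deriveC L t (L' t) ->
  pullQ P Q h (x, t) = form P Q (L t) (L' t).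
Proof.
  intros E [A B]. unfold pullQ. rewrite E. f_equal.
  apply injective_projections.
  - apply (pdy_val (fun q => Re (h q))). apply (is_derive_ext (fun s => Re (L s))); auto.
    intros s; now rewrite E.
  - apply (pdy_val (fun q => Im (h q))). apply (is_derive_ext (fun s => Im (L s))); auto.
    intros s; now rewrite E.
Qed.

(** The circle of a generator may be large: a radial homotopy shrinks it. *)
Lemma loop_to_circle E n gamma P Q R0 : bryant_end E -> closed_form (dom_star E) P Q ->
  generator E n gamma -> 0 < R0 -> exists r, 0 < r < R0 /\
  RInt (fun t => form P Q (gamma t) (dplane (V := R_NormedModule) gamma 1 t)) 0 (2 * PI) =
  RInt (fun t => form P Q (circle r n t) (Cmult (0, IZR n) (circle r n t))) 0 (2 * PI).
Proof.
  intros HE HF HG HR0. destruct (cmc1_end E HE) as (HU & _).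
  destruct HG as (Hn & Hg & (r & h & W & Hr & Hdisc & HW & HSW & Hh & Hhs & Hper & Hh0 & Hh1)).
  destruct (Ck_plane_R gamma Hg) as [Dg Cg].
  exists (Rmin r (R0 / 2)). set (r' := Rmin r (R0 / 2)).
  assert (Hr' : 0 < r' <= r /\ r' < R0).
  { unfold r'. pose proof (Rmin_l r (R0 / 2)). pose proof (Rmin_r r (R0 / 2)).
    assert (0 < Rmin r (R0 / 2)) by (apply Rmin_glb_lt; lra). lra. }
  split; [lra|].
  assert (H2 : C2_map W h).
  { exact (conj (Ck_plane_CK 2 W _ HW (proj1 Hh)) (Ck_plane_CK 2 W _ HW (proj2 Hh))). }
  pose proof (homotopy_invariance (dom_star E) W P Q h HU HW HSW Hhs HF H2 Hper) as H1.
  transitivity (RInt (fun t => pullQ P Q h (0, t)) 0 (2 * PI)).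
  { apply RInt_ext. intros t _. symmetry.
    exact (pullQ_line W P Q h 0 gamma (fun t => dplane (V := R_NormedModule) gamma 1 t) t Hh0 (Dg t)). }
  rewrite <- H1.
  pose (h2 := fun q : plane => circle (r + fst q * (r' - r)) n (snd q)).
  transitivity (RInt (fun t => pullQ P Q h2 (0, t)) 0 (2 * PI)).
  { apply RInt_ext. intros t _.
    rewrite (pullQ_line W P Q h 1 (circle r n) (fun t => Cmult (0, IZR n) (circle r n t)) t);
      auto using circle_deriv.
    rewrite (pullQ_line W P Q h2 0 (circle r n) (fun t => Cmult (0, IZR n) (circle r n t)) t);
      auto using circle_deriv.
    intros s. unfold h2; simpl. f_equal. ring. }
  assert (H3 : forall q, strip q -> dom_star E (h2 q)).
  { intros [x t] Hx. unfold strip in Hx; simpl in Hx. unfold h2; simpl.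
    assert (0 < r + x * (r' - r) <= r) by nra.
    split; [apply Hdisc; rewrite Cmod_circle by lra; lra | apply circle_neq0; lra]. }
  rewrite <- (homotopy_invariance (dom_star E) (fun _ => True) P Q h2 HU open_all
    (fun _ _ => I) H3 HF (C2_scaled_circle r (r' - r) n)).
  2:{ intros x t _. unfold h2; simpl. apply circle_per. }
  apply RInt_ext. intros t _.
  apply (pullQ_line W P Q h2 1 (circle r' n) (fun t => Cmult (0, IZR n) (circle r' n t)) t);
      auto using circle_deriv.
  intros s. unfold h2; simpl. f_equal. ring.
Qed.

(** The sign comes from the clockwise orientation of the loop. *)
Lemma flux_period al be ga E (Y : space -> space) (c J : R) : bryant_end E ->
  (forall p, H3 p -> Y p = Kf al be ga p) ->
  (forall (L L' : R -> C) m, winds L m ->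
    (forall t, is_deriveC L t (L' t)) -> (forall t, Cmod (L t) < exp c) ->
    RInt (fun t => form (fluxP al be ga (param E)) (fluxQ al be ga (param E)) (L t) (L' t))
     0 (2 * PI) = IZR m * J) ->
  is_flux E Y (- J).
Proof.
  intros HE HY HJ n gamma eta kappa HG HN HD.
  destruct (flux_line_integral al be ga Y E n gamma eta kappa HE HY HG HN HD) as [Hn ->].
  destruct (loop_to_circle E n gamma _ _ (exp c) HE
    (flux_form_closed al be ga _ _ (cmc1_end E HE)) HG (exp_pos c)) as (r & Hr & ->).
  rewrite (HJ (circle r n) (fun t => Cmult (0, IZR n) (circle r n t)) n).
  - rewrite Hn. simpl. ring.
  - apply circle_winds; lra.
  - intros t. apply circle_deriv.
  - intros t. rewrite Cmod_circle; lra.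
Qed.

(** * Complex derivatives *)

(** Complex derivative in a form common to the two normed module structures of C over
    itself. *)
Definition Cd (f : C -> C) (z l : C) : Prop :=
  forall eps : posreal, exists d : posreal, forall y : C, Cmod (y - z) < d ->
    Cmod (f y - f z - (y - z) * l)%C <= eps * Cmod (y - z).

Lemma Cd_iff (f : C -> C) (z l : C) :
  is_derive (K := C_AbsRing) (V := AbsRing_NormedModule C_AbsRing) f z l <-> Cd f z l.
Proof.
  split.
  - intros [_ H] eps. destruct (H z (fun P HP => HP) eps) as [d Hd].
    exists d. exact Hd.
  - intros H. split.
    + apply is_linear_scal_l.
    + intros x Hx eps.
      assert (E : x = z) by (symmetry; apply (is_filter_lim_locally_unique (V := AbsRing_NormedModule C_AbsRing) z x Hx)).
      subst x. destruct (H eps) as [d Hd]. exists d. exact Hd.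
Qed.

Lemma Cd_of_derive (f : C -> C) (z l : C) :
  is_derive (K := C_AbsRing) (V := C_NormedModule) f z l -> Cd f z l.
Proof.
  intros [_ H] eps. destruct (H z (fun P HP => HP) eps) as [d Hd].
  exists d. exact Hd.
Qed.

Lemma Cd_derive (f : C -> C) (z : C) :
  ex_derive (K := C_AbsRing) (V := C_NormedModule) f z -> Cd f z (C_derive f z).
Proof. intros H. apply Cd_of_derive, C_derive_correct; auto. Qed.

Lemma Cd_const (c z : C) : Cd (fun _ => c) z (RtoC 0).
Proof.
  intros eps. exists (mkposreal 1 Rlt_0_1). intros y _.
  replace (c - c - (y - z) * RtoC 0)%C with (RtoC 0) by ring. rewrite Cmod_0.
  apply Rmult_le_pos; [left; apply eps | apply Cmod_ge_0].
Qed.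

Lemma Cd_plus f g z l m : Cd f z l -> Cd g z m -> Cd (fun x => f x + g x)%C z (l + m)%C.
Proof.
  intros Hf Hg. apply (proj1 (Cd_iff _ _ _)).
  apply (is_derive_plus (K := C_AbsRing) (V := AbsRing_NormedModule C_AbsRing) f g);
    apply (proj2 (Cd_iff _ _ _)); assumption.
Qed.

Lemma Cd_mult f g z l m : Cd f z l -> Cd g z m ->
  Cd (fun x => f x * g x)%C z (l * g z + f z * m)%C.
Proof.
  intros Hf Hg. apply (proj1 (Cd_iff _ _ _)).
  apply (is_derive_mult (K := C_AbsRing) f g);
    try (apply (proj2 (Cd_iff _ _ _)); assumption).
  intros n k. apply Cmult_comm.
Qed.

Lemma Cd_scal c f z l : Cd f z l -> Cd (fun x => c * f x)%C z (c * l)%C.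
Proof.
  intros H. replace (c * l)%C with (RtoC 0 * f z + c * l)%C by ring.
  apply Cd_mult; auto. apply Cd_const.
Qed.

Lemma Cd_cont f z l : Cd f z l ->
  forall eps : posreal, exists d : posreal, forall y, Cmod (y - z) < d -> Cmod (f y - f z) < eps.
Proof.
  intros H eps. destruct (H (mkposreal 1 Rlt_0_1)) as [d Hd]. simpl in Hd.
  assert (P : 0 < Rmin d (eps / (2 + Cmod l))).
  { apply Rmin_glb_lt; [apply d|]. apply Rdiv_lt_0_compat; [apply eps|].
    pose proof (Cmod_ge_0 l). lra. }
  exists (mkposreal _ P). simpl. intros y Hy.
  assert (H1 : Cmod (y - z) < d) by (eapply Rlt_le_trans; [exact Hy | apply Rmin_l]).
  assert (H2 : Cmod (y - z) < eps / (2 + Cmod l)) by (eapply Rlt_le_trans; [exact Hy | apply Rmin_r]).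
  specialize (Hd y H1).
  replace (f y - f z)%C with ((f y - f z - (y - z) * l) + (y - z) * l)%C by ring.
  eapply Rle_lt_trans; [apply Cmod_triangle|]. rewrite Cmod_mult.
  pose proof (Cmod_ge_0 l). pose proof (Cmod_ge_0 (y - z)).
  assert (E : pos eps = eps / (2 + Cmod l) * (2 + Cmod l)) by (field; lra).
  rewrite E. nra.
Qed.

Lemma Cd_differentiable (f : C -> C) z l : Cd f z l ->
  differentiable_pt_lim (fun a b => Re (f (a, b))) (Re z) (Im z) (Re l) (- Im l) /\
  differentiable_pt_lim (fun a b => Im (f (a, b))) (Re z) (Im z) (Im l) (Re l).
Proof.
  intros H.
  assert (K : forall eps : posreal, exists d : posreal, forall a b,
    Rabs (a - Re z) < d -> Rabs (b - Im z) < d ->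
    Cmod (f (a, b) - f z - ((a, b) - z) * l)%C <= eps * Rmax (Rabs (a - Re z)) (Rabs (b - Im z))).
  { intros eps.
    assert (S : 0 < sqrt 2) by (apply sqrt_lt_R0; lra).
    assert (P1 : 0 < eps / sqrt 2) by (apply Rdiv_lt_0_compat; [apply eps | auto]).
    destruct (H (mkposreal _ P1)) as [d Hd]. simpl in Hd.
    assert (P2 : 0 < d / sqrt 2) by (apply Rdiv_lt_0_compat; [apply d | auto]).
    exists (mkposreal _ P2). simpl. intros a b Ha Hb.
    assert (B : Cmod ((a, b) - z) <= sqrt 2 * Rmax (Rabs (a - Re z)) (Rabs (b - Im z))).
    { pose proof (Cmod_2Rmax ((a, b) - z)%C) as B. exact B. }
    assert (M : Rmax (Rabs (a - Re z)) (Rabs (b - Im z)) < d / sqrt 2) by (apply Rmax_lub_lt; auto).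
    eapply Rle_trans; [apply Hd|].
    - eapply Rle_lt_trans; [exact B|].
      replace (pos d) with (sqrt 2 * (d / sqrt 2)) by (field; lra).
      now apply Rmult_lt_compat_l.
    - replace (eps * Rmax (Rabs (a - Re z)) (Rabs (b - Im z))) with
       (eps / sqrt 2 * (sqrt 2 * Rmax (Rabs (a - Re z)) (Rabs (b - Im z)))) by (field; lra).
      apply Rmult_le_compat_l; [lra | auto]. }
  split; intros eps; destruct (K eps) as [d Hd]; exists d; intros a b Ha Hb;
    specialize (Hd a b Ha Hb); (eapply Rle_trans; [|exact Hd]);
    (eapply Rle_trans; [|apply Rmax_Cmod]); destruct z as [x y], l as [l1 l2].
  - eapply Rle_trans; [|apply Rmax_l]. apply Req_le. f_equal. simpl.
    destruct (f (a, b)), (f (x, y)); simpl. ring.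
  - eapply Rle_trans; [|apply Rmax_r]. apply Req_le. f_equal. simpl.
    destruct (f (a, b)), (f (x, y)); simpl. ring.
Qed.

Lemma Cd_curve (f : C -> C) (c : R -> C) t v l : Cd f (c t) l -> is_deriveC c t v ->
  is_deriveC (fun s => f (c s)) t (l * v)%C.
Proof.
  intros H [A B]. destruct (Cd_differentiable f (c t) l H) as [D1 D2].
  assert (E : forall s, (Re (c s), Im (c s)) = c s) by (intros; symmetry; apply surjective_pairing).
  split.
  - apply (is_derive_ext (fun s => Re (f (Re (c s), Im (c s))))).
    { intros s. now rewrite E. }
    apply is_derive_Reals.
    replace (Re (l * v)%C) with (Re l * Re v + - Im l * Im v) by (simpl; unfold Re, Im; ring).
    apply (derivable_pt_lim_comp_2d (fun a b => Re (f (a, b))) (fun s => Re (c s))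
      (fun s => Im (c s))); auto; now apply is_derive_Reals.
  - apply (is_derive_ext (fun s => Im (f (Re (c s), Im (c s))))).
    { intros s. now rewrite E. }
    apply is_derive_Reals.
    replace (Im (l * v)%C) with (Im l * Re v + Re l * Im v) by (simpl; unfold Re, Im; ring).
    apply (derivable_pt_lim_comp_2d (fun a b => Im (f (a, b))) (fun s => Re (c s))
      (fun s => Im (c s))); auto; now apply is_derive_Reals.
Qed.

Definition ray (s v : C) (t : R) : C := (s + RtoC t * v)%C.
(** Complex derivative along all lines through a point: this is all that the computation
    of the residues needs. *)
Definition Dc (f : C -> C) (s l : C) : Prop :=
  forall v, is_deriveC (fun t => f (ray s v t)) 0 (l * v)%C.

Lemma ray0 s v : ray s v 0 = s.
Proof. unfold ray. ring. Qed.

Lemma ray_deriv s v t : is_deriveC (ray s v) t v.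
Proof.
  destruct s as [a b], v as [c d]. split; simpl; auto_derive; auto; ring.
Qed.

Lemma Dc_const c s : Dc (fun _ => c) s (RtoC 0).
Proof.
  intros v. replace (RtoC 0 * v)%C with (RtoC 0) by ring.
  split; apply (is_derive_const (V := R_NormedModule)).
Qed.

Lemma Dc_mult f g s l m : Dc f s l -> Dc g s m ->
  Dc (fun x => f x * g x)%C s (l * g s + f s * m)%C.
Proof.
  intros Hf Hg v. pose proof (is_deriveC_mult _ _ 0 _ _ (Hf v) (Hg v)) as H.
  cbv beta in H. rewrite ray0 in H.
  replace ((l * g s + f s * m) * v)%C with (l * v * g s + f s * (m * v))%C by ring. exact H.
Qed.

Lemma is_deriveC_plus (f g : R -> C) t a b : is_deriveC f t a -> is_deriveC g t b ->
  is_deriveC (fun s => f s + g s)%C t (a + b)%C.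
Proof.
  intros [A B] [A' B']. split.
  - apply (is_derive_plus (fun s => Re (f s)) (fun s => Re (g s))); auto.
  - apply (is_derive_plus (fun s => Im (f s)) (fun s => Im (g s))); auto.
Qed.

Lemma Dc_plus f g s l m : Dc f s l -> Dc g s m -> Dc (fun x => f x + g x)%C s (l + m)%C.
Proof.
  intros Hf Hg v. replace ((l + m) * v)%C with (l * v + m * v)%C by ring.
  now apply is_deriveC_plus.
Qed.

Lemma Dc_scal c f s l : Dc f s l -> Dc (fun x => c * f x)%C s (c * l)%C.
Proof.
  intros H. replace (c * l)%C with (RtoC 0 * f s + c * l)%C by ring.
  apply Dc_mult; auto. apply Dc_const.
Qed.

Lemma Dc_ext f g s l : (forall x, f x = g x) -> Dc f s l -> Dc g s l.
Proof. intros E H v. apply (is_deriveC_ext (fun t => f (ray s v t))); auto. Qed.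

Lemma Dc_cexp s : Dc cexp s (cexp s).
Proof.
  intros v. pose proof (is_deriveC_cexp (ray s v) 0 v (ray_deriv s v 0)) as H.
  rewrite ray0 in H. exact H.
Qed.

Lemma Dc_zpow a s : Dc (zpow a) s (RtoC a * zpow a s)%C.
Proof.
  intros v.
  assert (L : is_deriveC (fun t => RtoC a * ray s v t)%C 0 (RtoC a * v)%C).
  { replace (RtoC a * v)%C with (RtoC 0 * ray s v 0 + RtoC a * v)%C by ring.
    apply (is_deriveC_mult (fun _ => RtoC a) (ray s v)).
    - split; apply (is_derive_const (V := R_NormedModule)).
    - apply ray_deriv. }
  pose proof (is_deriveC_cexp _ 0 _ L) as H. cbv beta in H. rewrite ray0 in H.
  replace (RtoC a * zpow a s * v)%C with (cexp (RtoC a * s) * (RtoC a * v))%C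
    by (unfold zpow; ring). exact H.
Qed.

Lemma Dc_comp f (g : C -> C) s l m : Cd f (g s) l -> Dc g s m ->
  Dc (fun x => f (g x)) s (l * m)%C.
Proof.
  intros Hf Hg v. replace (l * m * v)%C with (l * (m * v))%C by ring.
  apply (Cd_curve f (fun t => g (ray s v t))); auto. now rewrite ray0.
Qed.

Lemma Dc_Cd f s l : Cd f s l -> Dc f s l.
Proof.
  intros H v. apply (Cd_curve f (ray s v)); [now rewrite ray0 | apply ray_deriv].
Qed.

Lemma Dc_unique f s l m : Dc f s l -> Dc f s m -> l = m.
Proof.
  intros Hl Hm. pose proof (is_deriveC_unique _ _ _ _ (Hl (RtoC 1)) (Hm (RtoC 1))) as E.
  now rewrite !Cmult_1_r in E.
Qed.

Lemma Dc_partial f s l : Dc f s l ->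
  pdx (fun q => Re (f q)) s = Re l /\ pdx (fun q => Im (f q)) s = Im l /\
  pdy (fun q => Re (f q)) s = - Im l /\ pdy (fun q => Im (f q)) s = Re l.
Proof.
  intros H.
  assert (K : forall v : C, dir_deriv (V := plane) (fun q : plane => Re (f q)) v s = Re (l * v)%C /\
    dir_deriv (V := plane) (fun q : plane => Im (f q)) v s = Im (l * v)%C).
  { intros v. destruct (H v) as [A B].
    assert (E : forall t, ray s v t = plus (s : plane) (scal t (v : plane))).
    { intros t. destruct s as [a b], v as [c d]. unfold ray.
      change (Cplus (a, b) (Cmult (RtoC t) (c, d)) = (a + t * c, b + t * d)).
      apply injective_projections; simpl; ring. }
    split; apply dir_unique.
    - apply (is_derive_ext (fun t => Re (f (ray s v t)))); auto. intros t; now rewrite E.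
    - apply (is_derive_ext (fun t => Im (f (ray s v t)))); auto. intros t; now rewrite E. }
  destruct (K e1) as [A B]. destruct (K e2) as [A' B'].
  unfold pdx, pdy. rewrite A, B, A', B'. destruct l as [l1 l2]. simpl.
  repeat split; ring.
Qed.

(** * Powers *)

Lemma zpow_add a b s : (zpow a s * zpow b s)%C = zpow (a + b) s.
Proof. unfold zpow. rewrite <- cexp_add, RtoC_plus. f_equal. ring. Qed.

Lemma zpow_1 s : zpow 1 s = cexp s.
Proof. unfold zpow. f_equal. ring. Qed.

Lemma zpow_0 s : zpow 0 s = RtoC 1.
Proof.
  unfold zpow. replace (RtoC 0 * s)%C with (RtoC 0) by ring.
  unfold cexp; simpl. rewrite exp_0, cos_0, sin_0. apply injective_projections; simpl; ring.
Qed.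

Lemma zpow_neq0 a s : zpow a s <> RtoC 0.
Proof. apply cexp_neq0. Qed.

(** * Limits at the left end of a half-plane *)

Definition tends (f : C -> C) (l : C) : Prop :=
  forall eps : posreal, exists x0 : R, forall s, Re s < x0 -> Cmod (f s - l) < eps.

Lemma tends_const c : tends (fun _ => c) c.
Proof.
  intros eps. exists 0. intros s _. replace (c - c)%C with (RtoC 0) by ring.
  rewrite Cmod_0. apply eps.
Qed.

Lemma tends_plus f g l m : tends f l -> tends g m -> tends (fun s => f s + g s)%C (l + m)%C.
Proof.
  intros Hf Hg eps. destruct (Hf (pos_div_2 eps)) as [x Hx]. destruct (Hg (pos_div_2 eps)) as [y Hy].
  exists (Rmin x y). intros s Hs.
  specialize (Hx s (Rlt_le_trans _ _ _ Hs (Rmin_l _ _))).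
  specialize (Hy s (Rlt_le_trans _ _ _ Hs (Rmin_r _ _))). simpl in *.
  replace (f s + g s - (l + m))%C with ((f s - l) + (g s - m))%C by ring.
  eapply Rle_lt_trans; [apply Cmod_triangle|]. lra.
Qed.

Lemma tends_mult f g l m : tends f l -> tends g m -> tends (fun s => f s * g s)%C (l * m)%C.
Proof.
  intros Hf Hg eps.
  set (M := 1 + Cmod l + Cmod m).
  assert (HM : 0 < M) by (unfold M; pose proof (Cmod_ge_0 l); pose proof (Cmod_ge_0 m); lra).
  assert (P : 0 < Rmin 1 (eps / (2 * M))).
  { apply Rmin_glb_lt; [lra|]. apply Rdiv_lt_0_compat; [apply eps | lra]. }
  destruct (Hf (mkposreal _ P)) as [x Hx]. destruct (Hg (mkposreal _ P)) as [y Hy].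
  exists (Rmin x y). intros s Hs.
  specialize (Hx s (Rlt_le_trans _ _ _ Hs (Rmin_l _ _))).
  specialize (Hy s (Rlt_le_trans _ _ _ Hs (Rmin_r _ _))). simpl in Hx, Hy.
  replace (f s * g s - l * m)%C with ((f s - l) * (g s - m) + ((f s - l) * m + l * (g s - m)))%C by ring.
  eapply Rle_lt_trans; [apply Cmod_triangle|].
  eapply Rle_lt_trans; [apply Rplus_le_compat_l, Cmod_triangle|].
  rewrite !Cmod_mult.
  set (u := Cmod (f s - l)) in *. set (v := Cmod (g s - m)) in *.
  pose proof (Rmin_l 1 (eps / (2 * M))). pose proof (Rmin_r 1 (eps / (2 * M))).
  set (k := Rmin 1 (eps / (2 * M))) in *.
  pose proof (Cmod_ge_0 l). pose proof (Cmod_ge_0 m).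
  assert (0 <= u) by apply Cmod_ge_0. assert (0 <= v) by apply Cmod_ge_0.
  assert (u * v + (u * Cmod m + Cmod l * v) <= k * M) by (unfold M; nra).
  assert (k * M <= eps / 2).
  { apply Rle_trans with (eps / (2 * M) * M); [apply Rmult_le_compat_r; lra|].
    apply Req_le. field. lra. }
  assert (0 < eps) by apply eps. lra.
Qed.

Lemma tends_ext f g l : (forall s, f s = g s) -> tends f l -> tends g l.
Proof. intros E H eps. destruct (H eps) as [x Hx]. exists x. intros s Hs. rewrite <- E. auto. Qed.

Lemma tends_ext_loc c f g l : (forall s, HP c s -> f s = g s) -> tends f l -> tends g l.
Proof.
  intros E H eps. destruct (H eps) as [x Hx]. exists (Rmin x c). intros s Hs.
  rewrite <- E. { apply Hx. eapply Rlt_le_trans; [exact Hs | apply Rmin_l]. }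
  unfold HP. eapply Rlt_le_trans; [exact Hs | apply Rmin_r].
Qed.

Lemma exp_small (d : posreal) : exists x0, forall s : C, Re s < x0 -> Cmod (cexp s) < d.
Proof.
  exists (ln d). intros s Hs. rewrite Cmod_cexp. rewrite <- (exp_ln d) by apply d.
  now apply exp_increasing.
Qed.

Lemma tends_cexp f l : Cd f (RtoC 0) l -> tends (fun s => f (cexp s)) (f (RtoC 0)).
Proof.
  intros H eps. destruct (Cd_cont f _ l H eps) as [d Hd]. destruct (exp_small d) as [x Hx].
  exists x. intros s Hs. apply Hd. replace (cexp s - RtoC 0)%C with (cexp s) by ring. auto.
Qed.

(** First order expansion at 0, with z = exp s. *)
Lemma tends_quotient f l : Cd f (RtoC 0) l ->
  tends (fun s => (f (cexp s) - f (RtoC 0)) / cexp s)%C l.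
Proof.
  intros H eps. destruct (H (pos_div_2 eps)) as [d Hd]. destruct (exp_small d) as [x Hx].
  exists x. intros s Hs. specialize (Hx s Hs).
  specialize (Hd (cexp s)). replace (cexp s - RtoC 0)%C with (cexp s) in Hd by ring.
  specialize (Hd Hx). simpl in Hd.
  assert (P : 0 < Cmod (cexp s)) by (rewrite Cmod_cexp; apply exp_pos).
  replace ((f (cexp s) - f (RtoC 0)) / cexp s - l)%C with
    ((f (cexp s) - f (RtoC 0) - cexp s * l) / cexp s)%C by (field; apply cexp_neq0).
  rewrite Cmod_div by apply cexp_neq0.
  apply Rle_lt_trans with (eps / 2).
  - apply (Rmult_le_reg_r (Cmod (cexp s))); auto. unfold Rdiv at 1.
    rewrite Rmult_assoc, Rinv_l, Rmult_1_r by lra. exact Hd.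
  - assert (0 < eps) by apply eps. lra.
Qed.

(** * Asymptotics of the Bryant representation *)

(** On [x/2, x] the mean value theorem gives a point xi where K(xi)/xi is close to al;
    it is also close to K0/xi + K1. *)
Lemma lhopital_R (phi K : R -> R) (delta phi0 al K0 K1 : R) : 0 < delta ->
  (forall x, 0 < x < delta -> is_derive phi x (K x / x)) ->
  (forall eps : posreal, exists d : posreal, forall x, 0 < x < d ->
     Rabs (K x - K0 - K1 * x) <= eps * x) ->
  (forall eps : posreal, exists d : posreal, forall x, 0 < x < d ->
     Rabs (phi x - phi0 - al * x) <= eps * x) ->
  K0 = 0 /\ K1 = al.
Proof.
  intros Hd D HK Hphi.
  assert (M : forall eps : posreal, exists d, 0 < d /\ forall x, 0 < x < d ->
     exists xi, 0 < xi <= x /\ Rabs (K0 + (K1 - al) * xi) <= eps * xi).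
  { intros eps. assert (P : 0 < eps / 5) by (pose proof (cond_pos eps); lra).
    destruct (HK (mkposreal _ P)) as [d1 H1]. destruct (Hphi (mkposreal _ P)) as [d2 H2].
    simpl in H1, H2.
    exists (Rmin delta (Rmin d1 d2)). split.
    { apply Rmin_glb_lt; [auto | apply Rmin_glb_lt; [apply d1 | apply d2]]. }
    intros x Hx.
    assert (B : x < delta /\ x < d1 /\ x < d2).
    { pose proof (Rmin_l delta (Rmin d1 d2)). pose proof (Rmin_r delta (Rmin d1 d2)).
      pose proof (Rmin_l d1 d2). pose proof (Rmin_r d1 d2). lra. }
    destruct (MVT_gen phi (x / 2) x (fun t => K t / t)) as (xi & Hxi & E).
    - rewrite Rmin_left, Rmax_right by lra. intros t Ht. apply D. lra.
    - rewrite Rmin_left, Rmax_right by lra. intros t Ht.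
      apply derivable_continuous_pt. exists (K t / t). apply is_derive_Reals, D. lra.
    - rewrite Rmin_left, Rmax_right in Hxi by lra.
      exists xi. split; [lra|].
      assert (A1 := H2 x ltac:(lra)). assert (A2 := H2 (x / 2) ltac:(lra)).
      assert (A3 := H1 xi ltac:(lra)).
      apply Rabs_le_between in A1. apply Rabs_le_between in A2. apply Rabs_le_between in A3.
      assert (E2 : K xi * x = 2 * (phi x - phi (x / 2)) * xi) by (rewrite E; field; lra).
      assert (B1 : - (3 * (eps / 5)) * x <= 2 * (phi x - phi (x / 2)) - al * x <= 3 * (eps / 5) * x) by lra.
      apply Rabs_le_between. set (e := eps / 5) in *.
      replace (pos eps) with (5 * e) by (unfold e; field).
      assert (Ex : (K0 + (K1 - al) * xi) * x =
        (2 * (phi x - phi (x / 2)) - al * x) * xi - (K xi - K0 - K1 * xi) * x).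
      { transitivity (K0 * x + K1 * xi * x - K xi * x + K xi * x - al * xi * x); [ring|].
        rewrite E2 at 2. ring. }
      split; apply (Rmult_le_reg_r x); try lra; rewrite Ex; nra. }
  assert (Z : K0 = 0).
  { apply NNPP. intros N.
    set (m := Rabs K0 / (2 * (1 + Rabs (K1 - al)))).
    assert (P0 : 0 < Rabs K0) by now apply Rabs_pos_lt.
    pose proof (Rabs_pos (K1 - al)) as P1.
    assert (Hm : 0 < m) by (apply Rdiv_lt_0_compat; lra).
    destruct (M (mkposreal 1 Rlt_0_1)) as (d & Hd0 & H).
    assert (Hx : 0 < Rmin (d / 2) m < d).
    { split; [apply Rmin_glb_lt; lra|]. pose proof (Rmin_l (d / 2) m). lra. }
    destruct (H _ Hx) as (xi & Hxi & B). simpl in B.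
    assert (xi <= m) by (pose proof (Rmin_r (d / 2) m); lra).
    assert (Rabs K0 <= (1 + Rabs (K1 - al)) * xi).
    { replace K0 with ((K0 + (K1 - al) * xi) - (K1 - al) * xi) by ring.
      eapply Rle_trans; [apply Rabs_triang|]. rewrite Rabs_Ropp, Rabs_mult, (Rabs_pos_eq xi) by lra.
      lra. }
    assert ((1 + Rabs (K1 - al)) * xi <= (1 + Rabs (K1 - al)) * m) by (apply Rmult_le_compat_l; lra).
    assert ((1 + Rabs (K1 - al)) * m = Rabs K0 / 2) by (unfold m; field; lra). lra. }
  split; auto. subst K0.
  apply NNPP. intros N. assert (P : 0 < Rabs (K1 - al)) by (apply Rabs_pos_lt; lra).
  assert (P2 : 0 < Rabs (K1 - al) / 2) by lra.
  destruct (M (mkposreal _ P2)) as (d & Hd0 & H).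
  destruct (H (d / 2) ltac:(lra)) as (xi & Hxi & B). simpl in B.
  rewrite Rplus_0_l, Rabs_mult, (Rabs_pos_eq xi) in B by lra. nra.
Qed.

Lemma Cd_real_axis f l : Cd f (RtoC 0) l -> forall eps : posreal, exists d : posreal,
  forall x, 0 < x < d ->
   Rabs (Re (f (RtoC x)) - Re (f (RtoC 0)) - Re l * x) <= eps * x /\
   Rabs (Im (f (RtoC x)) - Im (f (RtoC 0)) - Im l * x) <= eps * x.
Proof.
  intros H eps. destruct (H eps) as [d Hd]. exists d. intros x Hx.
  assert (E : Cmod (RtoC x - RtoC 0) = x).
  { rewrite <- RtoC_minus, Cmod_R, Rminus_0_r. apply Rabs_pos_eq. lra. }
  specialize (Hd (RtoC x)). rewrite E in Hd. specialize (Hd (proj2 Hx)).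
  split; (eapply Rle_trans; [|exact Hd]); (eapply Rle_trans; [|apply Rmax_Cmod]).
  - eapply Rle_trans; [|apply Rmax_l]. apply Req_le. f_equal. simpl.
    destruct (f (RtoC x)), (f (RtoC 0)), l; simpl. ring.
  - eapply Rle_trans; [|apply Rmax_r]. apply Req_le. f_equal. simpl.
    destruct (f (RtoC x)), (f (RtoC 0)), l; simpl. ring.
Qed.

(** If f' were known to be continuous at 0 this would be immediate; the
    differentiability of z f'(z) at 0 replaces continuity. *)
Lemma lhopital (f k : C -> C) (delta : R) (k1 : C) : 0 < delta ->
  holomorphic_on (Defs.disc delta) f -> Cd k (RtoC 0) k1 ->
  (forall x, 0 < x < delta -> k (RtoC x) = (RtoC x * C_derive f (RtoC x))%C) ->
  k (RtoC 0) = RtoC 0 /\ k1 = C_derive f (RtoC 0).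
Proof.
  intros Hd Hf Hk E.
  assert (H0 : Defs.disc delta (RtoC 0)) by (unfold Defs.disc; rewrite Cmod_0; auto).
  assert (F0 := Cd_derive f _ (Hf _ H0)).
  assert (D : forall x, 0 < x < delta ->
    is_deriveC (fun t => f (RtoC t)) x (C_derive f (RtoC x))).
  { intros x Hx. replace (C_derive f (RtoC x)) with (C_derive f (RtoC x) * RtoC 1)%C by ring.
    apply (Cd_curve f RtoC).
    - apply Cd_derive, Hf. unfold Defs.disc. rewrite Cmod_R, Rabs_pos_eq; lra.
    - split; simpl; auto_derive; auto. }
  assert (Q : forall x, 0 < x < delta -> Re (C_derive f (RtoC x)) = Re (k (RtoC x)) / x /\
     Im (C_derive f (RtoC x)) = Im (k (RtoC x)) / x).
  { intros x Hx. rewrite E by auto. destruct (C_derive f (RtoC x)); simpl. split; field; lra. }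
  destruct (lhopital_R (fun x => Re (f (RtoC x))) (fun x => Re (k (RtoC x))) delta
    (Re (f (RtoC 0))) (Re (C_derive f (RtoC 0))) (Re (k (RtoC 0))) (Re k1)) as [A1 A2]; auto.
  { intros x Hx. rewrite <- (proj1 (Q x Hx)). apply (D x Hx). }
  { intros eps. destruct (Cd_real_axis k k1 Hk eps) as [d H]. exists d. intros x Hx. apply (H x Hx). }
  { intros eps. destruct (Cd_real_axis f _ F0 eps) as [d H]. exists d. intros x Hx. apply (H x Hx). }
  destruct (lhopital_R (fun x => Im (f (RtoC x))) (fun x => Im (k (RtoC x))) delta
    (Im (f (RtoC 0))) (Im (C_derive f (RtoC 0))) (Im (k (RtoC 0))) (Im k1)) as [B1 B2]; auto.
  { intros x Hx. rewrite <- (proj2 (Q x Hx)). apply (D x Hx). }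
  { intros eps. destruct (Cd_real_axis k k1 Hk eps) as [d H]. exists d. intros x Hx. apply (H x Hx). }
  { intros eps. destruct (Cd_real_axis f _ F0 eps) as [d H]. exists d. intros x Hx. apply (H x Hx). }
  split; apply injective_projections; auto.
Qed.

Lemma Cmult_cancel (a x y : C) : (a * x = a * y)%C -> a <> RtoC 0 -> x = y.
Proof.
  intros E H. transitivity (/ a * (a * x))%C; [field; auto|]. rewrite E. field. auto.
Qed.

(** The data of a Bryant representation F = (A, B; C', D) on a half-plane, with
    derivative (a, b; c', d), that enter the flux: the entries of F' F^-1 have the
    limits that give the residues. *)
Definition frame_at (A B C' D a b c' d : C -> C) (s : C) : Prop :=
  (Dc A s (a s) /\ Dc B s (b s) /\ Dc C' s (c' s) /\ Dc D s (d s)) /\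
  (A s * D s - B s * C' s)%C = RtoC 1 /\
  (a s * d s - b s * c' s)%C = RtoC 0 /\
  (exists l, Dc a s l) /\ (exists l, Dc b s l) /\ (exists l, Dc c' s l) /\
  (exists l, Dc d s l).

Definition bryant_frame (kappa : R) (c : R) (A B C' D a b c' d : C -> C) : Prop :=
  (forall s, HP c s -> frame_at A B C' D a b c' d s) /\
  tends (fun s => a s * D s - b s * C' s)%C (RtoC kappa) /\
  tends (fun s => b s * A s - a s * B s)%C (RtoC 0) /\
  exists q0 : C, tends (fun s => c' s * D s - d s * C' s - q0 / cexp s)%C (RtoC 0).

(** Since F' = F N om with N = (g, -g^2; 1, -g), the entries of F' F^-1 are built from
    functions p, u, v holomorphic near 0: p v, - z p^2 h and u v / z. The value p(0)
    v(0) is the limit of the first one. For the last one, f1'(0) = 0 (the axis is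
    normalized) forces v'(0) = 0 and g1'(0) = 0 through the differential equations of C'
    and D, so that u v has no term of order one. *)
Lemma canonical_frame mu Ec : 0 < mu -> mu <> 1 -> canonical_catenoidal_end mu (RtoC 0) Ec ->
  exists delta A B C' D a b c' d, 0 < delta /\ (forall z, Defs.disc delta z -> dom Ec z) /\
   bryant_frame ((1 - mu ^ 2) / 4) (ln delta) A B C' D a b c' d /\
   forall s, HP (ln delta) s ->
     param Ec (cexp s) =
      (let n := Cmod (A s) ^ 2 + Cmod (B s) ^ 2 in
       ((Cconj (A s) * C' s + Cconj (B s) * D s) / RtoC n)%C, / (Cmod (A s) ^ 2 + Cmod (B s) ^ 2)).
Proof.
  intros Hmu Hmu1 (_ & _ & _ & delta & h & f1 & f2 & g1 & g2 & Hd & Hdom & Hh & Hh0 & Hf1 & F1 &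
    Hf2 & F2 & Hg1 & G1 & Hg2 & G2 & HZ & HB & HW).
  cbv zeta in HB, HW.
  set (kB := (mu - 1) / (mu + 1)) in *. set (kC := (mu ^ 2 - 1) / (4 * mu)) in *.
  set (kD := (1 + mu) ^ 2 / (4 * mu)) in *.
  set (A := fun s => (zpow ((1 - mu) / 2) s * f2 (cexp s))%C) in *.
  set (B := fun s => (RtoC kB * zpow ((1 + mu) / 2) s * g2 (cexp s))%C) in *.
  set (C' := fun s => (RtoC kC * zpow ((-1 - mu) / 2) s * f1 (cexp s))%C) in *.
  set (D := fun s => (RtoC kD * zpow ((mu - 1) / 2) s * g1 (cexp s))%C) in *.
  assert (HkC : kC <> 0).
  { unfold kC. intros Q. apply (f_equal (fun x => x * (4 * mu))) in Q.
    field_simplify in Q; try lra. assert ((mu - 1) * (mu + 1) = 0) by (ring_simplify; lra).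
    apply Rmult_integral in H. lra. }
  assert (HkD : kD <> 0).
  { unfold kD. apply Rgt_not_eq, Rdiv_lt_0_compat; [apply pow_lt; lra | lra]. }
  assert (F1' : C_derive f1 (RtoC 0) = RtoC 0).
  { assert (N : RtoC kC <> RtoC 0) by (intros Q; apply HkC; now apply RtoC_inj).
    destruct (Ceq_dec (C_derive f1 (RtoC 0)) (RtoC 0)) as [|N2]; auto.
    exfalso. apply (Cmult_neq_0 _ _ N N2). auto. }
  assert (HPs : forall s, HP (ln delta) s <-> half_plane delta s).
  { intros s. unfold HP, half_plane. change (fst s) with (Re s). split; intros Q.
    - rewrite <- (exp_ln delta) by auto. now apply exp_increasing.
    - apply exp_lt_inv. now rewrite exp_ln. }
  assert (Hds : forall s, HP (ln delta) s -> Defs.disc delta (cexp s)).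
  { intros s Q. unfold Defs.disc. rewrite Cmod_cexp. now apply HPs in Q. }
  exists delta, A, B, C', D, (C_derive A), (C_derive B), (C_derive C'), (C_derive D).
  split; auto. split; auto.
  destruct HB as (HA & HB & HC & HD & HBr).
  set (om := fun s => (zpow (-1 - mu) s * h (cexp s) * cexp s)%C) in *.
  set (g := zpow mu) in *.
  (* F' = F N om; the second column of N is -g times the first *)
  assert (DF : forall s, HP (ln delta) s ->
    C_derive A s = ((A s * g s + B s) * om s)%C /\
    C_derive B s = (- g s * C_derive A s)%C /\
    C_derive C' s = ((C' s * g s + D s) * om s)%C /\
    C_derive D s = (- g s * C_derive C' s)%C).
  { intros s Hs. apply HPs in Hs. destruct (HW s Hs) as (W1 & W2 & W3 & W4).
    destruct (HBr s Hs) as (W5 & _).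
    assert (EA : C_derive A s = ((A s * g s + B s) * om s)%C).
    { transitivity ((A s * D s - B s * C' s) * C_derive A s)%C; [rewrite W5; ring|].
      transitivity (A s * (D s * C_derive A s - B s * C_derive C' s) +
        B s * (A s * C_derive C' s - C' s * C_derive A s))%C; [ring|]. rewrite W1, W3. ring. }
    assert (EC : C_derive C' s = ((C' s * g s + D s) * om s)%C).
    { transitivity ((A s * D s - B s * C' s) * C_derive C' s)%C; [rewrite W5; ring|].
      transitivity (C' s * (D s * C_derive A s - B s * C_derive C' s) +
        D s * (A s * C_derive C' s - C' s * C_derive A s))%C; [ring|]. rewrite W1, W3. ring. }
    refine (conj EA (conj _ (conj EC _))).
    - transitivity ((A s * D s - B s * C' s) * C_derive B s)%C; [rewrite W5; ring|].
      transitivity (A s * (D s * C_derive B s - B s * C_derive D s) +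
        B s * (A s * C_derive D s - C' s * C_derive B s))%C; [ring|]. rewrite W2, W4, EA. ring.
    - transitivity ((A s * D s - B s * C' s) * C_derive D s)%C; [rewrite W5; ring|].
      transitivity (C' s * (D s * C_derive B s - B s * C_derive D s) +
        D s * (A s * C_derive D s - C' s * C_derive B s))%C; [ring|]. rewrite W2, W4, EC. ring. }
  assert (DcA : forall s, HP (ln delta) s -> Dc A s (C_derive A s)) by
    (intros s Hs; apply Dc_Cd, Cd_derive, HA, HPs, Hs).
  assert (DcB : forall s, HP (ln delta) s -> Dc B s (C_derive B s)) by
    (intros s Hs; apply Dc_Cd, Cd_derive, HB, HPs, Hs).
  assert (DcC : forall s, HP (ln delta) s -> Dc C' s (C_derive C' s)) by
    (intros s Hs; apply Dc_Cd, Cd_derive, HC, HPs, Hs).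
  assert (DcD : forall s, HP (ln delta) s -> Dc D s (C_derive D s)) by
    (intros s Hs; apply Dc_Cd, Cd_derive, HD, HPs, Hs).
  assert (De : forall f, holomorphic_on (Defs.disc delta) f -> forall s, HP (ln delta) s ->
    Dc (fun s => f (cexp s)) s (C_derive f (cexp s) * cexp s)%C).
  { intros f Hf s Hs. apply Dc_comp; [|apply Dc_cexp]. apply Cd_derive, Hf, Hds, Hs. }
  assert (Dom : forall s, HP (ln delta) s -> exists l, Dc om s l).
  { intros s Hs. eexists. apply Dc_mult; [apply Dc_mult; [apply Dc_zpow | now apply De]|].
    apply Dc_cexp. }
  assert (Dg : forall s, Dc g s (RtoC mu * g s)%C) by (intros; apply Dc_zpow).
  assert (D0 : Defs.disc delta (RtoC 0)) by (unfold Defs.disc; rewrite Cmod_0; auto).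
  assert (Cdf1 := Cd_derive f1 _ (Hf1 _ D0)). assert (Cdf2 := Cd_derive f2 _ (Hf2 _ D0)).
  assert (Cdg1 := Cd_derive g1 _ (Hg1 _ D0)). assert (Cdg2 := Cd_derive g2 _ (Hg2 _ D0)).
  assert (Cdh := Cd_derive h _ (Hh _ D0)).
  set (p := fun z => (f2 z + RtoC kB * g2 z)%C).
  set (u := fun z => (RtoC kC * f1 z + RtoC kD * g1 z)%C).
  set (v := fun z => (u z * h z)%C).
  assert (EAg : forall s, (A s * g s + B s)%C = (zpow ((1 + mu) / 2) s * p (cexp s))%C).
  { intros s. unfold A, B, p, g. replace ((1 + mu) / 2) with ((1 - mu) / 2 + mu) by field.
    rewrite <- zpow_add. ring. }
  assert (ECg : forall s, (C' s * g s + D s)%C = (zpow ((mu - 1) / 2) s * u (cexp s))%C).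
  { intros s. unfold C', D, u, g. replace ((mu - 1) / 2) with ((-1 - mu) / 2 + mu) by field.
    rewrite <- zpow_add. ring. }
  assert (Eom : forall s, om s = (zpow (- mu) s * h (cexp s))%C).
  { intros s. unfold om. replace (- mu) with (-1 - mu + 1) by ring.
    rewrite <- zpow_add, zpow_1. ring. }
  (* the differential equations of C' and D, divided by their power of z *)
  assert (Rv : forall s, HP (ln delta) s -> v (cexp s) =
    (RtoC kC * (RtoC ((-1 - mu) / 2) * f1 (cexp s) + cexp s * C_derive f1 (cexp s)))%C).
  { intros s Hs. destruct (DF s Hs) as (_ & _ & E3 & _).
    pose proof (Dc_mult _ _ s _ _ (Dc_scal (RtoC kC) _ s _ (Dc_zpow ((-1 - mu) / 2) s)) (De f1 Hf1 s Hs)) as Q.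
    pose proof (Dc_unique _ _ _ _ (DcC s Hs) Q) as E. rewrite E3, ECg, Eom in E.
    apply (Cmult_cancel (zpow ((-1 - mu) / 2) s)).
    - transitivity (zpow ((mu - 1) / 2) s * u (cexp s) * (zpow (- mu) s * h (cexp s)))%C.
      + unfold v. replace ((-1 - mu) / 2) with ((mu - 1) / 2 + - mu) by field.
        rewrite <- zpow_add. ring.
      + rewrite E. ring.
    - apply zpow_neq0. }
  assert (Rg : forall s, HP (ln delta) s -> (- v (cexp s))%C =
    (RtoC kD * (RtoC ((mu - 1) / 2) * g1 (cexp s) + cexp s * C_derive g1 (cexp s)))%C).
  { intros s Hs. destruct (DF s Hs) as (_ & _ & E3 & E4).
    pose proof (Dc_mult _ _ s _ _ (Dc_scal (RtoC kD) _ s _ (Dc_zpow ((mu - 1) / 2) s)) (De g1 Hg1 s Hs)) as Q.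
    pose proof (Dc_unique _ _ _ _ (DcD s Hs) Q) as E. rewrite E4, E3, ECg, Eom in E.
    apply (Cmult_cancel (zpow ((mu - 1) / 2) s)).
    - transitivity (- g s * (zpow ((mu - 1) / 2) s * u (cexp s) * (zpow (- mu) s * h (cexp s))))%C.
      + unfold v, g.
        transitivity (- (zpow mu s * zpow (- mu) s) * zpow ((mu - 1) / 2) s * u (cexp s) * h (cexp s))%C; [|ring].
        rewrite zpow_add. replace (mu + - mu) with 0 by ring. rewrite zpow_0. ring.
      + rewrite E. ring.
    - apply zpow_neq0. }
  assert (NC : RtoC kC <> RtoC 0) by (intros Q; apply HkC; now apply RtoC_inj).
  assert (ND : RtoC kD <> RtoC 0) by (intros Q; apply HkD; now apply RtoC_inj).
  assert (Hreal : forall x, 0 < x < delta -> HP (ln delta) (ln x, 0) /\ cexp (ln x, 0) = RtoC x).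
  { intros x Hx. split.
    - unfold HP; simpl. apply ln_increasing; lra.
    - unfold cexp; simpl. rewrite exp_ln, cos_0, sin_0 by lra.
      apply injective_projections; simpl; ring. }
  set (g1' := C_derive g1 (RtoC 0)) in *.
  set (u' := (RtoC kC * C_derive f1 (RtoC 0) + RtoC kD * g1')%C).
  assert (Cdu : Cd u (RtoC 0) u') by (apply Cd_plus; now apply Cd_scal).
  set (v' := (u' * h (RtoC 0) + u (RtoC 0) * C_derive h (RtoC 0))%C).
  assert (Cdv : Cd v (RtoC 0) v') by now apply Cd_mult.
  (* order one terms at 0 of the two relations: the first gives v'(0), then the second
     gives g1'(0) *)
  destruct (lhopital f1 (fun z => / RtoC kC * v z + RtoC ((1 + mu) / 2) * f1 z)%C delta
    (/ RtoC kC * v' + RtoC ((1 + mu) / 2) * C_derive f1 (RtoC 0))%C) as [V0 V1]; auto.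
  { apply Cd_plus; now apply Cd_scal. }
  { intros x Hx. destruct (Hreal x Hx) as [Q1 Q2]. rewrite <- Q2, (Rv _ Q1).
    replace ((1 + mu) / 2) with (- ((-1 - mu) / 2)) by field. rewrite RtoC_opp. field. auto. }
  destruct (lhopital g1 (fun z => - / RtoC kD * v z + RtoC (- ((mu - 1) / 2)) * g1 z)%C delta
    (- / RtoC kD * v' + RtoC (- ((mu - 1) / 2)) * g1')%C) as [_ W1]; auto.
  { apply Cd_plus; now apply Cd_scal. }
  { intros x Hx. destruct (Hreal x Hx) as [Q1 Q2]. rewrite <- Q2.
    replace (- / RtoC kD * v (cexp (ln x, 0)))%C with (/ RtoC kD * - v (cexp (ln x, 0)))%C by ring.
    rewrite (Rg _ Q1). rewrite RtoC_opp. field. auto. }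
  fold g1' in W1. rewrite F1' in V1.
  assert (Ev' : v' = RtoC 0).
  { transitivity (RtoC kC * (/ RtoC kC * v' + RtoC ((1 + mu) / 2) * RtoC 0))%C; [field; auto|].
    rewrite V1. ring. }
  assert (Eg1' : g1' = RtoC 0).
  { rewrite Ev' in W1.
    apply (Cmult_cancel (RtoC ((1 + mu) / 2))).
    - replace ((1 + mu) / 2) with (1 - - ((mu - 1) / 2)) by field.
      rewrite RtoC_minus.
      transitivity (g1' - RtoC (- ((mu - 1) / 2)) * g1')%C; [ring|].
      rewrite <- W1 at 1. ring.
    - intros Q. apply RtoC_inj in Q. lra. }
  assert (Ev0 : v (RtoC 0) = RtoC (- kC * ((1 + mu) / 2))).
  { rewrite F1 in V0.
    transitivity (RtoC kC * (/ RtoC kC * v (RtoC 0) + RtoC ((1 + mu) / 2) * RtoC 1)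
      - RtoC kC * RtoC ((1 + mu) / 2))%C; [field; auto|]. rewrite V0.
    rewrite RtoC_mult, RtoC_opp. ring. }
  (* the derivatives of F are differentiable because F N om is *)
  assert (DfL : forall f k l s, HP (ln delta) s -> (forall s, HP (ln delta) s -> f s = k s) ->
    Dc k s l -> Dc f s l).
  { intros f k l s Hs E H w. destruct (H w) as [Q1 Q2].
    assert (L : locally (0 : R) (fun t => HP (ln delta) (ray s w t))).
    { assert (CR : continuous (fun t => Re (ray s w t)) 0).
      { apply (ex_derive_continuous (fun t => Re (ray s w t))). eexists.
        exact (proj1 (ray_deriv s w 0)). }
      assert (H0 : Re (ray s w 0) < ln delta) by (rewrite ray0; exact Hs).
      exact (CR _ (open_lt (ln delta) _ H0)). }
    split.
    - apply (is_derive_ext_loc (fun t => Re (k (ray s w t)))); auto.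
      generalize L. apply filter_imp. intros t Ht. now rewrite E.
    - apply (is_derive_ext_loc (fun t => Im (k (ray s w t)))); auto.
      generalize L. apply filter_imp. intros t Ht. now rewrite E. }
  assert (D2A : forall s, HP (ln delta) s -> exists l, Dc (C_derive A) s l).
  { intros s Hs. destruct (Dom s Hs) as [l Hl]. eexists.
    apply (DfL _ (fun s => (A s * g s + B s) * om s)%C); auto.
    { intros r Hr; exact (proj1 (DF r Hr)). }
    apply Dc_mult; [|exact Hl]. apply Dc_plus; [|now apply DcB].
    apply Dc_mult; [now apply DcA | apply Dg]. }
  assert (D2C : forall s, HP (ln delta) s -> exists l, Dc (C_derive C') s l).
  { intros s Hs. destruct (Dom s Hs) as [l Hl]. eexists.
    apply (DfL _ (fun s => (C' s * g s + D s) * om s)%C); auto.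
    { intros r Hr; exact (proj1 (proj2 (proj2 (DF r Hr)))). }
    apply Dc_mult; [|exact Hl]. apply Dc_plus; [|now apply DcD].
    apply Dc_mult; [now apply DcC | apply Dg]. }
  assert (Dng : forall s, exists l, Dc (fun s => - g s)%C s l).
  { intros s. eexists. apply (Dc_ext (fun s => (RtoC (-1)) * g s)%C).
    - intros x. change (RtoC (-1)) with (RtoC (- (1))). rewrite RtoC_opp. ring.
    - apply Dc_scal, Dg. }
  split.
  { split; [|split; [|split]].
    - intros s Hs. refine (conj (conj (DcA s Hs) (conj (DcB s Hs) (conj (DcC s Hs) (DcD s Hs)))) _).
      assert (Hs' := proj1 (HPs s) Hs). destruct (HBr s Hs') as (Q1 & Q2 & _).
      refine (conj Q1 (conj Q2 (conj (D2A s Hs) (conj _ (conj (D2C s Hs) _))))).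
      + destruct (Dng s) as [l Hl]. destruct (D2A s Hs) as [m Hm]. eexists.
        apply (DfL _ (fun s => - g s * C_derive A s)%C); auto.
        { intros r Hr; exact (proj1 (proj2 (DF r Hr))). }
        apply Dc_mult; eauto.
      + destruct (Dng s) as [l Hl]. destruct (D2C s Hs) as [m Hm]. eexists.
        apply (DfL _ (fun s => - g s * C_derive C' s)%C); auto.
        { intros r Hr; exact (proj2 (proj2 (proj2 (DF r Hr)))). }
        apply Dc_mult; eauto.
    - apply (tends_ext_loc (ln delta) (fun s => p (cexp s) * v (cexp s))%C).
      + intros s Hs. destruct (DF s Hs) as (E1 & E2 & E3 & E4).
        transitivity (C_derive A s * (C' s * g s + D s))%C.
        * rewrite E1, EAg, ECg, Eom. unfold v.
          transitivity ((zpow ((1 + mu) / 2) s * zpow ((mu - 1) / 2) s * zpow (- mu) s) *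
            (p (cexp s) * (u (cexp s) * h (cexp s))))%C; [|ring].
          rewrite !zpow_add. replace ((1 + mu) / 2 + (mu - 1) / 2 + - mu) with 0 by field.
          rewrite zpow_0. ring.
        * rewrite E2. ring.
      + replace (RtoC ((1 - mu ^ 2) / 4)) with (p (RtoC 0) * v (RtoC 0))%C.
        * apply tends_mult; [|eapply tends_cexp; exact Cdv].
          eapply tends_cexp. apply Cd_plus; [exact Cdf2 | apply Cd_scal; exact Cdg2].
        * rewrite Ev0. unfold p. rewrite F2, G2, <- RtoC_mult, <- RtoC_plus, <- RtoC_mult.
          f_equal. unfold kB, kC. field. lra.
    - apply (tends_ext_loc (ln delta) (fun s => RtoC (-1) * (cexp s * (p (cexp s) * (p (cexp s) * h (cexp s)))))%C).
      + intros s Hs. destruct (DF s Hs) as (E1 & E2 & E3 & E4).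
        transitivity (- (C_derive A s * (A s * g s + B s)))%C.
        * rewrite E1, EAg, Eom.
          transitivity (- ((zpow ((1 + mu) / 2) s * zpow ((1 + mu) / 2) s * zpow (- mu) s) *
            (p (cexp s) * (p (cexp s) * h (cexp s)))))%C; [|ring].
          rewrite !zpow_add. replace ((1 + mu) / 2 + (1 + mu) / 2 + - mu) with 1 by field.
          rewrite zpow_1. change (RtoC (-1)) with (RtoC (- (1))). rewrite RtoC_opp. ring.
        * rewrite E2. ring.
      + replace (RtoC 0) with (RtoC (-1) * (RtoC 0 * (p (RtoC 0) * (p (RtoC 0) * h (RtoC 0)))))%C by ring.
        assert (Tp : tends (fun s => p (cexp s)) (p (RtoC 0))).
        { eapply tends_cexp. apply Cd_plus; [exact Cdf2 | apply Cd_scal; exact Cdg2]. }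
        apply tends_mult; [apply tends_const|].
        apply tends_mult.
        { intros eps. destruct (exp_small eps) as [x Hx]. exists x. intros s Hs.
          replace (cexp s - RtoC 0)%C with (cexp s) by ring. auto. }
        apply tends_mult; auto. apply tends_mult; auto.
        eapply tends_cexp; exact Cdh.
    - exists (u (RtoC 0) * v (RtoC 0))%C.
      apply (tends_ext_loc (ln delta) (fun s => (u (cexp s) * v (cexp s) - u (RtoC 0) * v (RtoC 0)) / cexp s)%C).
      + intros s Hs. destruct (DF s Hs) as (E1 & E2 & E3 & E4).
        assert (EE : (C_derive C' s * D s - C_derive D s * C' s)%C = (u (cexp s) * v (cexp s) / cexp s)%C).
        { transitivity (C_derive C' s * (C' s * g s + D s))%C; [rewrite E4; ring|].
          rewrite E3, ECg, Eom.
          transitivity ((zpow ((mu - 1) / 2) s * zpow ((mu - 1) / 2) s * zpow (- mu) s) *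
            (u (cexp s) * (u (cexp s) * h (cexp s))))%C; [ring|].
          rewrite !zpow_add. replace ((mu - 1) / 2 + (mu - 1) / 2 + - mu) with (-1) by field.
          assert (Z : zpow (-1) s = (/ cexp s)%C).
          { apply (Cmult_cancel (cexp s)); [|apply cexp_neq0].
            rewrite Cinv_r by apply cexp_neq0. rewrite <- zpow_1, zpow_add.
            replace (1 + -1) with 0 by ring. apply zpow_0. }
          rewrite Z. unfold v, Cdiv. ring. }
        rewrite EE. field. apply cexp_neq0.
      + assert (Z : (u' * v (RtoC 0) + u (RtoC 0) * v')%C = RtoC 0).
        { rewrite Ev'. unfold u'. rewrite F1', Eg1'. ring. }
        pose proof (tends_quotient (fun z => u z * v z)%C _ (Cd_mult _ _ _ _ _ Cdu Cdv)) as TQ.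
        rewrite Z in TQ. exact TQ. }
  intros s Hs. destruct (HBr s (proj1 (HPs s) Hs)) as (_ & _ & E). exact E.
Qed.

(** * Hermitian matrices *)

(** The point (z, w) corresponds to the positive hermitian matrix M = (1/w) (1, conj z;
    z, |z|^2 + w^2) of determinant one. *)
Definition m11 (p : space) : C := RtoC (/ snd p).
Definition m21 (p : space) : C := (Re (fst p) / snd p, Im (fst p) / snd p).
Definition m22 (p : space) : C :=
  RtoC ((Re (fst p) ^ 2 + Im (fst p) ^ 2 + snd p ^ 2) / snd p).

(** Entries of the derivative of M at p in the direction x. *)
Definition dm11 (p x : space) : C := RtoC (- snd x / snd p ^ 2).
Definition dm21 (p x : space) : C :=
  (Re (fst x) / snd p - Re (fst p) * snd x / snd p ^ 2,
   Im (fst x) / snd p - Im (fst p) * snd x / snd p ^ 2).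
Definition dm22 (p x : space) : C :=
  RtoC ((2 * Re (fst p) * Re (fst x) + 2 * Im (fst p) * Im (fst x) + 2 * snd p * snd x) / snd p -
   (Re (fst p) ^ 2 + Im (fst p) ^ 2 + snd p ^ 2) * snd x / snd p ^ 2).

Lemma m_curve (c : R -> space) t v : 0 < snd (c t) -> is_deriveS c t v ->
  is_deriveC (fun s => m11 (c s)) t (dm11 (c t) v) /\
  is_deriveC (fun s => m21 (c s)) t (dm21 (c t) v) /\
  is_deriveC (fun s => m22 (c s)) t (dm22 (c t) v).
Proof.
  intros Hp (H1 & H2 & H3).
  destruct v as [[x y] z]. simpl in H1, H2, H3.
  set (u := fun s => Re (fst (c s))) in *. set (v := fun s => Im (fst (c s))) in *.
  set (w := fun s => snd (c s)) in *.
  derivative H1 u t F1.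
  derivative H2 v t F2.
  derivative H3 w t F3.
  assert (W : w t <> 0) by (apply Rgt_not_eq; exact Hp).
  assert (D11 : is_derive (fun s => / w s) t (- z / (w t) ^ 2)).
  { auto_derive; [auto|]. rewrite F3. field. auto. }
  assert (D21 : is_derive (fun s => u s / w s) t (x / w t - u t * z / (w t) ^ 2)).
  { auto_derive; [auto|]. rewrite F1, F3. field. auto. }
  assert (D21' : is_derive (fun s => v s / w s) t (y / w t - v t * z / (w t) ^ 2)).
  { auto_derive; [auto|]. rewrite F2, F3. field. auto. }
  assert (D22 : is_derive (fun s => (u s ^ 2 + v s ^ 2 + w s ^ 2) / w s) t
    ((2 * u t * x + 2 * v t * y + 2 * w t * z) / w t - (u t ^ 2 + v t ^ 2 + w t ^ 2) * z / w t ^ 2)).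
  { auto_derive; [repeat split; auto|]. rewrite F1, F2, F3. field. auto. }
  assert (D0 : is_derive (fun _ : R => 0) t 0) by apply (is_derive_const (V := R_NormedModule)).
  exact (conj (conj D11 D0) (conj (conj D21 D21') (conj D22 D0))).
Qed.

(** The trace of p k for the matrix k = (-be/2, -al; ga, be/2) of the Killing field. *)
Definition tr_k (al be ga p11 p12 p21 p22 : C) : C :=
  (- (be / RtoC 2) * p11 + ga * p12 - al * p21 + be / RtoC 2 * p22)%C.

(** The trace of u n^-1 k, for n of determinant one. *)
Definition tr_inv al be ga (u11 u12 u21 u22 n11 n12 n21 n22 : C) : C :=
  tr_k al be ga (u11 * n22 - u12 * n21) (u12 * n11 - u11 * n12)
    (u21 * n22 - u22 * n21) (u22 * n11 - u21 * n12).

Lemma Tf_trace al be ga p x : 0 < snd p ->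
  Tf al be ga p x = tr_inv al be ga (dm11 p x) (Cconj (dm21 p x)) (dm21 p x) (dm22 p x)
    (m11 p) (Cconj (m21 p)) (m21 p) (m22 p).
Proof.
  intros Hp. rewrite Tf_parts by auto.
  destruct al as [a1 a2], be as [b1 b2], ga as [g1 g2].
  destruct p as [[u v] w], x as [[x1 x2] x3].
  unfold RTf, ITf, qf, qf', tr_inv, tr_k, m11, m21, m22, dm11, dm21, dm22.
  simpl in *. apply injective_projections; simpl; field; lra.
Qed.

(** The metric is the opposite of the determinant on tangent hermitian matrices; on x -
    i y, the determinant measures the failure of conformality. *)
Lemma hyp_inner_dm p x y : 0 < snd p ->
  let d12 := fun v => Cconj (dm21 p v) in
  ((d12 x - Ci * d12 y) * (dm21 p x - Ci * dm21 p y)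
   - (dm11 p x - Ci * dm11 p y) * (dm22 p x - Ci * dm22 p y))%C =
  (hyp_inner p x x - hyp_inner p y y, - 2 * hyp_inner p x y).
Proof.
  intros Hp. destruct p as [[u v] w], x as [[x1 x2] x3], y as [[y1 y2] y3].
  unfold hyp_inner, dot, dm11, dm21, dm22. simpl in *.
  apply injective_projections; simpl; field; lra.
Qed.

(** If M = F F^* then the (1,0) part of dM is dF F^*, and dF F^* M^-1 = dF F^-1 when det
    F = 1. *)
Lemma tr_frame al be ga (A B C' D a b c d Ab Bb Cb Db : C) :
  tr_inv al be ga (a * Ab + b * Bb) (a * Cb + b * Db) (c * Ab + d * Bb) (c * Cb + d * Db)
    (A * Ab + B * Bb) (A * Cb + B * Db) (C' * Ab + D * Bb) (C' * Cb + D * Db) =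
  ((Ab * Db - Bb * Cb) * tr_k al be ga (a * D - b * C') (b * A - a * B)
     (c * D - d * C') (d * A - c * B))%C.
Proof. unfold tr_inv, tr_k. field. Qed.

Lemma is_deriveC_conj (f : R -> C) t v : is_deriveC f t v ->
  is_deriveC (fun s => Cconj (f s)) t (Cconj v).
Proof.
  intros [A B]. split; [exact A|]. apply (is_derive_opp (fun s => Im (f s))). exact B.
Qed.

Lemma is_deriveC_ext_loc (L M : R -> C) t v : locally t (fun s : R => L s = M s) ->
  is_deriveC L t v -> is_deriveC M t v.
Proof.
  intros E [A B]. split.
  - apply (is_derive_ext_loc (fun s => Re (L s))); auto.
    generalize E. apply filter_imp. intros s Hs. now rewrite Hs.
  - apply (is_derive_ext_loc (fun s => Im (L s))); auto.
    generalize E. apply filter_imp. intros s Hs. now rewrite Hs.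
Qed.

Lemma ray_line (s v : C) t : ray s v t = plus (s : plane) (scal t (v : plane)).
Proof.
  destruct s as [a b], v as [c d]. unfold ray.
  change (Cplus (a, b) (Cmult (RtoC t) (c, d)) = (a + t * c, b + t * d)).
  apply injective_projections; simpl; ring.
Qed.

(** The matrix F F^* determines a surface; here its points are those of [W]. *)
Definition frame_of (U : plane -> Prop) (W : plane -> space) (A B C' D : C -> C) : Prop :=
  forall s, U s -> m11 (W s) = (A s * Cconj (A s) + B s * Cconj (B s))%C /\
    m21 (W s) = (C' s * Cconj (A s) + D s * Cconj (B s))%C /\
    m22 (W s) = (C' s * Cconj (C' s) + D s * Cconj (D s))%C.

Lemma Cconj_RtoC r : Cconj (RtoC r) = RtoC r.
Proof. unfold Cconj, RtoC; simpl. f_equal. ring. Qed.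

(** X1 - i X2 is twice the derivative d/ds, which only sees the holomorphic factor of F
    F^*. *)
Lemma frame_dm (U : plane -> Prop) W A B C' D s a b c d : open U -> C2_surf U W ->
  (forall q, U q -> 0 < snd (W q)) -> frame_of U W A B C' D -> U s ->
  Dc A s a -> Dc B s b -> Dc C' s c -> Dc D s d ->
  (dm11 (W s) (X1 W s) - Ci * dm11 (W s) (X2 W s))%C =
    (RtoC 2 * (a * Cconj (A s) + b * Cconj (B s)))%C /\
  (Cconj (dm21 (W s) (X1 W s)) - Ci * Cconj (dm21 (W s) (X2 W s)))%C =
    (RtoC 2 * (a * Cconj (C' s) + b * Cconj (D s)))%C /\
  (dm21 (W s) (X1 W s) - Ci * dm21 (W s) (X2 W s))%C =
    (RtoC 2 * (c * Cconj (A s) + d * Cconj (B s)))%C /\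
  (dm22 (W s) (X1 W s) - Ci * dm22 (W s) (X2 W s))%C =
    (RtoC 2 * (c * Cconj (C' s) + d * Cconj (D s)))%C.
Proof.
  intros HU HW Hp HF Hs DA DB DC DD.
  assert (K : forall v : plane,
    dm11 (W s) (dspace W v s) = (a * v * Cconj (A s) + A s * Cconj (a * v) +
       (b * v * Cconj (B s) + B s * Cconj (b * v)))%C /\
    dm21 (W s) (dspace W v s) = (c * v * Cconj (A s) + C' s * Cconj (a * v) +
       (d * v * Cconj (B s) + D s * Cconj (b * v)))%C /\
    dm22 (W s) (dspace W v s) = (c * v * Cconj (C' s) + C' s * Cconj (c * v) +
       (d * v * Cconj (D s) + D s * Cconj (d * v)))%C).
  { intros v.
    pose proof (is_deriveS_dir U W s v Hs (C2_C1 U W HW)) as S.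
    assert (P0 : 0 < snd (W (plus s (scal 0 v)))) by (rewrite line_0; auto).
    destruct (m_curve _ _ _ P0 S) as (M1 & M2 & M3).
    cbv beta in M1, M2, M3. rewrite line_0 in M1, M2, M3.
    assert (L : locally (0 : R) (fun t => U (ray s v t))).
    { generalize (line_locally0 U s v HU Hs). apply filter_imp. intros t Ht.
      now rewrite ray_line. }
    assert (Q : forall f g x y, Dc f s x -> Dc g s y ->
      is_deriveC (fun t => f (ray s v t) * Cconj (g (ray s v t)))%C 0
        (x * v * Cconj (g s) + f s * Cconj (y * v))%C).
    { intros f g x y Hx Hy.
      pose proof (is_deriveC_mult _ _ 0 _ _ (Hx v) (is_deriveC_conj _ 0 _ (Hy v))) as R.
      cbv beta in R. rewrite ray0 in R. exact R. }
    refine (conj (is_deriveC_unique _ 0 _ _ M1 _) (conj (is_deriveC_unique _ 0 _ _ M2 _)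
      (is_deriveC_unique _ 0 _ _ M3 _))).
    - apply (is_deriveC_ext_loc (fun t => A (ray s v t) * Cconj (A (ray s v t)) +
        B (ray s v t) * Cconj (B (ray s v t)))%C).
      + generalize L. apply filter_imp. intros t Ht.
        rewrite <- (proj1 (HF _ Ht)), ray_line. reflexivity.
      + apply (is_deriveC_plus (fun t => A (ray s v t) * Cconj (A (ray s v t)))%C
          (fun t => B (ray s v t) * Cconj (B (ray s v t)))%C); now apply Q.
    - apply (is_deriveC_ext_loc (fun t => C' (ray s v t) * Cconj (A (ray s v t)) +
        D (ray s v t) * Cconj (B (ray s v t)))%C).
      + generalize L. apply filter_imp. intros t Ht.
        rewrite <- (proj1 (proj2 (HF _ Ht))), ray_line. reflexivity.
      + apply (is_deriveC_plus (fun t => C' (ray s v t) * Cconj (A (ray s v t)))%C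
          (fun t => D (ray s v t) * Cconj (B (ray s v t)))%C); now apply Q.
    - apply (is_deriveC_ext_loc (fun t => C' (ray s v t) * Cconj (C' (ray s v t)) +
        D (ray s v t) * Cconj (D (ray s v t)))%C).
      + generalize L. apply filter_imp. intros t Ht.
        rewrite <- (proj2 (proj2 (HF _ Ht))), ray_line. reflexivity.
      + apply (is_deriveC_plus (fun t => C' (ray s v t) * Cconj (C' (ray s v t)))%C
          (fun t => D (ray s v t) * Cconj (D (ray s v t)))%C); now apply Q. }
  destruct (K e1) as (K1 & K2 & K3). destruct (K e2) as (L1 & L2 & L3).
  change (dspace W e1 s) with (X1 W s) in *. change (dspace W e2 s) with (X2 W s) in *.
  rewrite K1, K2, K3, L1, L2, L3. clear.
  change e1 with (RtoC 1). change e2 with Ci.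
  destruct (A s), (B s), (C' s), (D s), a, b, c, d.
  refine (conj _ (conj _ (conj _ _))); apply injective_projections; simpl; ring.
Qed.

Definition tau al be ga (A B C' D a b c d : C) : C :=
  (Cconj (A * D - B * C') * tr_k al be ga (a * D - b * C') (b * A - a * B)
     (c * D - d * C') (d * A - c * B))%C.

(** The flux form of a surface given by F F^* is the imaginary part of twice the
    holomorphic form trace (dF F^-1 k). *)
Lemma frame_flux (U : plane -> Prop) W A B C' D s a b c d al be ga : open U -> C2_surf U W ->
  (forall q, U q -> 0 < snd (W q)) -> frame_of U W A B C' D -> U s ->
  Dc A s a -> Dc B s b -> Dc C' s c -> Dc D s d ->
  (RT al be ga W e1 s + IT al be ga W e2 s, IT al be ga W e1 s - RT al be ga W e2 s) =
  (RtoC 2 * tau al be ga (A s) (B s) (C' s) (D s) a b c d)%C.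
Proof.
  intros HU HW Hp HF Hs DA DB DC DD.
  destruct (frame_dm U W A B C' D s a b c d HU HW Hp HF Hs DA DB DC DD) as (E1 & E2 & E3 & E4).
  destruct (HF s Hs) as (M1 & M2 & M3).
  transitivity (Tf al be ga (W s) (X1 W s) - Ci * Tf al be ga (W s) (X2 W s))%C.
  { rewrite !Tf_parts by auto. unfold RT, IT, X1, X2.
    apply injective_projections; simpl;
      match goal with |- ?x = ?y => change (@eq R x y) end; ring. }
  rewrite !Tf_trace by auto.
  transitivity (tr_inv al be ga
    (dm11 (W s) (X1 W s) - Ci * dm11 (W s) (X2 W s))
    (Cconj (dm21 (W s) (X1 W s)) - Ci * Cconj (dm21 (W s) (X2 W s)))
    (dm21 (W s) (X1 W s) - Ci * dm21 (W s) (X2 W s))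
    (dm22 (W s) (X1 W s) - Ci * dm22 (W s) (X2 W s))
    (m11 (W s)) (Cconj (m21 (W s))) (m21 (W s)) (m22 (W s)))%C.
  { unfold tr_inv, tr_k. match goal with |- ?x = ?y => change (@eq C x y) end. field. }
  rewrite E1, E2, E3, E4, M1, M2, M3.
  transitivity (RtoC 2 * tr_inv al be ga (a * Cconj (A s) + b * Cconj (B s))
    (a * Cconj (C' s) + b * Cconj (D s)) (c * Cconj (A s) + d * Cconj (B s))
    (c * Cconj (C' s) + d * Cconj (D s))
    (A s * Cconj (A s) + B s * Cconj (B s)) (A s * Cconj (C' s) + B s * Cconj (D s))
    (C' s * Cconj (A s) + D s * Cconj (B s)) (C' s * Cconj (C' s) + D s * Cconj (D s)))%C.
  { replace (Cconj (C' s * Cconj (A s) + D s * Cconj (B s)))%C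
     with (A s * Cconj (C' s) + B s * Cconj (D s))%C.
    2:{ destruct (A s), (B s), (C' s), (D s). apply injective_projections; simpl; ring. }
    unfold tr_inv, tr_k. match goal with |- ?x = ?y => change (@eq C x y) end. field. }
  rewrite tr_frame. unfold tau. f_equal. f_equal.
  destruct (A s), (B s), (C' s), (D s). apply injective_projections; simpl; ring.
Qed.

(** The determinant of the (1,0) part of dM is det dF times a conjugate determinant. *)
Lemma frame_conformal (U : plane -> Prop) W A B C' D s a b c d : open U -> C2_surf U W ->
  (forall q, U q -> 0 < snd (W q)) -> frame_of U W A B C' D -> U s ->
  Dc A s a -> Dc B s b -> Dc C' s c -> Dc D s d -> (a * d - b * c)%C = RtoC 0 ->
  hyp_inner (W s) (X1 W s) (X1 W s) = hyp_inner (W s) (X2 W s) (X2 W s) /\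
  hyp_inner (W s) (X1 W s) (X2 W s) = 0.
Proof.
  intros HU HW Hp HF Hs DA DB DC DD H0.
  destruct (frame_dm U W A B C' D s a b c d HU HW Hp HF Hs DA DB DC DD) as (E1 & E2 & E3 & E4).
  pose proof (hyp_inner_dm (W s) (X1 W s) (X2 W s) (Hp s Hs)) as H. cbv zeta beta in H.
  rewrite E1, E2, E3, E4 in H.
  assert (Z : (RtoC 2 * (a * Cconj (C' s) + b * Cconj (D s)) *
    (RtoC 2 * (c * Cconj (A s) + d * Cconj (B s))) -
    RtoC 2 * (a * Cconj (A s) + b * Cconj (B s)) * (RtoC 2 * (c * Cconj (C' s) + d * Cconj (D s))))%C = RtoC 0).
  { transitivity (RtoC 2 * RtoC 2 * (a * d - b * c) *
      (Cconj (C' s) * Cconj (B s) - Cconj (A s) * Cconj (D s)))%C; [ring|]. rewrite H0. ring. }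
  rewrite Z in H. pose proof (f_equal fst H) as H1. pose proof (f_equal snd H) as H2.
  simpl in H1, H2. lra.
Qed.

(** * Computation of the flux from the Bryant representation *)

Lemma map_curve (U : plane -> Prop) (h : plane -> plane) (l : R -> C) t v : open U ->
  C2_map U h -> U (l t) -> is_deriveC l t v ->
  is_deriveC (fun s => h (l s)) t
   (Re v * Re (hx h (l t)) + Im v * Re (hy h (l t)), Re v * Im (hx h (l t)) + Im v * Im (hy h (l t))).
Proof.
  intros HU [A B] Hl [G1 G2].
  assert (E : forall s, (Re (l s), Im (l s)) = l s) by (intros; symmetry; apply surjective_pairing).
  assert (G : forall f, CK 1 U f -> is_derive (fun s => f (l s)) t
    (Re v * pdx f (l t) + Im v * pdy f (l t))).
  { intros f Hf. apply (is_derive_ext (fun s => f (Re (l s), Im (l s)))).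
    { intros s. apply f_equal, E. }
    pose proof (chain_plane U f (fun s => Re (l s)) (fun s => Im (l s)) t (Re v) (Im v) HU Hf) as K.
    cbv beta in K. rewrite E in K. now apply K. }
  split.
  - exact (G _ (CK_pred 1 U _ A)).
  - exact (G _ (CK_pred 1 U _ B)).
Qed.

Lemma map_curve_cont (U : plane -> Prop) (h : plane -> plane) (l v : R -> C) : open U ->
  C2_map U h -> (forall t, U (l t)) -> (forall t, is_deriveC l t (v t)) -> contC v ->
  contC (fun t => (Re (v t) * Re (hx h (l t)) + Im (v t) * Re (hy h (l t)),
    Re (v t) * Im (hx h (l t)) + Im (v t) * Im (hy h (l t))) : C).
Proof.
  intros HU [A B] Hl D Hv.
  assert (K : forall f, CK 2 U f -> forall t : R,
    continuous (fun t => Re (v t) * pdx f (l t) + Im (v t) * pdy f (l t)) t).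
  { intros f Hf t. apply (continuous_ext (fun t => form (pdx f) (pdy f) (l t) (v t))).
    { intros s. unfold form. match goal with |- ?x = ?y => change (@eq R x y) end. ring. }
    apply (contC_form U); auto. split; [exact (CK_S 1 U f Hf e1) | exact (CK_S 1 U f Hf e2)]. }
  split; intros t; [exact (K _ A t) | exact (K _ B t)].
Qed.

Lemma CK_ln n : CK n posR ln.
Proof.
  destruct n; [split; auto|].
  - intros x Hx. unfold posR in Hx. apply (ex_derive_continuous ln x). auto_derive. lra.
  - apply (CK_R_intro n posR ln Rinv); auto using open_posR.
    + intros x Hx. unfold posR in Hx. auto_derive; [lra|]. field. lra.
    + apply CK_Rinv.
Qed.

Lemma disc_in_open (U : plane -> Prop) : open U -> U (RtoC 0) ->
  exists r : posreal, forall z : C, Cmod z < r -> U z.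
Proof.
  intros HU H0. destruct (HU _ H0) as [r Hr]. exists r. intros z Hz. apply Hr.
  pose proof (Rmax_Cmod z) as M. pose proof (Rmax_l (Rabs (fst z)) (Rabs (snd z))).
  pose proof (Rmax_r (Rabs (fst z)) (Rabs (snd z))).
  split.
  - change (Rabs (fst z - 0) < r). rewrite Rminus_0_r. lra.
  - change (Rabs (snd z - 0) < r). rewrite Rminus_0_r. lra.
Qed.

Lemma tends0 (f : C -> C) : tends f (RtoC 0) -> forall eps : posreal, exists x0,
  forall s, Re s < x0 -> Cmod (f s) < eps.
Proof.
  intros H eps. destruct (H eps) as [x0 Hx0]. exists x0. intros s Hs.
  replace (f s) with (f s - RtoC 0)%C by ring. auto.
Qed.

(** The end E is parametrized over a half-plane by W = E o Psi, where Psi is the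
    composition of the exponential with a diffeomorphism of punctured discs, of inverse
    psi'; nothing says yet that it is holomorphic. W has the frame r adj(H) F, where F
    is a Bryant frame and H = (h11, h12; h21, h22) is the matrix of an isometry. *)
Section Core.
Variables (E : surface_end) (kappa c : R).
Variables (A0 B0 C0 D0 a0 b0 c0 d0 : C -> C).
Variables (h11 h12 h21 h22 r : C) (Psi : plane -> plane) (psi' : plane -> plane).

Let dH := (h11 * h22 - h12 * h21)%C.
Let W := fun s => param E (Psi s).
Let fA s := (r * (h22 * A0 s - h12 * C0 s))%C.
Let fB s := (r * (h22 * B0 s - h12 * D0 s))%C.
Let fC s := (r * (h11 * C0 s - h21 * A0 s))%C.
Let fD s := (r * (h11 * D0 s - h21 * B0 s))%C.

Hypotheses (HE : bryant_end E) (Hframe : bryant_frame kappa c A0 B0 C0 D0 a0 b0 c0 d0).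
Hypotheses (Hr : Cmod (r * r * dH) = 1) (HPsi : C2_map (HP c) Psi).
Hypotheses (Hdom : forall s, HP c s -> dom_star E (Psi s)).
Hypotheses (Hper : forall x y, Psi (x, y + 2 * PI) = Psi (x, y)).
Hypotheses (Hlim : tends Psi (RtoC 0)).
Hypotheses (HW : frame_of (HP c) W fA fB fC fD).
Hypotheses (Hpsi' : C2_map (dom_star E) psi').
Hypotheses (Hinv : forall z, dom_star E z -> psi' z <> RtoC 0 /\
  forall s, HP c s -> cexp s = psi' z -> Psi s = z).
Hypotheses (Hlim' : forall eps : posreal, exists d : posreal, forall z, dom_star E z ->
  Cmod z < d -> Cmod (psi' z) < eps).

Let HC := cmc1_end E HE.
Let HU : open (dom_star E) := proj1 HC.
Let HX : C2_surf (dom_star E) (param E) := proj1 (proj2 HC).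

Lemma end_height_pos q : dom_star E q -> 0 < snd (param E q).
Proof. intros Hq. apply (proj2 (proj2 HC) q Hq). Qed.

Lemma dH_neq0 : dH <> RtoC 0.
Proof. intros Q. rewrite Q, Cmult_0_r, Cmod_0 in Hr. lra. Qed.

Lemma lifted_surf : C2_surf (HP c) W.
Proof.
  destruct HX as (X1' & X2' & X3'). destruct HPsi as [P1 P2].
  refine (conj _ (conj _ _)).
  - exact (CK_compp 2 (dom_star E) (HP c) Psi _ HU (open_HP c) Hdom X1' P1 P2).
  - exact (CK_compp 2 (dom_star E) (HP c) Psi _ HU (open_HP c) Hdom X2' P1 P2).
  - exact (CK_compp 2 (dom_star E) (HP c) Psi _ HU (open_HP c) Hdom X3' P1 P2).
Qed.

Lemma lifted_height_pos q : HP c q -> 0 < snd (W q).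
Proof. intros Hq. apply end_height_pos, Hdom, Hq. Qed.

Lemma lifted_partials s : HP c s ->
  X1 W s = comb (Re (hx Psi s)) (Im (hx Psi s)) (X1 (param E) (Psi s)) (X2 (param E) (Psi s)) /\
  X2 W s = comb (Re (hy Psi s)) (Im (hy Psi s)) (X1 (param E) (Psi s)) (X2 (param E) (Psi s)).
Proof.
  intros Hs. destruct (C2_C1 _ _ HX) as (A & B & D). destruct HPsi as [P1 P2].
  assert (Q1 := CK_pred 1 _ _ P1). assert (Q2 := CK_pred 1 _ _ P2).
  assert (K : forall f v, CK 1 (dom_star E) f -> dir_deriv (fun q => f (Psi q)) v s =
    dir_deriv (fun q => Re (Psi q)) v s * pdx f (Psi s) +
    dir_deriv (fun q => Im (Psi q)) v s * pdy f (Psi s)).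
  { intros f v Hf. exact (dir_comp (dom_star E) (HP c) Psi f v s HU (open_HP c) Hdom Hf Q1 Q2 Hs). }
  split; rewrite comb_eq; apply space_eq.
  - exact (K _ e1 A).
  - exact (K _ e1 B).
  - exact (K _ e1 D).
  - exact (K _ e2 A).
  - exact (K _ e2 B).
  - exact (K _ e2 D).
Qed.

Definition k11 (be : C) : C := (- (be / RtoC 2))%C.
(** Entries of H k H^-1, where k is the matrix of the Killing field. *)
Definition K11 (al be ga : C) : C :=
  (((h11 * k11 be + h12 * ga) * h22 - (h11 * - al + h12 * - k11 be) * h21) / dH)%C.
Definition K12 (al be ga : C) : C :=
  ((- (h11 * k11 be + h12 * ga) * h12 + (h11 * - al + h12 * - k11 be) * h11) / dH)%C.
Definition K21 (al be ga : C) : C :=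
  (((h21 * k11 be + h22 * ga) * h22 - (h21 * - al + h22 * - k11 be) * h21) / dH)%C.

(** The trace of F' F^-1 H k H^-1, given that F' F^-1 is traceless. *)
Definition tau0 al be ga (s : C) : C :=
  (RtoC 2 * K11 al be ga * (a0 s * D0 s - b0 s * C0 s)
   + K21 al be ga * (b0 s * A0 s - a0 s * B0 s)
   + K12 al be ga * (c0 s * D0 s - d0 s * C0 s))%C.

Lemma lifted_frame_Dc s : HP c s ->
  Dc fA s (r * (h22 * a0 s - h12 * c0 s))%C /\ Dc fB s (r * (h22 * b0 s - h12 * d0 s))%C /\
  Dc fC s (r * (h11 * c0 s - h21 * a0 s))%C /\ Dc fD s (r * (h11 * d0 s - h21 * b0 s))%C.
Proof.
  intros Hs. destruct Hframe as (HF & _). destruct (HF s Hs) as ((DA & DB & DC & DD) & _).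
  assert (K : forall x y f g l m, Dc f s l -> Dc g s m ->
    Dc (fun z => r * (x * f z - y * g z))%C s (r * (x * l - y * m))%C).
  { intros x y f g l m Hf Hg. apply Dc_scal.
    apply (Dc_ext (fun z => x * f z + (- y) * g z)%C). { intros; ring. }
    replace (x * l - y * m)%C with (x * l + - y * m)%C by ring.
    apply Dc_plus; now apply Dc_scal. }
  refine (conj _ (conj _ (conj _ _))); now apply K.
Qed.

(** The determinant of F is constant. *)
Lemma frame_traceless s : HP c s -> (d0 s * A0 s - c0 s * B0 s)%C = (- (a0 s * D0 s - b0 s * C0 s))%C.
Proof.
  intros Hs. destruct Hframe as (HF & _). destruct (HF s Hs) as ((DA & DB & DC & DD) & _).
  assert (H1 : Dc (fun z => A0 z * D0 z + (RtoC (-1)) * (B0 z * C0 z))%C s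
    ((a0 s * D0 s + A0 s * d0 s) + RtoC (-1) * (b0 s * C0 s + B0 s * c0 s))%C).
  { apply Dc_plus; [|apply Dc_scal]; now apply Dc_mult. }
  assert (H2 : Dc (fun z => A0 z * D0 z + (RtoC (-1)) * (B0 z * C0 z))%C s (RtoC 0)).
  { intros v. assert (D1 := Dc_const (RtoC 1) s v).
    assert (L : locally (0 : R) (fun t => HP c (ray s v t))).
    { generalize (line_locally0 (HP c) s v (open_HP c) Hs). apply filter_imp. intros t Ht.
      now rewrite ray_line. }
    apply (is_deriveC_ext_loc (fun _ => RtoC 1)); [|exact D1].
    generalize L. apply filter_imp. intros t Ht.
    destruct (HF _ Ht) as (_ & Q & _). rewrite <- Q.
    change (RtoC (-1)) with (RtoC (- (1))). rewrite RtoC_opp. ring. }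
  pose proof (Dc_unique _ _ _ _ H1 H2) as Q.
  change (RtoC (-1)) with (RtoC (- (1))) in Q. rewrite RtoC_opp in Q.
  transitivity ((a0 s * D0 s + A0 s * d0 s + - RtoC 1 * (b0 s * C0 s + B0 s * c0 s)) -
     (a0 s * D0 s - b0 s * C0 s))%C; [ring|]. rewrite Q. ring.
Qed.

Lemma tau_lifted_frame al be ga s : HP c s ->
  tau al be ga (fA s) (fB s) (fC s) (fD s)
    (r * (h22 * a0 s - h12 * c0 s)) (r * (h22 * b0 s - h12 * d0 s))
    (r * (h11 * c0 s - h21 * a0 s)) (r * (h11 * d0 s - h21 * b0 s)) = tau0 al be ga s.
Proof.
  intros Hs. pose proof (frame_traceless s Hs) as T.
  destruct Hframe as (HF & _). destruct (HF s Hs) as (_ & Q & _).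
  pose proof dH_neq0 as N.
  unfold tau.
  assert (Edet : (fA s * fD s - fB s * fC s)%C = (r * r * dH)%C).
  { transitivity (r * r * dH * (A0 s * D0 s - B0 s * C0 s))%C.
    - unfold fA, fB, fC, fD, dH. ring.
    - rewrite Q. ring. }
  rewrite Edet.
  assert (U1 : (Cconj (r * r * dH) * (r * r * dH))%C = RtoC 1).
  { generalize Hr. generalize (r * r * dH)%C. intros [x y] Hxy.
    pose proof (Cmod2 (x, y)) as M. rewrite Hxy in M. simpl in M.
    apply injective_projections; simpl; lra. }
  assert (Etr : tr_k al be ga
   (r * (h22 * a0 s - h12 * c0 s) * fD s - r * (h22 * b0 s - h12 * d0 s) * fC s)
   (r * (h22 * b0 s - h12 * d0 s) * fA s - r * (h22 * a0 s - h12 * c0 s) * fB s)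
   (r * (h11 * c0 s - h21 * a0 s) * fD s - r * (h11 * d0 s - h21 * b0 s) * fC s)
   (r * (h11 * d0 s - h21 * b0 s) * fA s - r * (h11 * c0 s - h21 * a0 s) * fB s) =
   (r * r * dH * tau0 al be ga s)%C).
  { set (p11 := (a0 s * D0 s - b0 s * C0 s)%C) in *. set (p12 := (b0 s * A0 s - a0 s * B0 s)%C).
    set (p21 := (c0 s * D0 s - d0 s * C0 s)%C). set (p22 := (d0 s * A0 s - c0 s * B0 s)%C) in *.
    transitivity (r * r * tr_k al be ga
      (h11 * (h22 * p11 - h12 * p21) + h21 * (h22 * p12 - h12 * p22))
      (h12 * (h22 * p11 - h12 * p21) + h22 * (h22 * p12 - h12 * p22))
      (h11 * (- h21 * p11 + h11 * p21) + h21 * (- h21 * p12 + h11 * p22))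
      (h12 * (- h21 * p11 + h11 * p21) + h22 * (- h21 * p12 + h11 * p22)))%C.
    - unfold tr_k, fA, fB, fC, fD, p11, p12, p21, p22. field.
    - rewrite T. unfold tau0, tr_k, K11, K12, K21, k11. fold p11 p12 p21. unfold dH in *.
      field. exact N. }
  rewrite Etr. transitivity ((Cconj (r * r * dH) * (r * r * dH)) * tau0 al be ga s)%C; [ring|].
  rewrite U1. ring.
Qed.

Lemma lifted_flux_form al be ga s : HP c s ->
  RT al be ga W e1 s + IT al be ga W e2 s = 2 * Re (tau0 al be ga s) /\
  IT al be ga W e1 s - RT al be ga W e2 s = 2 * Im (tau0 al be ga s).
Proof.
  intros Hs. destruct (lifted_frame_Dc s Hs) as (DA & DB & DC & DD).
  pose proof (frame_flux (HP c) W fA fB fC fD s _ _ _ _ al be ga (open_HP c) lifted_surf lifted_height_pos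
    HW Hs DA DB DC DD) as Q.
  rewrite (tau_lifted_frame al be ga s Hs) in Q.
  destruct (tau0 al be ga s) as [t1 t2].
  pose proof (f_equal fst Q) as Q1. pose proof (f_equal snd Q) as Q2.
  cbn [fst snd Cmult RtoC Re Im] in *. split; [rewrite Q1 | rewrite Q2]; ring.
Qed.

Lemma tau0_Dc al be ga s : HP c s -> exists l, Dc (tau0 al be ga) s l.
Proof.
  intros Hs. destruct Hframe as (HF & _).
  destruct (HF s Hs) as ((DA & DB & DC & DD) & _ & _ & [la La] & [lb Lb] & [lc Lc] & [ld Ld]).
  assert (K : forall u f u' f' x1 x2 x3 x4 k, Dc u s x1 -> Dc f s x2 -> Dc u' s x3 ->
    Dc f' s x4 -> Dc (fun z => k * (u z * f z - u' z * f' z))%C s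
      (k * ((x1 * f s + u s * x2) + - RtoC 1 * (x3 * f' s + u' s * x4)))%C).
  { intros u f u' f' x1 x2 x3 x4 k H1 H2 H3 H4. apply Dc_scal.
    apply (Dc_ext (fun z => u z * f z + (- RtoC 1) * (u' z * f' z))%C). { intros; ring. }
    apply Dc_plus; [now apply Dc_mult | apply Dc_scal; now apply Dc_mult]. }
  eexists. unfold tau0. apply Dc_plus; [apply Dc_plus|].
  - exact (K a0 D0 b0 C0 _ _ _ _ _ La DD Lb DC).
  - exact (K b0 A0 a0 B0 _ _ _ _ _ Lb DA La DB).
  - exact (K c0 D0 d0 C0 _ _ _ _ _ Lc DD Ld DC).
Qed.

(** W is conformal because it has a frame with det dF = 0, and so is the parametrization
    of the end. *)
Lemma Psi_conformal s : HP c s ->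
  hy Psi s = (- Im (hx Psi s), Re (hx Psi s)) \/ hy Psi s = (Im (hx Psi s), - Re (hx Psi s)).
Proof.
  intros Hs. destruct (lifted_frame_Dc s Hs) as (DA & DB & DC & DD).
  pose proof dH_neq0 as N. destruct Hframe as (HF & _). destruct (HF s Hs) as (_ & _ & Q & _).
  destruct (frame_conformal (HP c) W fA fB fC fD s _ _ _ _ (open_HP c) lifted_surf lifted_height_pos
    HW Hs DA DB DC DD) as [G1 G2].
  { transitivity (r * r * dH * (a0 s * d0 s - b0 s * c0 s))%C; [unfold dH; ring|]. rewrite Q. ring. }
  destruct (lifted_partials s Hs) as [E1 E2]. rewrite E1, E2 in G1, G2.
  pose proof (end_height_pos _ (Hdom s Hs)) as P.
  destruct (proj2 (proj2 HC) _ (Hdom s Hs)) as (_ & Hcf & _).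
  destruct (conformal_dot _ _ P Hcf) as (L0 & L1 & L2).
  unfold hyp_inner in G1, G2. rewrite !dot_comb in G1 by auto. rewrite dot_comb in G2 by auto.
  change (snd (W s)) with (snd (param E (Psi s))) in G1, G2.
  set (L := dot (X1 (param E) (Psi s)) (X1 (param E) (Psi s))) in *.
  set (w := snd (param E (Psi s))) in *.
  assert (W2 : 0 < L / w ^ 2) by (apply Rdiv_lt_0_compat; auto; apply pow_lt; auto).
  destruct (hx Psi s) as [a b]. destruct (hy Psi s) as [a' b']. simpl Re in *; simpl Im in *.
  assert (F1 : a * a + b * b = a' * a' + b' * b').
  { apply (Rmult_eq_reg_r (L / w ^ 2)); [|lra]. unfold Rdiv in *. lra. }
  assert (F2 : a * a' + b * b' = 0).
  { apply (Rmult_eq_reg_r (L / w ^ 2)); [|lra]. unfold Rdiv in *. lra. }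
  destruct (Req_dec (a * a + b * b) 0) as [Z|Z].
  - assert (a = 0 /\ b = 0 /\ 0 = 0) as (-> & -> & _) by (apply (sq3_zero a b 0); lra).
    assert (a' = 0 /\ b' = 0 /\ 0 = 0) as (-> & -> & _) by (apply (sq3_zero a' b' 0); lra).
    left. f_equal; ring.
  - assert (S : (a * b' - b * a') ^ 2 = (a * a + b * b) ^ 2).
    { transitivity ((a * a + b * b) * (a' * a' + b' * b') - (a * a' + b * b') ^ 2); [ring|].
      rewrite F2, <- F1. ring. }
    assert (S2 : ((a * b' - b * a') - (a * a + b * b)) * ((a * b' - b * a') + (a * a + b * b)) = 0)
      by (ring_simplify; ring_simplify in S; lra).
    assert (I1 : (a * a + b * b) * a' = - b * (a * b' - b * a')).
    { transitivity (a * (a * a' + b * b') - b * (a * b' - b * a')); [ring|]. rewrite F2. ring. }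
    assert (I2 : (a * a + b * b) * b' = a * (a * b' - b * a')).
    { transitivity (b * (a * a' + b * b') + a * (a * b' - b * a')); [ring|]. rewrite F2. ring. }
    destruct (Rmult_integral _ _ S2) as [S3|S3].
    + left. assert (Q2 : a * b' - b * a' = a * a + b * b) by lra. rewrite Q2 in I1, I2.
      f_equal; apply (Rmult_eq_reg_l (a * a + b * b)); auto; lra.
    + right. assert (Q2 : a * b' - b * a' = - (a * a + b * b)) by lra. rewrite Q2 in I1, I2.
      f_equal; apply (Rmult_eq_reg_l (a * a + b * b)); auto; lra.
Qed.

Lemma Psi_partials_continuous s : HP c s ->
  continuous (fun q => Re (hx Psi q)) s /\ continuous (fun q => Im (hx Psi q)) s /\
  continuous (fun q => Re (hy Psi q)) s /\ continuous (fun q => Im (hy Psi q)) s.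
Proof.
  intros Hs. destruct HPsi as [P1 P2]. refine (conj _ (conj _ (conj _ _))).
  - exact (CK_cont 1 _ _ s (CK_S 1 _ _ P1 e1) Hs).
  - exact (CK_cont 1 _ _ s (CK_S 1 _ _ P2 e1) Hs).
  - exact (CK_cont 1 _ _ s (CK_S 1 _ _ P1 e2) Hs).
  - exact (CK_cont 1 _ _ s (CK_S 1 _ _ P2 e2) Hs).
Qed.

(** The flux form of W is the pull-back of the flux form of the end where Psi
    preserves the orientation; where it would reverse it, both combinations of the
    two halves of the flux form would be closed, and the surface would not be
    immersed. *)
Lemma Psi_holomorphic s : HP c s -> hy Psi s = (- Im (hx Psi s), Re (hx Psi s)).
Proof.
  intros Hs. apply NNPP. intros Nbad.
  pose (dlt := fun q => (Re (hy Psi q) + Im (hx Psi q)) ^ 2 + (Im (hy Psi q) - Re (hx Psi q)) ^ 2).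
  assert (Hbad : forall q, 0 < dlt q -> hy Psi q <> (- Im (hx Psi q), Re (hx Psi q))).
  { intros q Hq Q. unfold dlt in Hq. rewrite Q in Hq. simpl in Hq. lra. }
  assert (Hs0 : 0 < dlt s).
  { unfold dlt. destruct (Req_dec (dlt s) 0) as [Z|Z].
    - exfalso. apply Nbad. unfold dlt in Z.
      assert (Z1 : Re (hy Psi s) + Im (hx Psi s) = 0 /\ Im (hy Psi s) - Re (hx Psi s) = 0 /\ 0 = 0)
        by (apply sq3_zero; lra).
      destruct (hy Psi s), (hx Psi s). simpl in *. f_equal; lra.
    - unfold dlt in Z. pose proof (pow2_ge_0 (Re (hy Psi s) + Im (hx Psi s))).
      pose proof (pow2_ge_0 (Im (hy Psi s) - Re (hx Psi s))). lra. }
  pose (V := fun q => HP c q /\ 0 < dlt q).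
  assert (HV : open V).
  { apply open_pos; [apply open_HP|]. intros q Hq. destruct (Psi_partials_continuous q Hq) as (K1 & K2 & K3 & K4).
    unfold dlt.
    assert (KM : forall f g : plane -> R, continuous f q -> continuous g q -> continuous (fun q => f q * g q) q).
    { intros f g Hf Hg. now apply (continuous_mult f g). }
    apply (continuous_ext (fun q => (Re (hy Psi q) + Im (hx Psi q)) * (Re (hy Psi q) + Im (hx Psi q)) +
      (Im (hy Psi q) - Re (hx Psi q)) * (Im (hy Psi q) - Re (hx Psi q)))).
    { intros q'. match goal with |- ?x = ?y => change (@eq R x y) end. ring. }
    apply (continuous_plus (fun q => (Re (hy Psi q) + Im (hx Psi q)) * (Re (hy Psi q) + Im (hx Psi q)))
      (fun q => (Im (hy Psi q) - Re (hx Psi q)) * (Im (hy Psi q) - Re (hx Psi q)))).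
    - apply KM; apply (continuous_plus (fun q => Re (hy Psi q)) (fun q => Im (hx Psi q))); auto.
    - apply KM; apply (continuous_minus (fun q => Im (hy Psi q)) (fun q => Re (hx Psi q))); auto. }
  assert (HVb : forall q, V q -> hy Psi q = (Im (hx Psi q), - Re (hx Psi q))).
  { intros q [H1 H2]. destruct (Psi_conformal q H1) as [Q|Q]; auto. now apply Hbad in H2. }
  assert (HsV : V s) by (split; auto).
  assert (HPsiV : C2_map V Psi).
  { destruct HPsi as [P1 P2]. split; [apply (CK_sub 2 (HP c)) | apply (CK_sub 2 (HP c))]; auto;
    intros q [? ?]; auto. }
  assert (HdomV : forall q, V q -> dom_star E (Psi q)) by (intros q [? ?]; auto).
  set (X := param E) in *. set (z := Psi s).
  assert (Hz : dom_star E z) by (apply Hdom; auto).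
  (* where Psi reverses the orientation, Im T minus the Hodge dual of Re T pulls back to
     the real part of a holomorphic form, so that it is closed; together with the flux
     form this makes Im T closed *)
  assert (KEY : forall al be ga, dot (cross (X1 X z) (X2 X z)) (Kf al be ga (X z)) = 0).
  { intros al be ga.
    destruct (CK_RT_IT al be ga (dom_star E) X HU HX end_height_pos e1) as [R1 I1].
    destruct (CK_RT_IT al be ga (dom_star E) X HU HX end_height_pos e2) as [R2 I2].
    pose (P := fun q => IT al be ga X e1 q + RT al be ga X e2 q).
    pose (Q := fun q => IT al be ga X e2 q - RT al be ga X e1 q).
    assert (HPQ : C1_form (dom_star E) P Q).
    { split; [exact (CK_plus 1 _ _ _ HU I1 R2) | exact (CK_minus 1 _ _ _ HU I2 R1)]. }
    pose proof (pull_curl (dom_star E) V P Q Psi s HU HV HdomV HPQ HPsiV HsV) as PC.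
    destruct (tau0_Dc al be ga s Hs) as [l Hl].
    destruct (Dc_partial _ _ _ Hl) as (T1 & T2 & T3 & T4).
    assert (EQ : forall q, V q -> pullP P Q Psi q = 2 * Im (tau0 al be ga q) /\
       pullQ P Q Psi q = 2 * Re (tau0 al be ga q)).
    { intros q Hq. destruct (lifted_flux_form al be ga q (proj1 Hq)) as [F1 F2].
      destruct (lifted_partials q (proj1 Hq)) as [E1 E2]. rewrite <- F1, <- F2.
      unfold pullP, pullQ, form, P, Q, RT, IT.
      change (dspace W e1 q) with (X1 W q). change (dspace W e2 q) with (X2 W q).
      rewrite E1, E2, !RTf_comb, !ITf_comb, (HVb q Hq). unfold X1, X2.
      change (W q) with (X (Psi q)). change (param E) with X. simpl. unfold Re, Im. split; ring. }
    assert (C0' : curl (pullP P Q Psi) (pullQ P Q Psi) s = 0).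
    { unfold curl, pdx, pdy.
      rewrite (dir_ext_loc V _ (fun q => 2 * Re (tau0 al be ga q)) s e1 HV (fun q Hq => proj2 (EQ q Hq)) HsV).
      rewrite (dir_ext_loc V _ (fun q => 2 * Im (tau0 al be ga q)) s e2 HV (fun q Hq => proj1 (EQ q Hq)) HsV).
      assert (D2 : forall f : plane -> R, forall v : plane, dir_deriv (fun q => 2 * f q) v s = 2 * dir_deriv f v s).
      { intros f v. unfold dir_deriv. apply Derive_scal. }
      rewrite !D2. unfold pdx, pdy in T1, T4. rewrite T1, T4. ring. }
    rewrite C0' in PC. rewrite (HVb s HsV) in PC.
    change (0 = curl P Q z * (Re (hx Psi s) * - Re (hx Psi s) - Im (hx Psi s) * Im (hx Psi s))) in PC.
    assert (Nx : Re (hx Psi s) * Re (hx Psi s) + Im (hx Psi s) * Im (hx Psi s) <> 0).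
    { intros Z. unfold dlt in Hs0. rewrite (HVb s HsV) in Hs0.
      change (0 < (Im (hx Psi s) + Im (hx Psi s)) ^ 2 + (- Re (hx Psi s) - Re (hx Psi s)) ^ 2) in Hs0.
      assert (Re (hx Psi s) = 0 /\ Im (hx Psi s) = 0 /\ 0 = 0) as (Z1 & Z2 & _) by (apply sq3_zero; lra).
      rewrite Z1, Z2 in Hs0. lra. }
    assert (CC : curl P Q z = 0).
    { apply (Rmult_eq_reg_r (Re (hx Psi s) * Re (hx Psi s) + Im (hx Psi s) * Im (hx Psi s))); auto.
      rewrite Rmult_0_l. lra. }
    pose proof (proj2 (flux_form_closed al be ga _ _ HC) z Hz) as CF.
    change (param E) with X in CF.
    assert (CI : curl (IT al be ga X e1) (IT al be ga X e2) z = 0).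
    { unfold curl, pdx, pdy in *. unfold P, Q in CC. unfold fluxP, fluxQ in CF.
      assert (O1 := CK_opp 1 _ _ HU R1). assert (O2 := CK_opp 1 _ _ HU R2).
      assert (EQ1 : dir_deriv (fun q => IT al be ga X e2 q - RT al be ga X e1 q) e1 z =
        dir_deriv (IT al be ga X e2) e1 z + dir_deriv (fun q => - RT al be ga X e1 q) e1 z)
        by exact (dir_add (dom_star E) _ _ e1 z I2 O1 Hz).
      rewrite EQ1 in CC.
      rewrite (dir_add (dom_star E) _ _ e2 z I1 R2 Hz) in CC.
      rewrite (dir_add (dom_star E) _ _ e1 z R1 I2 Hz), (dir_add (dom_star E) _ _ e2 z O2 I1 Hz) in CF.
      assert (N1 : forall f v, CK 1 (dom_star E) f -> dir_deriv (fun q => - f q) v z = - dir_deriv f v z).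
      { intros f v Hf. apply dir_unique.
        apply (is_derive_opp (fun t : R => f (plus z (scal t v)))).
        exact (dir_is_derive 0 _ f z v Hf Hz). }
      rewrite (N1 _ _ R1) in CC. rewrite (N1 _ _ R2) in CF. lra. }
    rewrite (curl_IT al be ga (dom_star E) X HU HX end_height_pos z Hz) in CI.
    pose proof (end_height_pos z Hz) as Pz. fold X in Pz.
    apply (Rmult_eq_reg_r (/ snd (X z) ^ 3)).
    - rewrite Rmult_0_l. unfold Rdiv in CI. lra.
    - apply Rinv_neq_0_compat, pow_nonzero. lra. }
  pose proof (end_height_pos z Hz) as Pz. fold X in Pz.
  destruct (proj2 (proj2 HC) z Hz) as (_ & Hcf & _). change (param E) with X in Hcf.
  destruct (conformal_dot X z Pz Hcf) as (L0 & L1 & L2).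
  assert (CS : 0 < dot (cross (X1 X z) (X2 X z)) (cross (X1 X z) (X2 X z))).
  { rewrite cross_sq, L2, <- L1. rewrite pow_i by lia. rewrite Rminus_0_r. now apply Rmult_lt_0_compat. }
  (* these three Killing fields span the tangent space *)
  pose proof (KEY (RtoC 0) (RtoC 0) (RtoC 1)) as Y1.
  pose proof (KEY (RtoC 0) (RtoC 0) Ci) as Y2.
  pose proof (KEY (RtoC 0) (RtoC 1) (RtoC 0)) as Y3.
  destruct (cross (X1 X z) (X2 X z)) as [[c1 c2] c3].
  destruct (X z) as [[x y] w]. simpl in Pz.
  unfold dot, Kf, qf, qf' in Y1, Y2, Y3, CS. simpl in Y1, Y2, Y3, CS. unfold Re, Im in *. simpl in *.
  assert (c1 = 0) by lra. assert (c2 = 0) by lra. subst c1 c2.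
  assert (c3 * w = 0) by lra.
  destruct (Rmult_integral _ _ H) as [Z|Z]; [subst c3; lra | lra].
Qed.

Lemma flux_form_pullback al be ga s : HP c s ->
  pullQ (fluxP al be ga (param E)) (fluxQ al be ga (param E)) Psi s = 2 * Re (tau0 al be ga s).
Proof.
  intros Hs. destruct (lifted_flux_form al be ga s Hs) as [F1 F2].
  destruct (lifted_partials s Hs) as [E1 E2]. rewrite <- F1.
  unfold pullQ, form, fluxP, fluxQ, RT, IT.
  change (dspace W e1 s) with (X1 W s). change (dspace W e2 s) with (X2 W s).
  rewrite E1, E2, !RTf_comb, !ITf_comb, (Psi_holomorphic s Hs). unfold X1, X2.
  change (W s) with (param E (Psi s)).
  change (Re (- Im (hx Psi s), Re (hx Psi s))) with (- Im (hx Psi s)).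
  change (Im (- Im (hx Psi s), Re (hx Psi s))) with (Re (hx Psi s)). ring.
Qed.

Lemma Psi_per_x x y : hx Psi (x, y + 2 * PI) = hx Psi (x, y).
Proof.
  apply injective_projections; unfold hx; simpl; unfold pdx, dir_deriv, Derive;
    apply (f_equal real); apply Lim_ext; intros h; simpl;
    change (plus ((x, y + 2 * PI) : plane) (scal (0 + h) e1))
      with ((x + (0 + h) * 1, y + 2 * PI + (0 + h) * 0) : plane);
    change (plus ((x, y + 2 * PI) : plane) (scal 0 e1))
      with ((x + 0 * 1, y + 2 * PI + 0 * 0) : plane);
    change (plus ((x, y) : plane) (scal (0 + h) e1))
      with ((x + (0 + h) * 1, y + (0 + h) * 0) : plane);
    change (plus ((x, y) : plane) (scal 0 e1)) with ((x + 0 * 1, y + 0 * 0) : plane);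
    replace (y + 2 * PI + (0 + h) * 0) with ((y + (0 + h) * 0) + 2 * PI) by ring;
    replace (y + 2 * PI + 0 * 0) with ((y + 0 * 0) + 2 * PI) by ring;
    rewrite !Hper; reflexivity.
Qed.

Lemma Psi_per_y x y : x < c -> hy Psi (x, y + 2 * PI) = hy Psi (x, y).
Proof.
  intros Hx. rewrite !Psi_holomorphic by exact Hx. now rewrite Psi_per_x.
Qed.

Lemma Psi_pullback_period P Q : closed_form (dom_star E) P Q ->
  exists J : R, forall (l v : R -> C) (m : Z),
    (forall t, is_deriveC l t (v t)) -> contC v -> (forall t, HP c (l t)) ->
    l (2 * PI) = vshift (l 0) (2 * PI * IZR m) ->
    RInt (fun t => form (pullP P Q Psi) (pullQ P Q Psi) (l t) (v t)) 0 (2 * PI) = IZR m * J.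
Proof.
  intros HF. apply (half_plane_period c).
  - exact (pull_closed (dom_star E) (HP c) P Q Psi HU (open_HP c) Hdom HF HPsi).
  - intros x y Hx. unfold pullP. now rewrite Hper, Psi_per_x.
  - intros x y Hx. unfold pullQ. now rewrite Hper, Psi_per_y.
Qed.

Lemma vertical_deriv x t : is_deriveC (fun t => (x, t) : C) t (0, 1).
Proof. split; simpl; auto_derive; auto. Qed.

Lemma vertical_cont : contC (fun _ => (0, 1)).
Proof. split; intros t; apply continuous_const. Qed.

Lemma vertical_integral P Q J x :
  (forall (l v : R -> C) (m : Z),
    (forall t, is_deriveC l t (v t)) -> contC v -> (forall t, HP c (l t)) ->
    l (2 * PI) = vshift (l 0) (2 * PI * IZR m) ->
    RInt (fun t => form (pullP P Q Psi) (pullQ P Q Psi) (l t) (v t)) 0 (2 * PI) = IZR m * J) ->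
  x < c -> RInt (fun t => pullQ P Q Psi (x, t)) 0 (2 * PI) = J.
Proof.
  intros H Hx.
  rewrite (RInt_ext _ (fun t => form (pullP P Q Psi) (pullQ P Q Psi) (x, t) (0, 1))).
  - rewrite (H (fun t => (x, t)) (fun _ => (0, 1)) 1%Z); auto.
    + simpl. ring.
    + intros t. apply vertical_deriv.
    + apply vertical_cont.
    + unfold vshift; simpl. f_equal. ring.
  - intros t _. unfold form. simpl. match goal with |- ?a = ?b => change (@eq R a b) end. ring.
Qed.

Lemma Psi_vertical x t : x < c -> is_deriveC (fun t => Psi (x, t)) t (hy Psi (x, t)).
Proof.
  intros Hx. pose proof (map_curve (HP c) Psi (fun t => (x, t)) t (0, 1) (open_HP c) HPsi Hx
    (vertical_deriv x t)) as D.
  cbv beta in D. simpl Re in D. simpl Im in D.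
  replace (hy Psi (x, t)) with
    (0 * Re (hx Psi (x, t)) + 1 * Re (hy Psi (x, t)), 0 * Im (hx Psi (x, t)) + 1 * Im (hy Psi (x, t))).
  - exact D.
  - destruct (hy Psi (x, t)), (hx Psi (x, t)). simpl. f_equal; ring.
Qed.

Lemma Psi_vertical_cont x : x < c -> contC (fun t => hy Psi (x, t)).
Proof.
  intros Hx. split; intros t.
  - apply (cont_y (fun q => Re (hy Psi q))). apply (Psi_partials_continuous (x, t) Hx).
  - apply (cont_y (fun q => Im (hy Psi q))). apply (Psi_partials_continuous (x, t) Hx).
Qed.

Lemma ang_closed_E : closed_form (dom_star E) angP angQ.
Proof.
  destruct ang_closed as [[P1 Q1] Hc].
  assert (S : forall q, dom_star E q -> Cstar q) by (intros q [_ Hq]; exact Hq).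
  split; [split; eapply CK_sub; eauto|]. intros q Hq. apply Hc, S, Hq.
Qed.

Definition sqn (q : plane) : R := Re (Psi q) * Re (Psi q) + Im (Psi q) * Im (Psi q).

Lemma sqn_pos q : HP c q -> 0 < sqn q.
Proof. intros Hq. apply Cstar_pos. apply (Hdom q Hq). Qed.

Lemma CK_ln_sqn : CK 1 (HP c) (fun q => ln (sqn q)).
Proof.
  destruct HPsi as [P1 P2]. assert (Q1 := CK_pred 1 _ _ P1). assert (Q2 := CK_pred 1 _ _ P2).
  assert (HO := open_HP c).
  apply (CK_comp1 1 (HP c) sqn posR ln HO sqn_pos (CK_ln 1)).
  exact (CK_plus 1 _ _ _ HO (CK_mult 1 _ _ _ HO Q1 Q1) (CK_mult 1 _ _ _ HO Q2 Q2)).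
Qed.

(** Cauchy-Riemann: the radial derivative of log |Psi|^2 is twice the angular speed. *)
Lemma pdx_ln_sqn q : HP c q -> pdx (fun q => ln (sqn q)) q = 2 * pullQ angP angQ Psi q.
Proof.
  intros Hq. destruct HPsi as [P1 P2]. assert (Q1 := CK_pred 1 _ _ P1). assert (Q2 := CK_pred 1 _ _ P2).
  pose proof (sqn_pos q Hq) as Pq. destruct q as [x y].
  assert (D1 := plane_x _ x y (CK_ex 0 _ _ _ e1 Q1 Hq)).
  assert (D2 := plane_x _ x y (CK_ex 0 _ _ _ e1 Q2 Hq)).
  apply (pdx_val (fun q => ln (sqn q))).
  unfold pullQ, form, angP, angQ. rewrite (Psi_holomorphic _ Hq).
  change (Re (- Im (hx Psi (x, y)), Re (hx Psi (x, y)))) with (- pdx (fun q => Im (Psi q)) (x, y)).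
  change (Im (- Im (hx Psi (x, y)), Re (hx Psi (x, y)))) with (pdx (fun q => Re (Psi q)) (x, y)).
  fold (sqn (x, y)). unfold sqn in *.
  set (u := fun t : R => Re (Psi (t, y))) in *. set (w := fun t : R => Im (Psi (t, y))) in *.
  change (Re (Psi (x, y))) with (u x) in *. change (Im (Psi (x, y))) with (w x) in *.
  assert (E1 : ex_derive u x) by (eexists; exact D1).
  assert (E2 : ex_derive w x) by (eexists; exact D2).
  assert (F1 : Derive (fun t : R => u t) x = pdx (fun q => Re (Psi q)) (x, y))
    by (now apply is_derive_unique).
  assert (F2 : Derive (fun t : R => w t) x = pdx (fun q => Im (Psi q)) (x, y))
    by (now apply is_derive_unique).
  apply (is_derive_ext (fun t : R => ln (u t * u t + w t * w t))). { reflexivity. }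
  evar_last.
  { auto_derive; [repeat split; auto | reflexivity]. }
  rewrite F1, F2. field. lra.
Qed.

(** The winding number of Psi around the puncture is positive because |Psi| tends
    to zero: the mean of log |Psi| over a period grows linearly with it. *)
Lemma Psi_winding_pos m J : J = 2 * PI * IZR m ->
  (forall x, x < c -> RInt (fun t => pullQ angP angQ Psi (x, t)) 0 (2 * PI) = J) -> (1 <= m)%Z.
Proof.
  intros HJ HV. pose proof PI_RGT_0 as HPI.
  pose (M := fun x : R => RInt (fun t => ln (sqn (x, t))) 0 (2 * PI)).
  assert (DM : forall x, x < c -> is_derive M x (2 * J)).
  { intros x Hx.
    pose proof (is_derive_RInt_y (HP c) (fun q => ln (sqn q)) x 0 (2 * PI) ltac:(lra)
      (open_HP c) CK_ln_sqn (fun t _ => Hx)) as D.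
    assert (EQ : RInt (fun t => pdx (fun q => ln (sqn q)) (x, t)) 0 (2 * PI) = 2 * J).
    { rewrite <- (HV x Hx).
      transitivity (RInt (fun t => scal 2 (pullQ angP angQ Psi (x, t))) 0 (2 * PI)).
      - apply RInt_ext. intros t _. exact (pdx_ln_sqn (x, t) Hx).
      - apply (RInt_scal (V := R_CompleteNormedModule)).
        apply ex_RInt_y; [lra|]. intros t _.
        destruct (pull_closed (dom_star E) (HP c) angP angQ Psi HU (open_HP c) Hdom ang_closed_E HPsi)
          as [[_ CQ] _].
        exact (CK_cont 1 _ _ (x, t) CQ Hx). }
    rewrite EQ in D. exact D. }
  assert (CM : forall x y, x < c -> y < c -> M x - 2 * J * x = M y - 2 * J * y).
  { intros x y Hx Hy.
    apply (is_derive_0_const (fun x => M x - 2 * J * x) (fun x => x < c)); auto.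
    - intros; lra.
    - intros z Hz. replace 0 with (2 * J - 2 * J) by ring.
      apply (is_derive_minus M (fun x => 2 * J * x)); [now apply DM|].
      auto_derive; auto; ring. }
  destruct (Z_le_dec 1 m) as [|Hm]; auto. exfalso.
  assert (J0 : J <= 0).
  { rewrite HJ. assert (IZR m <= 0) by (apply IZR_le; lia). nra. }
  pose (K := (M (c - 1) - 1) / (2 * PI)).
  destruct (tends0 Psi Hlim (mkposreal _ (exp_pos (K / 2)))) as [x0 Hx0]. simpl in Hx0.
  pose (x := Rmin x0 (c - 1) - 1).
  assert (Hx : x < x0 /\ x < c - 1).
  { unfold x. pose proof (Rmin_l x0 (c - 1)). pose proof (Rmin_r x0 (c - 1)). lra. }
  assert (MK : M x <= 2 * PI * K).
  { unfold M. apply Rle_trans with (RInt (fun _ => K) 0 (2 * PI)).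
    - apply RInt_le; [lra | | |].
      + apply (ex_RInt_y (fun q => ln (sqn q))); [lra|]. intros t _.
        apply (CK_cont 1 _ _ (x, t) CK_ln_sqn). unfold HP; simpl; lra.
      + apply ex_RInt_const.
      + intros t _. assert (Hq : HP c (x, t)) by (unfold HP; simpl; lra).
        specialize (Hx0 (x, t) (proj1 Hx)).
        assert (Q : sqn (x, t) = Cmod (Psi (x, t)) ^ 2) by (rewrite Cmod2; unfold sqn; ring).
        pose proof (sqn_pos _ Hq) as P. rewrite <- (ln_exp K). left. apply ln_increasing; auto.
        rewrite Q. replace (exp K) with (exp (K / 2) ^ 2).
        2:{ simpl. rewrite Rmult_1_r, <- exp_plus. f_equal. field. }
        pose proof (Cmod_ge_0 (Psi (x, t))). pose proof (exp_pos (K / 2)). nra.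
    - rewrite RInt_const. unfold scal; simpl. unfold mult; simpl. lra. }
  assert (E2 := CM x (c - 1) ltac:(lra) ltac:(lra)).
  assert (2 * PI * K = M (c - 1) - 1) by (unfold K; field; lra).
  nra.
Qed.

Lemma end_punctured_disc : exists R0 : posreal, forall z : C, Cmod z < R0 -> z <> RtoC 0 -> dom_star E z.
Proof.
  pose proof HE as (HO & H0 & _). destruct (disc_in_open (dom E) HO H0) as [R0 HR].
  exists R0. intros z Hz Hz0. split; auto.
Qed.

(** The image under psi' of a small circle lifts to a path that Psi maps back to the
    circle; hence its winding number times that of Psi is one, and the latter is
    positive. *)
Lemma Psi_winding x : x < c -> winds (fun t => Psi (x, t)) 1.
Proof.
  intros Hx. pose proof PI_RGT_0 as HPI.
  destruct (Psi_pullback_period angP angQ ang_closed_E) as [J HJ].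
  assert (HV : forall x, x < c -> RInt (fun t => pullQ angP angQ Psi (x, t)) 0 (2 * PI) = J).
  { intros y Hy. now apply vertical_integral. }
  assert (HM : forall x, x < c -> exists m, winds (fun t => Psi (x, t)) m /\ J = 2 * PI * IZR m).
  { intros y Hy.
    destruct (winds_exists (fun t => Psi (y, t)) (fun t => hy Psi (y, t))) as [m Hm].
    - intros t. now apply Psi_vertical.
    - now apply Psi_vertical_cont.
    - intros t. apply (Hdom (y, t) Hy).
    - rewrite <- (Hper y 0). f_equal. f_equal. ring.
    - exists m. split; auto. rewrite <- (HV y Hy).
      rewrite <- (ang_winds _ (fun t => hy Psi (y, t)) m Hm).
      + reflexivity.
      + intros t. now apply Psi_vertical. }
  destruct (HM x Hx) as (m & Wm & Jm). replace 1%Z with m; auto.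
  pose proof (Psi_winding_pos m J Jm HV) as Hm.
  destruct end_punctured_disc as [R0 HR0].
  destruct (Hlim' (mkposreal _ (exp_pos c))) as [d Hd]. simpl in Hd.
  pose (rho := Rmin R0 d / 2).
  assert (Hrho : 0 < rho /\ rho < R0 /\ rho < d).
  { unfold rho. assert (0 < Rmin R0 d) by (apply Rmin_glb_lt; [apply R0 | apply d]).
    pose proof (Rmin_l R0 d). pose proof (Rmin_r R0 d). lra. }
  pose (L := circle rho 1).
  assert (HL : forall t, dom_star E (L t) /\ Cmod (L t) < d).
  { intros t. unfold L. split; [apply HR0; [rewrite Cmod_circle; lra | apply circle_neq0; lra]|].
    rewrite Cmod_circle; lra. }
  assert (DL : forall t, is_deriveC L t (Cmult (0, IZR 1) (L t))) by (intros; apply circle_deriv).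
  pose proof (fun t => map_curve _ psi' L t _ HU Hpsi' (proj1 (HL t)) (DL t)) as DP.
  pose proof (map_curve_cont _ psi' L _ HU Hpsi' (fun t => proj1 (HL t)) DL (circle_cont rho 1)) as CP.
  destruct (winds_exists (fun t => psi' (L t)) _ DP CP) as [n (l & v & Hl & Hn)].
  { intros t. apply (Hinv _ (proj1 (HL t))). }
  { f_equal. unfold L. rewrite <- (circle_per rho 1 0). f_equal. ring. }
  assert (Hlc : forall t, HP c (l t)).
  { intros t. destruct (HL t) as [H1 H2]. specialize (Hd _ H1 H2).
    rewrite <- (proj2 (proj2 Hl) t), Cmod_cexp in Hd. now apply exp_lt_inv in Hd. }
  assert (HPl : forall t, Psi (l t) = L t).
  { intros t. apply (proj2 (Hinv _ (proj1 (HL t)))); auto. apply (proj2 (proj2 Hl)). }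
  pose proof (HJ l v n (proj1 Hl) (proj1 (proj2 Hl)) Hlc Hn) as HJn.
  assert (EQ : RInt (fun t => form (pullP angP angQ Psi) (pullQ angP angQ Psi) (l t) (v t)) 0 (2 * PI) =
    2 * PI * IZR 1).
  { rewrite <- (ang_winds L (fun t => Cmult (0, IZR 1) (L t)) 1); auto.
    2:{ apply circle_winds; lra. }
    apply RInt_ext. intros t _.
    pose proof (map_curve (HP c) Psi l t (v t) (open_HP c) HPsi (Hlc t) (proj1 Hl t)) as D.
    assert (D2 : is_deriveC (fun s => Psi (l s)) t (Cmult (0, IZR 1) (L t))).
    { apply (is_deriveC_ext L); auto. }
    rewrite (is_deriveC_unique _ _ _ _ D2 D). rewrite <- HPl.
    unfold form, pullP, pullQ, form. simpl. unfold Re, Im. simpl.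
    match goal with |- ?a = ?b => change (@eq R a b) end. ring. }
  rewrite HJn, Jm in EQ.
  assert (NM : (n * m)%Z = 1%Z).
  { apply eq_IZR. rewrite mult_IZR. apply (Rmult_eq_reg_l (2 * PI)); [|lra].
    rewrite <- EQ. ring. }
  assert (n = 1%Z \/ n <= 0 \/ 2 <= n)%Z by lia. nia.
Qed.

(** The function exp(-s) has mean zero over a period, so that the pole of the
    holomorphic form does not contribute. *)
Lemma vertical_exp_integral (k : C) x :
  (forall t : R, continuous (fun t => Re (k / cexp (x, t))%C) t) /\
  RInt (fun t => Re (k / cexp (x, t))%C) 0 (2 * PI) = 0.
Proof.
  destruct k as [k1 k2].
  assert (EQ : forall t, Re ((k1, k2) / cexp (x, t))%C = exp (- x) * (k1 * cos (- t) - k2 * sin (- t))).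
  { intros t. replace ((k1, k2) / cexp (x, t))%C with ((k1, k2) * cexp (Copp (x, t)))%C.
    - unfold cexp. simpl. ring.
    - apply (Cmult_cancel (cexp (x, t))); [|apply cexp_neq0].
      transitivity ((k1, k2) * (cexp (x, t) * cexp (- (x, t))))%C; [ring|].
      rewrite cexp_opp. field. apply cexp_neq0. }
  assert (CT : forall t : R, continuous (fun t => Re ((k1, k2) / cexp (x, t))%C) t).
  { intros t. apply (continuous_ext (fun t => exp (- x) * (k1 * cos (- t) - k2 * sin (- t)))).
    { intros s. now rewrite EQ. }
    apply (ex_derive_continuous (fun t => exp (- x) * (k1 * cos (- t) - k2 * sin (- t)))).
    auto_derive; auto. }
  split; auto.
  transitivity (exp (- x) * (- k1 * sin (- (2 * PI)) - k2 * cos (- (2 * PI))) -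
    exp (- x) * (- k1 * sin (- 0) - k2 * cos (- 0))).
  - apply is_RInt_unique.
    apply (is_RInt_derive (V := R_CompleteNormedModule)
      (fun t => exp (- x) * (- k1 * sin (- t) - k2 * cos (- t)))).
    + intros t _. rewrite EQ. auto_derive; auto. ring.
    + intros t _. apply CT.
  - rewrite Ropp_0, sin_neg, cos_neg, sin_2PI, cos_2PI, sin_0, cos_0.
    match goal with |- ?a = ?b => change (@eq R a b) end. ring.
Qed.

(** The period of the flux form, as the limit of the integral over small circles. *)
Lemma flux_period_value al be ga J :
  (forall x, x < c -> RInt (fun t => pullQ (fluxP al be ga (param E)) (fluxQ al be ga (param E))
     Psi (x, t)) 0 (2 * PI) = J) ->
  J = 8 * PI * kappa * Re (K11 al be ga).
Proof.
  intros HJ. pose proof PI_RGT_0 as HPI.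
  destruct Hframe as (_ & T11 & T12 & q0 & T21).
  set (k := (K12 al be ga * q0)%C).
  assert (TG : tends (fun s => tau0 al be ga s - k / cexp s)%C (RtoC 2 * K11 al be ga * RtoC kappa)%C).
  { apply (tends_ext (fun s => RtoC 2 * K11 al be ga * (a0 s * D0 s - b0 s * C0 s) +
      K21 al be ga * (b0 s * A0 s - a0 s * B0 s) +
      K12 al be ga * (c0 s * D0 s - d0 s * C0 s - q0 / cexp s))%C).
    { intros s. unfold tau0, k. field. apply cexp_neq0. }
    replace (RtoC 2 * K11 al be ga * RtoC kappa)%C with
      (RtoC 2 * K11 al be ga * RtoC kappa + K21 al be ga * RtoC 0 + K12 al be ga * RtoC 0)%C by ring.
    apply tends_plus; [apply tends_plus|]; apply tends_mult; auto; apply tends_const. }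
  assert (Ev : Re (RtoC 2 * K11 al be ga * RtoC kappa)%C = 2 * kappa * Re (K11 al be ga)).
  { destruct (K11 al be ga). simpl. ring. }
  set (v := Re (RtoC 2 * K11 al be ga * RtoC kappa)%C) in *.
  assert (G : forall eps : posreal, Rabs (J - 2 * PI * (2 * v)) <= 2 * PI * (2 * eps)).
  { intros eps. destruct (TG eps) as [x0 Hx0].
    pose (x := Rmin x0 c - 1).
    assert (Hx : x < x0 /\ x < c).
    { unfold x. pose proof (Rmin_l x0 c). pose proof (Rmin_r x0 c). lra. }
    rewrite <- (HJ x (proj2 Hx)).
    destruct (vertical_exp_integral k x) as [Ck Ik].
    assert (HF := flux_form_closed al be ga _ _ HC).
    destruct (pull_closed (dom_star E) (HP c) _ _ Psi HU (open_HP c) Hdom HF HPsi) as [[_ CQ] _].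
    set (f := fun t => pullQ (fluxP al be ga (param E)) (fluxQ al be ga (param E)) Psi (x, t)).
    assert (EX : ex_RInt f 0 (2 * PI)).
    { apply ex_RInt_y; [lra|]. intros t _. exact (CK_cont 1 _ _ (x, t) CQ (proj2 Hx)). }
    assert (EK : ex_RInt (fun t => Re (k / cexp (x, t))%C) 0 (2 * PI)).
    { apply (ex_RInt_continuous (V := R_CompleteNormedModule)). intros; apply Ck. }
    assert (EK2 : ex_RInt (fun t => 2 * Re (k / cexp (x, t))%C) 0 (2 * PI)).
    { apply (ex_RInt_scal (V := R_CompleteNormedModule)); auto. }
    assert (EC : ex_RInt (fun _ : R => 2 * v) 0 (2 * PI)) by apply ex_RInt_const.
    assert (ED : ex_RInt (fun t => f t - 2 * Re (k / cexp (x, t))%C - 2 * v) 0 (2 * PI)).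
    { apply (ex_RInt_minus (V := R_CompleteNormedModule) (fun t => f t - 2 * Re (k / cexp (x, t))%C)); auto.
      apply (ex_RInt_minus (V := R_CompleteNormedModule) f); auto. }
    replace (RInt f 0 (2 * PI) - 2 * PI * (2 * v)) with
      (RInt (fun t => f t - 2 * Re (k / cexp (x, t))%C - 2 * v) 0 (2 * PI)).
    - apply Rle_trans with ((2 * PI - 0) * (2 * eps)).
      + apply abs_RInt_le_const; [lra | auto |]. intros t _.
        unfold f. rewrite (flux_form_pullback al be ga (x, t) (proj2 Hx)).
        specialize (Hx0 (x, t) (proj1 Hx)).
        replace (2 * Re (tau0 al be ga (x, t)) - 2 * Re (k / cexp (x, t))%C - 2 * v) with
          (2 * Re (tau0 al be ga (x, t) - k / cexp (x, t) - RtoC 2 * K11 al be ga * RtoC kappa)%C)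
          by (unfold v; simpl; unfold Re; simpl; ring).
        rewrite Rabs_mult, Rabs_pos_eq by lra. apply Rmult_le_compat_l; [lra|].
        left. eapply Rle_lt_trans; [|exact Hx0].
        eapply Rle_trans; [|apply Rmax_Cmod]. apply Rmax_l.
      + apply Req_le. ring.
    - etransitivity; [apply (RInt_minus (V := R_CompleteNormedModule)); auto;
        apply (ex_RInt_minus (V := R_CompleteNormedModule) f); auto|].
      rewrite (RInt_minus (V := R_CompleteNormedModule) f) by auto.
      rewrite (RInt_scal (V := R_CompleteNormedModule) (fun t => Re (k / cexp (x, t))%C)) by auto.
      rewrite Ik, RInt_const. unfold minus, plus, opp, scal; simpl. unfold mult; simpl. ring. }
  transitivity (2 * PI * (2 * v)).
  2:{ rewrite Ev. match goal with |- ?a = ?b => change (@eq R a b) end. ring. }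
  apply NNPP. intros N.
  assert (P : 0 < Rabs (J - 2 * PI * (2 * v))) by (apply Rabs_pos_lt; lra).
  assert (P2 : 0 < Rabs (J - 2 * PI * (2 * v)) / (8 * PI)) by (apply Rdiv_lt_0_compat; lra).
  specialize (G (mkposreal _ P2)). simpl in G.
  replace (2 * PI * (2 * (Rabs (J - 2 * PI * (2 * v)) / (8 * PI)))) with
    (Rabs (J - 2 * PI * (2 * v)) / 2) in G by (field; lra). lra.
Qed.

(** Psi winds once around the puncture, so that the period of the flux form around the
    puncture is its integral over a vertical period. *)
Lemma flux_of_frame al be ga (Y : space -> space) :
  (forall p, H3 p -> Y p = Kf al be ga p) ->
  is_flux E Y (- (8 * PI * kappa * Re (K11 al be ga))).
Proof.
  intros HY. assert (HF := flux_form_closed al be ga _ _ HC).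
  destruct end_punctured_disc as [R0 HR0].
  destruct (loop_period (dom_star E) _ _ (ln R0) HU HF) as [J HJ].
  { intros s Hs. apply HR0; [|apply cexp_neq0]. rewrite Cmod_cexp.
    rewrite <- (exp_ln R0) by apply R0. now apply exp_increasing. }
  destruct (Psi_pullback_period _ _ HF) as [JP HJP].
  assert (HV : forall x, x < c -> RInt (fun t => pullQ (fluxP al be ga (param E))
     (fluxQ al be ga (param E)) Psi (x, t)) 0 (2 * PI) = JP).
  { intros x Hx. now apply vertical_integral. }
  rewrite <- (flux_period_value al be ga JP HV).
  assert (EJ : J = JP).
  { destruct (tends0 Psi Hlim R0) as [x0 Hx0].
    pose (x := Rmin x0 c - 1).
    assert (Hx : x < x0 /\ x < c).
    { unfold x. pose proof (Rmin_l x0 c). pose proof (Rmin_r x0 c). lra. }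
    rewrite <- (HV x (proj2 Hx)).
    pose proof (HJ (fun t => Psi (x, t)) (fun t => hy Psi (x, t)) 1%Z (Psi_winding x (proj2 Hx))) as Q.
    rewrite Rmult_1_l in Q. rewrite <- Q.
    - reflexivity.
    - intros t. apply Psi_vertical. apply Hx.
    - intros t. rewrite exp_ln by apply R0. exact (Hx0 (x, t) (proj1 Hx)). }
  rewrite <- EJ. apply (flux_period al be ga E Y (ln R0) J HE HY HJ).
Qed.

End Core.

(** * Isometries are linear in the hyperboloid model *)

Definition b1 : space := vec 1 0 0.
Definition b2 : space := vec 0 1 0.
Definition b3 : space := vec 0 0 1.
Definition basis (a : space) : Prop := a = b1 \/ a = b2 \/ a = b3.

Lemma open_H3 : open H3.
Proof.
  apply (open_comp (snd : space -> R) (fun x => 0 < x)).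
  - intros x _. apply continuous_snd.
  - apply (open_gt 0).
Qed.

(** Restriction to a plane, used to reduce the symmetry of second derivatives in space
    to the plane. *)
Definition slice {V : NormedModule R_AbsRing} (p a b : V) (q : plane) : V :=
  plus p (plus (scal (fst q) a) (scal (snd q) b)).

Lemma slice_line {V : NormedModule R_AbsRing} (p a b : V) (q v : plane) (t : R) :
  slice p a b (plus q (scal t v)) =
  plus (slice p a b q) (scal t (plus (scal (fst v) a) (scal (snd v) b))).
Proof.
  unfold slice. destruct q as [x y], v as [c d].
  change (plus ((x, y) : plane) (scal t ((c, d) : plane))) with ((x + t * c, y + t * d) : plane).
  simpl fst; simpl snd.
  replace (scal (x + t * c) a) with (plus (scal x a) (scal t (scal c a))).
  2:{ rewrite scal_assoc. symmetry. apply (@scal_distr_r R_AbsRing V). }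
  replace (scal (y + t * d) b) with (plus (scal y b) (scal t (scal d b))).
  2:{ rewrite scal_assoc. symmetry. apply (@scal_distr_r R_AbsRing V). }
  rewrite scal_distr_l. rewrite <- !plus_assoc. f_equal. f_equal.
  rewrite !plus_assoc. f_equal. apply plus_comm.
Qed.

Lemma slice_cont {V : NormedModule R_AbsRing} (p a b : V) q : continuous (slice p a b) q.
Proof.
  apply (continuous_plus (fun _ : plane => p)); [apply continuous_const|].
  apply (continuous_plus (fun q : plane => scal (fst q) a) (fun q : plane => scal (snd q) b)).
  - apply (continuous_scal_l (fun q : plane => fst q) a). apply continuous_fst.
  - apply (continuous_scal_l (fun q : plane => snd q) b). apply continuous_snd.
Qed.

Lemma CK_slice {V : NormedModule R_AbsRing} n : forall (U : V -> Prop) (f : V -> R) (p a b : V),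
  CK n U f -> CK n (fun q => U (slice p a b q)) (fun q => f (slice p a b q)).
Proof.
  induction n as [|n IH]; intros U f p a b Hf; split.
  1,3: intros q Hq; apply (continuous_comp (slice p a b) f);
    [apply slice_cont | exact (CK_cont _ U f _ Hf Hq)].
  - exact I.
  - split.
    + intros q v Hq. destruct (CK_ex n U f _ (plus (scal (fst v) a) (scal (snd v) b)) Hf Hq) as [l Hl].
      exists l. apply (is_derive_ext (fun t : R =>
        f (plus (slice p a b q) (scal t (plus (scal (fst v) a) (scal (snd v) b)))))); auto.
      intros t. now rewrite slice_line.
    + intros v.
      assert (E : dir_deriv (fun q => f (slice p a b q)) v =
        fun q => dir_deriv f (plus (scal (fst v) a) (scal (snd v) b)) (slice p a b q)).
      { apply functional_extensionality. intros q.
        apply Derive_ext. intros t. now rewrite slice_line. }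
      rewrite E. apply IH. now apply CK_S.
Qed.

Lemma dir_sym (U : space -> Prop) (f : space -> R) a b p : open U -> CK 2 U f -> U p ->
  dir_deriv (dir_deriv f a) b p = dir_deriv (dir_deriv f b) a p.
Proof.
  intros HU Hf Hp.
  assert (S0 : slice p a b (0, 0) = p).
  { destruct p as [[x y] z], a as [[x' y'] z'], b as [[u v] w]. apply space_eq.
    - change (x + (0 * x' + 0 * u) = x). ring.
    - change (y + (0 * y' + 0 * v) = y). ring.
    - change (z + (0 * z' + 0 * w) = z). ring. }
  pose proof (CK_slice 2 U f p a b Hf) as G.
  assert (HO : open (fun q => U (slice p a b q))).
  { apply open_comp; auto. intros; apply slice_cont. }
  assert (D : forall g : space -> R, forall v : plane, dir_deriv (fun q => g (slice p a b q)) v =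
        fun q => dir_deriv g (plus (scal (fst v) a) (scal (snd v) b)) (slice p a b q)).
  { intros g v. apply functional_extensionality. intros q.
    apply Derive_ext. intros t. now rewrite slice_line. }
  assert (Ea : plus (scal (fst e1) a) (scal (snd e1) b) = a).
  { destruct a as [[x' y'] z'], b as [[u v] w]. apply space_eq.
    - change (1 * x' + 0 * u = x'). ring.
    - change (1 * y' + 0 * v = y'). ring.
    - change (1 * z' + 0 * w = z'). ring. }
  assert (Eb : plus (scal (fst e2) a) (scal (snd e2) b) = b).
  { destruct a as [[x' y'] z'], b as [[u v] w]. apply space_eq.
    - change (0 * x' + 1 * u = u). ring.
    - change (0 * y' + 1 * v = v). ring.
    - change (0 * z' + 1 * w = w). ring. }
  pose proof (pdx_pdy _ _ (0, 0) HO G) as K. cbv beta in K. rewrite S0 in K. specialize (K Hp).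
  change (dir_deriv (dir_deriv (fun q => f (slice p a b q)) e1) e2 (0, 0) =
    dir_deriv (dir_deriv (fun q => f (slice p a b q)) e2) e1 (0, 0)) in K || idtac.
  change (dir_deriv (dir_deriv (fun q => f (slice p a b q)) e2) e1 (0, 0) =
    dir_deriv (dir_deriv (fun q => f (slice p a b q)) e1) e2 (0, 0)) in K || idtac.
  rewrite (D f e1), (D f e2), Ea, Eb, (D (dir_deriv f a) e2), (D (dir_deriv f b) e1), Ea, Eb, S0 in K.
  auto.
Qed.

(** Coefficients of a linear function of the hyperboloid model, in the coordinates (1,
    x, y, |p|^2) / w. *)
Record vec4 : Type := V4 { t0 : R; t1 : R; t2 : R; t3 : R }.

(** These functions satisfy Hess n = n g. *)
Definition nf (k : vec4) (p : space) : R :=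
  (t0 k + t1 k * Re (fst p) + t2 k * Im (fst p) + t3 k * dot p p) * / snd p.
Definition dnf (k : vec4) (p x : space) : R :=
  (t1 k * Re (fst x) + t2 k * Im (fst x) + t3 k * (2 * dot p x)) * / snd p
  - nf k p * (snd x * / snd p).

Lemma nf_curve k (c : R -> space) t v : 0 < snd (c t) -> is_deriveS c t v ->
  is_derive (fun s => nf k (c s)) t (dnf k (c t) v).
Proof.
  intros Hp (H1 & H2 & H3).
  destruct v as [[x y] z]. simpl in H1, H2, H3.
  set (u := fun s => Re (fst (c s))) in *. set (v := fun s => Im (fst (c s))) in *.
  set (w := fun s => snd (c s)) in *.
  derivative H1 u t F1.
  derivative H2 v t F2.
  derivative H3 w t F3.
  assert (W : w t <> 0) by (apply Rgt_not_eq; exact Hp).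
  apply (is_derive_ext (fun s : R => (t0 k + t1 k * u s + t2 k * v s +
    t3 k * (u s * u s + v s * v s + w s * w s)) * / w s)). { reflexivity. }
  evar_last.
  { auto_derive; [repeat split; auto | reflexivity]. }
  rewrite F1, F2, F3.
  change (dnf k (c t) (x, y, z)) with
    ((t1 k * x + t2 k * y + t3 k * (2 * (u t * x + v t * y + w t * z))) * / w t
     - (t0 k + t1 k * u t + t2 k * v t + t3 k * (u t * u t + v t * v t + w t * w t)) * / w t
       * (z * / w t)).
  field. auto.
Qed.

(** The first term is Hess n = n g; the Christoffel term makes the derivative covariant.
    *)
Lemma dnf_curve k (c x : R -> space) t c' x' : 0 < snd (c t) ->
  is_deriveS c t c' -> is_deriveS x t x' ->
  is_derive (fun s => dnf k (c s) (x s)) t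
    (nf k (c t) * dot (x t) c' * / snd (c t) ^ 2 + dnf k (c t) (plus x' (christoffel (c t) (x t) c'))).
Proof.
  intros Hp (H1 & H2 & H3) (H4 & H5 & H6).
  destruct c' as [[u' v'] w'], x' as [[p' q'] r'].
  simpl in H1, H2, H3, H4, H5, H6.
  set (u := fun s => Re (fst (c s))) in *. set (v := fun s => Im (fst (c s))) in *.
  set (w := fun s => snd (c s)) in *.
  set (p := fun s => Re (fst (x s))) in *. set (q := fun s => Im (fst (x s))) in *.
  set (r := fun s => snd (x s)) in *.
  derivative H1 u t F1.
  derivative H2 v t F2.
  derivative H3 w t F3.
  derivative H4 p t F4.
  derivative H5 q t F5.
  derivative H6 r t F6.
  assert (W : w t <> 0) by (apply Rgt_not_eq; exact Hp).
  apply (is_derive_ext (fun s : R =>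
    (t1 k * p s + t2 k * q s + t3 k * (2 * (u s * p s + v s * q s + w s * r s))) * / w s
     - (t0 k + t1 k * u s + t2 k * v s + t3 k * (u s * u s + v s * v s + w s * w s)) * / w s
       * (r s * / w s))). { reflexivity. }
  evar_last.
  { auto_derive; [repeat split; auto | reflexivity]. }
  rewrite F1, F2, F3, F4, F5, F6.
  set (z1 := p' + / w t * (- r t * u' + - w' * p t + 0)).
  set (z2 := q' + / w t * (- r t * v' + - w' * q t + 0)).
  set (z3 := r' + / w t * (- r t * w' + - w' * r t + (p t * u' + q t * v' + r t * w'))).
  change (nf k (c t)) with
    ((t0 k + t1 k * u t + t2 k * v t + t3 k * (u t * u t + v t * v t + w t * w t)) * / w t).
  change (dnf k (c t) _) with
    ((t1 k * z1 + t2 k * z2 + t3 k * (2 * (u t * z1 + v t * z2 + w t * z3))) * / w t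
     - (t0 k + t1 k * u t + t2 k * v t + t3 k * (u t * u t + v t * v t + w t * w t)) * / w t
       * (z3 * / w t)).
  change (dot (x t) (u', v', w')) with (p t * u' + q t * v' + r t * w').
  change (snd (c t)) with (w t). unfold z1, z2, z3. field. auto.
Qed.

Lemma dnf_lin k p a b x y : dnf k p (comb a b x y) = a * dnf k p x + b * dnf k p y.
Proof.
  rewrite comb_eq. unfold dnf, dot, vec. simpl. unfold Re, Im; simpl. ring.
Qed.

Section Isometry.
Variable phi : space -> space.
Hypothesis Hphi : isometry phi.

Let F (a : space) : space -> space := dspace phi a.

Lemma iso_H3 p : H3 p -> 0 < snd (phi p).
Proof. intros Hp. exact (proj1 Hphi p Hp). Qed.

Lemma iso_CK : forall n, CKS n H3 phi.
Proof.
  intros n. destruct Hphi as (_ & _ & HS & _).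
  refine (conj _ (conj _ _)); apply CK_of_Ck; intros m; apply (HS m).
Qed.

Lemma iso_CK_F n a : CKS n H3 (F a).
Proof.
  destruct (iso_CK (S n)) as (A & B & D).
  exact (conj (CK_S n H3 _ A a) (conj (CK_S n H3 _ B a) (CK_S n H3 _ D a))).
Qed.

Let s2 (p : space) : R := (snd (phi p) * / snd p) ^ 2.

Lemma s2_pos p : H3 p -> 0 < s2 p.
Proof.
  intros Hp. unfold s2. apply pow_lt, Rmult_lt_0_compat; [now apply iso_H3|].
  now apply Rinv_0_lt_compat.
Qed.

Lemma iso_metric a b p : H3 p -> dot (F a p) (F b p) = s2 p * dot a b.
Proof.
  intros Hp. destruct Hphi as (_ & _ & _ & HM). specialize (HM p a b Hp).
  unfold hyp_inner in HM. pose proof (iso_H3 p Hp) as P. change (0 < snd p) in Hp.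
  unfold F, s2. apply (Rmult_eq_reg_r (/ snd (phi p) ^ 2)).
  2:{ apply Rinv_neq_0_compat, pow_nonzero. lra. }
  transitivity (dot a b / snd p ^ 2); [exact HM|]. field. lra.
Qed.

Lemma iso_sym a b p : H3 p -> dspace (F a) b p = dspace (F b) a p.
Proof.
  intros Hp. destruct (iso_CK 2) as (A & B & D). apply space_eq.
  - exact (dir_sym H3 _ a b p open_H3 A Hp).
  - exact (dir_sym H3 _ a b p open_H3 B Hp).
  - exact (dir_sym H3 _ a b p open_H3 D Hp).
Qed.

Let ds (c p : space) : R := 2 * s2 p * (snd (F c p) * / snd (phi p) - snd c * / snd p).

Lemma iso_ds c p : H3 p -> is_derive (fun t : R => s2 (plus p (scal t c))) 0 (ds c p).
Proof.
  intros Hp. destruct (iso_CK 1) as (_ & _ & D).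
  pose proof (dir_is_derive 0 H3 _ p c D Hp) as D1.
  assert (D2 : is_derive (fun t : R => snd (plus p (scal t c))) 0 (snd c)).
  { apply (is_derive_ext (fun t : R => snd p + t * snd c)). { reflexivity. }
    evar_last. { auto_derive; [exact I | reflexivity]. } exact (Rmult_1_l _). }
  set (f := fun t : R => snd (phi (plus p (scal t c)))) in *.
  set (g := fun t : R => snd (plus p (scal t c))) in *.
  derivative D1 f 0 F1.
  derivative D2 g 0 F2.
  change (Derive (fun x : R => f x) 0 = snd (F c p)) in F1.
  assert (G0 : g 0 = snd p) by (unfold g; now rewrite line_0).
  assert (F0 : f 0 = snd (phi p)) by (unfold f; now rewrite line_0).
  pose proof (iso_H3 p Hp) as P. change (0 < snd p) in Hp.
  apply (is_derive_ext (fun t : R => (f t * / g t) ^ 2)). { reflexivity. }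
  evar_last.
  { auto_derive; [repeat split; auto; rewrite G0; lra | reflexivity]. }
  rewrite F1, F2, G0, F0. unfold ds, s2. field. lra.
Qed.

Lemma iso_metric_d a b c p : H3 p ->
  dot (dspace (F a) c p) (F b p) + dot (F a p) (dspace (F b) c p) = ds c p * dot a b.
Proof.
  intros Hp. rewrite <- (dot_dir H3 (F a) (F b) c p open_H3 Hp (iso_CK_F 1 a) (iso_CK_F 1 b)).
  rewrite (dir_ext_loc H3 _ (fun q => s2 q * dot a b) p c open_H3); auto.
  2:{ intros q Hq. now apply iso_metric. }
  apply dir_unique. pose proof (iso_ds c p Hp) as D.
  pose proof (is_derive_scal_l (K := R_AbsRing) (V := R_NormedModule)
    (fun t : R => s2 (plus p (scal t c))) 0 (ds c p) (dot a b) D) as Q. exact Q.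
Qed.

(** Koszul formula: the second derivatives of an isometry are determined by its first
    derivatives. *)
Lemma iso_koszul a b c p : H3 p ->
  2 * dot (dspace (F a) b p) (F c p) = ds a p * dot b c + ds b p * dot a c - ds c p * dot a b.
Proof.
  intros Hp.
  pose proof (iso_metric_d a c b p Hp) as K1. pose proof (iso_metric_d b c a p Hp) as K2.
  pose proof (iso_metric_d a b c p Hp) as K3.
  rewrite (iso_sym b a p Hp) in K2. rewrite (iso_sym a c p Hp), (iso_sym b c p Hp) in K3.
  rewrite (dot_comm (F a p) (dspace (F c) b p)) in K1.
  rewrite (dot_comm (F b p) (dspace (F c) a p)) in K2.
  rewrite (dot_comm (F a p) (dspace (F c) b p)) in K3. lra.
Qed.

Lemma frame_spans p u : H3 p -> dot u (F b1 p) = 0 -> dot u (F b2 p) = 0 -> dot u (F b3 p) = 0 ->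
  u = vec 0 0 0.
Proof.
  intros Hp U1 U2 U3. pose proof (s2_pos p Hp) as S.
  assert (M : forall a b, dot (F a p) (F b p) = s2 p * dot a b) by (intros; now apply iso_metric).
  assert (E11 : dot (F b1 p) (F b1 p) = s2 p) by (rewrite M; unfold dot, b1; simpl; ring).
  assert (E22 : dot (F b2 p) (F b2 p) = s2 p) by (rewrite M; unfold dot, b2; simpl; ring).
  assert (E33 : dot (F b3 p) (F b3 p) = s2 p) by (rewrite M; unfold dot, b3; simpl; ring).
  assert (E12 : dot (F b1 p) (F b2 p) = 0) by (rewrite M; unfold dot, b1, b2; simpl; ring).
  assert (E31 : dot (F b3 p) (F b1 p) = 0) by (rewrite M; unfold dot, b1, b3; simpl; ring).
  assert (E32 : dot (F b3 p) (F b2 p) = 0) by (rewrite M; unfold dot, b2, b3; simpl; ring).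
  assert (NC : forall t, dot t (F b1 p) = 0 -> dot t (F b2 p) = 0 ->
    t = scal (dot t (cross (F b1 p) (F b2 p)) / dot (F b1 p) (F b1 p) ^ 2) (cross (F b1 p) (F b2 p))).
  { intros t. apply normal_component; auto; lra. }
  pose proof (NC u U1 U2) as Nu. pose proof (NC _ E31 E32) as N3.
  set (cr := cross (F b1 p) (F b2 p)) in *.
  set (ku := dot u cr / dot (F b1 p) (F b1 p) ^ 2) in *.
  set (k3 := dot (F b3 p) cr / dot (F b1 p) (F b1 p) ^ 2) in *.
  assert (E : ku * (k3 * dot cr cr) = 0).
  { rewrite <- U3. rewrite Nu, N3, dot_scal_l, dot_scal_r. ring. }
  assert (E3 : k3 * (k3 * dot cr cr) = s2 p).
  { rewrite <- E33. rewrite N3 at 1 2. rewrite dot_scal_l, dot_scal_r. ring. }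
  assert (k3 * dot cr cr <> 0).
  { intros Z. rewrite Z in E3. lra. }
  destruct (Rmult_integral _ _ E) as [Z|Z]; [|contradiction].
  rewrite Nu, Z. destruct cr as [[c1 c2] c3].
  change (scal 0 ((c1, c2, c3) : space)) with ((0 * c1, 0 * c2, 0 * c3) : space).
  apply space_eq; simpl; ring.
Qed.

(** By the Koszul formula both sides have the same inner products with the images of the
    basis vectors. *)
Lemma iso_connection a b p : basis a -> basis b -> H3 p ->
  plus (dspace (F a) b p) (christoffel (phi p) (F a p) (F b p)) =
  comb (/ snd p * - snd a) (/ snd p) (F b p) (comb (- snd b) (dot a b) (F a p) (F b3 p)).
Proof.
  intros Ba Bb Hp. pose proof (iso_H3 p Hp) as P. pose proof (s2_pos p Hp) as S.
  assert (M : forall a b, dot (F a p) (F b p) = s2 p * dot a b) by (intros; now apply iso_metric).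
  set (L := plus (dspace (F a) b p) (christoffel (phi p) (F a p) (F b p))).
  set (R0 := comb (/ snd p * - snd a) (/ snd p) (F b p) (comb (- snd b) (dot a b) (F a p) (F b3 p))).
  assert (K : forall c, basis c -> dot L (F c p) = dot R0 (F c p)).
  { intros c Bc. unfold L, R0, comb, christoffel.
    rewrite !dot_plus_l, !dot_scal_l, !dot_plus_l, !dot_scal_l.
    pose proof (iso_koszul a b c p Hp) as KZ.
    assert (V : forall r x, dot (vec 0 0 r) x = r * snd x).
    { intros r x. unfold dot, vec; simpl. ring. }
    rewrite V, !M.
    assert (B3 : forall x, dot b3 x = snd x).
    { intros x. unfold dot, b3, vec; simpl. ring. }
    rewrite B3.
    replace (dot (dspace (F a) b p) (F c p)) with
      ((ds a p * dot b c + ds b p * dot a c - ds c p * dot a b) / 2) by lra.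
    unfold ds. change (0 < snd p) in Hp. field. lra. }
  assert (Z : plus L (opp R0) = vec 0 0 0).
  { assert (O : forall c, basis c -> dot (plus L (opp R0)) (F c p) = 0).
    { intros c Bc. rewrite dot_plus_l, (K c Bc).
      assert (N : dot (opp R0) (F c p) = - dot R0 (F c p)).
      { destruct R0 as [[x y] z], (F c p) as [[x' y'] z'].
        change (- x * x' + - y * y' + - z * z' = - (x * x' + y * y' + z * z')). ring. }
      rewrite N. ring. }
    apply (frame_spans p); auto; apply O; unfold basis; auto. }
  destruct L as [[x y] z], R0 as [[x' y'] z'].
  change ((x + - x', y + - y', z + - z') = (0, 0, 0)) in Z.
  injection Z as Z1 Z2 Z3. apply space_eq; simpl; lra.
Qed.

Variable k : vec4.
Let N (p : space) : R := nf k (phi p).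

Lemma iso_N_CK n : CK n H3 N.
Proof.
  destruct (iso_CK n) as (A & B & D). assert (HO := open_H3).
  assert (I : CK n H3 (fun q => / snd (phi q))).
  { apply (CK_inv n H3 (fun q => snd (phi q))); auto. intros q Hq. now apply iso_H3. }
  unfold N, nf, dot.
  set (u := fun q => Re (fst (phi q))) in *. set (v := fun q => Im (fst (phi q))) in *.
  set (w := fun q => snd (phi q)) in *.
  change (CK n H3 (fun p => (t0 k + t1 k * u p + t2 k * v p + t3 k * (u p * u p + v p * v p + w p * w p)) *
    / snd (phi p))).
  ck.
Qed.

Lemma iso_N1 b p : H3 p -> dir_deriv N b p = dnf k (phi p) (F b p).
Proof.
  intros Hp. apply dir_unique.
  pose proof (is_deriveS_dir H3 phi p b Hp (iso_CK 1)) as D.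
  assert (P0 : 0 < snd (phi (plus p (scal 0 b)))) by (rewrite line_0; now apply iso_H3).
  pose proof (nf_curve k _ _ _ P0 D) as Q. cbv beta in Q. rewrite line_0 in Q. exact Q.
Qed.

(** Hess (n o phi) = (n o phi) g, for the metric g. *)
Lemma iso_N2 a b p : basis a -> basis b -> H3 p ->
  dir_deriv (dir_deriv N a) b p = N p * dot a b / snd p ^ 2 +
    (- snd a * dir_deriv N b p - snd b * dir_deriv N a p + dot a b * dir_deriv N b3 p) / snd p.
Proof.
  intros Ba Bb Hp.
  rewrite (dir_ext_loc H3 _ (fun q => dnf k (phi q) (F a q)) p b open_H3); auto.
  2:{ intros q Hq. now apply iso_N1. }
  rewrite !iso_N1 by auto. apply dir_unique.
  pose proof (is_deriveS_dir H3 phi p b Hp (iso_CK 1)) as D1.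
  pose proof (is_deriveS_dir H3 (F a) p b Hp (iso_CK_F 1 a)) as D2.
  assert (P0 : 0 < snd (phi (plus p (scal 0 b)))) by (rewrite line_0; now apply iso_H3).
  pose proof (dnf_curve k _ _ _ _ _ P0 D1 D2) as Q. cbv beta in Q. rewrite !line_0 in Q.
  match type of Q with is_derive _ _ ?l => match goal with |- is_derive _ _ ?r =>
    replace r with l; [exact Q|] end end.
  change (dspace phi b p) with (F b p). rewrite (iso_connection a b p Ba Bb Hp), !dnf_lin.
  rewrite (iso_metric a b p Hp). pose proof (iso_H3 p Hp). unfold s2, N.
  change (0 < snd p) in Hp. field. lra.
Qed.

End Isometry.

Lemma H3_const (f : space -> R) : CK 1 H3 f ->
  (forall p, H3 p -> dir_deriv f b1 p = 0 /\ dir_deriv f b2 p = 0 /\ dir_deriv f b3 p = 0) ->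
  forall p q, H3 p -> H3 q -> f p = f q.
Proof.
  intros Hf H0 [[x y] w] [[x' y'] w'] Hp Hq. unfold H3 in Hp, Hq; simpl in Hp, Hq.
  assert (L : forall a x y w (t : R), H3 (plus ((x, y, w) : space) (scal t a)) ->
    dir_deriv f a (plus ((x, y, w) : space) (scal t a)) = 0 ->
    is_derive (fun t : R => f (plus ((x, y, w) : space) (scal t a))) t 0).
  { intros a x0 y0 w0 t Ht Z.
    exact (eq_rect _ (fun l => is_derive (fun t : R => f (plus ((x0, y0, w0) : space) (scal t a))) t l)
      (line_is_derive 0 H3 f _ a t Hf Ht) _ Z). }
  transitivity (f (x', y, w)).
  - pose proof (is_derive_0_const (fun t : R => f (plus ((0, y, w) : space) (scal t b1)))
      (fun _ => True) x x') as K.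
    assert (E : forall t, plus ((0, y, w) : space) (scal t b1) = ((t, y, w) : space)).
    { intros t. change ((0 + t * 1, y + t * 0, w + t * 0) = (t, y, w) :> R * R * R).
      do 2 (apply injective_projections; simpl; try ring). }
    refine (eq_trans (eq_sym (f_equal f (E x))) (eq_trans (K _ _ _ _) (f_equal f (E x')))); auto. intros t _.
    assert (Ht : H3 (plus ((0, y, w) : space) (scal t b1))) by (rewrite E; exact Hp).
    exact (L b1 0 y w t Ht (proj1 (H0 _ Ht))).
  - transitivity (f (x', y', w)).
    + pose proof (is_derive_0_const (fun t : R => f (plus ((x', 0, w) : space) (scal t b2)))
        (fun _ => True) y y') as K.
      assert (E : forall t, plus ((x', 0, w) : space) (scal t b2) = ((x', t, w) : space)).
      { intros t. change ((x' + t * 0, 0 + t * 1, w + t * 0) = (x', t, w) :> R * R * R).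
        do 2 (apply injective_projections; simpl; try ring). }
      refine (eq_trans (eq_sym (f_equal f (E y))) (eq_trans (K _ _ _ _) (f_equal f (E y')))); auto. intros t _.
      assert (Ht : H3 (plus ((x', 0, w) : space) (scal t b2))) by (rewrite E; exact Hp).
      exact (L b2 x' 0 w t Ht (proj1 (proj2 (H0 _ Ht)))).
    + pose proof (is_derive_0_const (fun t : R => f (plus ((x', y', 0) : space) (scal t b3)))
        (fun t => 0 < t) w w') as K.
      assert (E : forall t, plus ((x', y', 0) : space) (scal t b3) = ((x', y', t) : space)).
      { intros t. change ((x' + t * 0, y' + t * 0, 0 + t * 1) = (x', y', t) :> R * R * R).
        do 2 (apply injective_projections; simpl; try ring). }
      refine (eq_trans (eq_sym (f_equal f (E w))) (eq_trans (K _ _ _ _) (f_equal f (E w')))); auto.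
      * intros; lra.
      * intros t Ht0. assert (Ht : H3 (plus ((x', y', 0) : space) (scal t b3))) by (rewrite E; exact Ht0).
        exact (L b3 x' y' 0 t Ht (proj2 (proj2 (H0 _ Ht)))).
Qed.

Lemma CK_snd_space n (U : space -> Prop) : CK n U (fun p : space => snd p).
Proof. apply CK_linear; [intros p; apply continuous_snd | reflexivity]. Qed.

Lemma CK_Re_space n (U : space -> Prop) : CK n U (fun p : space => Re (fst p)).
Proof.
  apply CK_linear; [intros p | reflexivity].
  apply (continuous_comp (fun p : space => fst p) (fun z : plane => Re z)).
  - apply continuous_fst.
  - apply (CK_cont 0 (fun _ => True) (fun z : plane => fst z)); [apply CK_fst | exact I].
Qed.

Lemma CK_Im_space n (U : space -> Prop) : CK n U (fun p : space => Im (fst p)).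
Proof.
  apply CK_linear; [intros p | reflexivity].
  apply (continuous_comp (fun p : space => fst p) (fun z : plane => Im z)).
  - apply continuous_fst.
  - apply (CK_cont 0 (fun _ => True) (fun z : plane => snd z)); [apply CK_snd | exact I].
Qed.

Lemma coord_line (p a : space) :
  is_derive (fun t : R => Re (fst (plus p (scal t a)))) 0 (Re (fst a)) /\
  is_derive (fun t : R => Im (fst (plus p (scal t a)))) 0 (Im (fst a)) /\
  is_derive (fun t : R => snd (plus p (scal t a))) 0 (snd a).
Proof.
  assert (L : forall u v : R, is_derive (fun t : R => u + t * v) 0 v).
  { intros u v. evar_last. { auto_derive; [exact I | reflexivity]. } exact (Rmult_1_l _). }
  exact (conj (L _ _) (conj (L _ _) (L _ _))).
Qed.

(** The functions with Hess N = N g are the linear ones: w N is a polynomial because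
    its second derivatives are those of a multiple of |p|^2. *)
Lemma hess_linear (N : space -> R) : (forall n, CK n H3 N) ->
  (forall a b p, basis a -> basis b -> H3 p ->
  dir_deriv (dir_deriv N a) b p = N p * dot a b / snd p ^ 2 +
    (- snd a * dir_deriv N b p - snd b * dir_deriv N a p + dot a b * dir_deriv N b3 p) / snd p) ->
  exists k, forall p, H3 p -> N p = nf k p.
Proof.
  intros HN HH. assert (HO := open_H3).
  assert (LN : forall p b, H3 p -> is_derive (fun t : R => N (plus p (scal t b))) 0 (dir_deriv N b p)).
  { intros p b Hp. exact (dir_is_derive 0 H3 N p b (HN 1%nat) Hp). }
  assert (LD : forall a p b, H3 p -> is_derive (fun t : R => dir_deriv N a (plus p (scal t b))) 0
    (dir_deriv (dir_deriv N a) b p)).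
  { intros a p b Hp. exact (dir_is_derive 0 H3 _ p b (CK_S 1 H3 N (HN 2%nat) a) Hp). }
  assert (CKw : forall n, CK n H3 (fun p => / snd p)).
  { intros n. apply (CK_inv n H3 (fun p : space => snd p)); auto. apply CK_snd_space. }
  assert (CD : forall a, CK 1 H3 (dir_deriv N a)) by (intros a; exact (CK_S 1 H3 N (HN 2%nat) a)).
  pose proof (HN 1%nat) as CN. pose proof (CKw 1%nat) as Cw.
  pose proof (CK_snd_space 1 H3) as C3. pose proof (CK_Re_space 1 H3) as C1.
  pose proof (CK_Im_space 1 H3) as C2.
  assert (o0 : H3 (0, 0, 1)) by (unfold H3; simpl; lra).
  (* the second derivatives of w N are those of S |p|^2 / 2, and S is constant *)
  set (S := fun p => N p * / snd p + dir_deriv N b3 p).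
  assert (dS : forall b p, basis b -> H3 p -> dir_deriv S b p = 0).
  { intros b p Bb Hp. apply dir_unique. unfold S.
    destruct (coord_line p b) as (_ & _ & L3). pose proof (LN p b Hp) as L1. pose proof (LD b3 p b Hp) as L2.
    rewrite (HH b3 b p) in L2; unfold basis; auto.
    set (n := fun t : R => N (plus p (scal t b))) in *. set (w := fun t : R => snd (plus p (scal t b))) in *.
    set (d := fun t : R => dir_deriv N b3 (plus p (scal t b))) in *.
    assert (n0 : n 0 = N p) by (unfold n; now rewrite line_0).
    assert (w0 : w 0 = snd p) by (unfold w; now rewrite line_0).
    derivative L1 n 0 F1.
    derivative L2 d 0 F2.
    derivative L3 w 0 F3.
    change (0 < snd p) in Hp.
    apply (is_derive_ext (fun t : R => n t * / w t + d t)). { reflexivity. }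
    evar_last. { auto_derive; [repeat split; auto; rewrite w0; lra | reflexivity]. }
    rewrite F1, F2, F3, n0, w0.
    replace (dot b3 b) with (snd b) by (unfold dot, b3, vec; simpl; ring).
    change (snd b3) with 1. field. lra. }
  assert (CS : CK 1 H3 S) by (unfold S; specialize (CD b3); ck).
  set (s := S (0, 0, 1)).
  assert (ES : forall p, H3 p -> N p * / snd p + dir_deriv N b3 p = s).
  { intros p Hp. apply (H3_const S CS); auto. intros q Hq. unfold basis in dS. repeat split; apply dS; auto. }
  set (H1 := fun a p : space => snd a * N p + snd p * dir_deriv N a p).
  assert (dH1 : forall a b p, basis a -> basis b -> H3 p ->
    is_derive (fun t : R => H1 a (plus p (scal t b))) 0 (dot a b * s)).
  { intros a b p Ba Bb Hp. unfold H1.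
    destruct (coord_line p b) as (_ & _ & L3). pose proof (LN p b Hp) as L1. pose proof (LD a p b Hp) as L2.
    rewrite (HH a b p) in L2; auto.
    set (n := fun t : R => N (plus p (scal t b))) in *. set (w := fun t : R => snd (plus p (scal t b))) in *.
    set (d := fun t : R => dir_deriv N a (plus p (scal t b))) in *.
    assert (d0 : d 0 = dir_deriv N a p) by (unfold d; now rewrite line_0).
    assert (w0 : w 0 = snd p) by (unfold w; now rewrite line_0).
    derivative L1 n 0 F1.
    derivative L2 d 0 F2.
    derivative L3 w 0 F3.
    apply (is_derive_ext (fun t : R => snd a * n t + w t * d t)). { reflexivity. }
    evar_last. { auto_derive; [repeat split; auto | reflexivity]. }
    rewrite F1, F2, F3, d0, w0, <- (ES p Hp). change (0 < snd p) in Hp.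
    pose (Y := snd a). repeat match goal with |- context [@snd ?A ?B a] => change (@snd A B a) with Y end.
    field. lra. }
  assert (CH1 : forall a, CK 1 H3 (H1 a)) by (intros a; unfold H1; specialize (CD a); ck).
  assert (G : forall a x, basis a -> CK 1 H3 x -> (forall b p, basis b ->
      is_derive (fun t : R => x (plus p (scal t b))) 0 (dot a b)) ->
    forall p, H3 p -> H1 a p - s * x p = H1 a (0, 0, 1) - s * x (0, 0, 1)).
  { intros a x Ba Cx Hx p Hp. apply (H3_const (fun p => H1 a p - s * x p)); auto.
    - specialize (CH1 a). ck.
    - intros q Hq. assert (Z : forall b, basis b -> dir_deriv (fun p => H1 a p - s * x p) b q = 0).
      { intros b Bb. apply dir_unique.
        pose proof (is_derive_minus _ _ _ _ _ (dH1 a b q Ba Bb Hq) (is_derive_scal _ _ s _ (Hx b q Bb))) as Q.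
        replace 0 with (minus (dot a b * s) (s * dot a b)) at 2; [exact Q|].
        unfold minus, plus, opp; simpl. ring. }
      unfold basis in Z. repeat split; apply Z; auto. }
  set (g1 := H1 b1 (0, 0, 1)). set (g2 := H1 b2 (0, 0, 1)).
  assert (E1 : forall p, H3 p -> H1 b1 p = g1 + s * Re (fst p)).
  { intros p Hp. assert (Q := G b1 (fun p => Re (fst p)) (or_introl eq_refl) C1). cbv beta in Q.
    assert (L : forall b q, basis b -> is_derive (fun t : R => Re (fst (plus q (scal t b)))) 0 (dot b1 b)).
    { intros b q Bb. replace (dot b1 b) with (Re (fst b)) by (unfold dot, b1, vec; simpl; ring).
      apply (coord_line q b). }
    specialize (Q L p Hp). fold g1 in Q. change (Re (fst ((0, 0, 1) : space))) with 0 in Q. lra. }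
  assert (E2 : forall p, H3 p -> H1 b2 p = g2 + s * Im (fst p)).
  { intros p Hp. assert (Q := G b2 (fun p => Im (fst p)) (or_intror (or_introl eq_refl)) C2). cbv beta in Q.
    assert (L : forall b q, basis b -> is_derive (fun t : R => Im (fst (plus q (scal t b)))) 0 (dot b2 b)).
    { intros b q Bb. replace (dot b2 b) with (Im (fst b)) by (unfold dot, b2, vec; simpl; ring).
      apply (coord_line q b). }
    specialize (Q L p Hp). fold g2 in Q. change (Im (fst ((0, 0, 1) : space))) with 0 in Q. lra. }
  assert (E3 : forall p, H3 p -> H1 b3 p = s * snd p).
  { intros p Hp. rewrite <- (ES p Hp). unfold H1. change (snd b3) with 1. change (0 < snd p) in Hp. field. lra. }
  set (K := fun p : space => snd p * N p - g1 * Re (fst p) - g2 * Im (fst p) -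
     s / 2 * (Re (fst p) * Re (fst p) + Im (fst p) * Im (fst p) + snd p * snd p)).
  assert (CK1 : CK 1 H3 K) by (unfold K; ck).
  assert (dK : forall b p, H3 p -> H1 b p = g1 * Re (fst b) + g2 * Im (fst b) +
     s * (Re (fst p) * Re (fst b) + Im (fst p) * Im (fst b) + snd p * snd b) -> dir_deriv K b p = 0).
  { intros b p Hp EH. apply dir_unique. unfold K.
    destruct (coord_line p b) as (L1 & L2 & L3). pose proof (LN p b Hp) as L0.
    set (n := fun t : R => N (plus p (scal t b))) in *. set (w := fun t : R => snd (plus p (scal t b))) in *.
    set (u := fun t : R => Re (fst (plus p (scal t b)))) in *.
    set (v := fun t : R => Im (fst (plus p (scal t b)))) in *.
    assert (n0 : n 0 = N p) by (unfold n; now rewrite line_0).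
    assert (u0 : u 0 = Re (fst p)) by (unfold u; now rewrite line_0).
    assert (v0 : v 0 = Im (fst p)) by (unfold v; now rewrite line_0).
    assert (w0 : w 0 = snd p) by (unfold w; now rewrite line_0).
    derivative L1 u 0 F1.
    derivative L2 v 0 F2.
    derivative L3 w 0 F3.
    derivative L0 n 0 F0.
    apply (is_derive_ext (fun t : R => w t * n t - g1 * u t - g2 * v t -
       s / 2 * (u t * u t + v t * v t + w t * w t))). { reflexivity. }
    evar_last. { auto_derive; [repeat split; auto | reflexivity]. }
    rewrite F0, F1, F2, F3, n0, u0, v0, w0. unfold H1 in EH.
    replace (dir_deriv N b p * snd p) with (snd p * dir_deriv N b p) by ring.
    assert (EH' : snd p * dir_deriv N b p = g1 * Re (fst b) + g2 * Im (fst b) +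
     s * (Re (fst p) * Re (fst b) + Im (fst p) * Im (fst b) + snd p * snd b) - snd b * N p) by lra.
    match goal with |- ?l = _ => replace l with
      (snd b * N p + (snd p * dir_deriv N b p) - g1 * Re (fst b) - g2 * Im (fst b) -
       s * (Re (fst p) * Re (fst b) + Im (fst p) * Im (fst b) + snd p * snd b)) by field end.
    rewrite EH'. ring. }
  exists (V4 (K (0, 0, 1)) g1 g2 (s / 2)).
  intros p Hp. assert (EK : K p = K (0, 0, 1)).
  { apply (H3_const K CK1); auto. intros q Hq. repeat split; apply dK; auto.
    - rewrite E1 by auto. change (g1 + s * Re (fst q) = g1 * 1 + g2 * 0 + s * (Re (fst q) * 1 + Im (fst q) * 0 + snd q * 0)). ring.
    - rewrite E2 by auto. change (g2 + s * Im (fst q) = g1 * 0 + g2 * 1 + s * (Re (fst q) * 0 + Im (fst q) * 1 + snd q * 0)). ring.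
    - rewrite E3 by auto. change (s * snd q = g1 * 0 + g2 * 0 + s * (Re (fst q) * 0 + Im (fst q) * 0 + snd q * 1)). ring. }
  unfold nf. cbn [t0 t1 t2 t3]. rewrite <- EK. unfold K, dot. change (0 < snd p) in Hp. field. lra.
Qed.

(** Isometries preserve the equation Hess n = n g. *)
Lemma isometry_linear phi k : isometry phi -> exists k', forall p, H3 p -> nf k (phi p) = nf k' p.
Proof.
  intros Hphi. destruct (hess_linear (fun p => nf k (phi p))) as [k' Hk].
  - intros n. exact (iso_N_CK phi Hphi k n).
  - intros a b p Ba Bb Hp. exact (iso_N2 phi Hphi k a b p Ba Bb Hp).
  - exists k'. exact Hk.
Qed.

(** * Isometries sending two boundary points to 0 and infinity *)

(** Homogeneous coordinates (xh, yh) of a boundary point. *)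
Definition xh (z : Cbar) : R := match z with Some _ => 1 | None => 0 end.
Definition yh (z : Cbar) : C := match z with Some z => z | None => RtoC 1 end.

Lemma bracket_h c d : bracket c d = (xh d * yh c - xh c * yh d)%C.
Proof. destruct c, d; simpl; unfold xh, yh; match goal with |- ?x = ?y => change (@eq C x y) end; try ring. Qed.

Lemma bracket_neq0 c d : c <> d -> bracket c d <> RtoC 0.
Proof.
  intros N. destruct c as [x|], d as [y|]; simpl.
  - intros Z. apply N. f_equal. apply Cminus_eq_0 in Z || idtac.
    replace x with (x - y + y)%C by ring. change (x - y)%C with (Cminus x y). rewrite Z. ring.
  - intros Z. apply RtoC_inj in Z. lra.
  - intros Z. apply RtoC_inj in Z. lra.
  - exfalso; apply N; reflexivity.
Qed.

Definition br2 (c d : Cbar) : R := Re (bracket c d) ^ 2 + Im (bracket c d) ^ 2.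
(** The bracket of c and of the vertical projection of p. *)
Definition sh (c : Cbar) (p : space) : C := (yh c - xh c * fst p)%C.
(** For a Moebius transformation of H3, hN is the extension to H3 of the square of the
    modulus of the denominator of pole c, and h1 + i h2 that of the product of the
    numerator of zero c with the conjugate of the denominator of pole d. *)
Definition hN (c : Cbar) (p : space) : R := Re (sh c p) ^ 2 + Im (sh c p) ^ 2 + xh c ^ 2 * snd p ^ 2.
Definition h1 (c d : Cbar) (p : space) : R :=
  Re (sh c p) * Re (sh d p) + Im (sh c p) * Im (sh d p) + xh c * xh d * snd p ^ 2.
Definition h2 (c d : Cbar) (p : space) : R :=
  Im (sh c p) * Re (sh d p) - Re (sh c p) * Im (sh d p).

(** Real and imaginary parts of the polarization, at two boundary points, of the
    hermitian form given by k: pol1 at c, c is the limit at c of the linear function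
    times a height. *)
Definition pol1 (k : vec4) (d c : Cbar) : R :=
  t0 k * (xh d * xh c) + t1 k * ((xh c * Re (yh d) + xh d * Re (yh c)) / 2) +
  t2 k * ((xh c * Im (yh d) + xh d * Im (yh c)) / 2) +
  t3 k * (Re (yh d) * Re (yh c) + Im (yh d) * Im (yh c)).
Definition pol2 (k : vec4) (d c : Cbar) : R :=
  t1 k * ((xh c * Im (yh d) - xh d * Im (yh c)) / 2) -
  t2 k * ((xh c * Re (yh d) - xh d * Re (yh c)) / 2) +
  t3 k * (Im (yh d) * Re (yh c) - Re (yh d) * Im (yh c)).
Definition bval (k : vec4) (c : Cbar) : R := pol1 k c c.

Lemma br2_h c d : br2 c d = (xh d * Re (yh c) - xh c * Re (yh d)) ^ 2 + (xh d * Im (yh c) - xh c * Im (yh d)) ^ 2.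
Proof. unfold br2. rewrite bracket_h. unfold Re, Im. simpl. ring. Qed.

Lemma br2_pos c d : c <> d -> 0 < br2 c d.
Proof.
  intros N. unfold br2. rewrite <- Cmod2. apply pow_lt, Cmod_gt_0, bracket_neq0, N.
Qed.

(** Expansion of the hermitian form k in the basis (c, d) of C^2. *)
Lemma nf_basis k c d p : 0 < snd p ->
  br2 c d * (snd p * nf k p) =
  hN d p * bval k c + hN c p * bval k d - 2 * (h1 c d p * pol1 k d c - h2 c d p * pol2 k d c).
Proof.
  intros Hp. rewrite br2_h. unfold nf, hN, h1, h2, bval, pol1, pol2, sh, dot, Re, Im. simpl. field. apply Rgt_not_eq; exact Hp.
Qed.

(** The hermitian matrix of a point of H3 has determinant one, also in the basis (c, d).
    *)
Lemma h_sq c d p : h1 c d p ^ 2 + h2 c d p ^ 2 = hN c p * hN d p - br2 c d * snd p ^ 2.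
Proof. rewrite br2_h. unfold hN, h1, h2, sh, Re, Im. simpl. ring. Qed.

Lemma hN_pos c p : H3 p -> 0 < hN c p.
Proof.
  unfold H3, hN. intros Hp. pose proof (pow2_ge_0 (Re (sh c p))). pose proof (pow2_ge_0 (Im (sh c p))).
  pose proof (pow_lt (snd p) 2 Hp). destruct c as [z|].
  - change (xh (Some z)) with 1. lra.
  - change (xh None) with 0. replace (Re (sh None p)) with 1. { lra. }
    unfold sh, Re. simpl. ring.
Qed.

(** It ends at c as s tends to 0. *)
Definition towards (c : Cbar) (s : R) : space :=
  match c with Some z => (z, s) | None => (RtoC 0, / s) end.

Lemma towards_H3 c s : 0 < s -> H3 (towards c s).
Proof. destruct c; unfold H3, towards; simpl; auto. apply Rinv_0_lt_compat. Qed.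

Lemma towards_nf k c : exists r, forall s, 0 < s -> s * nf k (towards c s) = bval k c + r * s ^ 2.
Proof.
  destruct c as [z|].
  - exists (t3 k). intros s Hs. unfold nf, bval, pol1, towards, dot, xh, yh, Re, Im. simpl. field. lra.
  - exists (t0 k). intros s Hs. unfold nf, bval, pol1, towards, dot, xh, yh, Re, Im. simpl. field. lra.
Qed.

Lemma towards_boundary c Q : at_boundary c Q -> exists s0, 0 < s0 /\ forall s, 0 < s < s0 -> Q (towards c s).
Proof.
  destruct c as [z|]; simpl.
  - intros [eps He]. exists eps. split; [apply cond_pos|]. intros s Hs. apply He.
    + split; [apply ball_center|]. change (Rabs (s - 0) < eps). rewrite Rabs_pos_eq; lra.
    + exact (proj1 Hs).
  - intros [M HM]. exists (/ (Rabs M + 1)). assert (A := Rabs_pos M). assert (A' := Rle_abs M).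
    split; [apply Rinv_0_lt_compat; lra|]. intros s [Hs Hs']. apply HM.
    + unfold H3; simpl. now apply Rinv_0_lt_compat.
    + apply Rinv_lt_contravar in Hs'. 2:{ apply Rmult_lt_0_compat; auto. apply Rinv_0_lt_compat; lra. }
      rewrite Rinv_inv in Hs'. unfold dot; simpl. nra.
Qed.

Lemma ge0_limit (P Q s0 : R) : 0 < s0 -> (forall s, 0 < s < s0 -> 0 <= P + Q * s ^ 2) -> 0 <= P.
Proof.
  intros H0 H. destruct (Rle_lt_dec 0 P) as [|N]; auto. exfalso.
  set (B := Rabs Q + 1). assert (A := Rabs_pos Q). assert (A' := Rle_abs Q).
  set (s := Rmin (s0 / 2) (Rmin 1 (- P / (2 * B)))).
  assert (HB : 0 < - P / (2 * B)) by (apply Rdiv_lt_0_compat; unfold B; lra).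
  assert (S1 : s <= s0 / 2) by apply Rmin_l.
  assert (S2 : s <= 1) by (eapply Rle_trans; [apply Rmin_r|apply Rmin_l]).
  assert (S3 : s <= - P / (2 * B)) by (eapply Rle_trans; [apply Rmin_r|apply Rmin_r]).
  assert (S4 : 0 < s) by (unfold s; apply Rmin_glb_lt; [lra|apply Rmin_glb_lt; lra]).
  specialize (H s ltac:(lra)).
  assert (s * (2 * B) <= - P).
  { apply (Rmult_le_compat_r (2 * B)) in S3; [|unfold B; lra].
    replace (- P / (2 * B) * (2 * B)) with (- P) in S3 by (field; unfold B; lra). exact S3. }
  assert (Q * s ^ 2 <= B * s).
  { assert (s ^ 2 <= s) by nra. assert (Q <= B) by (unfold B; lra).
    assert (0 <= s ^ 2) by (apply pow_le; lra). unfold B in *. nra. }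
  lra.
Qed.

Definition hpt (z : C) (w : R) : space := (z, w).

(** The point over which the Moebius transformation with zero c and pole d takes the
    value e. *)
Lemma ratio_point c d (e : C) : c <> d -> Cmod e <> 1 -> e <> RtoC 0 ->
  exists z : C, forall w, sh c (hpt z w) = (e * sh d (hpt z w))%C /\ sh d (hpt z w) <> RtoC 0.
Proof.
  intros Ncd He He0.
  assert (N : (xh c - e * xh d)%C <> RtoC 0).
  { intros Z. destruct c as [x|], d as [y|]; unfold xh in Z.
    - apply He. replace e with (RtoC 1). now rewrite Cmod_1.
      replace (RtoC 1) with ((1 - e * 1) + e)%C by ring. rewrite Z. ring.
    - apply RtoC_inj with (x := 1) (y := 0) || idtac. replace (1 - e * 0)%C with (RtoC 1) in Z by ring.
      apply RtoC_inj in Z; lra.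
    - apply He0. replace e with (- (0 - e * 1))%C by ring. rewrite Z. ring.
    - now apply Ncd. }
  set (z := ((yh c - e * yh d) / (xh c - e * xh d))%C).
  assert (E : sh c (hpt z 0) = (e * sh d (hpt z 0))%C).
  { unfold sh, z, hpt. simpl fst. field. exact N. }
  exists z. intros w. split; [exact E|]. change (sh d (hpt z w)) with (sh d (hpt z 0)).
  intros Z. rewrite Z, Cmult_0_r in E.
  apply (bracket_neq0 c d Ncd). rewrite bracket_h.
  replace (xh d * yh c - xh c * yh d)%C with (xh d * sh c (hpt z 0) - xh c * sh d (hpt z 0))%C
    by (unfold sh, hpt; simpl fst; ring).
  rewrite E, Z. ring.
Qed.

Lemma ratio_values c d (e : C) : c <> d -> Cmod e <> 1 -> e <> RtoC 0 ->
  exists (z : C) (m : R), 0 < m /\ forall w,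
    hN d (hpt z w) = m + xh d ^ 2 * w ^ 2 /\ hN c (hpt z w) = Cmod e ^ 2 * m + xh c ^ 2 * w ^ 2 /\
    h1 c d (hpt z w) = Re e * m + xh c * xh d * w ^ 2 /\ h2 c d (hpt z w) = Im e * m.
Proof.
  intros Ncd He He0. destruct (ratio_point c d e Ncd He He0) as [z Hz].
  exists z, (Cmod (sh d (hpt z 0)) ^ 2). split.
  - apply pow_lt, Cmod_gt_0. apply (Hz 0).
  - intros w. destruct (Hz w) as [E _]. unfold hN, h1, h2. rewrite E.
    change (sh d (hpt z 0)) with (sh d (hpt z w)). rewrite !Cmod2.
    destruct (sh d (hpt z w)) as [x y], e as [u v]. simpl. repeat split; ring.
Qed.

(** An isotropic vector of a nonnegative hermitian form is in its kernel. *)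
Lemma nonneg_isotropic k c d : c <> d -> (forall p, H3 p -> 0 < nf k p) -> bval k d = 0 ->
  pol1 k d c = 0 /\ pol2 k d c = 0.
Proof.
  intros Ncd Hk Hd. set (P1 := pol1 k d c). set (P2 := pol2 k d c). set (K := bval k c).
  assert (B := br2_pos c d Ncd).
  assert (G : forall e : C, 1 < Cmod e -> 2 * (Re e * P1 - Im e * P2) <= K).
  { intros e He.
    destruct (ratio_values c d e Ncd) as (z & m & Hm & E).
    { lra. } { intros Z. rewrite Z, Cmod_0 in He. lra. }
    assert (L : 0 <= m * (K - 2 * (Re e * P1 - Im e * P2))).
    { apply (ge0_limit _ (xh d ^ 2 * K - 2 * (xh c * xh d * P1)) 1); [lra|].
      intros w [Hw _]. assert (Hp : H3 (hpt z w)) by exact Hw.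
      pose proof (nf_basis k c d (hpt z w) Hw) as Q. change (snd (hpt z w)) with w in Q. rewrite Hd in Q. fold P1 P2 K in Q.
      destruct (E w) as (E1 & E2 & E3 & E4). rewrite E1, E3, E4 in Q.
      specialize (Hk _ Hp).
      assert (0 <= br2 c d * (w * nf k (hpt z w))).
      { apply Rmult_le_pos; [lra|]. apply Rmult_le_pos; [lra | lra]. }
      rewrite Q in H. lra. }
    apply Rmult_le_reg_l in L || (apply Rnot_lt_le; intros N; nra). }
  set (q := P1 * P1 + P2 * P2).
  destruct (Req_dec q 0) as [Z|N].
  { unfold q in Z. split; nra. }
  exfalso. assert (Hq : 0 < q) by (unfold q in *; nra).
  set (m := (Rabs K + 1) * / q + 1 + / q).
  assert (I : 0 < / q) by now apply Rinv_0_lt_compat.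
  assert (A := Rabs_pos K). assert (A' := Rle_abs K).
  assert (Hm : 1 + / q <= m) by (unfold m; nra).
  assert (J : q * / q = 1) by (field; lra).
  assert (M1 : 1 < m * m * q).
  { assert (q + 1 <= m * q) by nra. nra. }
  specialize (G (m * P1, - (m * P2))).
  assert (Cm : Cmod ((m * P1, - (m * P2)) : C) ^ 2 = m * m * q).
  { rewrite Cmod2. unfold q. simpl. ring. }
  assert (C1 : 1 < Cmod ((m * P1, - (m * P2)) : C)).
  { assert (P := Cmod_ge_0 ((m * P1, - (m * P2)) : C)). apply Rnot_le_lt. intros Q. nra. }
  specialize (G C1). simpl in G.
  assert (2 * (m * q) <= K) by (unfold q; lra).
  assert (m * q >= Rabs K + 1) by (unfold m; nra). lra.
Qed.

Definition v0 : vec4 := V4 1 0 0 0.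
Definition v1 : vec4 := V4 0 1 0 0.
Definition v2 : vec4 := V4 0 0 1 0.
Definition v3 : vec4 := V4 0 0 0 1.

Lemma nf_v0 p : nf v0 p = / snd p.
Proof. unfold nf, v0; simpl. ring. Qed.
Lemma nf_v1 p : nf v1 p = Re (fst p) * / snd p.
Proof. unfold nf, v1; simpl. ring. Qed.
Lemma nf_v2 p : nf v2 p = Im (fst p) * / snd p.
Proof. unfold nf, v2; simpl. ring. Qed.
Lemma nf_v3 p : nf v3 p = dot p p * / snd p.
Proof. unfold nf, v3; simpl. ring. Qed.
Lemma hyperboloid p : 0 < snd p -> nf v0 p * nf v3 p - nf v1 p ^ 2 - nf v2 p ^ 2 = 1.
Proof. intros Hp. rewrite nf_v0, nf_v1, nf_v2, nf_v3. unfold dot. field. apply Rgt_not_eq; exact Hp. Qed.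

(** The orientation-preserving isometry sending c to 0 and d to infinity that comes from
    the matrix (yh d, - xh d; yh c, - xh c). *)
Definition stdmap (c d : Cbar) (p : space) : space :=
  ((h1 c d p / hN d p, h2 c d p / hN d p), sqrt (br2 c d) * snd p / hN d p).

(** Three values of w determine the polynomial. *)
Lemma even_poly0 (P Q S : R) : (forall w, 0 < w -> P + Q * w ^ 2 + S * w ^ 4 = 0) -> P = 0.
Proof.
  intros H. assert (A := H 1 ltac:(lra)). assert (B := H 2 ltac:(lra)). assert (D := H 3 ltac:(lra)).
  lra.
Qed.

(* The height of p as a variable, whatever the form of the type of p *)
Ltac ht p w := pose (w := snd p);
  repeat match goal with |- context [@snd ?A ?B p] => change (@snd A B p) with w end;
  assert (0 < w) by assumption; clearbody w.

Section Classify.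
Variables (phi : space -> space) (c d : Cbar).
Hypotheses (Hphi : isometry phi) (Hcd : c <> d).
Hypotheses (Hc : boundary_maps phi c (Some (RtoC 0))) (Hd : boundary_maps phi d None).

Lemma classify_forms : exists k0 k1 k2 k3, forall p, H3 p ->
  nf v0 (phi p) = nf k0 p /\ nf v1 (phi p) = nf k1 p /\ nf v2 (phi p) = nf k2 p /\ nf v3 (phi p) = nf k3 p.
Proof.
  destruct (isometry_linear phi v0 Hphi) as [k0 K0]. destruct (isometry_linear phi v1 Hphi) as [k1 K1].
  destruct (isometry_linear phi v2 Hphi) as [k2 K2]. destruct (isometry_linear phi v3 Hphi) as [k3 K3].
  exists k0, k1, k2, k3. intros p Hp. repeat split; auto.
Qed.

Lemma near_d M : exists s0, 0 < s0 /\ forall s, 0 < s < s0 -> M < dot (phi (towards d s)) (phi (towards d s)).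
Proof.
  destruct (towards_boundary d (fun p => H3 p -> M < dot (phi p) (phi p))) as (s0 & H0 & K).
  - assert (Q : at_boundary None (fun q => H3 q -> M < dot q q)) by (exists M; auto).
    specialize (Hd _ Q). unfold filtermap in Hd.
    destruct d as [z|]; simpl in Hd |- *.
    + unfold within in Hd |- *. revert Hd. apply (filter_imp (F := locally ((z, 0) : space))). intros p HH Hp _. apply HH; auto. apply (proj1 Hphi); auto.
    + destruct Hd as [M' HM]. exists M'. intros p Hp HMp _. apply HM; auto. apply (proj1 Hphi); auto.
  - exists s0. split; auto. intros s Hs. apply K; auto. apply towards_H3. lra.
Qed.

Lemma near_c eps : 0 < eps -> exists s0, 0 < s0 /\
  forall s, 0 < s < s0 -> dot (phi (towards c s)) (phi (towards c s)) < eps.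
Proof.
  intros He.
  assert (Q : at_boundary (Some (RtoC 0)) (fun q => H3 q -> dot q q < eps)).
  { set (e := Rmin 1 (eps / 3)). assert (E0 : 0 < e) by (unfold e; apply Rmin_glb_lt; lra).
    exists (mkposreal e E0). intros [[x y] w] [[B1 B2] B3] _ _.
    change (Rabs (x - 0) < e) in B1. change (Rabs (y - 0) < e) in B2. change (Rabs (w - 0) < e) in B3.
    change (x * x + y * y + w * w < eps).
    assert (E1 : e <= 1) by apply Rmin_l. assert (E3 : e <= eps / 3) by apply Rmin_r.
    assert (G : forall u, Rabs (u - 0) < e -> u * u < eps / 3).
    { intros u Hu. rewrite Rminus_0_r in Hu. apply Rabs_def2 in Hu. nra. }
    pose proof (G _ B1). pose proof (G _ B2). pose proof (G _ B3). lra. }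
  destruct (towards_boundary c (fun p => H3 p -> dot (phi p) (phi p) < eps)) as (s0 & H0 & K).
  - specialize (Hc _ Q). unfold filtermap in Hc.
    destruct c as [z|]; simpl in Hc |- *.
    + unfold within in Hc |- *. revert Hc. apply (filter_imp (F := locally ((z, 0) : space))). intros p HH Hp _. apply HH; auto. apply (proj1 Hphi); auto.
    + destruct Hc as [M' HM]. exists M'. intros p Hp HMp _. apply HM; auto. apply (proj1 Hphi); auto.
  - exists s0. split; auto. intros s Hs. apply K; auto. apply towards_H3. lra.
Qed.

Lemma even_ge0 (P Q S : R) : (forall s, 0 < s -> 0 <= P + Q * s ^ 2 + S * s ^ 4) -> 0 <= P.
Proof.
  intros H. apply (ge0_limit P (Q + Rabs S) 1); [lra|]. intros s [H0 H1]. specialize (H s H0).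
  assert (S * s ^ 4 <= Rabs S * s ^ 2).
  { assert (A := Rle_abs S). assert (A' := Rabs_pos S). assert (0 <= s ^ 4) by (apply pow_le; lra).
    assert (s ^ 4 <= s ^ 2).
    { replace (s ^ 4) with (s ^ 2 * s ^ 2) by ring. assert (0 <= s ^ 2 <= 1) by (split; [apply pow_le; lra | nra]). nra. }
    apply Rle_trans with (Rabs S * s ^ 4); [apply Rmult_le_compat_r; lra | apply Rmult_le_compat_l; lra]. }
  lra.
Qed.

Lemma perp_cases (p1 q1 p2 q2 r : R) : p1 * p1 + q1 * q1 = r -> p2 * p2 + q2 * q2 = r ->
  p1 * p2 + q1 * q2 = 0 -> (p2 = - q1 /\ q2 = p1) \/ (p2 = q1 /\ q2 = - p1).
Proof.
  intros H1 H2 H3.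
  assert (E : (p1 * q2 - p2 * q1 - r) * (p1 * q2 - p2 * q1 + r) = 0).
  { replace ((p1 * q2 - p2 * q1 - r) * (p1 * q2 - p2 * q1 + r)) with
      ((p1 * p1 + q1 * q1) * (p2 * p2 + q2 * q2) - (p1 * p2 + q1 * q2) ^ 2 - r * r) by ring.
    rewrite H1, H2, H3. ring. }
  assert (Z : forall a b : R, a * a + b * b = 0 -> a = 0 /\ b = 0) by (intros; split; nra).
  destruct (Rmult_integral _ _ E) as [F|F].
  - left. destruct (Z (p2 + q1) (q2 - p1)).
    { replace ((p2 + q1) * (p2 + q1) + (q2 - p1) * (q2 - p1)) with
       ((p2 * p2 + q2 * q2) + (p1 * p1 + q1 * q1) - 2 * (p1 * q2 - p2 * q1)) by ring. rewrite H1, H2. lra. }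
    lra.
  - right. destruct (Z (p2 - q1) (q2 + p1)).
    { replace ((p2 - q1) * (p2 - q1) + (q2 + p1) * (q2 + p1)) with
       ((p2 * p2 + q2 * q2) + (p1 * p1 + q1 * q1) + 2 * (p1 * q2 - p2 * q1)) by ring. rewrite H1, H2. lra. }
    lra.
Qed.

Lemma pol_sym k a b : pol1 k a b = pol1 k b a /\ pol2 k a b = - pol2 k b a.
Proof. unfold pol1, pol2. split; field. Qed.

(** The coordinates n0, ..., n3 of the image are linear in the hyperboloid model. The
    first and the last are positive, and vanish at d and c respectively: this determines
    both up to a factor. The two others vanish at c and d; n0 n3 - n1^2 - n2^2 = 1
    leaves a similarity, direct or not. *)
Lemma isometry_classification : exists lam : C, lam <> RtoC 0 /\
  ((forall p, H3 p -> phi p = ((lam * fst (stdmap c d p))%C, Cmod lam * snd (stdmap c d p))) \/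
   (forall p, H3 p -> phi p = ((lam * Cconj (fst (stdmap c d p)))%C, Cmod lam * snd (stdmap c d p)))).
Proof.
  destruct classify_forms as (k0 & k1 & k2 & k3 & HK).
  assert (HP3 : forall p, H3 p -> 0 < snd (phi p)) by (intros p Hp; exact (proj1 Hphi p Hp)).
  assert (pos0 : forall p, H3 p -> 0 < nf k0 p).
  { intros p Hp. destruct (HK p Hp) as (E & _). rewrite <- E, nf_v0. apply Rinv_0_lt_compat; auto. }
  assert (dotpos : forall p, H3 p -> 0 < dot p p).
  { intros p Hp. unfold dot. change (0 < snd p) in Hp. pose proof (Rmult_lt_0_compat _ _ Hp Hp).
    pose proof (Rle_0_sqr (Re (fst p))). pose proof (Rle_0_sqr (Im (fst p))). unfold Rsqr in *. lra. }
  assert (pos3 : forall p, H3 p -> 0 < nf k3 p).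
  { intros p Hp. destruct (HK p Hp) as (_ & _ & _ & E). rewrite <- E, nf_v3.
    apply Rmult_lt_0_compat; [apply dotpos; apply (proj1 Hphi); auto | apply Rinv_0_lt_compat; auto]. }
  assert (rat : forall p, H3 p -> nf k3 p = dot (phi p) (phi p) * nf k0 p).
  { intros p Hp. destruct (HK p Hp) as (E0 & _ & _ & E). now rewrite <- E, <- E0, nf_v3, nf_v0. }
  assert (hyp : forall p, H3 p -> nf k0 p * nf k3 p - nf k1 p ^ 2 - nf k2 p ^ 2 = 1).
  { intros p Hp. destruct (HK p Hp) as (E0 & E1 & E2 & E3). rewrite <- E0, <- E1, <- E2, <- E3.
    apply hyperboloid; auto. }
  assert (bpos : forall k z, (forall p, H3 p -> 0 < nf k p) -> 0 <= bval k z).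
  { intros k z Hk. destruct (towards_nf k z) as [r Hr]. apply (ge0_limit _ r 1); [lra|].
    intros s [Hs _]. rewrite <- Hr by auto. apply Rmult_le_pos; [lra|]. left. apply Hk, towards_H3; auto. }
  (* phi tends to infinity at d, so n3 / n0 does too *)
  assert (K0d : bval k0 d = 0).
  { destruct (towards_nf k0 d) as [r0 Hr0]. destruct (towards_nf k3 d) as [r3 Hr3].
    assert (Q : forall M, 0 <= bval k3 d - M * bval k0 d).
    { intros M. destruct (near_d M) as (s0 & Hs0 & Hs).
      apply (ge0_limit _ (r3 - M * r0) s0 Hs0). intros s Is. specialize (Hs s Is).
      replace (bval k3 d - M * bval k0 d + (r3 - M * r0) * s ^ 2) with
        ((bval k3 d + r3 * s ^ 2) - M * (bval k0 d + r0 * s ^ 2)) by ring.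
      rewrite <- Hr0, <- Hr3 by lra.
      assert (T := towards_H3 d s (proj1 Is)). rewrite (rat _ T).
      replace (s * (dot (phi (towards d s)) (phi (towards d s)) * nf k0 (towards d s)) - M * (s * nf k0 (towards d s)))
        with (s * nf k0 (towards d s) * (dot (phi (towards d s)) (phi (towards d s)) - M)) by ring.
      apply Rmult_le_pos; [|lra]. apply Rmult_le_pos; [lra|]. left. now apply pos0. }
    apply Rle_antisym; [|now apply bpos]. apply Rnot_lt_le. intros N.
    specialize (Q ((Rabs (bval k3 d) + 1) / bval k0 d)).
    replace ((Rabs (bval k3 d) + 1) / bval k0 d * bval k0 d) with (Rabs (bval k3 d) + 1) in Q by (field; lra).
    assert (A := Rle_abs (bval k3 d)). lra. }
  assert (K3c : bval k3 c = 0).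
  { destruct (towards_nf k0 c) as [r0 Hr0]. destruct (towards_nf k3 c) as [r3 Hr3].
    assert (Q : forall eps, 0 < eps -> 0 <= eps * bval k0 c - bval k3 c).
    { intros eps He. destruct (near_c eps He) as (s0 & Hs0 & Hs).
      apply (ge0_limit _ (eps * r0 - r3) s0 Hs0). intros s Is. specialize (Hs s Is).
      replace (eps * bval k0 c - bval k3 c + (eps * r0 - r3) * s ^ 2) with
        (eps * (bval k0 c + r0 * s ^ 2) - (bval k3 c + r3 * s ^ 2)) by ring.
      rewrite <- Hr0, <- Hr3 by lra.
      assert (T := towards_H3 c s (proj1 Is)). rewrite (rat _ T).
      replace (eps * (s * nf k0 (towards c s)) - s * (dot (phi (towards c s)) (phi (towards c s)) * nf k0 (towards c s)))
        with (s * nf k0 (towards c s) * (eps - dot (phi (towards c s)) (phi (towards c s)))) by ring.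
      apply Rmult_le_pos; [|lra]. apply Rmult_le_pos; [lra|]. left. now apply pos0. }
    apply Rle_antisym; [|now apply bpos]. apply Rnot_lt_le. intros N.
    assert (B := bpos k0 c pos0).
    specialize (Q (bval k3 c / (2 * (bval k0 c + 1))) ltac:(apply Rdiv_lt_0_compat; lra)).
    assert (bval k3 c / (2 * (bval k0 c + 1)) * bval k0 c < bval k3 c).
    { apply (Rmult_lt_reg_r (2 * (bval k0 c + 1))); [lra|].
      replace (bval k3 c / (2 * (bval k0 c + 1)) * bval k0 c * (2 * (bval k0 c + 1))) with
        (bval k3 c * bval k0 c) by (field; lra). nra. }
    lra. }
  (* n1^2 + n2^2 is less than n0 n3 *)
  assert (K12 : forall z, bval k0 z * bval k3 z = 0 -> bval k1 z = 0 /\ bval k2 z = 0).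
  { intros z Hz. destruct (towards_nf k0 z) as [r0 Hr0]. destruct (towards_nf k3 z) as [r3 Hr3].
    destruct (towards_nf k1 z) as [r1 Hr1]. destruct (towards_nf k2 z) as [r2 Hr2].
    assert (Q : 0 <= bval k0 z * bval k3 z - bval k1 z ^ 2 - bval k2 z ^ 2).
    { apply (even_ge0 _ (bval k0 z * r3 + r0 * bval k3 z - 2 * bval k1 z * r1 - 2 * bval k2 z * r2)
        (r0 * r3 - r1 ^ 2 - r2 ^ 2)). intros s Hs.
      match goal with |- 0 <= ?x => replace x with
       ((bval k0 z + r0 * s ^ 2) * (bval k3 z + r3 * s ^ 2) - (bval k1 z + r1 * s ^ 2) ^ 2 - (bval k2 z + r2 * s ^ 2) ^ 2)
       by ring end.
      rewrite <- Hr0, <- Hr1, <- Hr2, <- Hr3 by auto.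
      match goal with |- 0 <= ?x => replace x with (s ^ 2 * (nf k0 (towards z s) * nf k3 (towards z s)
         - nf k1 (towards z s) ^ 2 - nf k2 (towards z s) ^ 2)) by ring end.
      rewrite hyp by (apply towards_H3; auto). pose proof (pow2_ge_0 s). lra. }
    rewrite Hz in Q. split; nra. }
  destruct (K12 c) as [K1c K2c]. { rewrite K3c. ring. }
  destruct (K12 d) as [K1d K2d]. { rewrite K0d. ring. }
  destruct (nonneg_isotropic k0 c d Hcd pos0 K0d) as [Z1 Z2].
  destruct (nonneg_isotropic k3 d c (not_eq_sym Hcd) pos3 K3c) as [Z3 Z4].
  rewrite (proj1 (pol_sym _ _ _)) in Z3. rewrite (proj2 (pol_sym _ _ _)) in Z4.
  assert (HB := br2_pos c d Hcd).
  set (B := br2 c d) in *. set (K0 := bval k0 c) in *. set (K3 := bval k3 d) in *.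
  set (P1 := pol1 k1 d c). set (P2 := pol2 k1 d c). set (Q1 := pol1 k2 d c). set (Q2 := pol2 k2 d c).
  assert (F0 : forall p, H3 p -> B * (snd p * nf k0 p) = hN d p * K0).
  { intros p Hp. pose proof (nf_basis k0 c d p Hp) as E. rewrite K0d, Z1, Z2 in E. etransitivity; [exact E|]. fold K0. ring. }
  assert (F3 : forall p, H3 p -> B * (snd p * nf k3 p) = hN c p * K3).
  { intros p Hp. pose proof (nf_basis k3 c d p Hp) as E. rewrite K3c, Z3 in E.
    replace (pol2 k3 d c) with 0 in E by lra. etransitivity; [exact E|]. fold K3. ring. }
  assert (F1 : forall p, H3 p -> B * (snd p * nf k1 p) = - 2 * (h1 c d p * P1 - h2 c d p * P2)).
  { intros p Hp. pose proof (nf_basis k1 c d p Hp) as E. rewrite K1c, K1d in E. etransitivity; [exact E|]. fold P1 P2. ring. }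
  assert (F2 : forall p, H3 p -> B * (snd p * nf k2 p) = - 2 * (h1 c d p * Q1 - h2 c d p * Q2)).
  { intros p Hp. pose proof (nf_basis k2 c d p Hp) as E. rewrite K2c, K2d in E. etransitivity; [exact E|]. fold Q1 Q2. ring. }
  (* coefficients of n0 n3 - n1^2 - n2^2 as a quadratic form in h1, h2; it has to be a
     multiple of the square of the height *)
  set (a := K0 * K3 - 4 * (P1 * P1 + Q1 * Q1)). set (b := 8 * (P1 * P2 + Q1 * Q2)).
  set (e := K0 * K3 - 4 * (P2 * P2 + Q2 * Q2)).
  assert (F : forall p, H3 p -> a * h1 c d p ^ 2 + b * (h1 c d p * h2 c d p) + e * h2 c d p ^ 2 =
     (B ^ 2 - B * (K0 * K3)) * snd p ^ 2).
  { intros p Hp. assert (E := h_sq c d p). fold B in E.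
    assert (E' : (hN d p * K0) * (hN c p * K3) - (- 2 * (h1 c d p * P1 - h2 c d p * P2)) ^ 2 -
      (- 2 * (h1 c d p * Q1 - h2 c d p * Q2)) ^ 2 = B ^ 2 * snd p ^ 2).
    { rewrite <- F0, <- F1, <- F2, <- F3 by auto.
      match goal with |- ?x = _ => replace x with (B ^ 2 * snd p ^ 2 *
        (nf k0 p * nf k3 p - nf k1 p ^ 2 - nf k2 p ^ 2)) by ring end. rewrite hyp by auto. ring. }
    assert (E2 : hN c p * hN d p = h1 c d p ^ 2 + h2 c d p ^ 2 + B * snd p ^ 2) by lra.
    replace (hN d p * K0 * (hN c p * K3)) with (hN c p * hN d p * (K0 * K3)) in E' by ring.
    rewrite E2 in E'. unfold a, b, e. lra. }
  assert (G : forall u v : R, 1 < u ^ 2 + v ^ 2 -> a * u ^ 2 + b * (u * v) + e * v ^ 2 = 0).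
  { intros u v Huv.
    assert (M1 : Cmod ((u, v) : C) ^ 2 = u ^ 2 + v ^ 2) by (rewrite Cmod2; reflexivity).
    destruct (ratio_values c d (u, v) Hcd) as (z & m & Hm & V).
    { intros Z. rewrite Z in M1. lra. }
    { intros Z. injection Z as Zu Zv. rewrite Zu, Zv in Huv. lra. }
    set (x := xh c * xh d) in *.
    assert (L : m ^ 2 * (a * u ^ 2 + b * (u * v) + e * v ^ 2) = 0).
    { apply (even_poly0 _ (2 * a * u * m * x + b * v * m * x - (B ^ 2 - B * (K0 * K3))) (a * x ^ 2)).
      intros w Hw. assert (Hp : H3 (hpt z w)) by exact Hw. pose proof (F _ Hp) as E.
      destruct (V w) as (_ & _ & V1 & V2). rewrite V1, V2 in E. change (snd (hpt z w)) with w in E.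
      simpl Re in E. simpl Im in E. fold x in E.
      apply Rminus_diag_eq in E. rewrite <- E. ring. }
    apply Rmult_integral in L. destruct L as [L|L]; auto. exfalso. pose proof (pow_lt m 2 Hm). lra. }
  assert (Ga := G 2 0 ltac:(lra)). assert (Ge := G 0 2 ltac:(lra)). assert (Gb := G 2 2 ltac:(lra)).
  assert (a0 : a = 0) by lra. assert (e0 : e = 0) by lra. assert (b0 : b = 0) by lra.
  assert (o0 : H3 (hpt (RtoC 0) 1)) by (unfold H3, hpt; simpl; lra).
  assert (KK : K0 * K3 = B).
  { pose proof (F _ o0) as E. rewrite a0, b0, e0 in E. change (snd (hpt 0 1)) with 1 in E.
    assert (B * (K0 * K3 - B) = 0) by lra. apply Rmult_integral in H. lra. }
  assert (HK0 : 0 < K0).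
  { pose proof (F0 _ o0) as E. pose proof (pos0 _ o0). pose proof (hN_pos d _ o0).
    change (snd (hpt 0 1)) with 1 in E. assert (0 < hN d (hpt 0 1) * K0).
    { rewrite <- E. apply Rmult_lt_0_compat; lra. }
    apply (Rmult_lt_reg_l (hN d (hpt 0 1))); lra. }
  unfold a, b, e in a0, b0, e0. rewrite KK in a0, e0.
  set (lam := ((- 2 * P1 / K0, - 2 * Q1 / K0) : C)).
  assert (L2 : Cmod lam ^ 2 = B / K0 ^ 2).
  { rewrite Cmod2. unfold lam; simpl. replace B with (4 * (P1 * P1 + Q1 * Q1)) by lra. field. lra. }
  assert (L1 : Cmod lam = sqrt B / K0).
  { apply Rsqr_inj; [apply Cmod_ge_0| apply Rdiv_le_0_compat; [apply sqrt_pos | auto] |].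
    rewrite !Rsqr_pow2, L2. unfold Rdiv. rewrite Rpow_mult_distr, pow2_sqrt by lra. rewrite pow_inv. reflexivity. }
  assert (SB : sqrt B * sqrt B = B) by (apply sqrt_sqrt; lra).
  assert (W : forall p, H3 p -> snd (phi p) = Cmod lam * snd (stdmap c d p)).
  { intros p Hp. rewrite L1. simpl. fold B. destruct (HK p Hp) as (E0 & _). rewrite nf_v0 in E0.
    apply (f_equal Rinv) in E0. rewrite Rinv_inv in E0. etransitivity; [exact E0|]. pose proof (hN_pos d p Hp). change (0 < snd p) in Hp.
    replace (nf k0 p) with (hN d p * K0 / (B * snd p)).
    2:{ rewrite <- F0 by auto. field. lra. }
    transitivity ((sqrt B * sqrt B) * snd p / (hN d p * K0)); [rewrite SB|]; ht p w; field; repeat split; apply Rgt_not_eq; assumption. }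
  assert (V1 : forall p, H3 p -> Re (fst (phi p)) = - 2 * (h1 c d p * P1 - h2 c d p * P2) / (hN d p * K0) /\
     Im (fst (phi p)) = - 2 * (h1 c d p * Q1 - h2 c d p * Q2) / (hN d p * K0)).
  { intros p Hp. rewrite <- F0, <- F1, <- F2 by auto. destruct (HK p Hp) as (E0 & E1 & E2 & _).
    pose proof (pos0 p Hp). pose proof (HP3 p Hp). rewrite <- E0, <- E1, <- E2, nf_v0, nf_v1, nf_v2.
    change (0 < snd p) in Hp. ht p w. ht (phi p) w'. split; field; repeat split; apply Rgt_not_eq; assumption. }
  exists lam. split.
  { intros Z. rewrite Z, Cmod_0 in L2. assert (0 < B / K0 ^ 2) by (apply Rdiv_lt_0_compat; [lra | apply pow_lt; lra]).
    rewrite <- L2 in H. rewrite pow_i in H by lia. lra. }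
  destruct (perp_cases P1 Q1 P2 Q2 (B / 4)) as [[X Y]|[X Y]]; try lra.
  - right. intros p Hp. destruct (V1 p Hp) as [R1 R2]. pose proof (hN_pos d p Hp).
    apply space_eq; [| |now apply W].
    + etransitivity; [exact R1|]. rewrite X. simpl.  field. repeat split; lra.
    + etransitivity; [exact R2|]. rewrite Y. simpl.  field. repeat split; lra.
  - left. intros p Hp. destruct (V1 p Hp) as [R1 R2]. pose proof (hN_pos d p Hp).
    apply space_eq; [| |now apply W].
    + etransitivity; [exact R1|]. rewrite X. simpl.  field. repeat split; lra.
    + etransitivity; [exact R2|]. rewrite Y. simpl.  field. lra.
Qed.

End Classify.

(** * Killing fields *)

Definition gN (z : C) (p : space) : R :=
  (Re (fst p) - Re z) ^ 2 + (Im (fst p) - Im z) ^ 2 + snd p ^ 2.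

Lemma gN_pos z p : 0 < snd p -> 0 < gN z p.
Proof.
  intros Hp. unfold gN. apply Rplus_le_lt_0_compat; [apply Rplus_le_le_0_compat; apply pow2_ge_0|].
  apply pow_lt. exact Hp.
Qed.

(** stdmap c d for a finite d: an inversion centred at d followed by a similarity *)
Definition invsim (ep : R) (ka z : C) (p : space) : space :=
  ((ep - (Re ka * (Re (fst p) - Re z) + Im ka * (Im (fst p) - Im z)) * / gN z p,
    - (Im ka * (Re (fst p) - Re z) - Re ka * (Im (fst p) - Im z)) * / gN z p),
   Cmod ka * snd p * / gN z p).

Definition dinvsim (ka z : C) (p a : space) : space :=
  let U := Re (fst p) - Re z in let V := Im (fst p) - Im z in
  let P := 2 * (U * Re (fst a) + V * Im (fst a) + snd p * snd a) in
  let N := gN z p in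
  let DU := Re (fst a) * / N - U * P * (/ N) ^ 2 in
  let DV := Im (fst a) * / N - V * P * (/ N) ^ 2 in
  let DW := snd a * / N - snd p * P * (/ N) ^ 2 in
  ((- (Re ka * DU + Im ka * DV), - (Im ka * DU - Re ka * DV)), Cmod ka * DW).

Definition pole_bracket (c : Cbar) (z : C) : C := match c with Some x => (x - z)%C | None => RtoC 1 end.

Lemma pole_bracket_eq c z : pole_bracket c z = bracket c (Some z).
Proof. destruct c; reflexivity. Qed.

Lemma sqrt_br2 c d : sqrt (br2 c d) = Cmod (bracket c d).
Proof. unfold br2. rewrite <- Cmod2. apply sqrt_pow2, Cmod_ge_0. Qed.

Lemma stdmap_finite c z p : H3 p -> stdmap c (Some z) p = invsim (xh c) (pole_bracket c z) z p.
Proof.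
  intros Hp. pose proof (hN_pos (Some z) p Hp) as N. pose proof (gN_pos z p Hp) as N'.
  assert (E : hN (Some z) p = gN z p).
  { unfold hN, gN, sh, xh, yh, Re, Im. simpl. ring. }
  unfold stdmap. rewrite sqrt_br2, pole_bracket_eq, E. unfold invsim. apply space_eq.
  - assert (Q : h1 c (Some z) p = xh c * gN z p -
      (Re (pole_bracket c z) * (Re (fst p) - Re z) + Im (pole_bracket c z) * (Im (fst p) - Im z))).
    { destruct c as [x|]; unfold h1, sh, gN, xh, yh, pole_bracket, Re, Im; simpl; ring. }
    change (h1 c (Some z) p / gN z p = xh c -
      (Re (pole_bracket c z) * (Re (fst p) - Re z) + Im (pole_bracket c z) * (Im (fst p) - Im z)) * / gN z p).
    rewrite Q. field. lra.
  - assert (Q : h2 c (Some z) p = - (Im (pole_bracket c z) * (Re (fst p) - Re z) - Re (pole_bracket c z) * (Im (fst p) - Im z))).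
    { destruct c as [x|]; unfold h2, sh, gN, xh, yh, pole_bracket, Re, Im; simpl; ring. }
    change (h2 c (Some z) p / gN z p =
      - (Im (pole_bracket c z) * (Re (fst p) - Re z) - Re (pole_bracket c z) * (Im (fst p) - Im z)) * / gN z p).
    rewrite Q. reflexivity.
  - reflexivity.
Qed.

Lemma stdmap_infinite x p : stdmap (Some x) None p = ((x - fst p)%C, snd p).
Proof.
  assert (E : hN None p = 1). { unfold hN, sh, xh, yh, Re, Im. simpl. ring. }
  unfold stdmap. rewrite E, sqrt_br2. simpl bracket. rewrite Cmod_R, Rabs_left by lra.
  apply space_eq; unfold h1, h2, sh, xh, yh, Re, Im; simpl; field.
Qed.

Lemma invsim_curve ep ka z (q : R -> space) t v : 0 < snd (q t) -> is_deriveS q t v ->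
  is_deriveS (fun s => invsim ep ka z (q s)) t (dinvsim ka z (q t) v).
Proof.
  intros Hp (H1 & H2 & H3'). pose proof (gN_pos z _ Hp) as HN.
  destruct v as [[x y] e]. simpl in H1, H2, H3'.
  unfold dinvsim. cbv zeta.
  change (snd ((x, y, e) : space)) with e. change (Re (fst ((x, y, e) : space))) with x.
  change (Im (fst ((x, y, e) : space))) with y.
  set (u := fun s => Re (fst (q s))) in *. set (v := fun s => Im (fst (q s))) in *.
  set (w := fun s => snd (q s)) in *.
  derivative H1 u t F1.
  derivative H2 v t F2.
  derivative H3' w t F3.
  change (Re (fst (q t))) with (u t). change (Im (fst (q t))) with (v t). change (snd (q t)) with (w t).
  change (gN z (q t)) with ((u t - Re z) ^ 2 + (v t - Im z) ^ 2 + w t ^ 2) in *.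
  unfold is_deriveS. refine (conj _ (conj _ _)).
  - apply (is_derive_ext (fun s => ep - (Re ka * (u s - Re z) + Im ka * (v s - Im z)) *
      / ((u s - Re z) ^ 2 + (v s - Im z) ^ 2 + w s ^ 2))). { reflexivity. }
    evar_last. { auto_derive; [repeat split; auto; lra | reflexivity]. }
    rewrite F1, F2, F3. simpl Re. field. lra.
  - apply (is_derive_ext (fun s => - (Im ka * (u s - Re z) - Re ka * (v s - Im z)) *
      / ((u s - Re z) ^ 2 + (v s - Im z) ^ 2 + w s ^ 2))). { reflexivity. }
    evar_last. { auto_derive; [repeat split; auto; lra | reflexivity]. }
    rewrite F1, F2, F3. simpl Im. field. lra.
  - apply (is_derive_ext (fun s => Cmod ka * w s *
      / ((u s - Re z) ^ 2 + (v s - Im z) ^ 2 + w s ^ 2))). { reflexivity. }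
    evar_last. { auto_derive; [repeat split; auto; lra | reflexivity]. }
    rewrite F1, F2, F3. simpl snd. field. lra.
Qed.

(** Inversions and similarities are conformal. *)
Lemma dinvsim_dot ka z p a b : 0 < snd p ->
  dot (dinvsim ka z p a) (dinvsim ka z p b) = Cmod ka ^ 2 * dot a b * (/ gN z p) ^ 2.
Proof.
  intros Hp. pose proof (gN_pos z p Hp) as HN.
  assert (K := Cmod2 ka).
  assert (A : forall U V w a1 a2 a3 b1 b2 b3 i k1 k2 m N : R, m ^ 2 = k1 ^ 2 + k2 ^ 2 ->
    N = U ^ 2 + V ^ 2 + w ^ 2 -> N * i = 1 ->
    let P := 2 * (U * a1 + V * a2 + w * a3) in let Q := 2 * (U * b1 + V * b2 + w * b3) in
    let x1 := a1 * i - U * P * i ^ 2 in let x2 := a2 * i - V * P * i ^ 2 in let x3 := a3 * i - w * P * i ^ 2 in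
    let y1 := b1 * i - U * Q * i ^ 2 in let y2 := b2 * i - V * Q * i ^ 2 in let y3 := b3 * i - w * Q * i ^ 2 in
    - (k1 * x1 + k2 * x2) * - (k1 * y1 + k2 * y2) + - (k2 * x1 - k1 * x2) * - (k2 * y1 - k1 * y2) +
    m * x3 * (m * y3) = m ^ 2 * (a1 * b1 + a2 * b2 + a3 * b3) * i ^ 2).
  { intros U V w a1 a2 a3 b1 b2 b3 i k1 k2 m N Hm HN' Hi P Q x1 x2 x3 y1 y2 y3.
    transitivity (m ^ 2 * (x1 * y1 + x2 * y2 + x3 * y3)). { rewrite Hm at 1.
      replace (m * x3 * (m * y3)) with (m ^ 2 * (x3 * y3)) by ring. rewrite Hm. ring. }
    transitivity (m ^ 2 * (a1 * b1 + a2 * b2 + a3 * b3) * i ^ 2 + m ^ 2 * P * Q * i ^ 3 * (N * i - 1)).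
    { rewrite HN'. unfold x1, x2, x3, y1, y2, y3, P, Q. field. }
    rewrite Hi. ring. }
  pose proof (A (Re (fst p) - Re z) (Im (fst p) - Im z) (snd p) (Re (fst a)) (Im (fst a)) (snd a)
    (Re (fst b)) (Im (fst b)) (snd b) (/ gN z p) (Re ka) (Im ka) (Cmod ka) (gN z p) K eq_refl
    ltac:(field; lra)) as Q.
  exact Q.
Qed.

Lemma dinvsim_inj ka z p a b : ka <> RtoC 0 -> 0 < snd p -> dinvsim ka z p a = dinvsim ka z p b -> a = b.
Proof.
  intros Hka Hp E. pose proof (gN_pos z p Hp) as HN.
  assert (L : dinvsim ka z p (comb 1 (-1) a b) = comb 1 (-1) (dinvsim ka z p a) (dinvsim ka z p b)).
  { rewrite !comb_eq. apply space_eq; unfold dinvsim, vec; cbv zeta; simpl; unfold Re, Im; simpl; ring. }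
  pose proof (dinvsim_dot ka z p (comb 1 (-1) a b) (comb 1 (-1) a b) Hp) as D.
  rewrite L, E in D. set (X := comb 1 (-1) a b) in *.
  assert (Z : dot (comb 1 (-1) (dinvsim ka z p b) (dinvsim ka z p b)) (comb 1 (-1) (dinvsim ka z p b) (dinvsim ka z p b)) = 0).
  { rewrite comb_eq. unfold dot, vec. simpl. unfold Re, Im. simpl. ring. }
  rewrite Z in D. symmetry in D. apply Rmult_integral in D. destruct D as [D|D].
  2:{ exfalso. assert (0 < (/ gN z p) ^ 2) by (apply pow_lt, Rinv_0_lt_compat; auto). apply (Rlt_irrefl 0). rewrite <- D at 2. exact H. }
  apply Rmult_integral in D. destruct D as [D|D].
  { exfalso. assert (0 < Cmod ka ^ 2) by (apply pow_lt, Cmod_gt_0, Hka). apply (Rlt_irrefl 0). rewrite <- D at 2. exact H. }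
  apply sq3_zero in D. destruct D as (D1 & D2 & D3).
  unfold X in D1, D2, D3. destruct a as [[a1 a2] a3], b as [[b1 b2] b3].
  change (1 * a1 + -1 * b1 = 0) in D1. change (1 * a2 + -1 * b2 = 0) in D2.
  change (1 * a3 + -1 * b3 = 0) in D3.
  apply space_eq; simpl; lra.
Qed.

(** Translations (m = 1) and rotations (m = i) at once. *)
Definition flow (m : C) (t : R) (q : space) : space :=
  ((cexp (RtoC t * m) * fst q)%C, exp (t * Re m) * snd q).

Lemma cexp_tm t m : cexp (RtoC t * m)%C = (exp (t * Re m) * cos (t * Im m), exp (t * Re m) * sin (t * Im m)).
Proof.
  unfold cexp. replace (Re (RtoC t * m)) with (t * Re m) by (unfold Re, Im; simpl; ring).
  replace (Im (RtoC t * m)) with (t * Im m) by (unfold Re, Im; simpl; ring). reflexivity.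
Qed.

Lemma flow_translation t p : flow (RtoC 1) t p = std_translation t p.
Proof.
  unfold flow. rewrite cexp_tm. destruct p as [[x y] w].
  change (std_translation t (x, y, w)) with ((exp t * x, exp t * y, exp t * w) : space).
  simpl. rewrite Rmult_1_r, Rmult_0_r, cos_0, sin_0. apply space_eq; simpl; ring.
Qed.

Lemma flow_rotation t p : flow Ci t p = std_rotation t p.
Proof.
  unfold flow, std_rotation. rewrite cexp_tm. simpl. rewrite Rmult_0_r, exp_0, Rmult_1_r, !Rmult_1_l.
  reflexivity.
Qed.

Definition flow' (m : C) (q : space) : space := ((m * fst q)%C, Re m * snd q).

Lemma flow_deriv m q t : is_deriveS (fun s => flow m s q) t (flow' m (flow m t q)).
Proof.
  destruct q as [[x y] w], m as [a b].
  assert (E : forall s, flow (a, b) s (x, y, w) =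
    ((exp (s * a) * (cos (s * b) * x - sin (s * b) * y), exp (s * a) * (cos (s * b) * y + sin (s * b) * x)),
     exp (s * a) * w)).
  { intros s. unfold flow. rewrite cexp_tm. apply space_eq; simpl; ring. }
  rewrite E. unfold flow', is_deriveS. refine (conj _ (conj _ _)).
  - apply (is_derive_ext (fun s => exp (s * a) * (cos (s * b) * x - sin (s * b) * y))).
    { intros s. rewrite E. reflexivity. }
    evar_last. { auto_derive; [exact I | reflexivity]. } simpl. ring.
  - apply (is_derive_ext (fun s => exp (s * a) * (cos (s * b) * y + sin (s * b) * x))).
    { intros s. rewrite E. reflexivity. }
    evar_last. { auto_derive; [exact I | reflexivity]. } simpl. ring.
  - apply (is_derive_ext (fun s => exp (s * a) * w)).
    { intros s. rewrite E. reflexivity. }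
    evar_last. { auto_derive; [exact I | reflexivity]. } simpl. ring.
Qed.

(** Coefficients of the quadratic vector field vanishing at c and d, with
    multiplier m at c. *)
Definition kth (m : C) (c d : Cbar) : C := (m / bracket c d)%C.
Definition kal (m : C) (c d : Cbar) : C := (kth m c d * (RtoC (xh c) * RtoC (xh d)))%C.
Definition kbe (m : C) (c d : Cbar) : C :=
  (- (kth m c d * (yh c * RtoC (xh d) + yh d * RtoC (xh c))))%C.
Definition kga (m : C) (c d : Cbar) : C := (kth m c d * (yh c * yh d))%C.
Definition killing (m : C) (c d : Cbar) : space -> space := Kf (kal m c d) (kbe m c d) (kga m c d).

Lemma dinvsim_killing m c z p : c <> Some z -> 0 < snd p ->
  dinvsim (pole_bracket c z) z p (killing m c (Some z) p) = flow' m (invsim (xh c) (pole_bracket c z) z p).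
Proof.
  intros N Hp. pose proof (gN_pos z p Hp) as HN.
  assert (Em : m = (kth m c (Some z) * pole_bracket c z)%C).
  { unfold kth. rewrite pole_bracket_eq. field. now apply bracket_neq0. }
  assert (G : gN z p = (Re (fst p) - Re z) ^ 2 + (Im (fst p) - Im z) ^ 2 + snd p ^ 2) by reflexivity.
  unfold killing, kal, kbe, kga. set (th := kth m c (Some z)) in *. rewrite Em. clear Em.
  destruct p as [[x y] w], th as [a b], z as [z1 z2].
  destruct c as [[c1 c2]|].
  - unfold flow', invsim, dinvsim, pole_bracket, xh, yh. cbv zeta. unfold Kf, qf, qf'.
    set (K := Cmod _). rewrite G in *. clear G. simpl in *. unfold Re, Im in *. simpl in *.
    apply space_eq; simpl; field; lra.
  - unfold flow', invsim, dinvsim, pole_bracket, xh, yh. cbv zeta. unfold Kf, qf, qf'.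
    set (K := Cmod _). rewrite G in *. clear G. simpl in *. unfold Re, Im in *. simpl in *.
    apply space_eq; simpl; field; lra.
Qed.

(** The conjugate of the curve by stdmap has a known velocity, and the differential of
    stdmap is injective. *)
Lemma stdmap_curve_killing m c d (q : R -> space) P t v : c <> d -> (forall s, H3 (q s)) ->
  is_deriveS q t v -> (forall s, stdmap c d (q s) = flow m s P) -> v = killing m c d (q t).
Proof.
  intros N Hq D E. assert (Hp := Hq t : 0 < snd (q t)). destruct d as [z|].
  - assert (E' : forall s, invsim (xh c) (pole_bracket c z) z (q s) = flow m s P).
    { intros s. rewrite <- stdmap_finite by apply Hq. apply E. }
    apply (dinvsim_inj (pole_bracket c z) z (q t)); auto.
    { rewrite pole_bracket_eq. now apply bracket_neq0. }
    rewrite dinvsim_killing by auto. rewrite E'.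
    apply (is_deriveS_unique (fun s => flow m s P) t); [|apply flow_deriv].
    destruct (invsim_curve (xh c) (pole_bracket c z) z q t v Hp D) as (A1 & A2 & A3).
    refine (conj _ (conj _ _)).
    + refine (is_derive_ext _ _ _ _ (fun s => f_equal (fun P => Re (fst P)) (E' s)) A1).
    + refine (is_derive_ext _ _ _ _ (fun s => f_equal (fun P => Im (fst P)) (E' s)) A2).
    + refine (is_derive_ext _ _ _ _ (fun s => f_equal (fun P => snd P) (E' s)) A3).
  - destruct c as [x|]; [|now elim N].
    assert (E' : forall s, flow m s P = ((x - fst (q s))%C, snd (q s))).
    { intros s. rewrite <- E. apply stdmap_infinite. }
    pose proof (flow_deriv m P t) as F.
    assert (F' : is_deriveS (fun s => flow m s P) t ((- fst v)%C, snd v)).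
    { destruct D as (A1 & A2 & A3). refine (conj _ (conj _ _)).
      - apply (is_derive_ext (fun s => Re x - Re (fst (q s)))). { intros s. rewrite E'. reflexivity. }
        evar_last. { apply (is_derive_minus (fun _ => Re x) (fun s => Re (fst (q s)))); [apply is_derive_const | exact A1]. }
        change (0 - Re (fst v) = - Re (fst v)). ring.
      - apply (is_derive_ext (fun s => Im x - Im (fst (q s)))). { intros s. rewrite E'. reflexivity. }
        evar_last. { apply (is_derive_minus (fun _ => Im x) (fun s => Im (fst (q s)))); [apply is_derive_const | exact A2]. }
        change (0 - Im (fst v) = - Im (fst v)). ring.
      - apply (is_derive_ext (fun s => snd (q s))). { intros s. rewrite E'. reflexivity. } exact A3. }
    pose proof (is_deriveS_unique _ _ _ _ F F') as U. rewrite E' in U.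
    unfold killing, kal, kbe, kga, kth. simpl bracket. simpl xh. simpl yh.
    replace (m / RtoC (-1))%C with (- m)%C.
    2:{ apply injective_projections; simpl; field. }
    unfold Kf, qf, qf'. destruct (q t) as [[u1 u2] w], v as [[v1 v2] v3], m as [m1 m2], x as [x1 x2].
    unfold flow' in U. simpl in U. injection U as U1 U2 U3.
    apply space_eq; simpl; lra.
Qed.

Lemma dspace_line (phi psi : space -> space) p a v : (forall q, H3 q -> phi q = psi q) -> H3 p ->
  is_deriveS (fun t : R => psi (plus p (scal t a))) 0 v -> dspace phi a p = v.
Proof.
  intros E Hp (D1 & D2 & D3). destruct v as [[x y] w].
  assert (G : forall f : space -> R, forall l, is_derive (fun t : R => f (psi (plus p (scal t a)))) 0 l ->
    dir_deriv (fun q => f (phi q)) a p = l).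
  { intros f l Hl. rewrite (dir_ext_loc H3 _ (fun q => f (psi q)) p a open_H3); auto.
    - now apply dir_unique.
    - intros q Hq. now rewrite E. }
  apply space_eq; [exact (G (fun q => Re (fst q)) _ D1) | exact (G (fun q => Im (fst q)) _ D2) | exact (G (fun q => snd q) _ D3)].
Qed.

Lemma line_deriveS (p a : space) : is_deriveS (fun t : R => plus p (scal t a)) 0 a.
Proof. exact (coord_line p a). Qed.

Lemma stdmap_line c d p a : c <> d -> H3 p -> exists v, is_deriveS (fun t : R => stdmap c d (plus p (scal t a))) 0 v /\
  v = match d with Some z => dinvsim (pole_bracket c z) z p a | None => ((- fst a)%C, snd a) end.
Proof.
  intros N Hp. eexists. split; [|reflexivity]. destruct d as [z|].
  - assert (P0 : 0 < snd (plus p (scal 0 a))) by (rewrite line_0; exact Hp).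
    pose proof (invsim_curve (xh c) (pole_bracket c z) z _ 0 a P0 (line_deriveS p a)) as (A1 & A2 & A3).
    cbv beta in A1, A2, A3. rewrite line_0 in A1, A2, A3.
    assert (L : locally (0 : R) (fun t : R => invsim (xh c) (pole_bracket c z) z (plus p (scal t a)) =
       stdmap c (Some z) (plus p (scal t a)))).
    { generalize (line_locally0 H3 p a open_H3 Hp). apply filter_imp. intros t Ht.
      symmetry. now apply stdmap_finite. }
    refine (conj _ (conj _ _)).
    + refine (is_derive_ext_loc _ _ _ _ _ A1). revert L. apply filter_imp. intros t Ht. exact (f_equal (fun P => Re (fst P)) Ht).
    + refine (is_derive_ext_loc _ _ _ _ _ A2). revert L. apply filter_imp. intros t Ht. exact (f_equal (fun P => Im (fst P)) Ht).
    + refine (is_derive_ext_loc _ _ _ _ _ A3). revert L. apply filter_imp. intros t Ht. exact (f_equal (fun P => snd P) Ht).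
  - destruct c as [x|]; [|now elim N]. destruct p as [[u v] w], a as [[a1 a2] a3], x as [x1 x2].
    assert (L : forall r b : R, is_derive (fun t : R => r - (b + t * a1)) 0 (- a1)).
    { intros r b. evar_last. { auto_derive; [exact I | reflexivity]. } ring. }
    assert (L2 : forall r b : R, is_derive (fun t : R => r - (b + t * a2)) 0 (- a2)).
    { intros r b. evar_last. { auto_derive; [exact I | reflexivity]. } ring. }
    refine (conj _ (conj _ _)).
    + apply (is_derive_ext (fun t : R => x1 - (u + t * a1))); [|apply L].
      intros t. rewrite stdmap_infinite. reflexivity.
    + apply (is_derive_ext (fun t : R => x2 - (v + t * a2))); [|apply L2].
      intros t. rewrite stdmap_infinite. reflexivity.
    + apply (is_derive_ext (fun t : R => snd (plus ((u, v, w) : space) (scal t ((a1, a2, a3) : space))))).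
      * intros t. rewrite stdmap_infinite. reflexivity.
      * apply (coord_line (u, v, w) (a1, a2, a3)).
Qed.

(** The determinant of the differential is computed at a point where it is easy: over d
    if d is finite. *)
Lemma conj_not_orientation (phi : space -> space) c d lam : c <> d -> lam <> RtoC 0 ->
  (forall p, H3 p -> phi p = ((lam * Cconj (fst (stdmap c d p)))%C, Cmod lam * snd (stdmap c d p))) ->
  ~ orientation_preserving phi.
Proof.
  intros N Hl E HO. specialize (HO (towards d 1) (towards_H3 d 1 Rlt_0_1)).
  assert (D : forall a, dspace phi a (towards d 1) =
    let v := match d with Some z => dinvsim (pole_bracket c z) z (towards d 1) a | None => ((- fst a)%C, snd a) end in
    ((lam * Cconj (fst v))%C, Cmod lam * snd v)).
  { intros a. destruct (stdmap_line c d (towards d 1) a N (towards_H3 d 1 Rlt_0_1)) as (v & Dv & Ev).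
    rewrite <- Ev. cbv zeta. apply (dspace_line phi _ _ a _ E (towards_H3 d 1 Rlt_0_1)).
    destruct Dv as (A1 & A2 & A3). destruct lam as [l1 l2]. set (m := Cmod (l1, l2)).
    set (f := fun t : R => Re (fst (stdmap c d (plus (towards d 1) (scal t a))))) in *.
    set (g := fun t : R => Im (fst (stdmap c d (plus (towards d 1) (scal t a))))) in *.
    set (h := fun t : R => snd (stdmap c d (plus (towards d 1) (scal t a)))) in *.
    derivative A1 f 0 F1.
    derivative A2 g 0 F2.
    derivative A3 h 0 F3.
    refine (conj _ (conj _ _)).
    - apply (is_derive_ext (fun t : R => l1 * f t - l2 * - g t)). { reflexivity. }
      evar_last. { auto_derive; [repeat split; auto | reflexivity]. } rewrite F1, F2.
      destruct v as [[v1' v2'] v3']. simpl. ring.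
    - apply (is_derive_ext (fun t : R => l1 * - g t + l2 * f t)). { reflexivity. }
      evar_last. { auto_derive; [repeat split; auto | reflexivity]. } rewrite F1, F2.
      destruct v as [[v1' v2'] v3']. simpl. ring.
    - apply (is_derive_ext (fun t : R => m * h t)). { reflexivity. }
      evar_last. { auto_derive; [repeat split; auto | reflexivity]. } rewrite F3.
      destruct v as [[v1' v2'] v3']. simpl. ring. }
  rewrite !D in HO. cbv zeta in HO. clear D E.
  assert (HL' := proj1 (Cmod_gt_0 lam) Hl).
  assert (M := Cmod2 lam). set (m := Cmod lam) in *. clearbody m. destruct lam as [l1 l2]. simpl in M.
  destruct d as [z|].
  - assert (Hk : 0 < Cmod (pole_bracket c z)). { apply Cmod_gt_0. rewrite pole_bracket_eq. now apply bracket_neq0. }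
    assert (Mk := Cmod2 (pole_bracket c z)). unfold dinvsim in HO. set (mk := Cmod (pole_bracket c z)) in *. clearbody mk.
    destruct (pole_bracket c z) as [k1 k2], z as [z1 z2]. simpl in Mk.
    assert (G : gN (z1, z2) (towards (Some (z1, z2)) 1) = 1).
    { unfold gN; simpl. ring. }
    repeat match type of HO with context [gN ?a ?b] => change (gN a b) with (gN (z1, z2) (towards (Some (z1, z2)) 1)) in HO; rewrite G in HO end.
    unfold det3, dot, cross, vec, towards in HO. simpl in HO.
    assert (Q : 0 < (l1 * l1 + l2 * l2) * (k1 * k1 + k2 * k2) * - (m * mk)).
    { eapply Rlt_le_trans; [exact HO|]. right. field. }
    assert (0 < m * mk) by (apply Rmult_lt_0_compat; auto).
    assert (0 < (l1 * l1 + l2 * l2) * (k1 * k1 + k2 * k2)).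
    { replace (l1 * l1 + l2 * l2) with (m ^ 2) by (simpl; lra). replace (k1 * k1 + k2 * k2) with (mk ^ 2) by (simpl; lra).
      apply Rmult_lt_0_compat; apply pow_lt; auto. }
    nra.
  - unfold det3, dot, cross, vec in HO. simpl in HO.
    assert (Q : 0 < (l1 * l1 + l2 * l2) * - m).
    { eapply Rlt_le_trans; [exact HO|]. right. ring. }
    nra.
Qed.

Lemma isometry_inj phi p q : isometry phi -> H3 p -> H3 q -> phi p = phi q -> p = q.
Proof.
  intros (_ & (psi & Hpsi) & _) Hp Hq E.
  destruct (Hpsi p Hp) as (_ & _ & A). destruct (Hpsi q Hq) as (_ & _ & B). now rewrite <- A, <- B, E.
Qed.

Lemma conjugate_flow c d m t Phi : c <> d -> conjugate_along c d (flow m t) Phi ->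
  forall p, H3 p -> H3 (Phi p) /\ stdmap c d (Phi p) = flow m t (stdmap c d p).
Proof.
  intros N (phi & Hi & Ho & Hc & Hd & HP) p Hp. destruct (HP p Hp) as [HP3 E]. split; auto.
  destruct (isometry_classification phi c d Hi N Hc Hd) as (lam & Hl & [L|L]).
  - rewrite (L _ HP3), (L _ Hp) in E. unfold flow in E |- *.
    set (a := stdmap c d (Phi p)) in *. set (b := stdmap c d p) in *. clearbody a b.
    apply (f_equal fst) in E as E1. apply (f_equal snd) in E as E2. destruct a as [a1 a2], b as [b1' b2'].
    simpl fst in *. simpl snd in *.
    assert (HL : Cmod lam <> 0) by (apply Rgt_not_eq; exact (proj1 (Cmod_gt_0 lam) Hl)).
    apply injective_projections; simpl fst; simpl snd.
    + apply (Cmult_cancel lam); auto. rewrite E1. ring.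
    + apply (Rmult_eq_reg_l (Cmod lam)); auto. rewrite E2. ring.
  - exfalso. exact (conj_not_orientation phi c d lam N Hl L Ho).
Qed.

Lemma is_derive_S (f : R -> space) (t : R) l : is_derive (K := R_AbsRing) (V := space) f t l -> is_deriveS f t l.
Proof.
  intros D.
  assert (L1 : is_derive (K := R_AbsRing) (V := plane) (fun s => fst (f s)) t (fst l)).
  { exact (filterdiff_comp' f fst t _ _ D (filterdiff_linear _ is_linear_fst)). }
  refine (conj _ (conj _ _)).
  - exact (filterdiff_comp' (fun s => fst (f s)) (fun z : plane => fst z) t _ _ L1 (filterdiff_linear _ is_linear_fst)).
  - exact (filterdiff_comp' (fun s => fst (f s)) (fun z : plane => snd z) t _ _ L1 (filterdiff_linear _ is_linear_snd)).
  - exact (filterdiff_comp' f snd t _ _ D (filterdiff_linear _ is_linear_snd)).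
Qed.

Lemma is_derive_S_inv (f : R -> space) (t : R) l : is_deriveS f t l -> is_derive (K := R_AbsRing) (V := space) f t l.
Proof.
  intros (D1 & D2 & D3).
  assert (L1 : is_derive (K := R_AbsRing) (V := plane) (fun s => fst (f s)) t (fst l)).
  { apply (filterdiff_ext (fun s => (Re (fst (f s)), Im (fst (f s))) : plane)).
    { intros s. symmetry. apply surjective_pairing. }
    refine (filterdiff_ext_lin _ _ _ (filterdiff_comp'_2 (fun s => Re (fst (f s))) (fun s => Im (fst (f s)))
      (fun x y => (x, y) : plane) t _ _ (fun x y => (x, y) : plane) D1 D2 _) _).
    - apply filterdiff_linear. split; [reflexivity|reflexivity|].
      exists 1. split; [lra|]. intros x. rewrite Rmult_1_l. apply Rle_refl.
    - intros y. apply injective_projections; reflexivity. }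
  apply (filterdiff_ext (fun s => (fst (f s), snd (f s)) : space)).
  { intros s. symmetry. apply surjective_pairing. }
  refine (filterdiff_ext_lin _ _ _ (filterdiff_comp'_2 (fun s => fst (f s)) (fun s => snd (f s))
      (fun x y => (x, y) : space) t _ _ (fun x y => (x, y) : space) L1 D3 _) _).
  - apply filterdiff_linear. split; [reflexivity|reflexivity|].
    exists 1. split; [lra|]. intros x. rewrite Rmult_1_l. apply Rle_refl.
  - intros y. apply injective_projections; reflexivity.
Qed.

(** The conjugating isometry is not unique, but stdmap conjugates the flow as well. *)
Lemma generated_killing c d m Y : c <> d -> generated_by c d (flow m) Y ->
  forall p, H3 p -> Y p = killing m c d p.
Proof.
  intros N (Phi & HPhi & HD) p Hp.
  assert (E0 : Phi 0 p = p).
  { destruct (HPhi 0) as (phi & Hi & _ & _ & _ & HP). destruct (HP p Hp) as [H3P E].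
    apply (isometry_inj phi); auto. rewrite E. unfold flow. rewrite cexp_tm.
    rewrite !Rmult_0_l, exp_0, cos_0, sin_0. apply space_eq; simpl; ring. }
  pose proof (is_derive_S _ _ _ (HD 0 p Hp)) as D. rewrite E0 in D.
  rewrite <- E0 at 2.
  apply (stdmap_curve_killing m c d (fun s => Phi s p) (stdmap c d p)); auto.
  - intros s. apply (conjugate_flow c d m s (Phi s) N (HPhi s) p Hp).
  - intros s. apply (conjugate_flow c d m s (Phi s) N (HPhi s) p Hp).
Qed.

Section Moebius.
Variables (ep : R) (ka z : C).
Hypothesis Hka : ka <> RtoC 0.

Definition ginvX (q : space) : R := ((ep - Re (fst q)) * Re ka - Im (fst q) * Im ka) * / Cmod ka ^ 2.
Definition ginvY (q : space) : R := (Im (fst q) * Re ka + (ep - Re (fst q)) * Im ka) * / Cmod ka ^ 2.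
Definition ginvN (q : space) : R := ginvX q ^ 2 + ginvY q ^ 2 + (snd q * / Cmod ka) ^ 2.
Definition invsim_inv (q : space) : space :=
  ((Re z + ginvX q * / ginvN q, Im z + ginvY q * / ginvN q), snd q * / Cmod ka * / ginvN q).

Lemma Cmod_ka : 0 < Cmod ka.
Proof. exact (proj1 (Cmod_gt_0 ka) Hka). Qed.

Lemma ginvN_pos q : 0 < snd q -> 0 < ginvN q.
Proof.
  intros Hq. unfold ginvN. apply Rplus_le_lt_0_compat; [apply Rplus_le_le_0_compat; apply pow2_ge_0|].
  apply pow_lt, Rmult_lt_0_compat; [exact Hq|]. apply Rinv_0_lt_compat, Cmod_ka.
Qed.

Lemma invsim_H3 p : H3 p -> H3 (invsim ep ka z p).
Proof.
  intros Hp. unfold H3, invsim. simpl snd. apply Rmult_lt_0_compat.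
  - apply Rmult_lt_0_compat; [apply Cmod_ka | exact Hp].
  - apply Rinv_0_lt_compat, gN_pos. exact Hp.
Qed.

Lemma invsim_inv_H3 q : H3 q -> H3 (invsim_inv q).
Proof.
  intros Hp. unfold H3, invsim_inv. simpl snd. apply Rmult_lt_0_compat.
  - apply Rmult_lt_0_compat; [exact Hp | apply Rinv_0_lt_compat, Cmod_ka].
  - apply Rinv_0_lt_compat, ginvN_pos. exact Hp.
Qed.

Lemma invsim_inv_r q : H3 q -> invsim ep ka z (invsim_inv q) = q.
Proof.
  intros Hq. pose proof (ginvN_pos q Hq) as HN. pose proof Cmod_ka as Hm.
  assert (E : gN z (invsim_inv q) = / ginvN q).
  { transitivity (ginvN q * (/ ginvN q) ^ 2); [|field; lra].
    assert (A : forall x y w n i z1 z2 : R, n = x ^ 2 + y ^ 2 + w ^ 2 ->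
      (z1 + x * i - z1) ^ 2 + (z2 + y * i - z2) ^ 2 + (w * i) ^ 2 = n * i ^ 2) by (intros; subst n; ring).
    exact (A _ _ _ (ginvN q) (/ ginvN q) (Re z) (Im z) eq_refl). }
  pose proof (Cmod2 ka) as K.
  assert (K' : Re ka ^ 2 + Im ka ^ 2 <> 0) by (rewrite <- K; apply Rgt_not_eq, pow_lt; lra).
  unfold invsim. rewrite E, Rinv_inv. unfold invsim_inv. simpl Re. simpl Im. simpl snd.
  apply space_eq.
  - change (ep - (Re ka * (Re z + ginvX q * / ginvN q - Re z) + Im ka * (Im z + ginvY q * / ginvN q - Im z)) *
      ginvN q = Re (fst q)).
    transitivity (ep - (Re ka * ginvX q + Im ka * ginvY q)); [field; lra|].
    unfold ginvX, ginvY. rewrite K. field. exact K'.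
  - change (- (Im ka * (Re z + ginvX q * / ginvN q - Re z) - Re ka * (Im z + ginvY q * / ginvN q - Im z)) *
      ginvN q = Im (fst q)).
    transitivity (- (Im ka * ginvX q - Re ka * ginvY q)); [field; lra|].
    unfold ginvX, ginvY. rewrite K. field. exact K'.
  - change (Cmod ka * (snd q * / Cmod ka * / ginvN q) * ginvN q = snd q). field. lra.
Qed.

Lemma invsim_inv_l p : H3 p -> invsim_inv (invsim ep ka z p) = p.
Proof.
  intros Hp. pose proof (gN_pos z p Hp) as HN. pose proof Cmod_ka as Hm.
  pose proof (Cmod2 ka) as K.
  assert (K' : Re ka ^ 2 + Im ka ^ 2 <> 0) by (rewrite <- K; apply Rgt_not_eq, pow_lt; lra).
  assert (EX : ginvX (invsim ep ka z p) = (Re (fst p) - Re z) * / gN z p).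
  { unfold ginvX. rewrite K. unfold invsim. simpl fst. simpl Re. simpl Im. field. lra. }
  assert (EY : ginvY (invsim ep ka z p) = (Im (fst p) - Im z) * / gN z p).
  { unfold ginvY. rewrite K. unfold invsim. simpl fst. simpl Re. simpl Im. field. lra. }
  assert (EN : ginvN (invsim ep ka z p) = / gN z p).
  { unfold ginvN. rewrite EX, EY. simpl snd.
    transitivity (gN z p * (/ gN z p) ^ 2); [|field; lra].
    assert (A : forall x y w n i m : R, m <> 0 -> n = x ^ 2 + y ^ 2 + w ^ 2 ->
      (x * i) ^ 2 + (y * i) ^ 2 + (m * w * i * / m) ^ 2 = n * i ^ 2) by (intros; subst n; field; auto).
    exact (A _ _ (snd p) (gN z p) (/ gN z p) (Cmod ka) (Rgt_not_eq _ _ Hm) eq_refl). }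
  unfold invsim_inv. rewrite EX, EY, EN, Rinv_inv. apply space_eq.
  - change (Re z + (Re (fst p) - Re z) * / gN z p * gN z p = Re (fst p)). field. lra.
  - change (Im z + (Im (fst p) - Im z) * / gN z p * gN z p = Im (fst p)). field. lra.
  - change (Cmod ka * snd p * / gN z p * / Cmod ka * gN z p = snd p). field. lra.
Qed.

Lemma invsim_dspace p a : H3 p -> dspace (invsim ep ka z) a p = dinvsim ka z p a.
Proof.
  intros Hp. apply (dspace_line _ (invsim ep ka z) p a); auto.
  assert (P0 : 0 < snd (plus p (scal 0 a))) by (rewrite line_0; exact Hp).
  pose proof (invsim_curve ep ka z _ 0 a P0 (line_deriveS p a)) as A. cbv beta in A. rewrite line_0 in A. exact A.
Qed.

Lemma gN_CK n : CK n (fun p : space => 0 < gN z p) (gN z) /\ open (fun p : space => 0 < gN z p).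
Proof.
  assert (G : forall n, CK n (fun _ : space => True) (gN z)).
  { intros k. assert (HO : open (fun _ : space => True)) by (apply open_true).
    pose proof (CK_Re_space k (fun _ => True)) as C1. pose proof (CK_Im_space k (fun _ => True)) as C2.
    pose proof (CK_snd_space k (fun _ => True)) as C3.
    set (u := fun p : space => Re (fst p)) in *. set (v := fun p : space => Im (fst p)) in *.
    set (w := fun p : space => snd p) in *.
    apply (CK_ext k _ (fun p => (u p - Re z) * (u p - Re z) + (v p - Im z) * (v p - Im z) + w p * w p)); auto.
    - intros p _. unfold gN, u, v, w. ring.
    - ck. }
  split.
  - apply (CK_sub n (fun _ => True)); auto.
  - apply (open_comp (gN z) (fun y : R => 0 < y)); [|apply (open_gt 0)].
    intros p _. exact (CK_cont 0 _ _ p (G 0%nat) I).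
Qed.

Lemma invsim_CK n : CKS n (fun p => 0 < gN z p) (invsim ep ka z).
Proof.
  destruct (gN_CK n) as [CN HO]. set (U := fun p : space => 0 < gN z p) in *.
  assert (CI : CK n U (fun p => / gN z p)) by (apply (CK_inv n U (gN z)); auto).
  pose proof (CK_Re_space n U) as C1. pose proof (CK_Im_space n U) as C2. pose proof (CK_snd_space n U) as C3.
  set (u := fun p : space => Re (fst p)) in *. set (v := fun p : space => Im (fst p)) in *.
  set (w := fun p : space => snd p) in *. set (i := fun p : space => / gN z p) in *.
  refine (conj _ (conj _ _)).
  - change (CK n U (fun p => ep - (Re ka * (u p - Re z) + Im ka * (v p - Im z)) * i p)). ck.
  - change (CK n U (fun p => - (Im ka * (u p - Re z) - Re ka * (v p - Im z)) * i p)). ck.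
  - change (CK n U (fun p => Cmod ka * w p * i p)). ck.
Qed.

Lemma invsim_isometry : isometry (invsim ep ka z).
Proof.
  refine (conj invsim_H3 (conj _ (conj _ _))).
  - exists invsim_inv. intros p Hp. refine (conj (invsim_inv_H3 p Hp) (conj (invsim_inv_r p Hp) (invsim_inv_l p Hp))).
  - intros n. destruct (invsim_CK n) as (A & B & D).
    assert (S : forall p, H3 p -> 0 < gN z p) by (intros p Hp; now apply gN_pos).
    refine (conj (conj _ _) _); apply CK_to_Ck.
    + exact (CK_sub n _ H3 _ S A).
    + exact (CK_sub n _ H3 _ S B).
    + exact (CK_sub n _ H3 _ S D).
  - intros p a b Hp. rewrite !invsim_dspace by auto. unfold hyp_inner. rewrite (dinvsim_dot ka z p a b Hp).
    unfold invsim. simpl snd. pose proof (gN_pos z p Hp). pose proof Cmod_ka. change (0 < snd p) in Hp.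
    ht p w. field. repeat split; apply Rgt_not_eq; assumption.
Qed.

Lemma invsim_orientation : orientation_preserving (invsim ep ka z).
Proof.
  intros p Hp. rewrite !invsim_dspace by auto. pose proof (gN_pos z p Hp) as HN. pose proof Cmod_ka as Hm.
  pose proof (Cmod2 ka) as K.
  assert (E : det3 (dinvsim ka z p (vec 1 0 0)) (dinvsim ka z p (vec 0 1 0)) (dinvsim ka z p (vec 0 0 1)) =
    Cmod ka * (Re ka ^ 2 + Im ka ^ 2) * (/ gN z p) ^ 3).
  { assert (A : forall U V w i k1 k2 m N : R, N = U ^ 2 + V ^ 2 + w ^ 2 -> N * i = 1 ->
      let P := fun a b c => 2 * (U * a + V * b + w * c) in
      let X := fun a b c => - (k1 * (a * i - U * P a b c * i ^ 2) + k2 * (b * i - V * P a b c * i ^ 2)) in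
      let Y := fun a b c => - (k2 * (a * i - U * P a b c * i ^ 2) - k1 * (b * i - V * P a b c * i ^ 2)) in
      let S := fun a b c => m * (c * i - w * P a b c * i ^ 2) in
      (Y 1 0 0 * S 0 1 0 - S 1 0 0 * Y 0 1 0) * X 0 0 1 +
      (S 1 0 0 * X 0 1 0 - X 1 0 0 * S 0 1 0) * Y 0 0 1 +
      (X 1 0 0 * Y 0 1 0 - Y 1 0 0 * X 0 1 0) * S 0 0 1 = m * (k1 ^ 2 + k2 ^ 2) * i ^ 3).
    { intros U V w i k1 k2 m N HN' Hi P X Y S.
      transitivity (m * (k1 ^ 2 + k2 ^ 2) * i ^ 3 + m * (k1 ^ 2 + k2 ^ 2) * i ^ 3 * 2 * (N * i - 1)).
      - rewrite HN'. unfold X, Y, S, P. ring.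
      - rewrite Hi. ring. }
    exact (A (Re (fst p) - Re z) (Im (fst p) - Im z) (snd p) (/ gN z p) (Re ka) (Im ka) (Cmod ka) (gN z p)
      eq_refl ltac:(field; lra)). }
  rewrite E, <- K. apply Rmult_lt_0_compat; [apply Rmult_lt_0_compat; [lra | apply pow_lt; lra]|].
  apply pow_lt, Rinv_0_lt_compat; auto.
Qed.

End Moebius.

Lemma continuous_space {V : NormedModule R_AbsRing} (f : V -> space) (p : V) :
  continuous (fun q => Re (fst (f q))) p -> continuous (fun q => Im (fst (f q))) p ->
  continuous (fun q => snd (f q)) p -> continuous f p.
Proof.
  intros A B D. apply (filterlim_locally f (f p)). intros eps.
  pose proof (proj1 (filterlim_locally _ _) A eps) as A'. pose proof (proj1 (filterlim_locally _ _) B eps) as B'.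
  pose proof (proj1 (filterlim_locally _ _) D eps) as D'.
  generalize (filter_and _ _ (filter_and _ _ A' B') D'). apply filter_imp.
  intros q [[H1 H2] H3']. exact (conj (conj H1 H2) H3').
Qed.

Section MoebiusFinite.
Variables (x z : C).
Hypothesis Hxz : x <> z.
Let ka := (x - z)%C.

Lemma ka_neq0 : ka <> RtoC 0.
Proof.
  unfold ka. intros Q. apply Hxz. replace x with (x - z + z)%C by ring. rewrite Q. ring.
Qed.

Lemma invsim_boundary_0 : boundary_maps (invsim 1 ka z) (Some x) (Some (RtoC 0)).
Proof.
  intros Q HQ. pose proof Cmod_ka ka ka_neq0 as Hm. pose proof (Cmod2 ka) as K.
  assert (GN : gN z ((x, 0) : space) = Cmod ka ^ 2).
  { rewrite K. change ((Re x - Re z) ^ 2 + (Im x - Im z) ^ 2 + 0 ^ 2 = (Re x - Re z) ^ 2 + (Im x - Im z) ^ 2). ring. }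
  assert (G0 : 0 < gN z ((x, 0) : space)) by (rewrite GN; apply pow_lt; lra).
  destruct (invsim_CK 1 ka z 0) as (A & B & D).
  assert (CG : continuous (invsim 1 ka z) ((x, 0) : space)).
  { apply continuous_space; [exact (CK_cont 0 _ _ _ A G0) | exact (CK_cont 0 _ _ _ B G0) | exact (CK_cont 0 _ _ _ D G0)]. }
  assert (E : invsim 1 ka z ((x, 0) : space) = ((RtoC 0, 0) : space)).
  { unfold invsim. rewrite GN, K. assert (K' : Re ka ^ 2 + Im ka ^ 2 <> 0) by (rewrite <- K; apply Rgt_not_eq, pow_lt; lra).
    apply space_eq.
    - change (1 - (Re ka * (Re x - Re z) + Im ka * (Im x - Im z)) * / (Re ka ^ 2 + Im ka ^ 2) = 0).
      replace (Re x - Re z) with (Re ka) by reflexivity. replace (Im x - Im z) with (Im ka) by reflexivity. field. auto.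
    - change (- (Im ka * (Re x - Re z) - Re ka * (Im x - Im z)) * / (Re ka ^ 2 + Im ka ^ 2) = 0).
      replace (Re x - Re z) with (Re ka) by reflexivity. replace (Im x - Im z) with (Im ka) by reflexivity. field. auto.
    - change (Cmod ka * 0 * / (Re ka ^ 2 + Im ka ^ 2) = 0). ring. }
  unfold continuous in CG. rewrite E in CG. specialize (CG _ HQ). unfold filtermap in CG |- *.
  simpl. unfold within in *. revert CG. apply (filter_imp (F := locally ((x, 0) : space))).
  intros p HH Hp. apply HH, invsim_H3; auto. exact ka_neq0.
Qed.

Lemma invsim_norm p : H3 p -> dot (invsim 1 ka z p) (invsim 1 ka z p) * gN z p =
  (Re x - Re (fst p)) ^ 2 + (Im x - Im (fst p)) ^ 2 + snd p ^ 2.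
Proof.
  intros Hp. pose proof (gN_pos z p Hp) as HN. pose proof (Cmod2 ka) as K.
  assert (A : forall U V w i k1 k2 m N, N = U ^ 2 + V ^ 2 + w ^ 2 -> N * i = 1 -> m ^ 2 = k1 ^ 2 + k2 ^ 2 ->
    ((1 - (k1 * U + k2 * V) * i) * (1 - (k1 * U + k2 * V) * i) +
     (- (k2 * U - k1 * V) * i) * (- (k2 * U - k1 * V) * i) + (m * w * i) * (m * w * i)) * N =
    (k1 - U) ^ 2 + (k2 - V) ^ 2 + w ^ 2).
  { intros U V w i k1 k2 m N EN Ei Em.
    transitivity (N - 2 * (k1 * U + k2 * V) * (N * i) + (N * i) * i * (k1 ^ 2 + k2 ^ 2) * (U ^ 2 + V ^ 2) +
      (N * i) * i * m ^ 2 * w ^ 2). { ring. }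
    rewrite Ei, Em. transitivity (N - 2 * (k1 * U + k2 * V) + (k1 ^ 2 + k2 ^ 2) * ((U ^ 2 + V ^ 2 + w ^ 2) * i)). { ring. }
    rewrite <- EN, Ei, EN. ring. }
  transitivity ((Re ka - (Re (fst p) - Re z)) ^ 2 + (Im ka - (Im (fst p) - Im z)) ^ 2 + snd p ^ 2).
  - exact (A (Re (fst p) - Re z) (Im (fst p) - Im z) (snd p) (/ gN z p) (Re ka) (Im ka) (Cmod ka) (gN z p)
      eq_refl ltac:(field; lra) K).
  - change (Re ka) with (Re x - Re z). change (Im ka) with (Im x - Im z). ring.
Qed.

Lemma invsim_boundary_infinity : boundary_maps (invsim 1 ka z) (Some z) None.
Proof.
  intros Q [M HM]. pose proof Cmod_ka ka ka_neq0 as Hm. pose proof (Cmod2 ka) as K.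
  set (m2 := Cmod ka ^ 2) in *. assert (Hm2 : 0 < m2) by (unfold m2; apply pow_lt; lra).
  set (e := Rmin 1 (m2 / (8 * (Rabs M + 2)))). assert (AM := Rabs_pos M). assert (AM' := Rle_abs M).
  assert (E0 : 0 < e) by (apply Rmin_glb_lt; [lra | apply Rdiv_lt_0_compat; lra]).
  assert (E1 : e <= 1) by apply Rmin_l.
  assert (E2 : e * (8 * (Rabs M + 2)) <= m2).
  { assert (T : e <= m2 / (8 * (Rabs M + 2))) by apply Rmin_r.
    apply (Rmult_le_compat_r (8 * (Rabs M + 2))) in T; [|lra].
    replace (m2 / (8 * (Rabs M + 2)) * (8 * (Rabs M + 2))) with m2 in T by (field; lra). exact T. }
  exists (mkposreal e E0). intros p [[B1 B2] B3] Hp. apply HM; [apply invsim_H3; auto; exact ka_neq0|].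
  pose proof (invsim_norm p Hp) as G. pose proof (gN_pos z p Hp) as HN.
  change (Rabs (Re (fst p) - Re z) < e) in B1. change (Rabs (Im (fst p) - Im z) < e) in B2.
  change (Rabs (snd p - 0) < e) in B3. rewrite Rminus_0_r in B3.
  set (U := Re (fst p) - Re z) in *. set (V := Im (fst p) - Im z) in *.
  set (w := snd p) in *.
  assert (SQ : forall y, Rabs y < e -> y ^ 2 <= e).
  { intros y Hy. apply Rabs_def2 in Hy. nra. }
  pose proof (SQ _ B1) as S1. pose proof (SQ _ B2) as S2. pose proof (SQ _ B3) as S3.
  assert (N3 : gN z p <= 3 * e). { change (gN z p) with (U ^ 2 + V ^ 2 + w ^ 2). lra. }
  assert (L : m2 / 2 - 2 * e <= (Re x - Re (fst p)) ^ 2 + (Im x - Im (fst p)) ^ 2 + snd p ^ 2).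
  { replace (Re x - Re (fst p)) with (Re ka - U) by (unfold U; change (Re ka) with (Re x - Re z); ring).
    replace (Im x - Im (fst p)) with (Im ka - V) by (unfold V; change (Im ka) with (Im x - Im z); ring).
    change (snd p) with w. clearbody U V w m2. rewrite K. clear - S1 S2.
    pose proof (pow2_ge_0 (Re ka - 2 * U)). pose proof (pow2_ge_0 (Im ka - 2 * V)). pose proof (pow2_ge_0 w). nra. }
  apply (Rmult_lt_reg_r (gN z p)); auto. rewrite G.
  apply Rlt_le_trans with (m2 / 2 - 2 * e); auto.
  apply Rle_lt_trans with ((Rabs M) * (3 * e)).
  - apply Rle_trans with (Rabs M * gN z p); [apply Rmult_le_compat_r; lra | apply Rmult_le_compat_l; lra].
  - assert (0 <= e * Rabs M) by (apply Rmult_le_pos; lra). lra.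
Qed.

Lemma invsim_inv_curve (q : R -> space) t v : 0 < snd (q t) -> is_deriveS q t v ->
  exists v', is_deriveS (fun s => invsim_inv 1 ka z (q s)) t v'.
Proof.
  intros Hp (H1 & H2 & H3'). pose proof (ginvN_pos 1 ka ka_neq0 (q t) Hp) as HN.
  pose proof Cmod_ka ka ka_neq0 as Hm. set (m := Cmod ka) in *.
  set (u := fun s => Re (fst (q s))) in *. set (v1 := fun s => Im (fst (q s))) in *.
  set (w := fun s => snd (q s)) in *.
  assert (E1 : ex_derive u t) by (eexists; exact H1).
  assert (E2 : ex_derive v1 t) by (eexists; exact H2).
  assert (E3 : ex_derive w t) by (eexists; exact H3').
  set (X := fun s => ((1 - u s) * Re ka - v1 s * Im ka) * / m ^ 2).
  set (Y := fun s => (v1 s * Re ka + (1 - u s) * Im ka) * / m ^ 2).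
  set (N := fun s => X s ^ 2 + Y s ^ 2 + (w s * / m) ^ 2).
  assert (EX : ex_derive X t). { unfold X. auto_derive. repeat split; auto. }
  assert (EY : ex_derive Y t). { unfold Y. auto_derive. repeat split; auto. }
  assert (EN : ex_derive N t). { unfold N. auto_derive. repeat split; auto. }
  assert (N0 : N t <> 0) by (apply Rgt_not_eq; exact HN).
  assert (D1 : ex_derive (fun s : R => Re z + X s * / N s) t) by (auto_derive; repeat split; auto).
  assert (D2 : ex_derive (fun s : R => Im z + Y s * / N s) t) by (auto_derive; repeat split; auto).
  assert (D3 : ex_derive (fun s : R => w s * / m * / N s) t) by (auto_derive; repeat split; auto).
  destruct D1 as [l1 D1]. destruct D2 as [l2 D2]. destruct D3 as [l3 D3].
  exists ((l1, l2), l3). exact (conj D1 (conj D2 D3)).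
Qed.

(** Conjugate the linear flow by stdmap. *)
Lemma flow_exists m : exists Y, generated_by (Some x) (Some z) (flow m) Y.
Proof.
  exists (killing m (Some x) (Some z)).
  assert (N : Some x <> Some z) by (intros Q; injection Q; exact Hxz).
  assert (FH : forall t q, H3 q -> H3 (flow m t q)).
  { intros t q Hq. unfold H3, flow. simpl snd. apply Rmult_lt_0_compat; [apply exp_pos | exact Hq]. }
  exists (fun t p => invsim_inv 1 ka z (flow m t (invsim 1 ka z p))).
  assert (HP : forall t p, H3 p -> H3 (invsim_inv 1 ka z (flow m t (invsim 1 ka z p)))).
  { intros t p Hp. apply invsim_inv_H3; [exact ka_neq0|]. apply FH, invsim_H3; auto. exact ka_neq0. }
  split.
  - intros t. exists (invsim 1 ka z).
    refine (conj (invsim_isometry 1 ka z ka_neq0) (conj (invsim_orientation 1 ka z ka_neq0)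
      (conj invsim_boundary_0 (conj invsim_boundary_infinity _)))).
    intros p Hp. split; [now apply HP|]. apply invsim_inv_r; [exact ka_neq0|]. apply FH, invsim_H3; auto. exact ka_neq0.
  - intros t p Hp. apply is_derive_S_inv.
    set (P := invsim 1 ka z p). assert (HP' : H3 P) by (apply invsim_H3; auto; exact ka_neq0).
    destruct (invsim_inv_curve (fun s => flow m s P) t _ (FH t P HP') (flow_deriv m P t)) as [v Hv].
    rewrite <- (stdmap_curve_killing m (Some x) (Some z) (fun s => invsim_inv 1 ka z (flow m s P)) P t v N); auto.
    + intros s. now apply HP.
    + intros s. rewrite stdmap_finite by (now apply HP). apply invsim_inv_r; [exact ka_neq0 | now apply FH].
Qed.

End MoebiusFinite.

Lemma flow_fields c d Y : (translation_field c d Y <-> generated_by c d (flow (RtoC 1)) Y) /\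
  (rotation_field c d Y <-> generated_by c d (flow Ci) Y).
Proof.
  unfold translation_field, rotation_field.
  assert (E1 : flow (RtoC 1) = std_translation).
  { apply functional_extensionality. intros t.
    apply functional_extensionality. apply flow_translation. }
  assert (E2 : flow Ci = std_rotation).
  { apply functional_extensionality. intros t.
    apply functional_extensionality. apply flow_rotation. }
  rewrite E1, E2. tauto.
Qed.

(** * The flux is attained *)

Lemma Ck_circle r n : Ck_plane 2 (fun _ : R_NormedModule => True) (circle r n).
Proof.
  assert (HO : open (fun _ : R_NormedModule => True)) by apply open_true.
  assert (L : CK 2 (fun _ : R_NormedModule => True) (fun t : R_NormedModule => IZR n * t)).
  { apply CK_linear.
    - intros p. apply (continuous_mult (fun _ : R => IZR n) (fun t : R => t)); [apply continuous_const | apply continuous_id].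
    - intros p v t. change (IZR n * (p + t * v) = IZR n * p + t * (IZR n * v)). ring. }
  split; apply CK_to_Ck.
  - apply (CK_mult 2 _ (fun _ : R_NormedModule => r) (fun t : R_NormedModule => cos (IZR n * t))); auto.
    + apply CK_const.
    + exact (CK_comp1 2 _ _ allR cos HO (fun _ _ => I) (proj2 (CK_sin_cos 2)) L).
  - apply (CK_mult 2 _ (fun _ : R_NormedModule => r) (fun t : R_NormedModule => sin (IZR n * t))); auto.
    + apply CK_const.
    + exact (CK_comp1 2 _ _ allR sin HO (fun _ _ => I) (proj1 (CK_sin_cos 2)) L).
Qed.

Lemma det3_opp_r (x y z : space) : det3 x y (opp z) = - det3 x y z.
Proof.
  destruct x as [[a b] c], y as [[d e] f], z as [[g h] i].
  change (det3 (a, b, c) (d, e, f) (- g, - h, - i) = - det3 (a, b, c) (d, e, f) (g, h, i)).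
  unfold det3, dot, cross, vec; simpl. ring.
Qed.

(** A small circle run clockwise, its velocity turned by a right angle, and the cone
    over the circle with vertex (0, 1). *)
Lemma flux_data E : bryant_end E -> exists n gamma eta kappa,
  generator E n gamma /\ conormal E n gamma eta /\ spanning_disc (loop_in E gamma) kappa.
Proof.
  intros HE. destruct (cmc1_end E HE) as (HU & HX & Hpt).
  destruct (disc_in_open (dom E) (proj1 HE) (proj1 (proj2 HE))) as [r0 Hr0].
  set (r := r0 / 2). assert (Hr : 0 < r) by (unfold r; pose proof (cond_pos r0); lra).
  set (n := (-1)%Z). set (gamma := circle r n).
  assert (Hdom : forall t, dom_star E (gamma t)).
  { intros t. split; [|now apply circle_neq0]. apply Hr0. unfold gamma. rewrite Cmod_circle by auto.
    unfold r. pose proof (cond_pos r0). lra. }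
  set (v' := fun t => Cmult (0, IZR n) (gamma t)).
  assert (Hg : forall t, is_deriveC gamma t (v' t)) by (intros; apply circle_deriv).
  set (w := fun t => snd (param E (gamma t))).
  set (L := fun t => fst_form (param E) e1 e1 (gamma t)).
  set (s := fun t => / sqrt ((Re (v' t) ^ 2 + Im (v' t) ^ 2) * L t)).
  set (u := fun t => (s t * Im (v' t), - (s t * Re (v' t))) : C).
  exists n, gamma, (fun t => dspace (param E) (u t) (gamma t)).
  assert (HL : forall t, 0 < L t).
  { intros t. destruct (Hpt _ (Hdom t)) as (_ & (P & _) & _). exact P. }
  assert (Hv : forall t, 0 < Re (v' t) ^ 2 + Im (v' t) ^ 2).
  { intros t. rewrite <- Cmod2. apply pow_lt. apply Cmod_gt_0. unfold v'. apply Cmult_neq_0.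
    - intros Q. injection Q. unfold n. simpl. lra.
    - now apply circle_neq0. }
  assert (Hs : forall t, 0 < s t).
  { intros t. apply Rinv_0_lt_compat, sqrt_lt_R0. apply Rmult_lt_0_compat; auto. }
  assert (Hs2 : forall t, s t ^ 2 * ((Re (v' t) ^ 2 + Im (v' t) ^ 2) * L t) = 1).
  { intros t. unfold s. rewrite pow_inv, pow2_sqrt.
    - field. split; apply Rgt_not_eq; [apply HL | apply Hv].
    - apply Rlt_le, Rmult_lt_0_compat; auto. }
  set (h := fun q : plane => gamma (snd q) : plane).
  assert (HO := open_all).
  assert (Hh : C2_map (fun _ => True) h).
  { destruct (C2_scaled_circle r 0 n) as [A B]. split.
    - apply (CK_ext 2 _ (fun q : plane => Re (circle (r + fst q * 0) n (snd q)))); auto.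
      intros q _. unfold h, gamma. now rewrite Rmult_0_r, Rplus_0_r.
    - apply (CK_ext 2 _ (fun q : plane => Im (circle (r + fst q * 0) n (snd q)))); auto.
      intros q _. unfold h, gamma. now rewrite Rmult_0_r, Rplus_0_r. }
  set (G := loop_in E gamma).
  exists (fun q : plane => ((fst q * Re (fst (G (snd q))), fst q * Im (fst (G (snd q)))),
     1 + fst q * (snd (G (snd q)) - 1)) : space).
  refine (conj _ (conj _ _)).
  - refine (conj (or_intror eq_refl) (conj (Ck_circle r n) _)).
    exists r, h, (fun _ => True). refine (conj Hr (conj _ (conj HO (conj (fun _ _ => I) (conj _ (conj _ (conj _ (conj _ _)))))))).
    + intros z Hz. apply Hr0. unfold r in Hz. pose proof (cond_pos r0). lra.
    + destruct Hh as [A B]. split; now apply CK_to_Ck.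
    + intros q _. apply Hdom.
    + intros x t _. apply circle_per.
    + intros t. reflexivity.
    + intros t. reflexivity.
  - intros t. cbv zeta. rewrite (dplane_R gamma t _ (Hg t)).
    destruct (Hpt _ (Hdom t)) as (Hw & (C1 & C2 & C3) & _ & CH).
    change (0 < w t) in Hw.
    assert (EV : velocity (loop_in E gamma) t =
      comb (Re (v' t)) (Im (v' t)) (X1 (param E) (gamma t)) (X2 (param E) (gamma t))).
    { apply (dspace_R (loop_in E gamma)). apply (surf_curve (dom_star E) (param E) gamma t); auto using C2_C1. }
    assert (EE : dspace (param E) (u t) (gamma t) =
      comb (Re (u t)) (Im (u t)) (X1 (param E) (gamma t)) (X2 (param E) (gamma t))).
    { apply (dspace_plane (dom_star E)); auto using C2_C1. }
    assert (W2 : 0 < w t ^ 2) by (apply pow_lt; exact Hw).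
    assert (Q1 : dot (X1 (param E) (gamma t)) (X1 (param E) (gamma t)) = L t * w t ^ 2).
    { unfold L, fst_form, hyp_inner, X1. fold (w t). field. lra. }
    assert (Q2 : dot (X1 (param E) (gamma t)) (X1 (param E) (gamma t)) =
      dot (X2 (param E) (gamma t)) (X2 (param E) (gamma t))).
    { unfold fst_form, hyp_inner in C2. apply (Rmult_eq_reg_r (/ w t ^ 2)); [exact C2|].
      apply Rinv_neq_0_compat; lra. }
    assert (Q3 : dot (X1 (param E) (gamma t)) (X2 (param E) (gamma t)) = 0).
    { unfold fst_form, hyp_inner in C3. apply (Rmult_eq_reg_r (/ w t ^ 2)).
      - rewrite Rmult_0_l. exact C3.
      - apply Rinv_neq_0_compat; lra. }
    refine (conj _ (conj _ (conj _ _))).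
    + exists (u t). split; auto. assert (P : 0 < s t * (Re (v' t) ^ 2 + Im (v' t) ^ 2)) by (apply Rmult_lt_0_compat; auto).
      eapply Rlt_le_trans; [exact P|]. right. unfold u, n, Re, Im. simpl. ring.
    + unfold hyp_norm, hyp_inner. rewrite EE, dot_comb, Q1 by auto.
      change (snd (loop_in E gamma t)) with (w t).
      replace ((Re (u t) * Re (u t) + Im (u t) * Im (u t)) * (L t * w t ^ 2) / w t ^ 2) with 1; [apply sqrt_1|].
      rewrite <- (Hs2 t). unfold u. simpl Re. simpl Im. field. lra.
    + unfold hyp_inner. rewrite EE, EV, dot_comb by auto. unfold u. simpl Re. simpl Im.
      replace (s t * Im (v' t) * Re (v' t) + - (s t * Re (v' t)) * Im (v' t)) with 0 by ring.
      unfold Rdiv. ring.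
    + rewrite EE, EV, det3_opp_r, det3_comb.
      set (D := dot _ _). assert (PD : 0 < D) by exact CH. clearbody D.
      assert (P : 0 < s t * (Re (v' t) ^ 2 + Im (v' t) ^ 2) * D).
      { apply Rmult_lt_0_compat; auto. apply Rmult_lt_0_compat; auto. }
      eapply Rlt_le_trans; [exact P|]. right. unfold u, Re, Im. simpl. ring.
  - destruct Hh as [HA HB]. destruct HX as (XA & XB & XD).
    assert (F : forall f : plane -> R, CK 2 (dom_star E) f -> CK 2 (fun _ : plane => True) (fun q => f (h q))).
    { intros f Hf. exact (CK_compp 2 (dom_star E) (fun _ => True) h f HU HO (fun q _ => Hdom (snd q)) Hf HA HB). }
    pose proof (F _ XA) as FA. pose proof (F _ XB) as FB. pose proof (F _ XD) as FD.
    assert (F1 : CK 2 (fun _ : plane => True) (fun q : plane => fst q)) by apply CK_fst.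
    assert (HG : forall t, 0 < snd (G t)).
    { intros t. exact (proj1 (Hpt _ (Hdom t))). }
    refine (conj _ (conj _ (conj _ (conj _ _)))).
    + exists (fun _ => True). refine (conj HO (conj (fun _ _ => I) (conj (conj _ _) _))); apply CK_to_Ck.
      * exact (CK_mult 2 _ _ _ HO F1 FA).
      * exact (CK_mult 2 _ _ _ HO F1 FB).
      * exact (CK_plus 2 _ _ _ HO (CK_const 2 _ 1) (CK_mult 2 _ _ _ HO F1 (CK_minus 2 _ _ _ HO FD (CK_const 2 _ 1)))).
    + intros [x t] Hx. unfold strip in Hx. simpl in Hx. unfold H3. simpl snd at 1.
      change (0 < 1 + x * (snd (G t) - 1)). specialize (HG t).
      destruct (Rle_lt_dec 1 (snd (G t))).
      * assert (0 <= x * (snd (G t) - 1)) by (apply Rmult_le_pos; lra). lra.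
      * assert (x * (1 - snd (G t)) <= 1 * (1 - snd (G t))) by (apply Rmult_le_compat_r; lra). lra.
    + intros x t _. simpl. unfold G, loop_in, gamma. now rewrite circle_per.
    + intros t t'. simpl. rewrite !Rmult_0_l. reflexivity.
    + intros t. apply space_eq.
      * change (1 * Re (fst (G t)) = Re (fst (G t))). ring.
      * change (1 * Im (fst (G t)) = Im (fst (G t))). ring.
      * change (1 + 1 * (snd (G t) - 1) = snd (G t)). ring.
Qed.

Lemma is_flux_unique E Y x x' : bryant_end E -> is_flux E Y x -> is_flux E Y x' -> x = x'.
Proof.
  intros HE H1 H2. destruct (flux_data E HE) as (n & gamma & eta & kappa & A & B & D).
  rewrite <- (H1 n gamma eta kappa A B D). exact (H2 n gamma eta kappa A B D).
Qed.

(** * From the catenoidal end to its frame *)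

Lemma Cconj_mult x y : Cconj (x * y)%C = (Cconj x * Cconj y)%C.
Proof. destruct x, y. unfold Cconj, Cmult; simpl. f_equal; ring. Qed.
Lemma Cconj_plus x y : Cconj (x + y)%C = (Cconj x + Cconj y)%C.
Proof. destruct x, y. unfold Cconj, Cplus; simpl. f_equal; ring. Qed.
Lemma Cconj_opp x : Cconj (- x)%C = (- Cconj x)%C.
Proof. destruct x. unfold Cconj, Copp; simpl. f_equal; ring. Qed.
Lemma Cconj_minus x y : Cconj (x - y)%C = (Cconj x - Cconj y)%C.
Proof. unfold Cminus. now rewrite Cconj_plus, Cconj_opp. Qed.
Lemma Cconj_invol x : Cconj (Cconj x) = x.
Proof. destruct x. unfold Cconj; simpl. f_equal; ring. Qed.
Lemma Cmod_sq (x : C) : (x * Cconj x)%C = RtoC (Cmod x ^ 2).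
Proof. rewrite Cmod2. destruct x. apply injective_projections; simpl; ring. Qed.
Lemma Cconj_inv x : Cconj (/ x)%C = (/ Cconj x)%C.
Proof.
  destruct x as [a b]. unfold Cconj, Cinv; simpl.
  replace (a * (a * 1) + - b * (- b * 1)) with (a * (a * 1) + b * (b * 1)) by ring.
  f_equal. unfold Rdiv. ring.
Qed.
Lemma Cmod_Cconj x : Cmod (Cconj x) = Cmod x.
Proof. destruct x as [a b]. unfold Cmod, Cconj; simpl. f_equal. ring. Qed.
Lemma cexp_conj s : cexp (Cconj s) = Cconj (cexp s).
Proof.
  destruct s as [x y]. unfold cexp, Cconj; simpl. rewrite cos_neg, sin_neg. f_equal. ring.
Qed.

Lemma Dc_conj f s l : Dc f (Cconj s) l -> Dc (fun x => Cconj (f (Cconj x))) s (Cconj l).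
Proof.
  intros H v. specialize (H (Cconj v)). apply is_deriveC_conj in H.
  replace (Cconj l * v)%C with (Cconj (l * Cconj v)) by (rewrite Cconj_mult, Cconj_invol; reflexivity).
  apply (is_deriveC_ext (fun t : R => Cconj (f (ray (Cconj s) (Cconj v) t)))); auto.
  intros t. f_equal. f_equal. unfold ray. now rewrite Cconj_plus, Cconj_mult, Cconj_RtoC.
Qed.

Lemma tends_conj f l : tends f l -> tends (fun x => Cconj (f (Cconj x))) (Cconj l).
Proof.
  intros H eps. destruct (H eps) as [x0 Hx]. exists x0. intros s Hs.
  rewrite <- Cconj_minus, Cmod_Cconj. apply Hx. exact Hs.
Qed.

(** The limits that define a Bryant frame are compatible with conjugation because kappa
    is real. *)
Lemma bryant_frame_conj kappa c A B C' D a b c' d : bryant_frame kappa c A B C' D a b c' d ->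
  let J := fun (f : C -> C) s => Cconj (f (Cconj s)) in
  bryant_frame kappa c (J A) (J B) (J C') (J D) (J a) (J b) (J c') (J d).
Proof.
  intros (HF & T1 & T2 & q0 & T3) J. refine (conj _ (conj _ (conj _ _))).
  - intros s Hs. destruct (HF (Cconj s) Hs) as ((D1 & D2 & D3 & D4) & E1 & E2 & [l1 L1] & [l2 L2] & [l3 L3] & [l4 L4]).
    refine (conj (conj _ (conj _ (conj _ _))) (conj _ (conj _ (conj _ (conj _ (conj _ _)))))).
    + now apply Dc_conj. + now apply Dc_conj. + now apply Dc_conj. + now apply Dc_conj.
    + unfold J. rewrite <- !Cconj_mult, <- Cconj_minus, E1. apply Cconj_RtoC.
    + unfold J. rewrite <- !Cconj_mult, <- Cconj_minus, E2. apply Cconj_RtoC.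
    + exists (Cconj l1). now apply Dc_conj. + exists (Cconj l2). now apply Dc_conj.
    + exists (Cconj l3). now apply Dc_conj. + exists (Cconj l4). now apply Dc_conj.
  - apply tends_conj in T1. rewrite Cconj_RtoC in T1. revert T1. apply tends_ext.
    intros s. unfold J. now rewrite Cconj_minus, !Cconj_mult.
  - apply tends_conj in T2. rewrite Cconj_RtoC in T2. revert T2. apply tends_ext.
    intros s. unfold J. now rewrite Cconj_minus, !Cconj_mult.
  - exists (Cconj q0). apply tends_conj in T3. rewrite Cconj_RtoC in T3. revert T3. apply tends_ext.
    intros s. unfold J. rewrite !Cconj_minus, !Cconj_mult. f_equal. f_equal. unfold Cdiv.
    now rewrite Cconj_mult, Cconj_inv, <- cexp_conj, Cconj_invol.
Qed.

(** The Bryant formula for the point of H3 under a matrix of SL2(C) *)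
Definition bpoint (A B C' D : C) : space :=
  ((((Cconj A * C' + Cconj B * D) / RtoC (Cmod A ^ 2 + Cmod B ^ 2))%C, / (Cmod A ^ 2 + Cmod B ^ 2)) : space).

Lemma bpoint_m A B C' D : (A * D - B * C')%C = RtoC 1 ->
  m11 (bpoint A B C' D) = (A * Cconj A + B * Cconj B)%C /\
  m21 (bpoint A B C' D) = (C' * Cconj A + D * Cconj B)%C /\
  m22 (bpoint A B C' D) = (C' * Cconj C' + D * Cconj D)%C.
Proof.
  intros HD. assert (Hn : 0 < Cmod A ^ 2 + Cmod B ^ 2).
  { destruct (Req_dec (Cmod A) 0) as [Z|N].
    - assert (NB : B <> RtoC 0).
      { intros ZB. apply Cmod_eq_0 in Z. rewrite Z, ZB in HD. apply (f_equal fst) in HD. simpl in HD. lra. }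
      apply Rplus_le_lt_0_compat; [apply pow2_ge_0 | apply pow_lt; exact (proj1 (Cmod_gt_0 B) NB)].
    - apply Rplus_lt_le_0_compat; [|apply pow2_ge_0]. apply pow_lt. pose proof (Cmod_ge_0 A). lra. }
  destruct A as [a1 a2], B as [b1 b2], C' as [c1 c2], D as [d1 d2].
  unfold bpoint. rewrite !Cmod2 in *. simpl in Hn.
  apply (f_equal fst) in HD as H1. apply (f_equal snd) in HD as H2. simpl in H1, H2.
  set (n := Re (a1, a2) ^ 2 + Im (a1, a2) ^ 2 + (Re (b1, b2) ^ 2 + Im (b1, b2) ^ 2)) in *.
  assert (En : n = a1 * a1 + a2 * a2 + b1 * b1 + b2 * b2) by (unfold n; simpl; ring).
  assert (Pn : 0 < n) by (rewrite En; lra).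
  unfold m11, m21, m22. refine (conj _ (conj _ _)).
  - apply injective_projections; simpl; [rewrite Rinv_inv, En; ring | ring].
  - apply injective_projections; simpl; field; lra.
  - apply injective_projections; simpl.
    + transitivity ((((a1 * c1 + a2 * c2 + b1 * d1 + b2 * d2) ^ 2 + (a1 * c2 - a2 * c1 + b1 * d2 - b2 * d1) ^ 2) + 1) / n).
      { field. lra. }
      transitivity ((n * (c1 * c1 + c2 * c2 + d1 * d1 + d2 * d2)) / n); [|field; lra].
      f_equal. rewrite En.
      assert (E1 : (a1 * d1 - a2 * d2 - (b1 * c1 - b2 * c2)) ^ 2 + (a1 * d2 + a2 * d1 - (b1 * c2 + b2 * c1)) ^ 2 = 1).
      { replace (a1 * d1 - a2 * d2 - (b1 * c1 - b2 * c2)) with 1 by lra.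
        replace (a1 * d2 + a2 * d1 - (b1 * c2 + b2 * c1)) with 0 by lra. ring. }
      rewrite <- E1. ring.
    + ring.
Qed.

(** Entries of H M(p) H^* for the matrix H = diag(1, lam) (yb, -xb; ya, -xa) *)
Lemma std_entries a b lam p : a <> b -> lam <> RtoC 0 -> H3 p ->
  let q := (((lam * fst (stdmap a b p))%C, Cmod lam * snd (stdmap a b p)) : space) in
  let de := RtoC (Cmod lam * Cmod (bracket a b)) in
  let n11 := m11 p in let n21 := m21 p in let n22 := m22 p in
  let g11 := yh b in let g12 := (- RtoC (xh b))%C in let g21 := (lam * yh a)%C in
  let g22 := (- (lam * RtoC (xh a)))%C in
  (de * m11 q)%C = (g11 * Cconj g11 * n11 + g12 * Cconj g11 * n21 + g11 * Cconj g12 * Cconj n21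
    + g12 * Cconj g12 * n22)%C /\
  (de * m21 q)%C = (g21 * Cconj g11 * n11 + g22 * Cconj g11 * n21 + g21 * Cconj g12 * Cconj n21
    + g22 * Cconj g12 * n22)%C /\
  (de * m22 q)%C = (g21 * Cconj g21 * n11 + g22 * Cconj g21 * n21 + g21 * Cconj g22 * Cconj n21
    + g22 * Cconj g22 * n22)%C.
Proof.
  intros N Hl Hp q de n11 n21 n22 g11 g12 g21 g22.
  pose proof (hN_pos b p Hp) as HN. pose proof (h_sq a b p) as HS.
  pose proof (br2_pos a b N) as HB. pose proof (sqrt_br2 a b) as SB.
  assert (Hml : 0 < Cmod lam) by exact (proj1 (Cmod_gt_0 lam) Hl).
  assert (Hmb : 0 < Cmod (bracket a b)) by exact (proj1 (Cmod_gt_0 _) (bracket_neq0 a b N)).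
  assert (B2 : br2 a b = Cmod (bracket a b) ^ 2) by (rewrite Cmod2; reflexivity).
  pose proof (Cmod2 lam) as ML.
  set (w := snd p : R). assert (Hw : 0 < w) by exact Hp.
  set (h1' := h1 a b p) in *. set (h2' := h2 a b p) in *. set (Nb := hN b p) in *. set (Na := hN a p) in *.
  set (ml := Cmod lam) in *. set (mb := Cmod (bracket a b)) in *.
  assert (E11 : (de * m11 q)%C = RtoC (Nb / w)).
  { unfold de, m11, q, stdmap. fold Nb. rewrite SB. cbn [snd]. change (@snd _ _ p) with w.
    rewrite <- RtoC_mult. f_equal. field. repeat split; lra. }
  assert (E21 : (de * m21 q)%C = (lam * ((h1' / w)%R, (h2' / w)%R))%C).
  { unfold de, m21, q, stdmap. fold Nb h1' h2'. rewrite SB. cbn [snd fst]. change (@snd _ _ p) with w.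
    destruct lam as [l1 l2]. apply injective_projections; simpl; field; repeat split; lra. }
  assert (E22 : (de * m22 q)%C = (lam * Cconj lam * RtoC (Na / w))%C).
  { unfold de, m22, q, stdmap. fold Nb h1' h2'. rewrite SB. cbn [snd fst]. change (@snd _ _ p) with w.
    rewrite Cmod_sq, <- !RtoC_mult. f_equal. fold ml.
    assert (Q : Re (lam * ((h1' / Nb)%R, (h2' / Nb)%R))%C ^ 2 + Im (lam * ((h1' / Nb)%R, (h2' / Nb)%R))%C ^ 2 =
      ml ^ 2 * (h1' ^ 2 + h2' ^ 2) / Nb ^ 2).
    { rewrite ML. destruct lam as [l1 l2]. simpl. field. lra. }
    rewrite Q, HS, B2. fold mb. change (@snd _ _ p) with w. field. repeat split; lra. }
  assert (F11 : RtoC (Nb / w) = (g11 * Cconj g11 * n11 + g12 * Cconj g11 * n21 + g11 * Cconj g12 * Cconj n21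
    + g12 * Cconj g12 * n22)%C).
  { unfold Nb, hN, g11, g12, n11, n21, n22, m11, m21, m22, sh. change (@snd _ _ p) with w.
    destruct (fst p) as [u v], (yh b) as [y1 y2]. apply injective_projections; simpl; field; lra. }
  assert (F21 : (lam * ((h1' / w)%R, (h2' / w)%R))%C = (g21 * Cconj g11 * n11 + g22 * Cconj g11 * n21 + g21 * Cconj g12 * Cconj n21
    + g22 * Cconj g12 * n22)%C).
  { unfold h1', h2', h1, h2, g11, g12, g21, g22, n11, n21, n22, m11, m21, m22, sh. change (@snd _ _ p) with w.
    destruct (fst p) as [u v], (yh b) as [y1 y2], (yh a) as [z1 z2], lam as [l1 l2].
    apply injective_projections; simpl; field; lra. }
  assert (F22 : (lam * Cconj lam * RtoC (Na / w))%C = (g21 * Cconj g21 * n11 + g22 * Cconj g21 * n21 + g21 * Cconj g22 * Cconj n21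
    + g22 * Cconj g22 * n22)%C).
  { unfold Na, hN, g21, g22, n11, n21, n22, m11, m21, m22, sh. change (@snd _ _ p) with w.
    destruct (fst p) as [u v], (yh a) as [z1 z2], lam as [l1 l2].
    apply injective_projections; simpl; field; lra. }
  rewrite E11, E21, E22. auto.
Qed.

(** Multiply by adj(H) on the left and by its adjoint on the right. *)
Lemma frame_inversion (h11 h12 h21 h22 A B C' D n11 n21 n22 p11 p21 p22 : C) (de r : R) :
  Cconj n11 = n11 -> Cconj n22 = n22 ->
  de * de = Cmod (h11 * h22 - h12 * h21)%C ^ 2 -> r * r * de = 1 ->
  p11 = (A * Cconj A + B * Cconj B)%C -> p21 = (C' * Cconj A + D * Cconj B)%C ->
  p22 = (C' * Cconj C' + D * Cconj D)%C ->
  (RtoC de * p11)%C = (h11 * Cconj h11 * n11 + h12 * Cconj h11 * n21 + h11 * Cconj h12 * Cconj n21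
    + h12 * Cconj h12 * n22)%C ->
  (RtoC de * p21)%C = (h21 * Cconj h11 * n11 + h22 * Cconj h11 * n21 + h21 * Cconj h12 * Cconj n21
    + h22 * Cconj h12 * n22)%C ->
  (RtoC de * p22)%C = (h21 * Cconj h21 * n11 + h22 * Cconj h21 * n21 + h21 * Cconj h22 * Cconj n21
    + h22 * Cconj h22 * n22)%C ->
  let fA := (RtoC r * (h22 * A - h12 * C'))%C in let fB := (RtoC r * (h22 * B - h12 * D))%C in
  let fC := (RtoC r * (h11 * C' - h21 * A))%C in let fD := (RtoC r * (h11 * D - h21 * B))%C in
  n11 = (fA * Cconj fA + fB * Cconj fB)%C /\ n21 = (fC * Cconj fA + fD * Cconj fB)%C /\
  n22 = (fC * Cconj fC + fD * Cconj fD)%C.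
Proof.
  intros R1 R2 Hde Hr P11 P21 P22 E11 E21 E22 fA fB fC fD.
  assert (E12 := f_equal Cconj E21). rewrite !Cconj_plus, !Cconj_mult, !Cconj_invol, Cconj_RtoC, R1, R2 in E12.
  set (dH := (h11 * h22 - h12 * h21)%C) in *.
  assert (K : (RtoC (r * r * (r * r)) * (RtoC de * RtoC de) = RtoC 1)%C).
  { rewrite <- !RtoC_mult. f_equal. replace (r * r * (r * r) * (de * de)) with ((r * r * de) * (r * r * de)) by ring.
    rewrite Hr. ring. }
  assert (Kd : (RtoC de * RtoC de)%C = (dH * Cconj dH)%C) by (rewrite Cmod_sq, <- RtoC_mult, Hde; reflexivity).
  assert (Kr : (RtoC r * RtoC r)%C = (RtoC (r * r * (r * r)) * RtoC de)%C).
  { rewrite <- !RtoC_mult. f_equal. replace (r * r * (r * r) * de) with (r * r * (r * r * de)) by ring.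
    rewrite Hr. ring. }
  assert (Kc : Cconj dH = (Cconj h11 * Cconj h22 - Cconj h12 * Cconj h21)%C).
  { unfold dH. now rewrite Cconj_minus, !Cconj_mult. }
  assert (G : forall x : C, x = (RtoC (r * r * (r * r)) * (dH * Cconj dH * x))%C).
  { intros x. rewrite <- Kd. transitivity (RtoC 1 * x)%C; [ring|]. rewrite <- K. ring. }
  rewrite (G n11), (G n21), (G n22) at 1. rewrite Kc. unfold dH, fA, fB, fC, fD.
  rewrite !Cconj_mult, !Cconj_minus, !Cconj_mult, Cconj_RtoC.
  set (rho := RtoC (r * r * (r * r))) in *.
  assert (T : forall X, (RtoC r * RtoC r * X)%C = (rho * (RtoC de * X))%C).
  { intros X. rewrite Kr. ring. }
  rewrite P11 in E11. rewrite P21 in E21, E12. rewrite P22 in E22.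
  rewrite Cconj_plus, !Cconj_mult, !Cconj_invol in E12.
  refine (conj _ (conj _ _)).
  - transitivity (RtoC r * RtoC r * (h22 * Cconj h22 * (A * Cconj A + B * Cconj B)
      - h12 * Cconj h22 * (C' * Cconj A + D * Cconj B) - h22 * Cconj h12 * (Cconj C' * A + Cconj D * B)
      + h12 * Cconj h12 * (C' * Cconj C' + D * Cconj D)))%C; [|ring].
    rewrite T. f_equal.
    transitivity (h22 * Cconj h22 * (RtoC de * (A * Cconj A + B * Cconj B))
      - h12 * Cconj h22 * (RtoC de * (C' * Cconj A + D * Cconj B)) - h22 * Cconj h12 * (RtoC de * (Cconj C' * A + Cconj D * B))
      + h12 * Cconj h12 * (RtoC de * (C' * Cconj C' + D * Cconj D)))%C; [|ring].
    rewrite E11, E21, E12, E22. ring.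
  - transitivity (RtoC r * RtoC r * (- h21 * Cconj h22 * (A * Cconj A + B * Cconj B)
      + h11 * Cconj h22 * (C' * Cconj A + D * Cconj B) + h21 * Cconj h12 * (Cconj C' * A + Cconj D * B)
      - h11 * Cconj h12 * (C' * Cconj C' + D * Cconj D)))%C; [|ring].
    rewrite T. f_equal.
    transitivity (- h21 * Cconj h22 * (RtoC de * (A * Cconj A + B * Cconj B))
      + h11 * Cconj h22 * (RtoC de * (C' * Cconj A + D * Cconj B)) + h21 * Cconj h12 * (RtoC de * (Cconj C' * A + Cconj D * B))
      - h11 * Cconj h12 * (RtoC de * (C' * Cconj C' + D * Cconj D)))%C; [|ring].
    rewrite E11, E21, E12, E22. ring.
  - transitivity (RtoC r * RtoC r * (h21 * Cconj h21 * (A * Cconj A + B * Cconj B)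
      - h11 * Cconj h21 * (C' * Cconj A + D * Cconj B) - h21 * Cconj h11 * (Cconj C' * A + Cconj D * B)
      + h11 * Cconj h11 * (C' * Cconj C' + D * Cconj D)))%C; [|ring].
    rewrite T. f_equal.
    transitivity (h21 * Cconj h21 * (RtoC de * (A * Cconj A + B * Cconj B))
      - h11 * Cconj h21 * (RtoC de * (C' * Cconj A + D * Cconj B)) - h21 * Cconj h11 * (RtoC de * (Cconj C' * A + Cconj D * B))
      + h11 * Cconj h11 * (RtoC de * (C' * Cconj C' + D * Cconj D)))%C; [|ring].
    rewrite E11, E21, E12, E22. ring.
Qed.

(** The factor lam drops out: multiplying H on the left by a diagonal matrix does not
    change the diagonal of H k H^-1. *)
Lemma K11_cross_ratio m lam a b c d : a <> b -> c <> d -> lam <> RtoC 0 ->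
  K11 (yh b) (- RtoC (xh b))%C (lam * yh a)%C (- (lam * RtoC (xh a)))%C
    (kal m c d) (kbe m c d) (kga m c d) =
  (- (m * (RtoC 2 * cross_ratio a c d b - RtoC 1)) / RtoC 2)%C.
Proof.
  intros N M Hl. pose proof (bracket_neq0 a b N) as B1. pose proof (bracket_neq0 c d M) as B2.
  pose proof (bracket_neq0 d c (not_eq_sym M)) as B3. pose proof (bracket_neq0 b a (not_eq_sym N)) as B4.
  assert (T2 : RtoC 2 <> RtoC 0) by (intros Q; apply RtoC_inj in Q; lra).
  unfold K11, k11, kal, kbe, kga, kth, cross_ratio. rewrite !bracket_h in *.
  generalize (RtoC (xh a)) (RtoC (xh b)) (RtoC (xh c)) (RtoC (xh d)) (yh a) (yh b) (yh c) (yh d) B1 B2 B3 B4.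
  clear B1 B2 B3 B4.
  intros xa xb xc xd ya yb yc yd B1 B2 B3 B4.
  field. repeat split; auto.
  intros Q. apply (Cmult_neq_0 _ _ Hl B1). rewrite <- Q. ring.
Qed.

(** V is the punctured disc of radius exp c; the isometry of factor lam maps the end
    onto the surface of the Bryant frame. *)
Section EndFlux.
Variables (E : surface_end) (a b : Cbar) (lam : C) (kappa c : R).
Variables (A B C' D a0 b0 c0 d0 : C -> C) (psi psi' : plane -> plane).
Let V (z : plane) : Prop := 0 < Cmod z /\ Cmod z < exp c.
Hypotheses (HE : bryant_end E) (Hab : a <> b) (Hl : lam <> RtoC 0).
Hypotheses (HF : bryant_frame kappa c A B C' D a0 b0 c0 d0) (Hpsi : C2_map V psi).
Hypotheses (Hdom : forall z, V z -> dom_star E (psi z)) (Hpsi' : C2_map (dom_star E) psi').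
Hypotheses (Hinv : forall z, dom_star E z -> psi' z <> RtoC 0 /\ psi (psi' z) = z).
Hypotheses (Hlim : forall eps : posreal, exists d : posreal, forall z, V z -> Cmod z < d -> Cmod (psi z) < eps).
Hypotheses (Hlim' : forall eps : posreal, exists d : posreal, forall z, dom_star E z ->
  Cmod z < d -> Cmod (psi' z) < eps).
Hypotheses (HX : forall s, HP c s ->
  (((lam * fst (stdmap a b (param E (psi (cexp s)))))%C, Cmod lam * snd (stdmap a b (param E (psi (cexp s))))) : space)
   = bpoint (A s) (B s) (C' s) (D s)).

Lemma V_cexp s : HP c s -> V (cexp s).
Proof.
  intros Hs. unfold V. rewrite Cmod_cexp. split; [apply exp_pos|]. apply exp_increasing. exact Hs.
Qed.

Lemma open_V : open V.
Proof.
  assert (C0 : forall z : plane, continuous (Cmod : plane -> R) z).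
  { intros z. apply (continuous_comp (fun z : plane => Re z ^ 2 + Im z ^ 2) sqrt).
    - apply (CK_cont 0 (fun _ => True)); [|exact I].
      apply (CK_ext 0 (fun _ : plane => True) (fun z : plane => Re z * Re z + Im z * Im z)).
      + apply open_all.
      + intros; ring.
      + exact (CK_plus 0 _ _ _ open_all (CK_mult 0 _ _ _ open_all (CK_fst 0 _) (CK_fst 0 _))
         (CK_mult 0 _ _ _ open_all (CK_snd 0 _) (CK_snd 0 _))).
    - apply continuous_sqrt. }
  apply (open_and (fun z : plane => 0 < Cmod z) (fun z : plane => Cmod z < exp c)).
  - apply (open_comp (Cmod : plane -> R) (fun x => 0 < x)); [intros z _; apply C0 | apply open_gt].
  - apply (open_comp (Cmod : plane -> R) (fun x => x < exp c)); [intros z _; apply C0 | apply open_lt].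
Qed.

Lemma end_flux m p q Y : p <> q -> (forall x, H3 x -> Y x = killing m p q x) ->
  is_flux E Y (4 * PI * kappa * Re (m * (RtoC 2 * cross_ratio a p q b - RtoC 1))%C).
Proof.
  intros Hpq HY.
  assert (Hml : 0 < Cmod lam) by exact (proj1 (Cmod_gt_0 lam) Hl).
  assert (Hmb : 0 < Cmod (bracket a b)) by exact (proj1 (Cmod_gt_0 _) (bracket_neq0 a b Hab)).
  set (de := Cmod lam * Cmod (bracket a b)).
  assert (Hde : 0 < de) by (apply Rmult_lt_0_compat; auto).
  set (r := / sqrt de).
  assert (Hr : r * r * de = 1).
  { unfold r. assert (S := sqrt_lt_R0 _ Hde). pose proof (sqrt_sqrt de (Rlt_le _ _ Hde)) as Q.
    rewrite <- Q at 3. field. lra. }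
  assert (EdH : (yh b * - (lam * RtoC (xh a)) - - RtoC (xh b) * (lam * yh a))%C = (lam * bracket a b)%C).
  { rewrite bracket_h. ring. }
  pose proof (flux_of_frame E kappa c A B C' D a0 b0 c0 d0 (yh b) (- RtoC (xh b))%C (lam * yh a)%C
    (- (lam * RtoC (xh a)))%C (RtoC r) (fun s => psi (cexp s)) psi') as Core.
  cbv beta zeta in Core. rewrite EdH in Core.
  replace (4 * PI * kappa * Re (m * (RtoC 2 * cross_ratio a p q b - RtoC 1))%C) with
    (- (8 * PI * kappa * Re (K11 (yh b) (- RtoC (xh b))%C (lam * yh a)%C (- (lam * RtoC (xh a)))%C
       (kal m p q) (kbe m p q) (kga m p q)))).
  2:{ rewrite K11_cross_ratio by auto. set (X := (m * _)%C). destruct X as [x y]. simpl. field. }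
  apply Core; clear Core; auto.
  - rewrite !Cmod_mult, Cmod_R, Rabs_pos_eq; [exact Hr|]. left. apply Rinv_0_lt_compat, sqrt_lt_R0, Hde.
  - destruct (C2_cexp (HP c) (open_HP c)) as [X1' X2']. destruct Hpsi as [Y1 Y2]. split.
    + exact (CK_compp 2 V (HP c) cexp _ open_V (open_HP c) V_cexp Y1 X1' X2').
    + exact (CK_compp 2 V (HP c) cexp _ open_V (open_HP c) V_cexp Y2 X1' X2').
  - intros s Hs. apply Hdom, V_cexp, Hs.
  - intros x y. f_equal. pose proof (cexp_shift (x, y) 1) as Q. unfold vshift in Q. simpl in Q.
    rewrite Rmult_1_r in Q. exact Q.
  - intros eps. destruct (Hlim eps) as [d0' Hd]. destruct (exp_small d0') as [x0 Hx].
    exists (Rmin x0 c). intros s Hs. assert (C0 : forall x : C, (x - RtoC 0)%C = x) by (intros; ring). rewrite C0.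
    apply Hd.
    + apply V_cexp. eapply Rlt_le_trans; [exact Hs | apply Rmin_r].
    + apply Hx. eapply Rlt_le_trans; [exact Hs | apply Rmin_l].
  - intros s Hs. assert (Hp : H3 (param E (psi (cexp s)))).
    { apply (proj2 (proj2 (cmc1_end E HE))). apply Hdom, V_cexp, Hs. }
    destruct (std_entries a b lam _ Hab Hl Hp) as (E1 & E2 & E3). rewrite (HX s Hs) in E1, E2, E3.
    destruct HF as [HF1 _]. destruct (HF1 s Hs) as (_ & HD & _).
    destruct (bpoint_m _ _ _ _ HD) as (P1 & P2 & P3).
    apply (frame_inversion (yh b) (- RtoC (xh b))%C (lam * yh a)%C (- (lam * RtoC (xh a)))%C
      (A s) (B s) (C' s) (D s) _ _ _ _ _ _ de r) with (7 := P3) (6 := P2) (5 := P1); auto.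
    + apply Cconj_RtoC.
    + apply Cconj_RtoC.
    + rewrite EdH, Cmod_mult. unfold de. ring.
  - intros z Hz. destruct (Hinv z Hz) as [I1 I2]. split; auto. intros s _ Q. now rewrite Q.
Qed.

End EndFlux.

Lemma locally0_Cmod (P : plane -> Prop) (eps : posreal) : (forall z : C, Cmod z < eps -> P z) ->
  locally (RtoC 0 : plane) P.
Proof.
  intros H. assert (E : 0 < eps / 2) by (pose proof (cond_pos eps); lra).
  exists (mkposreal _ E). intros z [B1 B2]. apply H.
  change (Rabs (fst z - 0) < eps / 2) in B1. change (Rabs (snd z - 0) < eps / 2) in B2.
  rewrite Rminus_0_r in B1, B2.
  assert (Q : Cmod z <= Rabs (fst z) + Rabs (snd z)).
  { destruct z as [x y]. assert (E2 : ((x, y) : C) = (RtoC x + RtoC y * (0, 1))%C).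
    { apply injective_projections; simpl; ring. }
    assert (I1 : Cmod (0, 1) = 1). { unfold Cmod. simpl. replace (0 * (0 * 1) + 1 * (1 * 1)) with 1 by ring. apply sqrt_1. }
    rewrite E2 at 1. eapply Rle_trans; [apply Cmod_triangle|]. rewrite Cmod_mult, !Cmod_R, I1. simpl. lra. }
  lra.
Qed.

Lemma locally0_Cmod_inv (P : plane -> Prop) : locally (RtoC 0 : plane) P ->
  exists d : posreal, forall z : C, Cmod z < d -> P z.
Proof.
  intros [d Hd]. exists d. intros z Hz. apply Hd.
  pose proof (Rmax_Cmod z) as M. pose proof (Rmax_l (Rabs (fst z)) (Rabs (snd z))).
  pose proof (Rmax_r (Rabs (fst z)) (Rabs (snd z))).
  split.
  - change (Rabs (fst z - 0) < d). rewrite Rminus_0_r. lra.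
  - change (Rabs (snd z - 0) < d). rewrite Rminus_0_r. lra.
Qed.

Lemma puncture_limit (U : plane -> Prop) (f : plane -> plane) :
  filterlim f (within U (locally (RtoC 0 : plane))) (locally (RtoC 0 : plane)) ->
  forall eps : posreal, exists d : posreal, forall z, U z -> Cmod z < d -> Cmod (f z) < eps.
Proof.
  intros H eps. specialize (H (fun z => Cmod z < eps) (locally0_Cmod _ eps (fun z Hz => Hz))).
  unfold filtermap, within in H. destruct (locally0_Cmod_inv _ H) as [d Hd].
  exists d. intros z Uz Hz. now apply Hd.
Qed.

Lemma bpoint_conj A B C' D : bpoint (Cconj A) (Cconj B) (Cconj C') (Cconj D) =
  (Cconj (fst (bpoint A B C' D)), snd (bpoint A B C' D)).
Proof.
  unfold bpoint. cbn [fst snd]. rewrite !Cmod_Cconj. unfold Cdiv.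
  rewrite Cconj_mult, Cconj_plus, !Cconj_mult, Cconj_inv, Cconj_RtoC. reflexivity.
Qed.

(** If the isometry reverses the orientation, complex conjugation of its image reduces
    to the other case. *)
Lemma catenoidal_flux mu a b E m p q Y : 0 < mu -> mu <> 1 -> a <> b -> catenoidal_end mu a b E ->
  p <> q -> (forall x, H3 x -> Y x = killing m p q x) ->
  is_flux E Y (PI * (1 - mu ^ 2) * Re (m * (RtoC 2 * cross_ratio a p q b - RtoC 1))%C).
Proof.
  intros Hmu Hmu1 Hab (HE & _ & _ & _ & phi & E' & Hphi & Ha & Hb & (psi & psi' & Cpsi & Cpsi' & H1 & H2 & L1 & L2) & Hcan)
    Hpq HY.
  destruct (canonical_frame mu E' Hmu Hmu1 Hcan) as (delta & A & B & C' & D & a0 & b0 & c0 & d0 & Hd & Hdisc & HF & HX).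
  replace (PI * (1 - mu ^ 2) * Re (m * (RtoC 2 * cross_ratio a p q b - RtoC 1))%C) with
    (4 * PI * ((1 - mu ^ 2) / 4) * Re (m * (RtoC 2 * cross_ratio a p q b - RtoC 1))%C) by field.
  assert (HV : forall z : C, 0 < Cmod z /\ Cmod z < exp (ln delta) -> dom_star E' z).
  { intros z [Z1 Z2]. rewrite exp_ln in Z2 by auto. split; [now apply Hdisc|].
    now apply Cmod_gt_0. }
  assert (OV := open_V (ln delta)).
  assert (P2 : C2_map (fun z : plane => 0 < Cmod z /\ Cmod z < exp (ln delta)) psi).
  { split; apply (CK_sub 2 (dom_star E')); auto; apply CK_of_Ck; intros n; apply (Cpsi n). }
  assert (P2' : C2_map (dom_star E) psi').
  { split; apply CK_of_Ck; intros n; apply (Cpsi' n). }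
  assert (VC : forall s, HP (ln delta) s -> 0 < Cmod (cexp s) /\ Cmod (cexp s) < exp (ln delta)).
  { intros s Hs. rewrite Cmod_cexp. split; [apply exp_pos|]. apply exp_increasing. exact Hs. }
  assert (HXs : forall s, HP (ln delta) s -> phi (param E (psi (cexp s))) = bpoint (A s) (B s) (C' s) (D s)).
  { intros s Hs. destruct (H1 _ (HV _ (VC s Hs))) as (_ & _ & Q). etransitivity; [exact Q|]. exact (HX s Hs). }
  assert (HH : forall z, dom_star E z -> H3 (param E z)).
  { intros z Hz. apply (proj2 (proj2 (cmc1_end E HE)) z Hz). }
  assert (HL := puncture_limit _ _ L1). assert (HL' := puncture_limit _ _ L2).
  destruct (isometry_classification phi a b Hphi Hab Ha Hb) as (lam & Hlam & [K|K]).
  - apply (end_flux E a b lam _ (ln delta) A B C' D a0 b0 c0 d0 psi psi'); auto.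
    + intros z Hz. apply (H1 z (HV z Hz)).
    + intros z Hz. destruct (H2 z Hz) as [I1 I2]. split; auto. apply I1.
    + intros eps. destruct (HL eps) as [d Hd']. exists d. intros z Hz. apply Hd'. now apply HV.
    + intros s Hs. rewrite <- (HXs s Hs). rewrite K; [reflexivity|]. apply HH, (H1 _ (HV _ (VC s Hs))).
  - assert (CM : forall z : C, 0 < Cmod z /\ Cmod z < exp (ln delta) ->
       0 < Cmod (Cconj z) /\ Cmod (Cconj z) < exp (ln delta)) by (intros z Hz; now rewrite Cmod_Cconj).
    assert (CJ : forall U : plane -> Prop, open U -> CK 2 U (fun z : plane => Re (Cconj z)) /\ CK 2 U (fun z : plane => Im (Cconj z))).
    { intros U HU. split; [exact (CK_fst 2 U) | exact (CK_opp 2 U _ HU (CK_snd 2 U))]. }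
    assert (Hcl : Cconj lam <> RtoC 0).
    { intros Z. apply Hlam. rewrite <- (Cconj_invol lam), Z. apply Cconj_RtoC. }
    refine (end_flux E a b (Cconj lam) _ (ln delta) _ _ _ _ _ _ _ _ (fun z => psi (Cconj z)) (fun z => Cconj (psi' z))
      HE Hab Hcl (bryant_frame_conj _ _ _ _ _ _ _ _ _ _ HF) _ _ _ _ _ _ _ m p q Y Hpq HY).
    + destruct P2 as [Q1 Q2]. destruct (CJ _ OV) as [J1 J2]. split.
      * exact (CK_compp 2 _ _ (fun z : plane => Cconj z : plane) _ OV OV CM Q1 J1 J2).
      * exact (CK_compp 2 _ _ (fun z : plane => Cconj z : plane) _ OV OV CM Q2 J1 J2).
    + intros z Hz. apply (H1 _ (HV _ (CM z Hz))).
    + destruct P2' as [Q1 Q2]. split; [exact Q1|].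
      exact (CK_opp 2 _ _ (proj1 (cmc1_end E HE)) Q2).
    + intros z Hz. destruct (H2 z Hz) as [[_ I1] I2]. split.
      * intros Z. apply I1. rewrite <- (Cconj_invol (psi' z)), Z. apply Cconj_RtoC.
      * rewrite Cconj_invol. exact I2.
    + intros eps. destruct (HL eps) as [d Hd']. exists d. intros z Hz Hz'. apply Hd'.
      * exact (HV _ (CM z Hz)).
      * now rewrite Cmod_Cconj.
    + intros eps. destruct (HL' eps) as [d Hd']. exists d. intros z Hz Hz'. rewrite Cmod_Cconj. now apply Hd'.
    + intros s Hs. rewrite bpoint_conj, <- (HXs (Cconj s) Hs), <- cexp_conj.
      rewrite K by (apply HH, (H1 _ (HV _ (VC (Cconj s) Hs)))).
      cbn [fst snd]. rewrite Cconj_mult, Cconj_invol, Cmod_Cconj. reflexivity.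
Qed.

(** * The flux polynomial *)

Lemma cross_ratio_form a b c d : a <> b -> c <> d ->
  (RtoC 2 * cross_ratio a c d b - RtoC 1)%C =
  ((RtoC 2 * (RtoC (xh a) * RtoC (xh b)) * (yh c * yh d)
    - (RtoC (xh a) * yh b + yh a * RtoC (xh b)) * (yh c * RtoC (xh d) + yh d * RtoC (xh c))
    + RtoC 2 * (yh a * yh b) * (RtoC (xh c) * RtoC (xh d))) / (bracket b a * bracket c d))%C.
Proof.
  intros N M. pose proof (bracket_neq0 a b N) as B1. pose proof (bracket_neq0 c d M) as B2.
  pose proof (bracket_neq0 d c (not_eq_sym M)) as B3. pose proof (bracket_neq0 b a (not_eq_sym N)) as B4.
  unfold cross_ratio. rewrite !bracket_h in *.
  generalize (RtoC (xh a)) (RtoC (xh b)) (RtoC (xh c)) (RtoC (xh d)) (yh a) (yh b) (yh c) (yh d) B1 B2 B3 B4.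
  clear B1 B2 B3 B4. intros. field. repeat split; auto.
Qed.

(** Homogeneous coordinates of a and b give the limits at infinity. *)
Definition axis_flux_poly (k : R) (a b : Cbar) (x y : C) : C :=
  (RtoC k * ((RtoC 2 * (RtoC (xh a) * RtoC (xh b)) * (x * y)
    - (RtoC (xh a) * yh b + yh a * RtoC (xh b)) * (x + y) + RtoC 2 * (yh a * yh b)) / bracket b a))%C.

Lemma axis_flux_poly_polynomial k a b : polynomial2 (axis_flux_poly k a b).
Proof.
  set (S := (- (RtoC k * ((RtoC (xh a) * yh b + yh a * RtoC (xh b)) / bracket b a)))%C).
  exists 1%nat, (fun i j => match i, j with
    | O, O => (RtoC k * (RtoC 2 * (yh a * yh b) / bracket b a))%C
    | 1%nat, 1%nat => (RtoC k * (RtoC 2 * (RtoC (xh a) * RtoC (xh b)) / bracket b a))%C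
    | _, _ => S end).
  intros x y. rewrite !sum_Sn, !sum_O, !sum_Sn, !sum_O.
  unfold axis_flux_poly, S. generalize (RtoC (xh a)) (RtoC (xh b)) (yh a) (yh b) (bracket b a) (RtoC k) (RtoC 2).
  intros. cbn [Cpow]. unfold plus; simpl. unfold Cdiv.
  match goal with |- ?x = ?y => change (@eq C x y) end. ring.
Qed.

Lemma moebius_limit (u v x : C) :
  filterlim (fun y : C => ((u * y + v) / (x - y))%C) at_infinity (locally (- u)%C) /\
  filterlim (fun y : C => ((u * y + v) / (y - x))%C) at_infinity (locally u).
Proof.
  assert (G : forall eps : posreal, exists M : R, forall y : C, M < Cmod y ->
    Cmod ((v + u * x) / (x - y)) < eps /\ (x - y)%C <> RtoC 0).
  { intros eps. exists (Cmod x + (Cmod (v + u * x) + 1) / eps). intros y Hy.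
    set (T := Cmod (v + u * x)) in *. assert (0 <= T) by apply Cmod_ge_0.
    assert (He := cond_pos eps).
    assert (P : (T + 1) / eps < Cmod (x - y)).
    { assert (Cmod y <= Cmod (y - x) + Cmod x).
      { replace y with ((y - x) + x)%C at 1 by ring. apply Cmod_triangle. }
      replace (x - y)%C with (- (y - x))%C by ring. rewrite Cmod_opp. lra. }
    assert (0 < (T + 1) / eps) by (apply Rdiv_lt_0_compat; lra).
    assert (N : (x - y)%C <> RtoC 0) by (apply Cmod_gt_0; lra).
    split; auto. rewrite Cmod_div by auto. fold T.
    apply (Rmult_lt_reg_r (Cmod (x - y))); [lra|].
    unfold Rdiv. rewrite Rmult_assoc, Rinv_l, Rmult_1_r by lra.
    apply (Rmult_lt_compat_l eps) in P; auto. replace (eps * ((T + 1) / eps)) with (T + 1) in P by (field; lra). lra. }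
  assert (B : forall (l z : C) (eps : posreal), Cmod (z - l) < eps -> ball l eps z).
  { intros l z eps H. pose proof (Rmax_Cmod (z - l)%C) as M.
    pose proof (Rmax_l (Rabs (fst (z - l)%C)) (Rabs (snd (z - l)%C))).
    pose proof (Rmax_r (Rabs (fst (z - l)%C)) (Rabs (snd (z - l)%C))).
    split.
    - change (Rabs (fst (z - l)%C) < eps). lra.
    - change (Rabs (snd (z - l)%C) < eps). lra. }
  split; intros P [eps HP]; destruct (G eps) as [M HM]; exists M; intros y Hy; apply HP; apply B;
    destruct (HM y Hy) as [K N].
  - replace ((u * y + v) / (x - y) - - u)%C with ((v + u * x) / (x - y))%C by (field; auto). exact K.
  - assert (N' : (y - x)%C <> RtoC 0).
    { intros Z. apply N. replace (x - y)%C with (- (y - x))%C by ring. rewrite Z. ring. }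
    replace ((u * y + v) / (y - x) - u)%C with (- ((v + u * x) / (x - y)))%C by (field; auto).
    now rewrite Cmod_opp.
Qed.

Lemma axis_flux_poly_ratio k a b c d : a <> b -> c <> d ->
  flux_ratio (axis_flux_poly k a b) c d (RtoC k * (RtoC 2 * cross_ratio a c d b - RtoC 1))%C.
Proof.
  intros N M. rewrite cross_ratio_form by auto.
  pose proof (bracket_neq0 b a (not_eq_sym N)) as B.
  pose proof (bracket_neq0 c d M) as B2.
  unfold axis_flux_poly. set (S := (RtoC (xh a) * yh b + yh a * RtoC (xh b))%C). set (e := bracket b a) in *.
  set (A := (RtoC (xh a) * RtoC (xh b))%C). set (Y := (yh a * yh b)%C). clearbody S e A Y.
  destruct c as [x|], d as [y|].
  - unfold flux_ratio. simpl in B2 |- *. change (Cminus x y <> 0) in B2. field. auto.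
  - unfold flux_ratio. simpl bracket. simpl xh. simpl yh.
    destruct (moebius_limit (RtoC k * ((RtoC 2 * A * x - S) / e))%C (RtoC k * ((- S * x + RtoC 2 * Y) / e))%C x) as [L _].
    assert (T1 : RtoC (-1) <> RtoC 0) by (intros Q; apply RtoC_inj in Q; lra).
    replace (RtoC k * ((RtoC 2 * A * (x * RtoC 1) - S * (x * RtoC 0 + RtoC 1 * RtoC 1) + RtoC 2 * Y * (RtoC 1 * RtoC 0)) / (e * RtoC (-1))))%C
      with (- (RtoC k * ((RtoC 2 * A * x - S) / e)))%C.
    2:{ replace (RtoC (-1)) with (- RtoC 1)%C by (apply injective_projections; simpl; ring). field. exact B. }
    match type of L with filterlim ?f _ _ => match goal with |- filterlim ?g _ _ => replace g with f; [exact L|] end end.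
    apply functional_extensionality. intros y. unfold Cdiv. ring.
  - unfold flux_ratio. simpl bracket. simpl xh. simpl yh.
    destruct (moebius_limit (RtoC k * ((RtoC 2 * A * y - S) / e))%C (RtoC k * ((- S * y + RtoC 2 * Y) / e))%C y) as [_ L].
    replace (RtoC k * ((RtoC 2 * A * (RtoC 1 * y) - S * (RtoC 1 * RtoC 1 + y * RtoC 0) + RtoC 2 * Y * (RtoC 0 * RtoC 1)) / (e * RtoC 1)))%C
      with ((RtoC k * ((RtoC 2 * A * y - S) / e)))%C.
    2:{ field. auto. }
    match type of L with filterlim ?f _ _ => match goal with |- filterlim ?g _ _ => replace g with f; [exact L|] end end.
    apply functional_extensionality. intros x. unfold Cdiv. ring.
  - now elim M.
Qed.

Lemma polynomial2_Dc P x y : polynomial2 P -> exists l, Dc (P x) y l.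
Proof.
  intros (N & a & HP).
  assert (S : forall (f : nat -> C -> C) n, (forall i, exists l, Dc (f i) y l) ->
    exists l, Dc (fun z => sum_n (fun i => f i z) n) y l).
  { intros f n Hf. induction n as [|n [l IH]].
    - destruct (Hf 0%nat) as [l Hl]. exists l. revert Hl. apply Dc_ext. intros z. now rewrite sum_O.
    - destruct (Hf (Datatypes.S n)) as [l' Hl]. exists (l + l')%C.
      apply (Dc_ext (fun z => sum_n (fun i => f i z) n + f (Datatypes.S n) z)%C).
      + intros z. now rewrite sum_Sn.
      + now apply Dc_plus. }
  assert (W : forall j, exists l, Dc (fun z => Cpow z j) y l).
  { induction j as [|j [l IH]].
    - exists (RtoC 0). apply (Dc_ext (fun _ => RtoC 1)); [reflexivity|]. apply Dc_const.
    - assert (L1 : Dc (fun z => z) y (RtoC 1)).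
      { intros v. replace (RtoC 1 * v)%C with v by ring. apply ray_deriv. }
      eexists. apply (Dc_ext (fun z => (z * Cpow z j)%C)); [reflexivity|]. exact (Dc_mult _ _ y _ _ L1 IH). }
  assert (R1 : forall i j, exists l, Dc (fun z => Cmult (a i j) (Cmult (Cpow x i) (Cpow z j))) y l).
  { intros i j. destruct (W j) as [l Hl]. exists (a i j * (Cpow x i * l))%C.
    apply (Dc_scal (a i j) (fun z => Cmult (Cpow x i) (Cpow z j))).
    exact (Dc_scal (Cpow x i) (fun z => Cpow z j) y l Hl). }
  assert (R2 := fun i => S (fun j z => Cmult (a i j) (Cmult (Cpow x i) (Cpow z j))) N (R1 i)).
  destruct (S (fun i z => sum_n (fun j => Cmult (a i j) (Cmult (Cpow x i) (Cpow z j))) N) N R2) as [l Hl].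
  exists l. revert Hl. apply Dc_ext. intros z. symmetry. apply HP.
Qed.

(** By continuity along a line through the diagonal. *)
Lemma polynomial2_diagonal P Q : polynomial2 P -> polynomial2 Q ->
  (forall x y, x <> y -> P x y = Q x y) -> forall x y, P x y = Q x y.
Proof.
  intros HP HQ H x y. destruct (excluded_middle_informative (x = y)) as [<-|N]; [|now apply H].
  destruct (polynomial2_Dc P x x HP) as [l Hl]. destruct (polynomial2_Dc Q x x HQ) as [l' Hl'].
  specialize (Hl (RtoC 1)). specialize (Hl' (RtoC 1)).
  assert (Z : forall f g : R -> R, ex_derive f 0 -> ex_derive g 0 -> (forall t, t <> 0 -> f t = g t) -> f 0 = g 0).
  { intros f g Hf Hg E. set (h := fun t : R => f t - g t).
    assert (C : continuous h 0).
    { apply (continuous_minus f g); [apply (ex_derive_continuous f), Hf | apply (ex_derive_continuous g), Hg]. }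
    destruct (Req_dec (h 0) 0) as [F|F]; [unfold h in F; lra|]. exfalso.
    assert (P0 : 0 < Rabs (h 0)) by now apply Rabs_pos_lt.
    destruct (proj1 (filterlim_locally _ _) C (mkposreal _ P0)) as [d Hd].
    assert (D := cond_pos d). specialize (Hd (d / 2)).
    assert (B : ball (0 : R) d (d / 2)).
    { change (Rabs (d / 2 - 0) < d). rewrite Rminus_0_r, Rabs_pos_eq; lra. }
    specialize (Hd B). change (Rabs (h (d / 2) - h 0) < Rabs (h 0)) in Hd.
    unfold h in Hd at 1. rewrite (E (d / 2)) in Hd by lra.
    replace (g (d / 2) - g (d / 2) - h 0) with (- h 0) in Hd by ring. rewrite Rabs_Ropp in Hd. lra. }
  assert (E : forall t, t <> 0 -> P x (ray x (RtoC 1) t) = Q x (ray x (RtoC 1) t)).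
  { intros t Ht. apply H. unfold ray. intros X. apply Ht. apply (f_equal fst) in X. simpl in X. lra. }
  destruct Hl as [A1 A2], Hl' as [B1 B2].
  rewrite <- (ray0 x (RtoC 1)) at 2 4. apply injective_projections.
  - apply (Z (fun t => Re (P x (ray x (RtoC 1) t))) (fun t => Re (Q x (ray x (RtoC 1) t)))).
    + eexists; exact A1. + eexists; exact B1. + intros t Ht. now rewrite E.
  - apply (Z (fun t => Im (P x (ray x (RtoC 1) t))) (fun t => Im (Q x (ray x (RtoC 1) t)))).
    + eexists; exact A2. + eexists; exact B2. + intros t Ht. now rewrite E.
Qed.

Theorem theorem6 (mu : R) (a b c d : Cbar) (E : surface_end)
  (hmu : (0 < mu /\ mu <> 1)%R) (hab : a <> b) (hcd : c <> d)
  (hE : catenoidal_end mu a b E) :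
  (forall Y : space -> space, translation_field c d Y ->
     is_flux E Y
       (PI * (1 - mu ^ 2) * (2 * Re (cross_ratio a c d b) - 1))%R) /\
  (forall Y : space -> space, rotation_field c d Y ->
     is_flux E Y
       (- 2 * PI * (1 - mu ^ 2) * Im (cross_ratio a c d b))%R) /\
  flux_polynomial E
    (fun x : C =>
       Cmult (RtoC (2 * PI * (1 - mu ^ 2))%R) (axis_polynomial a b x)).
Proof.
  destruct hmu as [Hmu Hmu1]. pose proof (proj1 hE) as HE.
  assert (TR : forall p q, p <> q -> forall Y, translation_field p q Y ->
    is_flux E Y (PI * (1 - mu ^ 2) * (2 * Re (cross_ratio a p q b) - 1))).
  { intros p q Hpq Y HY. apply (proj1 (flow_fields p q Y)) in HY.
    pose proof (catenoidal_flux mu a b E (RtoC 1) p q Y Hmu Hmu1 hab hE Hpq (generated_killing p q _ Y Hpq HY)) as F.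
    destruct (cross_ratio a p q b) as [x y].
    replace (2 * Re (x, y) - 1) with (Re (RtoC 1 * (RtoC 2 * (x, y) - RtoC 1))%C) by (simpl; ring). exact F. }
  assert (RO : forall p q, p <> q -> forall Y, rotation_field p q Y ->
    is_flux E Y (- 2 * PI * (1 - mu ^ 2) * Im (cross_ratio a p q b))).
  { intros p q Hpq Y HY. apply (proj2 (flow_fields p q Y)) in HY.
    pose proof (catenoidal_flux mu a b E Ci p q Y Hmu Hmu1 hab hE Hpq (generated_killing p q _ Y Hpq HY)) as F.
    destruct (cross_ratio a p q b) as [x y].
    replace (- 2 * PI * (1 - mu ^ 2) * Im (x, y)) with
      (PI * (1 - mu ^ 2) * Re (Ci * (RtoC 2 * (x, y) - RtoC 1))%C) by (simpl; ring). exact F. }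
  refine (conj (TR c d hcd) (conj (RO c d hcd) _)).
  set (k := PI * (1 - mu ^ 2)).
  assert (FP : flux_polynomial2 E (axis_flux_poly k a b)).
  { split; [apply axis_flux_poly_polynomial|]. intros p q Hpq.
    exists (RtoC k * (RtoC 2 * cross_ratio a p q b - RtoC 1))%C.
    refine (conj (axis_flux_poly_ratio k a b p q hab Hpq) (conj _ _)); intros Y HY.
    - pose proof (TR p q Hpq Y HY) as F. fold k in F. destruct (cross_ratio a p q b) as [x y].
      replace (Re (RtoC k * (RtoC 2 * (x, y) - RtoC 1))%C) with (k * (2 * Re (x, y) - 1)) by (simpl; ring). exact F.
    - pose proof (RO p q Hpq Y HY) as F. destruct (cross_ratio a p q b) as [x y].
      replace (- Im (RtoC k * (RtoC 2 * (x, y) - RtoC 1))%C) with (- 2 * PI * (1 - mu ^ 2) * Im (x, y))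
        by (unfold k; simpl; ring). exact F. }
  exists (axis_flux_poly k a b). refine (conj FP (conj _ _)).
  - intros P' [HP' HF']. destruct FP as [HP HF]. apply polynomial2_diagonal; auto. intros x y Hxy.
    assert (N : Some x <> Some y) by (intros Q; injection Q; exact Hxy).
    destruct (HF _ _ N) as (l & El & Tl & Rl). destruct (HF' _ _ N) as (l' & El' & Tl' & Rl').
    destruct (flow_exists x y Hxy (RtoC 1)) as [Y1 G1]. destruct (flow_exists x y Hxy Ci) as [Y2 G2].
    apply (proj1 (flow_fields _ _ Y1)) in G1. apply (proj2 (flow_fields _ _ Y2)) in G2.
    assert (Q1 := is_flux_unique E Y1 _ _ HE (Tl Y1 G1) (Tl' Y1 G1)).
    assert (Q2 := is_flux_unique E Y2 _ _ HE (Rl Y2 G2) (Rl' Y2 G2)).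
    assert (Q : l = l') by (apply injective_projections; [exact Q1 | unfold Im in Q2; lra]).
    simpl in El, El'. rewrite Q, El' in El.
    assert (NZ : (x - y)%C <> RtoC 0).
    { intros Z. apply Hxy. replace x with (x - y + y)%C by ring. rewrite Z. ring. }
    replace (P' x y) with (P' x y / (x - y) * (x - y))%C by (field; auto). rewrite El. field. auto.
  - intros x. unfold axis_flux_poly. pose proof (bracket_neq0 b a (not_eq_sym hab)) as B.
    replace (RtoC (2 * PI * (1 - mu ^ 2))) with (RtoC 2 * RtoC k)%C
      by (rewrite <- RtoC_mult; f_equal; unfold k; ring).
    destruct a as [a'|], b as [b'|]; unfold axis_polynomial, xh, yh, bracket in *.
    + field. exact B.
    + assert (Em : forall z : C, (z / RtoC 1)%C = z).
      { intros z. apply injective_projections; simpl; field. }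
      rewrite Em. ring.
    + assert (Em : forall z : C, (z / RtoC (-1))%C = (- z)%C).
      { intros z. apply injective_projections; simpl; field. }
      rewrite Em. ring.
    + now elim hab.
Qed.
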